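(* Let $d \in\{2,3\}$. For $m>0$ let $Q : K_m \to K_0$ be the symplectomorphism $$Q: \omega_m^{-1/2} f + i\omega_m^{1/2} g \mapsto \omega_0^{-1/2} f + i \omega_0^{1/2} g, \qquad f \in H^{-1/2}_{\mathbb R}(B),\ g \in H^{1/2}_{\mathbb R}(B).$$ Then the operator $1 - Q^\dagger Q$ is Hilbert-Schmidt on $K_m + iK_m$ (with respect to the scalar product $\langle\cdot,\cdot\rangle_{s_m}$). Moreover, $\lim_{m\to 0^+} \|1-Q^\dagger Q\|_2 = 0$, where $\|\cdot\|_2$ denotes the Hilbert-Schmidt norm on $K_m+iK_m$.
   Context: Let $H = L^2(\mathbb R^d)$ with scalar product linear in the second variable. For $m \ge 0$ and $s\in\mathbb R$, $\omega_m^s$ is the operator of multiplication by $\omega_m(p)^s = (m^2+|p|^2)^{s/2}$ in Fourier transform. $B \subset \mathbb R^d$ is the ball of radius 1 centered at the origin, and $H^s_{\mathbb R}(B)$ is the closure of $C_c^\infty(B,\mathbb R)$ in the Sobolev space of real tempered distributions $f$ with $\int_{\mathbb R^d} dp\,(1+|p|^2)^s |\hat f(p)|^2 < +\infty$. Set $$K_m = \omega_m^{-1/2} H^{-1/2}_{\mathbb R}(B) + i \omega_m^{1/2} H^{1/2}_{\mathbb R}(B) \subset H .$$ It is known that $K_m$ is a standard subspace (a closed real subspace with $K_m+iK_m$ dense and $K_m\cap iK_m=\{0\}$) and a factor (i.e. $K_m\cap K_m'=\{0\}$, where $K_m'$ is the symplectic complement with respect to $\mathrm{Im}\langle\cdot,\cdot\rangle$).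 A symplectomorphism between standard subspaces is a real linear bijection preserving $\mathrm{Im}\langle\cdot,\cdot\rangle$. The Tomita operator is $s_m(h+ik) = h-ik$, $h,k\in K_m$, on $K_m+iK_m$, which is a complex Hilbert space with $\langle x,y\rangle_{s_m} = \langle x,y\rangle + \langle s_m y, s_m x\rangle$. $Q$ is bounded for the norm of $H$; $Q^\dagger : K_0 \to K_m$ is its adjoint with respect to the real scalar products: $\mathrm{Re}\langle Q^\dagger h,k\rangle = \mathrm{Re}\langle h,Qk\rangle$, $h\in K_0$, $k\in K_m$. Both $Q$ and $Q^\dagger$ are extended by $\mathbb C$-linearity to $K_m+iK_m$ and $K_0+iK_0$ respectively. *)

(* Defs.v *)
From HB Require Import structures.
From mathcomp Require Import all_boot all_order all_algebra.
From mathcomp Require Import all_classical all_reals all_analysis.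
From mathcomp Require Import measurable_realfun complex ring.

Set Implicit Arguments.
Unset Strict Implicit.
Unset Printing Implicit Defensive.

Import Order.TTheory GRing.Theory Num.Theory.
Import numFieldNormedType.Exports.
Import complex.

Local Open Scope quotient_scope.

Local Open Scope classical_set_scope.
Local Open Scope ring_scope.

Section measurable_rV.
Context {R : realType} {n : nat}.

Let coors : 'I_n -> 'rV[R]_n -> R := fun i x => x ord0 i.

Let rV_set0 : g_sigma_preimage coors set0.
Proof. exact: sigma_algebra0. Qed.

Let rV_setC A : g_sigma_preimage coors A -> g_sigma_preimage coors (~` A).
Proof. exact: sigma_algebraC. Qed.

Let rV_bigcup (F : (set 'rV[R]_n)^nat) :
  (forall i, g_sigma_preimage coors (F i)) ->
  g_sigma_preimage coors (\bigcup_i (F i)).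
Proof. exact: sigma_algebra_bigcup. Qed.

HB.instance Definition _ :=
  @isMeasurable.Build (measure_tuple_display default_measure_display)
    'rV[R]_n (g_sigma_preimage coors) rV_set0 rV_setC rV_bigcup.


Lemma measurable_coor (i : 'I_n) :
  measurable_fun [set: 'rV[R]_n] (fun x : 'rV[R]_n => x ord0 i).
Proof.
move=> _ Y mY; rewrite setTI; apply: sub_sigma_algebra => /=.
rewrite -bigcup_seq/=; exists i => /=; first by rewrite mem_index_enum.
by exists Y => //; rewrite setTI.
Qed.

Lemma measurable_fun_rV d (T : measurableType d) (f : T -> 'rV[R]_n) :
  (forall i, measurable_fun [set: T] (fun x => f x ord0 i)) ->
  measurable_fun [set: T] f.
Proof.
move=> mf; suff fS : g_sigma_preimage (fun i => coors i \o f) `<=` measurable.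
  move=> _ A mA; rewrite setTI; apply: fS; rewrite g_sigma_preimage_comp.
  by exists A => //; rewrite setTI.
apply: smallest_sub; first exact: sigma_algebra_measurable.
elim/big_ind : _ => //.
  by move=> X Y hX hY; rewrite subUset.
by move=> i _ _ [B mB <-]; exact: (mf i).
Qed.

End measurable_rV.

Section lebesgue_rV.
Context {R : realType}.

Definition cons_rV n (x : R * 'rV[R]_n) : 'rV[R]_n.+1 :=
  \row_i if unlift ord0 i is Some j then x.2 ord0 j else x.1.

Definition uncons_rV n (x : 'rV[R]_n.+1) : R * 'rV[R]_n :=
  (x ord0 ord0, \row_i x ord0 (lift ord0 i)).

Lemma cons_rV0 n x : @cons_rV n x ord0 ord0 = x.1.
Proof. by rewrite mxE unlift_none. Qed.

Lemma cons_rVS n x i : @cons_rV n x ord0 (lift ord0 i) = x.2 ord0 i.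
Proof. by rewrite mxE liftK. Qed.

Lemma cons_rVK n : cancel (@cons_rV n) (@uncons_rV n).
Proof.
move=> [a x]; rewrite /uncons_rV cons_rV0; congr (_, _).
by apply/rowP => i; rewrite mxE cons_rVS.
Qed.

Lemma uncons_rVK n : cancel (@uncons_rV n) (@cons_rV n).
Proof.
move=> x; apply/rowP => i; case: (unliftP ord0 i) => [j ->|->].
  by rewrite cons_rVS mxE.
by rewrite cons_rV0.
Qed.

Lemma measurable_cons_rV n : measurable_fun setT (@cons_rV n).
Proof.
apply: measurable_fun_rV => i; case: (unliftP ord0 i) => [j ->|->].
  under eq_fun do rewrite cons_rVS.
  exact: (measurableT_comp (measurable_coor j)).
under eq_fun do rewrite cons_rV0; exact: measurable_fst.
Qed.

Lemma measurable_uncons_rV n : measurable_fun setT (@uncons_rV n).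
Proof.
apply: measurable_fun_pair; first exact: (measurable_coor ord0).
apply: measurable_fun_rV => i /=; under eq_fun do rewrite mxE.
exact: measurable_coor.
Qed.

Section step.
Variables (n : nat) (mu1 : {sigma_finite_measure set (measurableTypeR R) -> \bar R}).
Variable mu : {sigma_finite_measure set 'rV[R]_n -> \bar R}.

(* The library provides no usable [sigma_finite_measure] structure on [\x], so
   it is established below directly on the pushforward. *)
Definition cons_measure : set 'rV[R]_n.+1 -> \bar R :=
  pushforward (mu1 \x mu)%E (@cons_rV n).

Let m (A : set 'rV[R]_n.+1) : measurable A -> measurable (@cons_rV n @^-1` A).
Proof. by move=> mA; rewrite -[X in measurable X]setTI; exact: measurable_cons_rV. Qed.

Let cons_measure0 : cons_measure set0 = 0%E.
Proof. by rewrite /cons_measure /pushforward preimage_set0 measure0. Qed.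

Let cons_measure_ge0 A : (0 <= cons_measure A)%E.
Proof. by rewrite /cons_measure /pushforward measure_ge0. Qed.

Let cons_measure_sigma_additive : semi_sigma_additive cons_measure.
Proof.
move=> F mF tF mUF; rewrite /cons_measure /pushforward preimage_bigcup.
apply: measure_semi_sigma_additive.
- by move=> k; exact: m.
- apply/trivIsetP => /= i j _ _ ij; rewrite -preimage_setI.
  by move/trivIsetP : tF => /(_ _ _ _ _ ij) ->//; rewrite preimage_set0.
- by rewrite -preimage_bigcup; exact: m.
Qed.

HB.instance Definition _ := isMeasure.Build _ _ _ cons_measure
  cons_measure0 cons_measure_ge0 cons_measure_sigma_additive.

Let cons_measure_sigma_finite : sigma_finite setT cons_measure.
Proof.
have /sigma_finiteP[F [TF ndF Foo]] := sigma_finiteT mu1.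
have /sigma_finiteP[G [TG ndG Goo]] := sigma_finiteT mu.
exists (fun k => @uncons_rV n @^-1` (F k `*` G k)).
  rewrite -preimage_bigcup (_ : \bigcup_k _ = setT) ?preimage_setT//.
  apply/seteqP; split => // -[x y] _.
  have : [set: measurableTypeR R] x by [].
  rewrite {1}TF => -[i _ Fix]; have : [set: 'rV[R]_n] y by [].
  rewrite {1}TG => -[j _ Gjy]; exists (maxn i j) => //; split => /=.
    by move: x Fix; exact/subsetPset/ndF/leq_maxl.
  by move: y Gjy; exact/subsetPset/ndG/leq_maxr.
move=> k; have [mFk Fk] := Foo k; have [mGk Gk] := Goo k; split.
  rewrite -[X in measurable X]setTI; apply: measurable_uncons_rV => //.
  exact: measurableX.
rewrite /cons_measure /pushforward -comp_preimage.
rewrite (_ : _ \o _ = id) ?preimage_id; last first.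
  by apply/funext => x /=; rewrite cons_rVK.
by rewrite product_measure1E// lte_mul_pinfty// ge0_fin_numE.
Qed.

HB.instance Definition _ := Measure_isSigmaFinite.Build _ _ _ cons_measure
  cons_measure_sigma_finite.

End step.

Fixpoint lebesgue_rV n : {sigma_finite_measure set 'rV[R]_n -> \bar R} :=
  match n with
  | 0 => \d_(0 : 'rV[R]_0)
  | n'.+1 => cons_measure lebesgue_measure (lebesgue_rV n')
  end.

End lebesgue_rV.

Local Open Scope complex_scope.

Definition sqnormc {R : realType} (z : R[i]) : R := Re z ^+ 2 + Im z ^+ 2.

Lemma sqnormcE {R : realType} (z : R[i]) : (sqnormc z)%:C = `|z| ^+ 2.
Proof.
by rewrite normc_def -rmorphXn sqr_sqrtr// addr_ge0// sqr_ge0.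
Qed.

Section complex_integral.
Context d (T : measurableType d) (R : realType).
Variable mu : {measure set T -> \bar R}.
Implicit Types f : T -> R[i].

Definition cmeasurable f :=
  measurable_fun [set: T] (fun x => Re (f x)) /\
  measurable_fun [set: T] (fun x => Im (f x)).

Definition cintegrable f :=
  mu.-integrable [set: T] (fun x => (Re (f x))%:E) /\
  mu.-integrable [set: T] (fun x => (Im (f x))%:E).

Definition cintegral f : R[i] :=
  (\int[mu]_x Re (f x)) +i* (\int[mu]_x Im (f x)).

Definition sqint : {pred (T -> R[i])} := mem [set f |
  cmeasurable f /\ (\int[mu]_x (sqnormc (f x))%:E < +oo)%E].

Lemma sqint_submod_closed : submod_closed sqint.
Proof.
split.
  rewrite inE /=; split; first by split; exact: measurable_cst.
  under eq_integral do rewrite /sqnormc /= expr0n /= addr0.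
  by rewrite integral0.
move=> a f g; rewrite !inE/= => -[[mfr mfi] foo] [[mgr mgi] goo].
have RIM (b z w : R[i]) :
    (Re (b * z + w) = Re b * Re z - Im b * Im z + Re w) *
    (Im (b * z + w) = Re b * Im z + Im b * Re z + Im w).
  by case: b z w => [? ?] [? ?] [? ?].
have ReE x : Re ((a *: f + g) x) =
    Re a * Re (f x) - Im a * Im (f x) + Re (g x).
  by rewrite -[(a *: f + g) x]/(a * f x + g x) RIM.
have ImE x : Im ((a *: f + g) x) =
    Re a * Im (f x) + Im a * Re (f x) + Im (g x).
  by rewrite -[(a *: f + g) x]/(a * f x + g x) RIM.
have mS h : cmeasurable h -> measurable_fun setT (fun x => sqnormc (h x)).
  by move=> [mr mi]; apply: measurable_funD; exact: measurable_funX.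
have mfg : cmeasurable (a *: f + g).
  split; [under eq_fun do rewrite ReE|under eq_fun do rewrite ImE].
    apply: measurable_funD => //; apply: measurable_funB;
      by apply: measurable_funM => //; exact: measurable_cst.
  apply: measurable_funD => //; apply: measurable_funD;
    by apply: measurable_funM => //; exact: measurable_cst.
split => //; set k := 2 * sqnormc a.
have k0 : 0 <= k by rewrite mulr_ge0// addr_ge0// sqr_ge0.
apply: (@le_lt_trans _ _ (\int[mu]_x
    (k%:E * (sqnormc (f x))%:E + 2%:E * (sqnormc (g x))%:E))%E).
  apply: ge0_le_integral => //.
  - by move=> x _; rewrite lee_fin addr_ge0// sqr_ge0.
  - exact/measurable_EFinP/mS.
  - apply: emeasurable_funD; apply: measurable_funeM;
      by apply/measurable_EFinP/mS.
  - move=> x _; rewrite -!EFinM -EFinD lee_fin /k /sqnormc ReE ImE.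
    rewrite -subr_ge0.
    set p := Re a; set q := Im a; set u := Re (f x); set v := Im (f x).
    set w := Re (g x); set t := Im (g x).
    have -> : 2 * (p ^+ 2 + q ^+ 2) * (u ^+ 2 + v ^+ 2) + 2 * (w ^+ 2 + t ^+ 2)
        - ((p * u - q * v + w) ^+ 2 + (p * v + q * u + t) ^+ 2) =
      (p * u - q * v - w) ^+ 2 + (p * v + q * u - t) ^+ 2 by ring.
    by rewrite addr_ge0// sqr_ge0.
have pos h x : (0 <= (sqnormc (h x))%:E)%E.
  by rewrite lee_fin addr_ge0// sqr_ge0.
rewrite ge0_integralD//; first last.
- by apply: measurable_funeM; exact/measurable_EFinP/mS.
- by move=> x _; rewrite mule_ge0.
- by apply: measurable_funeM; exact/measurable_EFinP/mS.
- by move=> x _; rewrite mule_ge0.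
rewrite !ge0_integralZl//; [|exact/measurable_EFinP/mS..].
by rewrite lte_add_pinfty// lte_mul_pinfty.
Qed.

HB.instance Definition _ := GRing.isSubmodClosed.Build _ _ sqint
  sqint_submod_closed.

Record sqintType := SqInt { sqint_fun :> T -> R[i]; sqint_funP : sqint_fun \in sqint }.

HB.instance Definition _ := [isSub for sqint_fun].
HB.instance Definition _ := [Choice of sqintType by <:].
HB.instance Definition _ := [SubChoice_isSubLmodule of sqintType by <:].

Lemma sqint_funB (f g : sqintType) x : (f - g) x = f x - g x.
Proof. by rewrite -[LHS]/(val (f - g) x) raddfB. Qed.

Lemma sqint_funZ a (f : sqintType) x : (a *: f) x = a * f x.
Proof. by []. Qed.

Definition ae0 : {pred sqintType} := mem [set f : sqintType |
  {ae mu, forall x, f x = 0}].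

Lemma ae0_zmod_closed : zmod_closed ae0.
Proof.
split; first by rewrite inE /=; apply/nearW.
move=> f g; rewrite !inE /= => f0 g0.
apply: filterS2 f0 g0 => x /= fx gx.
by rewrite [LHS](sqint_funB f g x) fx gx subr0.
Qed.

HB.instance Definition _ := GRing.isZmodClosed.Build _ ae0 ae0_zmod_closed.

Definition L2 : Type := {ideal_quot ae0}.
HB.instance Definition _ := GRing.Zmodule.on L2.
HB.instance Definition _ := EqQuotient.on L2.

Definition L2_class (f : sqintType) : L2 := \pi_L2 f.

Lemma L2_classP (f g : sqintType) :
  L2_class f = L2_class g <-> {ae mu, forall x, f x = g x}.
Proof.
have E : (f - g \in ae0) <-> {ae mu, forall x, f x = g x}.
  rewrite inE /=; split; apply: filterS => x.
    by rewrite [X in X = _ -> _](sqint_funB f g x) => /eqP; rewrite subr_eq0 => /eqP.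
  by move=> fg; rewrite [LHS](sqint_funB f g x) fg subrr.
rewrite -E; split => [/eqP|fg].
  by rewrite -Quotient.idealrBE.
by apply/eqP; rewrite -Quotient.idealrBE.
Qed.

Lemma L2_classD (f g : sqintType) :
  L2_class (f + g) = L2_class f + L2_class g.
Proof. exact: raddfD. Qed.

Definition L2_scale (a : R[i]) (u : L2) : L2 := L2_class (a *: repr u).

Lemma L2_scaleE a (f : sqintType) : L2_scale a (L2_class f) = L2_class (a *: f).
Proof.
apply/L2_classP; have /L2_classP : L2_class (repr (L2_class f)) = L2_class f.
  exact: reprK.
by apply: filterS => x fx; rewrite [LHS]sqint_funZ [RHS]sqint_funZ fx.
Qed.

Lemma L2_scaleA a b u : L2_scale a (L2_scale b u) = L2_scale (a * b) u.
Proof.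
by elim/quotW: u => f; rewrite -!/(L2_class _) !L2_scaleE scalerA.
Qed.

Lemma L2_scale1 : left_id 1 L2_scale.
Proof. by elim/quotW => f; rewrite -!/(L2_class _) L2_scaleE scale1r. Qed.

Lemma L2_scaleDr : right_distributive L2_scale +%R.
Proof.
move=> a; elim/quotW => f; elim/quotW => g; rewrite -!/(L2_class _).
by rewrite -L2_classD !L2_scaleE scalerDr L2_classD.
Qed.

Lemma L2_scaleDl u : {morph L2_scale^~ u : a b / a + b}.
Proof.
elim/quotW: u => f a b; rewrite -!/(L2_class _).
by rewrite !L2_scaleE scalerDl L2_classD.
Qed.

HB.instance Definition _ := GRing.Zmodule_isLmodule.Build R[i] L2
  L2_scaleA L2_scale1 L2_scaleDr L2_scaleDl.

Definition L2_fun (u : L2) : T -> R[i] := sqint_fun (repr u).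

Definition L2_ip (u v : L2) : R[i] :=
  cintegral (fun x => (L2_fun u x)^* * L2_fun v x).

End complex_integral.

Section distributions.
Context {R : realType} {d : nat}.
Local Notation Rd := 'rV[R]_d.
Local Notation leb := (@lebesgue_rV R d).
Implicit Types (x p : Rd) (phi psi : Rd -> R[i]).

Definition dotr (x p : Rd) : R := \sum_(i < d) x ord0 i * p ord0 i.

(* The library's norm on ['rV[R]_d] is the sup norm; [sqnormr x] is the squared
   Euclidean norm. *)
Definition sqnormr (x : Rd) : R := dotr x x.

Definition pderiv (i : 'I_d) phi : Rd -> R[i] := fun x =>
  'D_(delta_mx ord0 i) (fun y => Re (phi y) : R^o) x +i*
  'D_(delta_mx ord0 i) (fun y => Im (phi y) : R^o) x.

Definition pderivs (s : seq 'I_d) phi : Rd -> R[i] := foldr pderiv phi s.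

Definition smooth phi := forall (s : seq 'I_d) (x : Rd),
  differentiable (fun y => Re (pderivs s phi y) : R^o) x /\
  differentiable (fun y => Im (pderivs s phi y) : R^o) x.

Definition schwartz_bound (N : nat) phi (C : R) :=
  forall (s : seq 'I_d) x, (size s <= N)%N ->
    (1 + sqnormr x) ^+ N * Num.sqrt (sqnormc (pderivs s phi x)) <= C.

Definition schwartz phi := smooth phi /\
  forall N, exists C, schwartz_bound N phi C.

Definition fourier phi : Rd -> R[i] := fun p =>
  ((2 * pi) `^ (- (d%:R / 2)))%:C *
  cintegral leb (fun x => (cos (dotr p x) -i* sin (dotr p x)) * phi x).

(* Distributions are represented by total functionals; only their values on
   Schwartz functions are meaningful. *)
Definition distribution := (Rd -> R[i]) -> R[i].

Definition tempered (f : distribution) :=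
  (forall (a : R[i]) phi psi, schwartz phi -> schwartz psi ->
     f (fun x => a * phi x + psi x) = a * f phi + f psi) /\
  (exists N C, forall phi B, schwartz phi -> schwartz_bound N phi B ->
     Num.sqrt (sqnormc (f phi)) <= C * B).

Definition real_distribution (f : distribution) :=
  forall phi, schwartz phi -> (forall x, Im (phi x) = 0) -> Im (f phi) = 0.

Definition distr_of (h : Rd -> R[i]) : distribution := fun phi =>
  cintegral leb (fun x => h x * phi x).

(* The Fourier transform of [f], defined by duality, is the function [F]. *)
Definition is_fourier (f : distribution) (F : Rd -> R[i]) :=
  cmeasurable F /\
  forall phi, schwartz phi ->
    cintegrable leb (fun p => F p * phi p) /\
    f (fourier phi) = distr_of F phi.

(* Unique up to a.e. equality when the Fourier transform of [f] is a function,
   which holds in every Sobolev space. *)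
Definition fourierD (f : distribution) : Rd -> R[i] :=
  xget (fun=> 0) [set F | is_fourier f F].

Definition sobolev_norm (s : R) (f : distribution) : \bar R :=
  ((\int[leb]_p ((1 + sqnormr p) `^ s * sqnormc (fourierD f p))%:E)
     `^ 2^-1)%E.

Definition sobolev (s : R) (f : distribution) :=
  [/\ tempered f, real_distribution f, (exists F, is_fourier f F)
    & (sobolev_norm s f < +oo)%E].

Definition unit_ball : set Rd := [set x | sqnormr x < 1].

Definition test_fun (g : Rd -> R) :=
  smooth (fun x => (g x)%:C) /\
  let supp := closure [set x | g x != 0] in
  compact supp /\ supp `<=` unit_ball.

(* The closure of [C_c^oo(B, R)] in the Sobolev space of order [s]. *)
Definition sobolevB (s : R) (f : distribution) :=
  sobolev s f /\
  forall eps : R, 0 < eps -> exists2 g, test_fun g &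
    (sobolev_norm s (fun phi => (f phi - distr_of (fun x => (g x)%:C) phi)%R)
       < eps%:E)%E.

Definition omega (m : R) (p : Rd) : R := Num.sqrt (m ^+ 2 + sqnormr p).

(* [omega_m^s f] when it lies in [L^2(R^d)], 0 otherwise. It does for [f] in
   [sobolevB s'] with [(s, s') = (-1/2, -1/2)] or [(1/2, 1/2)], also for [m = 0]
   when [d >= 2], as [1/|p|] is then locally integrable. *)
Definition omega_pow (m s : R) (f : distribution) : L2 leb :=
  xget 0 [set u | is_fourier (distr_of (L2_fun u))
                    (fun p => (omega m p `^ s)%:C * fourierD f p)].

Definition Kspace (m : R) : set (L2 leb) :=
  [set u | exists f g, [/\ sobolevB (- 2^-1) f, sobolevB 2^-1 g &
    u = omega_pow m (- 2^-1) f + 'i *: omega_pow m 2^-1 g]].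

End distributions.

Section standard_subspaces.
Context {R : realType} {H : lmodType R[i]} (ip : H -> H -> R[i]).
Implicit Types (K L X : set H) (A B : H -> H).

Definition complex_span K : set H :=
  [set x | exists h k, [/\ K h, K k & x = h + 'i *: k]].

(* [tomita], [complex_ext] and [real_adjoint] are definite descriptions: the
   operator with the stated property, arbitrary off its natural domain. *)
Definition tomita K : H -> H := xget (@id H) [set s |
  forall h k, K h -> K k -> s (h + 'i *: k) = h - 'i *: k].

Definition tomita_ip K (x y : H) : R[i] :=
  ip x y + ip (tomita K y) (tomita K x).

Definition complex_ext K A : H -> H := xget (@id H) [set B |
  forall h k, K h -> K k -> B (h + 'i *: k) = A h + 'i *: A k].

Definition real_linear_on K A :=
  forall (a : R) h k, K h -> K k -> A (a%:C *: h + k) = a%:C *: A h + A k.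

Definition symplectomorphism K L A :=
  [/\ set_bij K L A, real_linear_on K A &
      forall h k, K h -> K k -> Im (ip (A h) (A k)) = Im (ip h k)].

Definition real_adjoint K L A : H -> H := xget (@id H) [set B |
  forall h, L h -> K (B h) /\
    forall k, K k -> Re (ip (B h) k) = Re (ip h (A k))].

End standard_subspaces.

Section hilbert_schmidt.
Context {R : realType} {H : lmodType R[i]}.
Variables (X : set H) (ip : H -> H -> R[i]).
Implicit Types (A : H -> H) (E : set H).

Definition hnorm (x : H) : R := Num.sqrt (Re (ip x x)).

(* A complete (maximal) orthonormal set, possibly uncountable. *)
Definition orthonormal_basis E :=
  [/\ E `<=` X, (forall e f, E e -> E f -> ip e f = (e == f)%:R) &
      forall x, X x -> (forall e, E e -> ip e x = 0) -> x = 0].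

Definition bounded_operator A :=
  [/\ (forall x, X x -> X (A x)),
      (forall (a : R[i]) x y, X x -> X y -> A (a *: x + y) = a *: A x + A y) &
      exists C : R, forall x, X x -> hnorm (A x) <= C * hnorm x].

Definition hs_sum A E : \bar R := \esum_(e in E) (hnorm (A e) ^+ 2)%:E.

Definition hilbert_schmidt A := bounded_operator A /\
  exists2 E, orthonormal_basis E & (hs_sum A E < +oo)%E.

(* In a Hilbert space the sum does not depend on the orthonormal basis. *)
Definition hs_norm A : R :=
  Num.sqrt (fine (hs_sum A (xget set0 [set E | orthonormal_basis E]))).

End hilbert_schmidt.

Section main_objects.
Context {R : realType} {d : nat}.
Local Notation leb := (@lebesgue_rV R d).
Local Notation H := (L2 leb).
Local Notation ip := (@L2_ip _ _ R leb).

Definition Qmap (m : R) : H -> H := xget (@id H) [set Q |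
  symplectomorphism ip (Kspace m) (Kspace 0) Q /\
  forall f g, sobolevB (- 2^-1) f -> sobolevB 2^-1 g ->
    Q (omega_pow m (- 2^-1) f + 'i *: omega_pow m 2^-1 g) =
    omega_pow 0 (- 2^-1) f + 'i *: omega_pow 0 2^-1 g].

Definition Qdag (m : R) : H -> H :=
  real_adjoint ip (Kspace m) (Kspace 0) (Qmap m).

Definition one_sub_QdagQ (m : R) : H -> H := fun x =>
  x - complex_ext (Kspace 0) (Qdag m) (complex_ext (Kspace m) (Qmap m) x).

End main_objects.

(* Main.v *)
(* Everything is done in momentum space. Through the Plancherel isometry [FF] a
   vector [u] of [K_m] is a pair of Hermitian functions [F = FK m u] and
   [G = GK m u], the Fourier transforms of elements of [H^{-1/2}_R(B)] and
   [H^{1/2}_R(B)]; then [Re <u, v>] is the integral of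
   [Re (conj F F') / w_m + w_m Re (conj G G')], [Im <u, v>] does not depend on
   [m], and [Q] keeps [F] and [G] while it replaces [w_m] by [w_0 = |p|].
   Hence [1 - Q^dagger Q] is the real form with weights [1/w_m - 1/|p|] and
   [w_m - |p|].

   Because [F] and [G] come from distributions supported in the ball, a cutoff
   function and Peetre's inequality give pointwise bounds
   [|F p|^2 <= C (1 + |p|^2)^{1/2} |u|^2] and
   [|G p|^2 <= C (1 + |p|^2)^{-1/2} |u|^2]: evaluation at [p] is a bounded real
   functional on [K_m]. For a bounded real functional [l] of norm [c^{1/2}] and a finite
   orthonormal family [h_j + i k_j], testing [l] on the combination of the
   family with coefficients [conj (l (h_j) + i l (k_j))] bounds
   [sum_j (l (h_j)^2 + l (k_j)^2)] by [c / 2]. Integrating against the weights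
   bounds the Hilbert-Schmidt norm by the integral of an integrable function
   times [sqrt m + m + m^4].

   [K_m] meets [i K_m] trivially: this reduces to [F = w_m G] forcing [G = 0].
   Along each ray [t e], the real part of [F] is an entire function of
   [t ^ 2], and its imaginary part is [t] times such a function; squaring
   [F = w_m G] gives [f ^ 2 = (m^2 + |e|^2 x) g ^ 2] for [x > 0], hence for all
   real [x], and for large negative [x] the two sides have opposite signs. *)
Require Import Defs.
From HB Require Import structures.
From mathcomp Require Import all_boot all_order all_algebra.
From mathcomp Require Import all_classical all_reals all_analysis.
From mathcomp Require Import measurable_realfun complex ring lra.

Set Implicit Arguments.
Unset Strict Implicit.
Unset Printing Implicit Defensive.

Import Order.TTheory GRing.Theory Num.Theory.
Import numFieldNormedType.Exports.
Import complex.

Local Open Scope classical_set_scope.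
Local Open Scope ring_scope.
Local Open Scope complex_scope.

(** * Hilbert spaces *)

(** The estimate has to stay uniform as [m -> 0], while the obvious bound of the [H^{1/2}] norm of
    [G] by the norm of [K_m] carries a factor [1 + 1/m]. The bound for [G p] is therefore drawn from
    the integral of [|q| |G q|^2] alone, at the price of a weight [1/|q|] on the transform of the
    cutoff, locally integrable for [d >= 2]. Cauchy-Schwarz splits each kernel into a weight on the
    argument, where the pointwise bounds are summed over the family, and a weight on the image,
    absorbed by its norm. For small [p], [1/|p| - 1/w_m] is at most [sqrt m |p|^{-3/2}], integrable
    for [d >= 2]; for large [p] the squared kernels leave [m^4 |p|^{-4}], integrable for [d <= 3].
    The Plancherel isometry comes from Gaussian coherent states: the Fourier transform permutes them
    and preserves their Gram matrix, and they are total because an integrable function with zero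
    Fourier transform vanishes. The Tomita operator, the complex extensions and [Q^dagger] are
    definite descriptions: the first two exist because [K_m] meets [i K_m] trivially, the last by
    Riesz representation on the closed space [K_m]. *)

Section complex_parts.
Context {R : realType}.
Implicit Types z w : R[i].

Lemma complexP z w : Re z = Re w -> Im z = Im w -> z = w.
Proof. by case: z w => [a b] [a' b'] /= -> ->. Qed.

Lemma cReD z w : Re (z + w) = Re z + Re w. Proof. by case: z w => [? ?] []. Qed.
Lemma cImD z w : Im (z + w) = Im z + Im w. Proof. by case: z w => [? ?] []. Qed.
Lemma cReN z : Re (- z) = - Re z. Proof. by case: z. Qed.
Lemma cImN z : Im (- z) = - Im z. Proof. by case: z. Qed.
Lemma cReM z w : Re (z * w) = Re z * Re w - Im z * Im w.
Proof. by case: z w => [? ?] []. Qed.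
Lemma cImM z w : Im (z * w) = Re z * Im w + Im z * Re w.
Proof. by case: z w => [? ?] []. Qed.
Lemma cReJ z : Re z^* = Re z. Proof. by case: z. Qed.
Lemma cImJ z : Im z^* = - Im z. Proof. by case: z. Qed.
Lemma cReC (x : R) : Re x%:C = x. Proof. by []. Qed.
Lemma cImC (x : R) : Im x%:C = 0. Proof. by []. Qed.
Lemma cRe0 : Re (0 : R[i]) = 0. Proof. by []. Qed.
Lemma cIm0 : Im (0 : R[i]) = 0. Proof. by []. Qed.
Lemma cRe1 : Re (1 : R[i]) = 1. Proof. by []. Qed.
Lemma cIm1 : Im (1 : R[i]) = 0. Proof. by []. Qed.
Lemma cRei : Re ('i : R[i]) = 0. Proof. by []. Qed.
Lemma cImi : Im ('i : R[i]) = 1. Proof. by []. Qed.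

Lemma Re_iM z : Re ('i * z) = - Im z. Proof. by rewrite cReM cRei cImi; lra. Qed.
Lemma Im_iM z : Im ('i * z) = Re z. Proof. by rewrite cImM cRei cImi; lra. Qed.
Lemma Re_JiM z : Re ('i^* * z) = Im z.
Proof. by rewrite cReM cReJ cImJ cRei cImi; lra. Qed.
Lemma Im_JiM z : Im ('i^* * z) = - Re z.
Proof. by rewrite cImM cReJ cImJ cRei cImi; lra. Qed.

(* [cReC] comes last: its left-hand side is convertible to a variable, so it
   matches any [Re _] whose argument reduces to a pair. *)
Definition cE0 := (Re_iM, Im_iM, Re_JiM, Im_JiM, cReD, cImD, cReN, cImN, cReM,
  cImM, cReJ, cImJ, cRe0, cIm0, cRe1, cIm1, cRei, cImi).
Definition cE := (cE0, cReC, cImC).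

Lemma Re_sum I (s : seq I) (F : I -> R[i]) :
  Re (\sum_(i <- s) F i) = \sum_(i <- s) Re (F i).
Proof. by elim/big_ind2 : _ => // ? ? ? ? <- <-; rewrite cReD. Qed.

End complex_parts.

Section hilbert.
Context {R : realType} {H : lmodType R[i]}.
Implicit Types (ip : H -> H -> R[i]) (K : set H).

(** Estimates are kept in squared norms, which avoids square roots; [nrm2_tri] with its factor 2
    plays the part of the triangle inequality. *)
Definition nrm2 ip (u : H) : R := Re (ip u u).

Definition hcauchy ip (u_ : nat -> H) := forall e, 0 < e -> exists N, forall m n,
  (N <= m)%N -> (N <= n)%N -> nrm2 ip (u_ m - u_ n) < e.

Definition hlim ip (u_ : nat -> H) (l : H) := forall e, 0 < e -> exists N,
  forall n, (N <= n)%N -> nrm2 ip (u_ n - l) < e.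

Record is_hilbert ip : Prop := IsHilbert {
  hil_D : forall u v w, ip u (v + w) = ip u v + ip u w;
  hil_Z : forall u a v, ip u (a *: v) = a * ip u v;
  hil_C : forall u v, ip v u = (ip u v)^*;
  hil_ge0 : forall u, 0 <= nrm2 ip u;
  hil_eq0 : forall u, nrm2 ip u = 0 -> u = 0;
  hil_complete : forall u_, hcauchy ip u_ -> exists l, hlim ip u_ l }.

Definition hclosure ip K : set H :=
  [set u | forall e, 0 < e -> exists2 k, K k & nrm2 ip (u - k) < e].

Definition real_subspace K := K 0 /\ forall (a : R) h k, K h -> K k ->
  K (a%:C *: h + k).

Context {ip : H -> H -> R[i]} (hip : is_hilbert ip).
Local Notation n2 := (nrm2 ip).
Local Notation rip u v := (Re (ip u v)).

Lemma ipDr u v w : ip u (v + w) = ip u v + ip u w. Proof. exact: hil_D. Qed.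
Lemma ipZr u a v : ip u (a *: v) = a * ip u v. Proof. exact: hil_Z. Qed.
Lemma ipC u v : ip v u = (ip u v)^*. Proof. exact: hil_C. Qed.
Lemma ipDl u v w : ip (u + v) w = ip u w + ip v w.
Proof.
rewrite [ip (u + v) w]ipC [ip u w]ipC [ip v w]ipC ipDr.
by apply: complexP; rewrite !cE//; ring.
Qed.
Lemma ipZl u a v : ip (a *: u) v = a^* * ip u v.
Proof.
rewrite [ip (a *: u) v]ipC [ip u v]ipC ipZr.
by apply: complexP; rewrite !cE//; ring.
Qed.
Lemma ip0r u : ip u 0 = 0.
Proof. by rewrite -(scale0r (0 : H)) ipZr mul0r. Qed.
Lemma ip0l u : ip 0 u = 0.
Proof. by rewrite ipC ip0r; apply: complexP; rewrite !cE// oppr0. Qed.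
Lemma ipNr u v : ip u (- v) = - ip u v.
Proof. by rewrite -scaleN1r ipZr mulN1r. Qed.
Lemma ipNl u v : ip (- u) v = - ip u v.
Proof.
rewrite [ip (- u) v]ipC [ip u v]ipC ipNr.
by apply: complexP; rewrite !cE.
Qed.
Lemma ip_sumr I (s : seq I) (F : I -> H) u :
  ip u (\sum_(i <- s) F i) = \sum_(i <- s) ip u (F i).
Proof.
elim: s => [|i s ih]; first by rewrite !big_nil ip0r.
by rewrite !big_cons ipDr ih.
Qed.
Lemma ip_suml I (s : seq I) (F : I -> H) u :
  ip (\sum_(i <- s) F i) u = \sum_(i <- s) ip (F i) u.
Proof.
elim: s => [|i s ih]; first by rewrite !big_nil ip0l.
by rewrite !big_cons ipDl ih.
Qed.

Definition ipE := (ipDr, ipDl, ipNr, ipNl, ipZr, ipZl, ip0r, ip0l).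

Lemma ripC u v : rip u v = rip v u. Proof. by rewrite ipC cReJ. Qed.
Lemma iipC u v : Im (ip u v) = - Im (ip v u). Proof. by rewrite ipC cImJ. Qed.
Lemma ipuu u : ip u u = (n2 u)%:C.
Proof.
apply: complexP; rewrite ?cReC ?cImC//.
by have := iipC u u; lra.
Qed.

Lemma nrm2_ge0 u : 0 <= n2 u. Proof. exact: hil_ge0. Qed.
Lemma nrm2_0 : n2 0 = 0. Proof. by rewrite /nrm2 ip0l. Qed.
Lemma nrm2_eq0 u : n2 u = 0 -> u = 0. Proof. exact: hil_eq0. Qed.

Lemma nrm2D u v : n2 (u + v) = n2 u + 2 * rip u v + n2 v.
Proof. by rewrite /nrm2 !ipE !cE (ripC v u); ring. Qed.
Lemma nrm2N u : n2 (- u) = n2 u. Proof. by rewrite /nrm2 !ipE opprK. Qed.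
Lemma nrm2B u v : n2 (u - v) = n2 u - 2 * rip u v + n2 v.
Proof. by rewrite nrm2D nrm2N ipNr !cE; ring. Qed.
Lemma nrm2BC u v : n2 (u - v) = n2 (v - u).
Proof. by rewrite -nrm2N opprB. Qed.
Lemma nrm2Z a u : n2 (a *: u) = sqnormc a * n2 u.
Proof. by rewrite /nrm2 !ipE ipuu !cE /sqnormc; ring. Qed.
Lemma nrm2ZR (a : R) u : n2 (a%:C *: u) = a ^+ 2 * n2 u.
Proof. by rewrite nrm2Z /sqnormc cReC cImC; ring. Qed.
Lemma rip_Zr a u v : rip u (a%:C *: v) = a * rip u v.
Proof. by rewrite ipE !cE; ring. Qed.
Lemma rip_Zl a u v : rip (a%:C *: u) v = a * rip u v.
Proof. by rewrite ipE !cE; ring. Qed.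

(** The vertex [- b / a] gives the inequality once [a] is known to be positive; a negative [a] is
    excluded at a large argument, and [a = 0] forces [b = 0]. *)
Lemma discr_le (a b c : R) : 0 <= c -> (forall t, 0 <= a * t ^+ 2 + 2 * b * t + c) ->
  b ^+ 2 <= a * c.
Proof.
move=> c0 P; have a0 : 0 <= a.
  rewrite leNgt; apply/negP => a0.
  (* At this argument [q >= 1] the value is [(a - 2 |b| - c) q + 2 b q + c], hence negative. *)
  have := P (1 + `|b| * 2 / (- a) + c / (- a)).
  set s := `|b| * 2 / (- a); set r := c / (- a).
  have s0 : 0 <= s by rewrite divr_ge0 ?mulr_ge0// oppr_ge0 ltW.
  have r0 : 0 <= r by rewrite divr_ge0 // oppr_ge0 ltW.
  have sE : a * s = - (`|b| * 2).
    by rewrite /s; field; rewrite lt_eqF.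
  have rE : a * r = - c by rewrite /r; field; rewrite lt_eqF.
  have bb : b <= `|b| by exact: ler_norm.
  have -> : a * (1 + s + r) ^+ 2 = (a + a * s + a * r) * (1 + s + r) by ring.
  rewrite sE rE; set q := 1 + s + r; have q1 : 1 <= q by rewrite /q; lra.
  have : 2 * b * q <= 2 * `|b| * q by rewrite ler_wpM2r//; lra.
  move: (normr_ge0 b) => b0; nra.
have [a00|an0] := eqVneq a 0.
  suff -> : b = 0 by rewrite a00; lra.
  apply/eqP; apply/negPn/negP => b0.
  have := P (- (c + 1) / (2 * b)); rewrite a00.
  have -> : 0 * (- (c + 1) / (2 * b)) ^+ 2 + 2 * b * (- (c + 1) / (2 * b)) + c = -1.
    by field.
  lra.
have {}a0 : 0 < a by rewrite lt_neqAle eq_sym an0.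
have := P (- b / a).
have -> : a * (- b / a) ^+ 2 + 2 * b * (- b / a) + c = (a * c - b ^+ 2) / a by field.
by rewrite pmulr_lge0 ?invr_gt0// subr_ge0.
Qed.

Lemma rip_cs u v : (rip u v) ^+ 2 <= n2 u * n2 v.
Proof.
rewrite mulrC; apply: discr_le; first exact: nrm2_ge0.
move=> t; have := nrm2_ge0 (u + t%:C *: v).
by rewrite nrm2D nrm2ZR rip_Zr; congr (_ <= _); ring.
Qed.

Lemma nrm2D_le u v : n2 (u + v) <= 2 * n2 u + 2 * n2 v.
Proof. by have := nrm2_ge0 (u - v); rewrite nrm2B nrm2D; lra. Qed.

Lemma nrm2_tri u v w : n2 (u - w) <= 2 * n2 (u - v) + 2 * n2 (v - w).
Proof. by apply: le_trans (nrm2D_le _ _); rewrite addrA subrK. Qed.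

Lemma hlim_cauchy u_ l : hlim ip u_ l -> hcauchy ip u_.
Proof.
move=> ul e e0; have [//|N Nu] := ul (e / 4); first by rewrite divr_gt0.
exists N => m n /Nu um /Nu un; apply: le_lt_trans (nrm2_tri _ l _) _.
by rewrite [n2 (l - _)]nrm2BC; lra.
Qed.

Lemma small_nrm2 u : (forall e, 0 < e -> n2 u < e) -> u = 0.
Proof.
move=> h; apply: nrm2_eq0; apply/eqP; rewrite eq_le nrm2_ge0 andbT leNgt.
by apply/negP => /h; rewrite ltxx.
Qed.

Lemma small_le (a : R) C : 0 <= C -> (forall e, 0 < e -> a <= C * e) -> a <= 0.
Proof.
move=> C0 h; rewrite leNgt; apply/negP => a0.
(* [C + 1] because [C] may be 0. *)
have := h (a / (2 * (C + 1))); rewrite divr_gt0//; last by lra.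
move=> /(_ isT); set q := a / _.
have qE : q * (2 * (C + 1)) = a by rewrite /q; field; rewrite gt_eqF//; lra.
have q0 : 0 < q by rewrite /q divr_gt0//; lra.
nra.
Qed.

Section riesz.
Variables (K : set H) (l : H -> R) (C : R).
Hypothesis C0 : 0 <= C.
Hypothesis rsK : real_subspace K.
Hypothesis clK : forall u_ v, (forall n, K (u_ n)) -> hlim ip u_ v -> K v.
Hypothesis lin : forall (a : R) h k, K h -> K k -> l (a%:C *: h + k) = a * l h + l k.
Hypothesis bnd : forall k, K k -> (l k) ^+ 2 <= C * n2 k.

Let K0 : K 0 := rsK.1.
Let KD h k : K h -> K k -> K (h + k).
Proof. by move=> Kh Kk; have := rsK.2 1 _ _ Kh Kk; rewrite scale1r. Qed.
Let KZ a h : K h -> K (a%:C *: h).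
Proof. by move=> Kh; have := rsK.2 a _ _ Kh K0; rewrite addr0. Qed.
Let lD h k : K h -> K k -> l (h + k) = l h + l k.
Proof. by move=> Kh Kk; have := lin 1 Kh Kk; rewrite scale1r mul1r. Qed.
Let l0 : l 0 = 0.
Proof. by have := lin 1 K0 K0; rewrite scaler0 addr0; lra. Qed.
Let lZ a h : K h -> l (a%:C *: h) = a * l h.
Proof. by move=> Kh; have := lin a Kh K0; rewrite addr0 l0 addr0. Qed.

Let J k := n2 k - 2 * l k.

Let Jlb k : K k -> - C <= J k.
Proof.
move=> Kk; rewrite /J; have := bnd Kk; have n0 := nrm2_ge0 k.
move=> lb; set x := n2 k in n0 lb *.
suff : (2 * l k) ^+ 2 <= (x + C) ^+ 2.
  rewrite -[(_ + _) ^+ 2]real_normK ?num_real// -[(2 * _) ^+ 2]real_normK ?num_real//.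
  rewrite ler_sqr ?nnegrE// [`|x + C|]ger0_norm ?addr_ge0//.
  by move/(le_trans (ler_norm _)); lra.
by have := sqr_ge0 (x - C); nra.
Qed.

Let S : set R := [set J k | k in K].

Let Sinf : has_inf S.
Proof.
by split; [exists (J 0), 0 | exists (- C) => _ [k Kk <-]; exact: Jlb].
Qed.

Let I := inf S.

Let Ile k : K k -> I <= J k.
Proof. by move=> Kk; apply: ge_inf; [exact: Sinf.2|exists k]. Qed.

Let minseq (n : nat) : exists k, K k /\ J k < I + n.+1%:R^-1.
Proof.
have [_ [k Kk <-] Jk] := @inf_adherent _ S n.+1%:R^-1 ltac:(by []) Sinf.
by exists k.
Qed.

(** If [k0] represents [l], then [J k] is [|k - k0|^2 - |k0|^2], so [k0] is found by minimising [J]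
    over [K]. The parallelogram law makes a minimising sequence Cauchy, and its limit lies in [K] by
    closedness. *)
Lemma riesz : exists2 k0, K k0 & forall k, K k -> rip k0 k = l k.
Proof.
have [u_ /all_and2[Ku Ju]] := choice minseq.
have half : (2^-1 : R) * 2 = 1 by rewrite mulVf.
(* Parallelogram law at the midpoint of [u_ m] and [u_ n], where [J] is still at least [I]. *)
have dist m n : n2 (u_ m - u_ n) <= 2 * m.+1%:R^-1 + 2 * n.+1%:R^-1.
  have := Ile (KZ 2^-1 (KD (Ku m) (Ku n))).
  rewrite /J nrm2ZR nrm2D lZ ?lD//; last exact: KD.
  move: (Ju m) (Ju n); rewrite /J nrm2B expr2.
  have -> : (2^-1 : R) * 2^-1 = 4^-1 by rewrite -invfM -natrM.
  have : (4^-1 : R) * 4 = 1 by rewrite mulVf.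
  set q := 4^-1; set h := 2^-1 in half *.
  set x := n2 _; set y := n2 _; set r := Re _.
  move=> q4 A B D; have -> : x - 2 * r + y = 2 * x + 2 * y - q * 4 * (x + 2 * r + y).
    by rewrite q4; ring.
  have -> : q * 4 * (x + 2 * r + y) = 4 * (q * (x + 2 * r + y)) by ring.
  move: D; have -> : 2 * (h * (l (u_ m) + l (u_ n))) = l (u_ m) + l (u_ n).
    by rewrite mulrA [2 * h]mulrC half mul1r.
  by move: A B; set p := m.+1%:R^-1; set p' := n.+1%:R^-1; set w := q * _; lra.
have inv_small (e : R) : 0 < e -> exists N : nat, forall n, (N <= n)%N -> n.+1%:R^-1 < e.
  move=> e0; exists (Num.trunc e^-1) => n Nn.
  rewrite invf_plt ?posrE// (lt_le_trans (truncnS_gt _))// ler_nat ltnS//.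
have cu : hcauchy ip u_.
  move=> e e0; have [|N Ns] := inv_small (e / 8); first by rewrite divr_gt0.
  exists N => m n /Ns Nm /Ns Nn; apply: le_lt_trans (dist _ _) _.
  by move: Nm Nn; set p := m.+1%:R^-1; set p' := n.+1%:R^-1; lra.
have [k0 uk0] := hil_complete hip cu.
exists k0; first exact: clK uk0.
move=> k Kk.
(* The polynomial [J (u_ n + t k) - I] in [t] is nonnegative and its constant term is below
   [1 / (n + 1)]. *)
have key n : (rip (u_ n) k - l k) ^+ 2 <= n2 k * n.+1%:R^-1.
  apply: discr_le; first by [].
  move=> t; have := Ile (KD (Ku n) (KZ t Kk)); have := Ju n.
  rewrite /J nrm2D nrm2ZR lD ?lZ//; last exact: KZ.
  by rewrite rip_Zr; set q := n.+1%:R^-1; lra.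
apply/eqP; rewrite -subr_eq0 -sqrf_eq0 eq_le sqr_ge0 andbT.
apply: (@small_le _ (4 * n2 k)); first by rewrite mulr_ge0// nrm2_ge0.
move=> e e0; have [N1 N1s] := inv_small e e0; have [N2 N2s] := uk0 e e0.
set n := maxn N1 N2; have := N1s n (leq_maxl _ _); have := N2s n (leq_maxr _ _).
have := rip_cs (u_ n - k0) k; have := key n; rewrite ipE ipE !cE.
set x := rip k0 k; set y := rip (u_ n) k; set z := l k; set q := _^-1.
move: (nrm2_ge0 k); set a := n2 k; set b := n2 (_ - _) => a0 A B Bb Q.
(* This is [(x - z)^2 <= 2 (y - x)^2 + 2 (y - z)^2]. *)
have := sqr_ge0 (2 * y - x - z).
nra.
Qed.

End riesz.

Lemma hclosure_closed K u_ v :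
  (forall n, hclosure ip K (u_ n)) -> hlim ip u_ v -> hclosure ip K v.
Proof.
move=> Ku uv e e0; have [//|N Nu] := uv (e / 4); first by rewrite divr_gt0.
have [//|k Kk uk] := Ku N (e / 4); first by rewrite divr_gt0.
exists k => //; apply: le_lt_trans (nrm2_tri _ (u_ N) _) _.
have := Nu N (leqnn _); rewrite nrm2BC; lra.
Qed.

Lemma hclosureS K : K `<=` hclosure ip K.
Proof. by move=> k Kk e e0; exists k => //; rewrite subrr nrm2_0. Qed.

Lemma hclosure_rs K : real_subspace K -> real_subspace (hclosure ip K).
Proof.
move=> [K0 KD]; split; first exact: hclosureS.
move=> a h k Kh Kk e e0.
have [|h' Kh' hh] := Kh (e / (4 * (a ^+ 2 + 1))).
  by rewrite divr_gt0// mulr_gt0// ltr_wpDl// sqr_ge0.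
have [|k' Kk' kk] := Kk (e / 4); first by rewrite divr_gt0.
exists (a%:C *: h' + k'); first exact: KD.
rewrite opprD addrACA -scalerBr; apply: le_lt_trans (nrm2D_le _ _) _.
rewrite nrm2ZR; move: hh kk (nrm2_ge0 (h - h')); set x := n2 _; set y := n2 _.
rewrite ltr_pdivlMr; last by rewrite mulr_gt0// ltr_wpDl// sqr_ge0.
move: (sqr_ge0 a); set b := a ^+ 2 => b0 A B x0; nra.
Qed.

(** * Unitary extension of a map between total families with equal Gram matrices *)

Section unitary.
Variable I : Type.
Implicit Types (g : I -> H) (s : seq (R[i] * I)).

Definition comb g s : H := \sum_(x <- s) x.1 *: g x.2.

Definition htotal g := forall u, (forall i, ip (g i) u = 0) -> u = 0.

Lemma comb_cat g s t : comb g (s ++ t) = comb g s + comb g t.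
Proof. by rewrite /comb big_cat. Qed.

Lemma comb_scale g a s : comb g [seq (a * x.1, x.2) | x <- s] = a *: comb g s.
Proof.
by rewrite /comb big_map scaler_sumr; apply: eq_bigr => x _; rewrite scalerA.
Qed.

Lemma comb_rs g : real_subspace (range (comb g)).
Proof.
split; first by exists [::] => //; rewrite /comb big_nil.
move=> a _ _ [s _ <-] [t _ <-].
exists ([seq (a%:C * x.1, x.2) | x <- s] ++ t) => //.
by rewrite comb_cat comb_scale.
Qed.

(** [riesz] on the closed span represents [Re <u, .>] by some [k0]. Then [u - k0] is orthogonal to
    every [g i], the multiples by [1] and ['i] giving both parts of the product, and totality yields
    [u = k0]. *)
Lemma total_dense g : htotal g -> forall u, hclosure ip (range (comb g)) u.
Proof.
move=> tg u; set K := hclosure _ _.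
have rsK : real_subspace K by apply/hclosure_rs/comb_rs.
have [||k Kk|k0 Kk0 k0P] := @riesz K (fun k => rip u k) (n2 u) (nrm2_ge0 u) rsK.
- by move=> u_ v; exact: hclosure_closed.
- by move=> a h k _ _; rewrite ipE !cE rip_Zr.
- by rewrite rip_cs.
suff -> : u = k0 by [].
apply/eqP; rewrite -subr_eq0; apply/eqP/tg => i.
have Kc c : K (c *: g i).
  by apply: hclosureS; exists [:: (c, i)] => //; rewrite /comb big_seq1.
have /eqP := k0P _ (Kc 1); have /eqP := k0P _ (Kc 'i).
rewrite !ipE !cE => /eqP A /eqP B.
rewrite [ip (g i) u]ipC [ip (g i) k0]ipC.
by apply: complexP; rewrite !cE; lra.
Qed.

Lemma comb_ip g g' s t : (forall i j, ip (g i) (g j) = ip (g' i) (g' j)) ->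
  ip (comb g s) (comb g t) = ip (comb g' s) (comb g' t).
Proof.
move=> gg; rewrite /comb !ip_suml; apply: eq_bigr => x _.
by rewrite !ip_sumr; apply: eq_bigr => y _; rewrite !ipE gg.
Qed.

Section ext.
Variables g g' : I -> H.
Hypothesis gram : forall i j, ip (g i) (g j) = ip (g' i) (g' j).
Hypotheses (tg : htotal g) (tg' : htotal g').

(** The closure of the graph of [comb g s |-> comb g' s]. A relation does not care whether [s] is
    determined by its combination; equal Gram matrices make it functional and injective. *)
Let G u v := forall e, 0 < e ->
  exists s, n2 (u - comb g s) < e /\ n2 (v - comb g' s) < e.

Let inv_small (e : R) : 0 < e -> exists N : nat, forall n, (N <= n)%N -> n.+1%:R^-1 < e.
Proof.
move=> e0; exists (Num.trunc e^-1) => n Nn.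
by rewrite invf_plt ?posrE// (lt_le_trans (truncnS_gt _))// ler_nat ltnS.
Qed.

Let gramB s t : n2 (comb g s - comb g t) = n2 (comb g' s - comb g' t).
Proof.
have E f : comb f s - comb f t = comb f (s ++ [seq (-1 * x.1, x.2) | x <- t]).
  by rewrite comb_cat comb_scale scaleN1r.
by rewrite !E /nrm2 (comb_ip _ _ gram).
Qed.

Let G_tot u : exists v, G u v.
Proof.
have ap (n : nat) : exists s, n2 (u - comb g s) < n.+1%:R^-1.
  have [|_ [s _ <-] us] := @total_dense g tg u n.+1%:R^-1; first by [].
  by exists s.
have [s_ sP] := choice ap.
have lu : hlim ip (fun n => comb g (s_ n)) u.
  move=> e e0; have [N Ns] := inv_small e0; exists N => n /Ns; apply: lt_trans.
  by rewrite nrm2BC.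
have cu : hcauchy ip (fun n => comb g' (s_ n)).
  move=> e /(hlim_cauchy lu)[N Ns]; exists N => m n Nm Nn.
  by rewrite -gramB; exact: Ns.
have [v vP] := hil_complete hip cu.
exists v => e e0; have [N Ns] := lu e e0; have [M Ms] := vP e e0.
exists (s_ (maxn N M)); split.
  by rewrite nrm2BC; apply: Ns; exact: leq_maxl.
by rewrite nrm2BC; apply: Ms; exact: leq_maxr.
Qed.

Let G_lin a u v u' v' : G u v -> G u' v' -> G (a *: u + u') (a *: v + v').
Proof.
move=> Guv Guv' e e0.
have p0 : 0 <= sqnormc a by rewrite addr_ge0// sqr_ge0.
have [|s [us vs]] := Guv (e / (4 * (sqnormc a + 1))).
  by rewrite divr_gt0// mulr_gt0// ltr_wpDl.
have [|t [ut vt]] := Guv' (e / 4); first by rewrite divr_gt0.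
exists ([seq (a * x.1, x.2) | x <- s] ++ t).
rewrite !comb_cat !comb_scale !opprD ![_ + (- _ + _)]addrACA -!scalerBr.
have gen x y : n2 x < e / (4 * (sqnormc a + 1)) -> n2 y < e / 4 ->
    n2 (a *: x + y) < e.
  move=> xe ye; apply: le_lt_trans (nrm2D_le _ _) _; rewrite nrm2Z.
  move: xe (nrm2_ge0 x); rewrite ltr_pdivlMr; last by rewrite mulr_gt0// ltr_wpDl.
  by move=> A B; nra.
by split; exact: gen.
Qed.

Let G_iso u v : G u v -> n2 v = 0 -> u = 0.
Proof.
move=> Guv v0; apply: small_nrm2 => e e0.
have [|s [us vs]] := Guv (e / 8); first by rewrite divr_gt0.
have sE : n2 (comb g s) = n2 (comb g' s) by rewrite /nrm2 (comb_ip _ _ gram).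
have := nrm2_tri u (comb g s) 0; rewrite !subr0 sE.
have := nrm2_tri (comb g' s) v 0; rewrite !subr0 v0 nrm2BC; lra.
Qed.

Let G_iso' u v : G u v -> n2 u = 0 -> v = 0.
Proof.
move=> Guv v0; apply: small_nrm2 => e e0.
have [|s [us vs]] := Guv (e / 8); first by rewrite divr_gt0.
have sE : n2 (comb g s) = n2 (comb g' s) by rewrite /nrm2 (comb_ip _ _ gram).
have := nrm2_tri v (comb g' s) 0; rewrite !subr0 -sE.
have := nrm2_tri (comb g s) u 0; rewrite !subr0 v0 nrm2BC; lra.
Qed.

Let G_fun u v v' : G u v -> G u v' -> v = v'.
Proof.
move=> A B; have := G_lin (-1) A B; rewrite !scaleN1r addNr => /G_iso'.
by rewrite nrm2_0 => /(_ erefl)/eqP; rewrite addrC subr_eq0 => /eqP.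
Qed.

Let G_inj u u' v : G u v -> G u' v -> u = u'.
Proof.
move=> A B; have := G_lin (-1) A B; rewrite !scaleN1r addNr => /G_iso.
by rewrite nrm2_0 => /(_ erefl)/eqP; rewrite addrC subr_eq0 => /eqP.
Qed.

Let G_n2 u v : G u v -> n2 u = n2 v.
Proof.
move=> Guv; apply/eqP; rewrite -subr_eq0 -sqrf_eq0 eq_le sqr_ge0 andbT.
have approx w x e : 0 < e -> e <= 1 -> n2 (w - x) < e ->
    (n2 w - n2 x) ^+ 2 <= e * (8 * n2 w + 8).
  move=> e0 e1 wx; have -> : n2 w - n2 x = 2 * rip (w - x) w - n2 (w - x).
    by rewrite nrm2B ipE !cE ipE !cE ripC /nrm2; ring.
  have := rip_cs (w - x) w; have := nrm2_ge0 (w - x); have := nrm2_ge0 w.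
  move: wx; set a := n2 _; set b := n2 w; set r := Re _ => A B D E.
  have := sqr_ge0 (2 * r + a); nra.
apply: (@small_le _ (32 * n2 u + 32 * n2 v + 64)).
  by have := nrm2_ge0 u; have := nrm2_ge0 v; lra.
move=> e e0; set e' := Num.min e 1.
have e'0 : 0 < e' by rewrite lt_min e0 ltr01.
have e'1 : e' <= 1 by rewrite ge_min lexx orbT.
have e'e : e' <= e by rewrite ge_min lexx.
have [s [us vs]] := Guv e' e'0.
have sE : n2 (comb g s) = n2 (comb g' s) by rewrite /nrm2 (comb_ip _ _ gram).
have := approx _ _ _ e'0 e'1 us; have := approx _ _ _ e'0 e'1 vs; rewrite sE.
move: (nrm2_ge0 u) (nrm2_ge0 v); set a := n2 u; set b := n2 v; set c := n2 _.
move=> a0 b0 A B; have := sqr_ge0 ((a - c) + (b - c)); nra.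
Qed.

(** Equality of the Gram matrices makes the map of combinations isometric, totality of [g] makes its
    domain dense and totality of [g'] its range. Norms are compared first; real parts of products
    follow by polarisation and imaginary parts by inserting ['i]. *)
Lemma unitary_extension : exists U : H -> H,
  [/\ forall a u v, U (a *: u + v) = a *: U u + U v,
      forall u v, ip (U u) (U v) = ip u v,
      forall i, U (g i) = g' i & forall v, exists u, U u = v].
Proof.
have [U UP] := choice G_tot; exists U.
have Ulin a u v : U (a *: u + v) = a *: U u + U v.
  exact: G_fun (UP _) (G_lin _ (UP _) (UP _)).
have Un u : n2 (U u) = n2 u by rewrite (G_n2 (UP u)).
have Ur u v : rip (U u) (U v) = rip u v.
  have := Un (1 *: u + v); rewrite Ulin !scale1r !nrm2D !Un; lra.
have UZ a u : U (a *: u) = a *: U u.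
  have U0 : U 0 = 0 by have := Ulin 0 0 0; rewrite !scale0r !add0r => /esym;
    have := Ulin 1 0 0; rewrite scaler0 addr0 scale1r => /eqP;
    rewrite -subr_eq0 opprD addrA subrr sub0r oppr_eq0 => /eqP.
  by have := Ulin a u 0; rewrite U0 !addr0.
split => //.
- move=> u v; apply: complexP; first exact: Ur.
  have := Ur ('i *: u) v; rewrite UZ !ipE !cE.
  lra.
- move=> i; apply: G_fun (UP _) _ => e e0.
  by exists [:: (1, i)]; rewrite /comb !big_seq1 !scale1r !subrr nrm2_0.
- move=> v.
  have : exists u, G u v.
    have ap (n : nat) : exists s, n2 (v - comb g' s) < n.+1%:R^-1.
      have [|_ [s _ <-] us] := @total_dense g' tg' v n.+1%:R^-1; first by [].
      by exists s.
    have [s_ sP] := choice ap.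
    have lv : hlim ip (fun n => comb g' (s_ n)) v.
      move=> e e0; have [N Ns] := inv_small e0; exists N => n /Ns.
      by apply: lt_trans; rewrite nrm2BC.
    have cu : hcauchy ip (fun n => comb g (s_ n)).
      move=> e /(hlim_cauchy lv)[N Ns]; exists N => m n Nm Nn.
      by rewrite gramB; exact: Ns.
    have [u uP] := hil_complete hip cu.
    exists u => e e0; have [N Ns] := lv e e0; have [M Ms] := uP e e0.
    exists (s_ (maxn N M)); split.
      by rewrite nrm2BC; apply: Ms; exact: leq_maxr.
    by rewrite nrm2BC; apply: Ns; exact: leq_maxl.
  by move=> [u Guv]; exists u; exact: G_fun (UP _) Guv.
Qed.

End ext.
End unitary.
End hilbert.

(** * Integration and square-integrable functions *)

Section real_integrals.
Context d (T : measurableType d) (R : realType).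
Variable mu : {measure set T -> \bar R}.
Implicit Types f g : T -> R.

Definition intg f := mu.-integrable [set: T] (EFin \o f).

Lemma intg_meas f : intg f -> measurable_fun setT f.
Proof. by move=> /integrableP[/measurable_EFinP]. Qed.

Lemma intgD f g : intg f -> intg g -> intg (fun x => f x + g x).
Proof. by move=> If Ig; exact: (integrableD measurableT If Ig). Qed.

Lemma intgB f g : intg f -> intg g -> intg (fun x => f x - g x).
Proof. by move=> If Ig; exact: (integrableB measurableT If Ig). Qed.

Lemma intgZ (k : R) f : intg f -> intg (fun x => k * f x).
Proof. by move=> If; exact: (integrableZl measurableT k If). Qed.

Lemma intgN f : intg f -> intg (fun x => - f x).
Proof. by move=> If; exact: (integrableN If). Qed.

Lemma intg0 : intg (fun=> 0).
Proof. exact: integrable0. Qed.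

Lemma intg_le g f : measurable_fun setT f -> (forall x, `|f x| <= g x) -> intg g -> intg f.
Proof.
move=> mf fg; apply: le_integrable => //; first exact/measurable_EFinP.
by move=> x _ /=; rewrite lee_fin (le_trans (fg x))// ler_norm.
Qed.

Lemma intg_norm f : intg f -> intg (fun x => `|f x|).
Proof. exact: integrable_norm. Qed.

Lemma intg_lty f : measurable_fun setT f -> (forall x, 0 <= f x) ->
  intg f <-> (\int[mu]_x (f x)%:E < +oo)%E.
Proof.
move=> mf f0; split => [/integrableP[_]|foo].
  by under eq_integral do rewrite /= ger0_norm//.
apply/integrableP; split; first exact/measurable_EFinP.
by under eq_integral do rewrite /= ger0_norm//.
Qed.

Lemma RintE f : intg f -> (\int[mu]_x (f x)%:E)%E = (\int[mu]_x f x)%:E.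
Proof. by move=> If; rewrite /Rintegral fineK// integrable_fin_num. Qed.

Lemma RintD f g : intg f -> intg g ->
  \int[mu]_x (f x + g x) = \int[mu]_x f x + \int[mu]_x g x.
Proof. by move=> If Ig; rewrite RintegralD. Qed.

Lemma RintB f g : intg f -> intg g ->
  \int[mu]_x (f x - g x) = \int[mu]_x f x - \int[mu]_x g x.
Proof. by move=> If Ig; rewrite RintegralB. Qed.

Lemma RintZ (k : R) f : intg f -> \int[mu]_x (k * f x) = k * \int[mu]_x f x.
Proof. by move=> If; rewrite RintegralZl. Qed.

Lemma RintN f : intg f -> \int[mu]_x (- f x) = - \int[mu]_x f x.
Proof.
move=> If; have := RintZ (-1) If; rewrite mulN1r => <-.
by apply: eq_Rintegral => x _; rewrite mulN1r.
Qed.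

Lemma Rint_ge0 f : (forall x, 0 <= f x) -> 0 <= \int[mu]_x f x.
Proof. by move=> f0; exact: Rintegral_ge0. Qed.

Lemma le_Rint f g : intg f -> intg g -> (forall x, f x <= g x) ->
  \int[mu]_x f x <= \int[mu]_x g x.
Proof. by move=> If Ig fg; exact: le_Rintegral. Qed.

Lemma Rint_norm f : intg f -> `|\int[mu]_x f x| <= \int[mu]_x `|f x|.
Proof. by move=> If; exact: le_normr_Rintegral. Qed.

Lemma Rint_ae f g : measurable_fun setT f -> measurable_fun setT g ->
  {ae mu, forall x, f x = g x} -> \int[mu]_x f x = \int[mu]_x g x.
Proof.
move=> mf mg fg; congr fine; apply: ae_eq_integral => //; try exact/measurable_EFinP.
by apply: filterS fg => x -> _.
Qed.

Lemma intg_ae f g : measurable_fun setT g -> {ae mu, forall x, f x = g x} ->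
  intg f -> intg g.
Proof.
move=> mg fg If; apply/integrableP; split; first exact/measurable_EFinP.
have mf := intg_meas If.
have /integrableP[_] := If; rewrite (@ae_eq_integral _ _ _ mu _ (abse \o (EFin \o g)))//.
- by apply: measurableT_comp => //; exact/measurable_EFinP.
- by apply: measurableT_comp => //; exact/measurable_EFinP.
- by apply: filterS fg => x /= -> _.
Qed.

Lemma le_Rint_ae f g : intg f -> intg g -> {ae mu, forall x, f x <= g x} ->
  \int[mu]_x f x <= \int[mu]_x g x.
Proof.
move=> If Ig fg.
have mf := intg_meas If; have mg := intg_meas Ig.
have mm : measurable_fun setT (fun x => Num.max (f x) (g x)) by exact: measurable_maxr.
have E : {ae mu, forall x, g x = Num.max (f x) (g x)}.
  by apply: filterS fg => x xx; rewrite max_r.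
rewrite [leRHS](Rint_ae _ _ E)//; apply: le_Rint => //; last first.
  by move=> x; rewrite le_max lexx.
exact: intg_ae E Ig.
Qed.

Lemma Rint_eq0 f : intg f -> (forall x, 0 <= f x) -> \int[mu]_x f x = 0 ->
  {ae mu, forall x, f x = 0}.
Proof.
move=> If f0 if0; have mf := intg_meas If.
have := RintE If; rewrite if0 => i0.
have /(_ (EFin \o f))[] := @ae_eq_integral_abs _ T R mu setT measurableT.
  exact/measurable_EFinP.
move=> h _; have : ae_eq mu setT (EFin \o f) (cst 0%E).
  apply: h; rewrite -[RHS]i0; apply: eq_integral => x _ /=.
  by rewrite ger0_norm.
by apply: filterS => x /(_ I) [].
Qed.

Lemma Rint_dct (f_ : nat -> T -> R) f g :
  (forall n, measurable_fun setT (f_ n)) -> measurable_fun setT f ->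
  {ae mu, forall x, f_ ^~ x @ \oo --> f x} -> intg g ->
  {ae mu, forall x n, `|f_ n x| <= g x} ->
  [/\ intg f, forall n, intg (f_ n) & (\int[mu]_x f_ n x) @[n --> \oo] --> \int[mu]_x f x].
Proof.
move=> mf_ mf ff Ig fg.
have mE (h : T -> R) : measurable_fun setT h -> measurable_fun setT (EFin \o h).
  by move=> ?; exact/measurable_EFinP.
have [If _ cf] := @dominated_convergence _ T R mu setT measurableT
  (fun n => EFin \o f_ n) (EFin \o f) (EFin \o g)
  (fun n => mE _ (mf_ n)) (mE _ mf)
  ltac:(by apply: filterS ff => x fx _; apply/cvg_EFin => //; exact: nearW)
  Ig ltac:(by apply: filterS fg => x fx n _; rewrite lee_fin).
have If_ n : intg (f_ n).
  (* Clamping [f_ n] between [- g] and [g] changes it on a null set only and gives a bound by [|g|]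
     at every point. *)
  have E : {ae mu, forall x, Num.min (Num.max (f_ n x) (- g x)) (g x) = f_ n x}.
    apply: filterS fg => x /(_ n); rewrite ler_norml => /andP[a b].
    by rewrite max_l// min_l.
  apply: intg_ae E _ => //.
  apply: (@intg_le (fun x => `|g x|)); last exact: intg_norm.
    by apply: measurable_minr; [apply: measurable_maxr => //; apply: measurable_funN|];
      exact: intg_meas Ig.
  move=> x; set a := f_ n x; set b := g x; rewrite ler_norml.
  apply/andP; split; last by rewrite ge_min (ler_norm b) orbT.
  rewrite le_min le_max (_ : - `|b| <= - b) ?orbT/=; last by rewrite lerN2 ler_norm.
  by rewrite lerNl -normrN ler_norm.
split => //.
have -> : (fun n => \int[mu]_x f_ n x) = (fun n => fine (\int[mu]_x (f_ n x)%:E)%E) by [].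
apply: fine_cvg; rewrite -RintE//.
Qed.

End real_integrals.

Section complex_integrals.
Context d (T : measurableType d) (R : realType).
Variable mu : {measure set T -> \bar R}.
Implicit Types f g : T -> R[i].
Local Notation intg := (intg mu).
Local Notation cint := (cintegral mu).

Lemma cmeasD f g : cmeasurable f -> cmeasurable g -> cmeasurable (fun x => f x + g x).
Proof.
move=> [a b] [a' b']; split.
  by under eq_fun do rewrite cReD; exact: measurable_funD.
by under eq_fun do rewrite cImD; exact: measurable_funD.
Qed.

Lemma cmeasM f g : cmeasurable f -> cmeasurable g -> cmeasurable (fun x => f x * g x).
Proof.
move=> [a b] [a' b']; split.
  by under eq_fun do rewrite cReM; apply: measurable_funB; exact: measurable_funM.
by under eq_fun do rewrite cImM; apply: measurable_funD; exact: measurable_funM.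
Qed.

Lemma cmeasJ f : cmeasurable f -> cmeasurable (fun x => (f x)^*).
Proof.
move=> [a b]; split; first by under eq_fun do rewrite cReJ.
by under eq_fun do rewrite cImJ; exact: measurable_funN.
Qed.

Lemma cmeas_cst (c : R[i]) : cmeasurable (fun _ : T => c).
Proof. by split; exact: measurable_cst. Qed.

Lemma cmeasN f : cmeasurable f -> cmeasurable (fun x => - f x).
Proof.
move=> [a b]; split; first by under eq_fun do rewrite cReN; exact: measurable_funN.
by under eq_fun do rewrite cImN; exact: measurable_funN.
Qed.

Lemma cmeasB f g : cmeasurable f -> cmeasurable g -> cmeasurable (fun x => f x - g x).
Proof. by move=> mf mg; apply: cmeasD => //; exact: cmeasN. Qed.

Lemma cmeasR (h : T -> R) : measurable_fun setT h -> cmeasurable (fun x => (h x)%:C).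
Proof. by move=> mh; split => //; exact: measurable_cst. Qed.

Lemma meas_sqnormc f : cmeasurable f -> measurable_fun setT (fun x => sqnormc (f x)).
Proof. by move=> [a b]; apply: measurable_funD; exact: measurable_funX. Qed.

Lemma sqnormc_ge0 (z : R[i]) : 0 <= sqnormc z.
Proof. by rewrite addr_ge0// sqr_ge0. Qed.
Lemma sqnormcM (z w : R[i]) : sqnormc (z * w) = sqnormc z * sqnormc w.
Proof. by rewrite /sqnormc !cE; ring. Qed.
Lemma sqnormcJ (z : R[i]) : sqnormc z^* = sqnormc z.
Proof. by rewrite /sqnormc !cE; ring. Qed.
Lemma sqnormcN (z : R[i]) : sqnormc (- z) = sqnormc z.
Proof. by rewrite /sqnormc !cE; ring. Qed.
Lemma sqnormcD_le (z w : R[i]) : sqnormc (z + w) <= 2 * sqnormc z + 2 * sqnormc w.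
Proof.
rewrite -subr_ge0 (_ : _ - _ = sqnormc (z - w)) ?addr_ge0 ?sqr_ge0//.
by rewrite /sqnormc !cE; ring.
Qed.
Lemma sqnormcB_le (z w : R[i]) : sqnormc (z - w) <= 2 * sqnormc z + 2 * sqnormc w.
Proof. by have := sqnormcD_le z (- w); rewrite sqnormcN. Qed.
Lemma sqnormc_eq0 (z : R[i]) : sqnormc z = 0 -> z = 0.
Proof.
rewrite /sqnormc => h; have := sqr_ge0 (Re z); have := sqr_ge0 (Im z) => a b.
have /eqP : Re z ^+ 2 = 0 by lra.
have /eqP : Im z ^+ 2 = 0 by lra.
by rewrite !sqrf_eq0 => /eqP ? /eqP ?; exact: complexP.
Qed.
Lemma sqnormc0 : sqnormc (0 : R[i]) = 0.
Proof. by rewrite /sqnormc !cE; ring. Qed.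
Lemma sqnormcR (x : R) : sqnormc x%:C = x ^+ 2.
Proof. by rewrite /sqnormc !cE; ring. Qed.

Lemma cintegralP f : cintegrable mu f <->
  intg (fun x => Re (f x)) /\ intg (fun x => Im (f x)).
Proof. by []. Qed.

Lemma cintgD f g : cintegrable mu f -> cintegrable mu g ->
  cintegrable mu (fun x => f x + g x).
Proof.
move=> /cintegralP[a b] /cintegralP[a' b']; apply/cintegralP; split.
  by under eq_fun do rewrite cReD; exact: intgD.
by under eq_fun do rewrite cImD; exact: intgD.
Qed.

Lemma cintgZ c f : cintegrable mu f -> cintegrable mu (fun x => c * f x).
Proof.
move=> /cintegralP[a b]; apply/cintegralP; split.
  by under eq_fun do rewrite cReM; apply: intgB; exact: intgZ.
by under eq_fun do rewrite cImM; apply: intgD; exact: intgZ.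
Qed.

Lemma cintg_meas f : cintegrable mu f -> cmeasurable f.
Proof. by move=> /cintegralP[/intg_meas a /intg_meas b]. Qed.

Lemma Re_cint f : Re (cint f) = \int[mu]_x Re (f x). Proof. by []. Qed.
Lemma Im_cint f : Im (cint f) = \int[mu]_x Im (f x). Proof. by []. Qed.

Lemma cintD f g : cintegrable mu f -> cintegrable mu g ->
  cint (fun x => f x + g x) = cint f + cint g.
Proof.
move=> /cintegralP[a b] /cintegralP[a' b']; apply: complexP; rewrite !cE0.
  by rewrite !Re_cint; under eq_Rintegral do rewrite cReD; rewrite RintD.
by rewrite !Im_cint; under eq_Rintegral do rewrite cImD; rewrite RintD.
Qed.

Lemma cintZ c f : cintegrable mu f -> cint (fun x => c * f x) = c * cint f.
Proof.
move=> /cintegralP[a b]; apply: complexP; rewrite !cE0.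
  rewrite !Re_cint !Im_cint; under eq_Rintegral do rewrite cReM.
  by rewrite RintB ?RintZ//; exact: intgZ.
rewrite !Re_cint !Im_cint; under eq_Rintegral do rewrite cImM.
by rewrite RintD ?RintZ//; exact: intgZ.
Qed.

Lemma cintJ f : cintegrable mu f -> cint (fun x => (f x)^*) = (cint f)^*.
Proof.
move=> /cintegralP[a b]; apply: complexP; rewrite !cE0.
  by rewrite !Re_cint; under eq_Rintegral do rewrite cReJ.
by rewrite !Im_cint; under eq_Rintegral do rewrite cImJ; rewrite RintN.
Qed.

Lemma cint_ae f g : cmeasurable f -> cmeasurable g ->
  {ae mu, forall x, f x = g x} -> cint f = cint g.
Proof.
move=> [a b] [a' b'] fg; apply: complexP.
  by rewrite !Re_cint; apply: Rint_ae => //; apply: filterS fg => x ->.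
by rewrite !Im_cint; apply: Rint_ae => //; apply: filterS fg => x ->.
Qed.

Lemma cintg_ae f g : cmeasurable g -> {ae mu, forall x, f x = g x} ->
  cintegrable mu f -> cintegrable mu g.
Proof.
move=> [a b] fg /cintegralP[If1 If2]; apply/cintegralP; split.
  by apply: intg_ae If1 => //; apply: filterS fg => x ->.
by apply: intg_ae If2 => //; apply: filterS fg => x ->.
Qed.

Lemma eq_cint f g : f =1 g -> cint f = cint g.
Proof. by move=> /funext ->. Qed.

Lemma cintg_le (h : T -> R) f : cmeasurable f -> intg h ->
  (forall x, sqnormc (f x) <= h x ^+ 2) -> (forall x, 0 <= h x) -> cintegrable mu f.
Proof.
move=> [a b] Ih fh h0; apply/cintegralP; split.
  apply: (intg_le a) Ih => x; rewrite -ler_sqr ?nnegrE// real_normK ?num_real//.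
  by apply: le_trans (fh x); rewrite /sqnormc lerDl sqr_ge0.
apply: (intg_le b) Ih => x; rewrite -ler_sqr ?nnegrE// real_normK ?num_real//.
by apply: le_trans (fh x); rewrite /sqnormc lerDr sqr_ge0.
Qed.

Definition sqi f := cmeasurable f /\ intg (fun x => sqnormc (f x)).

Lemma sqiP f : f \in sqint mu <-> sqi f.
Proof.
rewrite inE /=; split => -[mf] H; split => //.
  by apply/intg_lty => //; [exact: meas_sqnormc|move=> x; exact: sqnormc_ge0].
by apply/intg_lty => //; [exact: meas_sqnormc|move=> x; exact: sqnormc_ge0].
Qed.

Lemma sqiM f g : sqi f -> sqi g -> cintegrable mu (fun x => f x * g x).
Proof.
move=> [mf If] [mg Ig].
apply: (@cintg_le (fun x => sqnormc (f x) + sqnormc (g x))); first exact: cmeasM.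
- exact: intgD.
- move=> x; rewrite sqnormcM; have := sqnormc_ge0 (f x); have := sqnormc_ge0 (g x).
  by set a := sqnormc _; set b := sqnormc _; nra.
- by move=> x; rewrite addr_ge0// sqnormc_ge0.
Qed.

Lemma sqiJ f : sqi f -> sqi (fun x => (f x)^*).
Proof.
by move=> [mf If]; split; [exact: cmeasJ|under eq_fun do rewrite sqnormcJ].
Qed.

Lemma sqi_le (h : T -> R) f : cmeasurable f -> intg h ->
  (forall x, sqnormc (f x) <= h x) -> sqi f.
Proof.
move=> mf Ih fh; split => //; apply: intg_le Ih; first exact: meas_sqnormc.
by move=> x; rewrite ger0_norm ?sqnormc_ge0.
Qed.

Lemma sqiD f g : sqi f -> sqi g -> sqi (fun x => f x + g x).
Proof.
move=> [mf If] [mg Ig]; apply: sqi_le (cmeasD mf mg) (intgD (intgZ 2 If) (intgZ 2 Ig)) _.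
by move=> x; exact: sqnormcD_le.
Qed.

Lemma sqiZ c f : sqi f -> sqi (fun x => c * f x).
Proof.
move=> [mf If]; split; first by apply: cmeasM => //; exact: cmeas_cst.
by under eq_fun do rewrite sqnormcM; exact: intgZ.
Qed.

Lemma sqiB f g : sqi f -> sqi g -> sqi (fun x => f x - g x).
Proof.
move=> [mf If] [mg Ig]; apply: sqi_le (cmeasB mf mg) (intgD (intgZ 2 If) (intgZ 2 Ig)) _.
by move=> x; exact: sqnormcB_le.
Qed.

Lemma sqi_ae f g : cmeasurable g -> {ae mu, forall x, f x = g x} -> sqi f -> sqi g.
Proof.
move=> mg fg [mf If]; split => //; apply: intg_ae If; first exact: meas_sqnormc.
by apply: filterS fg => x ->.
Qed.

End complex_integrals.

Section L2_theory.
Context d (T : measurableType d) (R : realType).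
Variable mu : {measure set T -> \bar R}.
Implicit Types f g : T -> R[i].
Local Notation intg := (intg mu).
Local Notation cint := (cintegral mu).
Local Notation L2 := (L2 mu).
Local Notation sqi := (sqi mu).
Implicit Types u v w : L2.

Definition mkL2 f : L2 :=
  if pselect (f \in sqint mu) is left p then L2_class (SqInt p) else 0.

Lemma L2_sqi u : sqi (L2_fun u).
Proof. exact/sqiP/sqint_funP. Qed.

Lemma L2_class_ae (f : sqintType mu) : {ae mu, forall x, L2_fun (L2_class f) x = f x}.
Proof. by apply/L2_classP; exact: reprK. Qed.

Lemma mkL2_ae f : sqi f -> {ae mu, forall x, L2_fun (mkL2 f) x = f x}.
Proof.
move=> /sqiP sf; rewrite /mkL2; case: pselect => // p; exact: L2_class_ae.
Qed.

Lemma L2_funK u : mkL2 (L2_fun u) = u.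
Proof.
rewrite /mkL2; case: pselect => [p|]; last by move=> /(_ (sqint_funP _)).
rewrite -[RHS]reprK; congr (\pi_L2 _)%qT; exact: val_inj.
Qed.

Lemma L2_ext u v : {ae mu, forall x, L2_fun u x = L2_fun v x} -> u = v.
Proof. by move=> uv; rewrite -(reprK u) -(reprK v); exact/L2_classP. Qed.

Lemma mkL2_eq f g : sqi f -> sqi g -> {ae mu, forall x, f x = g x} -> mkL2 f = mkL2 g.
Proof.
move=> sf sg fg; apply: L2_ext; have := mkL2_ae sf; have := mkL2_ae sg.
by apply: filterS3 fg => x -> -> ->.
Qed.

Lemma L2_funD u v : {ae mu, forall x, L2_fun (u + v) x = L2_fun u x + L2_fun v x}.
Proof.
have E : L2_class (repr u + repr v) = u + v by rewrite L2_classD /L2_class !reprK.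
have := L2_class_ae (repr u + repr v); rewrite E; apply: filterS => x ->.
by rewrite -[LHS]/(val (repr u + repr v) x) raddfD.
Qed.

Lemma L2_funZ a u : {ae mu, forall x, L2_fun (a *: u) x = a * L2_fun u x}.
Proof. exact: L2_class_ae. Qed.

Lemma L2_fun0 : {ae mu, forall x, L2_fun (0 : L2) x = 0}.
Proof. by have := L2_funZ 0 0; rewrite scale0r; apply: filterS => x ->; rewrite mul0r. Qed.

Local Notation ip := (@L2_ip _ _ R mu).

Lemma ip_fun u v f g : sqi f -> sqi g ->
  {ae mu, forall x, L2_fun u x = f x} -> {ae mu, forall x, L2_fun v x = g x} ->
  ip u v = cint (fun x => (f x)^* * g x).
Proof.
move=> sf sg uf vg; apply: cint_ae.
- by apply: cmeasM; [apply: cmeasJ|]; exact: (L2_sqi _).1.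
- by apply: cmeasM; [apply: cmeasJ; exact: sf.1|exact: sg.1].
- by apply: filterS2 uf vg => x -> ->.
Qed.

Lemma ip_mk f g : sqi f -> sqi g -> ip (mkL2 f) (mkL2 g) = cint (fun x => (f x)^* * g x).
Proof. by move=> sf sg; apply: ip_fun => //; exact: mkL2_ae. Qed.

Lemma nrm2_fun u : nrm2 ip u = \int[mu]_x sqnormc (L2_fun u x).
Proof.
rewrite /nrm2 /L2_ip Re_cint; apply: eq_Rintegral => x _.
by rewrite /sqnormc !cE; ring.
Qed.

Lemma nrm2_mk f : sqi f -> nrm2 ip (mkL2 f) = \int[mu]_x sqnormc (f x).
Proof.
move=> sf; rewrite nrm2_fun; apply: Rint_ae.
- by apply: meas_sqnormc; exact: (L2_sqi _).1.
- by apply: meas_sqnormc; exact: sf.1.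
- by apply: filterS (mkL2_ae sf) => x ->.
Qed.

Lemma L2_ipDr u v w : ip u (v + w) = ip u v + ip u w.
Proof.
have s := L2_sqi.
rewrite (ip_fun (s u) (sqiD (s v) (s w)) _ (L2_funD v w)); last exact: nearW.
rewrite -cintD; [|by apply: sqiM => //; exact: sqiJ..].
by apply: eq_cint => x; rewrite mulrDr.
Qed.

Lemma L2_ipZr u a v : ip u (a *: v) = a * ip u v.
Proof.
have s := L2_sqi.
rewrite (ip_fun (s u) (sqiZ a (s v)) _ (L2_funZ a v)); last exact: nearW.
rewrite -cintZ; last by apply: sqiM => //; exact: sqiJ.
by apply: eq_cint => x; rewrite mulrCA.
Qed.

Lemma L2_ipC u v : ip v u = (ip u v)^*.
Proof.
rewrite -cintJ; last by apply: sqiM; [apply: sqiJ|]; exact: L2_sqi.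
by apply: eq_cint => x; apply: complexP; rewrite !cE; ring.
Qed.

Lemma L2_nrm2_eq0 u : nrm2 ip u = 0 -> u = 0.
Proof.
rewrite nrm2_fun => h; apply: L2_ext.
have [_ Iu] := L2_sqi u.
have := Rint_eq0 Iu (fun x => sqnormc_ge0 _) h.
by apply: filterS2 L2_fun0 => x -> /sqnormc_eq0.
Qed.

End L2_theory.

Section fatou_bound.
Context d (T : measurableType d) (R : realType).
Variable mu : {measure set T -> \bar R}.

(** The form of Fatou's lemma used for Sobolev norms: convergence almost everywhere, a bound that
    may hold for large [n] only, and integrability of the limit as part of the conclusion. *)
Lemma fatou_le (f_ : nat -> T -> R) (f : T -> R) (C : R) :
  (forall n, measurable_fun setT (f_ n)) -> measurable_fun setT f ->
  (forall n x, 0 <= f_ n x) -> {ae mu, forall x, f_ ^~ x @ \oo --> f x} ->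
  (exists N, forall n, (N <= n)%N -> (\int[mu]_x (f_ n x)%:E <= C%:E)%E) ->
  [/\ {ae mu, forall x, 0 <= f x}, intg mu f & \int[mu]_x f x <= C].
Proof.
move=> mf_ mf f0 ff [N fC].
have f0' : {ae mu, forall x, 0 <= f x}.
  apply: filterS ff => x fx; rewrite -(cvg_lim _ fx)//.
  by apply: limr_ge; [exact: cvgP fx|apply: nearW].
have mE (h : T -> R) : measurable_fun setT h -> measurable_fun setT (EFin \o h).
  by move=> ?; exact/measurable_EFinP.
(* Dropping the first [N] terms makes the bound on the integrals hold for all indices. *)
pose g n x := f_ (n + N)%N x.
have key : (\int[mu]_x `|f x|%:E <= C%:E)%E.
  have -> : (\int[mu]_x `|f x|%:E = \int[mu]_x limn_einf (fun n => (g n x)%:E))%E.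
    have m1 : measurable_fun setT (fun x => limn_einf (fun n => (g n x)%:E)).
      under eq_fun do rewrite /limn_einf.
      apply: measurableT_comp => //; apply: measurable_fun_limn_esup => n.
      exact: (mE (fun x => - g n x) (measurable_funN (mf_ _))).
    apply: ge0_ae_eq_integral => //.
    - by apply: mE; exact: measurableT_comp.
    - move=> x _; rewrite limn_einf_lim; apply: lime_ge.
        exact: is_cvg_einfs.
      apply: nearW => n; apply: le_ereal_inf_tmp => _ [m _ <-].
      by rewrite lee_fin f0.
    - apply: filterS2 ff f0' => x fx x0 _; rewrite ger0_norm//.
      have gx : (g n x)%:E @[n --> \oo] --> (f x)%:E.
        by apply/cvg_EFin; [exact: nearW|rewrite /g (cvg_shiftn N (fun n => f_ n x))].
      rewrite is_cvg_limn_einfE; first by rewrite (cvg_lim _ gx).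
      exact: cvgP gx.
  apply: le_trans (fatou _ measurableT _ _) _.
  - by move=> n; exact: (mE (g n) (mf_ _)).
  - by move=> n x _; rewrite lee_fin f0.
  rewrite limn_einf_lim; apply: lime_le; first exact: is_cvg_einfs.
  apply: nearW => n; apply: le_trans (fC (n + N)%N (leq_addl _ _)).
  by apply: ereal_inf_lbound; exists n => /=.
have If : intg mu f.
  by apply/integrableP; split; [exact: mE|exact: le_lt_trans key (ltry _)].
split => //.
have := Rint_norm If; rewrite -!lee_fin => h.
apply: le_trans (le_trans _ h) _; first by rewrite lee_fin ler_norm.
by rewrite -RintE//; exact: intg_norm.
Qed.

End fatou_bound.

(** * Completeness of L^2 *)

Section L2_complete.
Context d (T : measurableType d) (R : realType).
Variable mu : {measure set T -> \bar R}.
Local Notation L2 := (L2 mu).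
Local Notation ip := (@L2_ip _ _ R mu).
Local Notation n2 := (nrm2 ip).
Implicit Types u v : L2.

Lemma L2_funB u v : {ae mu, forall x, L2_fun (u - v) x = L2_fun u x - L2_fun v x}.
Proof.
have := L2_funD u (- v); have := L2_funZ (-1) v; rewrite scaleN1r.
by apply: filterS2 => x -> ->; rewrite mulN1r.
Qed.

Lemma nrm2B_fun u v : n2 (u - v) = \int[mu]_x sqnormc (L2_fun u x - L2_fun v x).
Proof.
rewrite nrm2_fun; apply: Rint_ae.
- by apply: meas_sqnormc; exact: (L2_sqi _).1.
- by apply/meas_sqnormc/cmeasB; exact: (L2_sqi _).1.
- by apply: filterS (L2_funB u v) => x ->.
Qed.

(** The inequality [2 s <= 1/q + q s^2] with [q = 2^k] bounds the increments by summable terms, so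
    geometrically weighted squares give absolute convergence. *)
Lemma real_series_cvg (a : nat -> R) (M : R) :
  (forall n, \sum_(0 <= k < n) 2 ^+ k * (a k.+1 - a k) ^+ 2 <= M) -> cvgn a.
Proof.
move=> aM.
suff : cvgn (series (telescope a)).
  rewrite telescopeK => h; have -> : a = (fun n => (a n - a 0%N) + a 0%N).
    by apply/funext => n; rewrite subrK.
  by apply: is_cvgD => //; exact: is_cvg_cst.
apply: (@normed_cvg R R^o).
apply: nondecreasing_is_cvgn.
  by apply/nondecreasing_series => n _ _; exact: normr_ge0.
exists (2 + M) => _ [n _ <-]; rewrite /series/=.
have key k : `|telescope a k| <= 2^-1 ^+ k + 2 ^+ k * (a k.+1 - a k) ^+ 2.
  rewrite /telescope; set t := a k.+1 - a k.
  have p : 0 < (2 : R) ^+ k by rewrite exprn_gt0.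
  rewrite exprVn; set q := 2 ^+ k in p *; have pv : 0 < q^-1 by rewrite invr_gt0.
  have pq : q * q^-1 = 1 by rewrite mulfV// gt_eqF.
  have tE : t ^+ 2 = `|t| ^+ 2 by rewrite real_normK ?num_real.
  rewrite tE; set s := `|t|; have s0 : 0 <= s by exact: normr_ge0.
  suff : 0 <= q^-1 + q * s ^+ 2 - 2 * s by lra.
  have -> : q^-1 + q * s ^+ 2 - 2 * s = q * (s - q^-1) ^+ 2.
    have -> : q * (s - q^-1) ^+ 2 = q * s ^+ 2 - 2 * (q * q^-1) * s + (q * q^-1) * q^-1 by ring.
    by rewrite pq; ring.
  by rewrite mulr_ge0 ?sqr_ge0// ltW.
apply: le_trans (ler_sum _ (fun k _ => key k)) _.
rewrite big_split/=; apply: lerD; last exact: aM.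
have := @geometric_le_lim R n 1 2^-1 ler01.
rewrite invr_gt0 ltr0n => /(_ isT).
have -> : `|2^-1 : R| < 1 by rewrite ger0_norm ?invr_ge0// invf_lt1// ltr1n.
have -> : 1 * (1 - 2^-1)^-1 = 2 :> R by field.
move=> /(_ isT); apply: le_trans.
by rewrite /series/= ler_sum// => k _; rewrite mul1r.
Qed.

(** The Riesz-Fischer argument. The weighted squares of the increments have a sum [H] of integral at
    most 2, so [H] is finite almost everywhere and the functions converge there; Fatou's lemma turns
    the Cauchy bounds into bounds on the distance to the limit. *)
Lemma L2_fast_complete (w : nat -> L2) :
  (forall k j, (k <= j)%N -> n2 (w j - w k) <= 4^-1 ^+ k) ->
  exists l, forall k, n2 (w k - l) <= 4^-1 ^+ k.
Proof.
move=> wP.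
pose f k := L2_fun (w k).
have mf k : cmeasurable (f k) by exact: (L2_sqi _).1.
pose h k x := 2 ^+ k * sqnormc (f k.+1 x - f k x).
have h0 k x : 0 <= h k x by rewrite mulr_ge0 ?exprn_ge0// sqnormc_ge0.
have mh k : measurable_fun setT (h k).
  by apply: measurable_funM => //; exact/meas_sqnormc/cmeasB.
have sB k j : sqi mu (fun x => f k x - f j x) by apply: sqiB; exact: L2_sqi.
have Ih k : intg mu (h k) by apply: intgZ; exact: (sB _ _).2.
pose H x := (\sum_(k <oo) (h k x)%:E)%E.
have mH : measurable_fun setT H.
  have := @ge0_emeasurable_sum _ T R setT (fun k x => (h k x)%:E) xpredT.
  by apply => // [k x _ _|k _]; [rewrite lee_fin|exact/measurable_EFinP].
have iH : (\int[mu]_x H x <= 2%:E)%E.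
  rewrite integral_nneseries//; last first.
  - by move=> k x _; rewrite lee_fin.
  - by move=> k; exact/measurable_EFinP.
  apply: lime_le.
    by apply: is_cvg_nneseries => k _ _; apply: integral_ge0 => x _; rewrite lee_fin.
  apply: nearW => n.
  have -> : (\sum_(0 <= k < n) \int[mu]_x (h k x)%:E)%E =
      (\sum_(0 <= k < n) \int[mu]_x h k x)%:E.
    by rewrite -sumEFin; apply: eq_bigr => k _; rewrite RintE.
  rewrite lee_fin.
  apply: le_trans (_ : \sum_(0 <= k < n) 1 * 2^-1 ^+ k <= _).
    apply: ler_sum => k _; rewrite mul1r RintZ//; last exact: (sB _ _).2.
    rewrite -nrm2B_fun; apply: le_trans (ler_wpM2l _ (wP k k.+1 (leqnSn _))) _.
      by rewrite exprn_ge0.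
    by rewrite -exprMn (_ : 2 * 4^-1 = 2^-1)//; field.
  have := @geometric_le_lim R n 1 2^-1 ler01.
  rewrite invr_gt0 ltr0n => /(_ isT).
  have -> : `|2^-1 : R| < 1 by rewrite ger0_norm ?invr_ge0// invf_lt1// ltr1n.
  have -> : 1 * (1 - 2^-1)^-1 = 2 :> R by field.
  by move=> /(_ isT); apply: le_trans; rewrite /series/= ler_sum.
have Hfin : {ae mu, forall x, H x \is a fin_num}.
  have : mu.-integrable setT H.
    apply/integrableP; split => //.
    have H0 x : (0 <= H x)%E by apply: nneseries_ge0 => k _ _; rewrite lee_fin.
    rewrite (_ : (\int[mu]_x `|H x| = \int[mu]_x H x)%E).
      exact: le_lt_trans iH (ltry _).
    by apply: eq_integral => x _; rewrite gee0_abs.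
  by move/(integrable_ae measurableT); apply: filterS => x; exact.
have pw : {ae mu, forall x, cvgn (fun k => Re (f k x)) /\ cvgn (fun k => Im (f k x))}.
  apply: filterS Hfin => x Hx.
  have bound n : \sum_(0 <= k < n) h k x <= fine (H x).
    rewrite -lee_fin fineK// -sumEFin; apply: nneseries_lim_ge => k _ _.
    by rewrite lee_fin.
  split; apply: (@real_series_cvg _ (fine (H x))) => n; apply: le_trans (bound n);
    apply: ler_sum => k _; rewrite ler_wpM2l ?exprn_ge0//.
    by rewrite /sqnormc !cE lerDl sqr_ge0.
  by rewrite /sqnormc !cE lerDr sqr_ge0.
(* The upper limit is defined and measurable everywhere, which spares the choice of an exceptional
   null set. *)
pose lm (g : nat -> T -> R) x := fine (limn_esup (fun k => (g k x)%:E)).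
have lmm (g : nat -> T -> R) : (forall k, measurable_fun setT (g k)) ->
    measurable_fun setT (lm g).
  move=> mg; apply: measurableT_comp => //.
  by apply: measurable_fun_limn_esup => k; exact/measurable_EFinP.
have lmE (g : nat -> T -> R) x : cvgn (fun k => g k x) -> g ^~ x @ \oo --> lm g x.
  move=> cg; suff -> : lm g x = limn (fun k => g k x) by [].
  have gx : (g n x)%:E @[n --> \oo] --> (limn (fun k => g k x))%:E.
    by apply/cvg_EFin => //; exact: nearW.
  rewrite /lm is_cvg_limn_esupE; first by rewrite (cvg_lim _ gx).
  exact: cvgP gx.
pose F x := lm (fun k x => Re (f k x)) x +i* lm (fun k x => Im (f k x)) x.
have mF : cmeasurable F by split; apply: lmm => k; exact: (mf k).1 || exact: (mf k).2.
have key k : intg mu (fun x => sqnormc (f k x - F x)) /\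
    \int[mu]_x sqnormc (f k x - F x) <= 4^-1 ^+ k.
  have [|||||_ ? ?] := @fatou_le _ T R mu (fun j x => sqnormc (f k x - f j x))
    (fun x => sqnormc (f k x - F x)) (4^-1 ^+ k).
  - by move=> j; exact/meas_sqnormc/cmeasB.
  - exact/meas_sqnormc/cmeasB.
  - by move=> j x; exact: sqnormc_ge0.
  - apply: filterS pw => x [cr ci].
    have rx := lmE (fun k x => Re (f k x)) x cr.
    have ix := lmE (fun k x => Im (f k x)) x ci.
    rewrite /sqnormc !cE0; under eq_fun do rewrite !cE0.
    by apply: cvgD; rewrite !expr2; apply: cvgM; apply: cvgB => //; exact: cvg_cst.
  - exists k => j kj; rewrite RintE; last exact: (sB _ _).2.
    rewrite lee_fin -nrm2B_fun; have -> : w k - w j = - (w j - w k) by rewrite opprB.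
    rewrite (_ : n2 _ = n2 (w j - w k)); first exact: wP.
    rewrite !nrm2_fun; apply: Rint_ae.
    + by apply: meas_sqnormc; exact: (L2_sqi _).1.
    + by apply: meas_sqnormc; exact: (L2_sqi _).1.
    + have := L2_funZ (-1) (w j - w k); rewrite scaleN1r; apply: filterS => x ->.
      by rewrite mulN1r sqnormcN.
  - by [].
have sF : sqi mu F.
  have [I0 _] := key 0%N; have := L2_sqi (w 0%N) => s0.
  have s1 : sqi mu (fun x => f 0%N x - F x) by split => //; exact: cmeasB.
  have := sqiB s0 s1; apply: sqi_ae => //; apply: nearW => x.
  by rewrite opprB addrC subrK.
exists (mkL2 mu F) => k; apply: le_trans (key k).2.
rewrite nrm2B_fun le_eqVlt; apply/orP; left; apply/eqP; apply: Rint_ae.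
- by apply/meas_sqnormc/cmeasB => //; exact: (L2_sqi _).1.
- exact/meas_sqnormc/cmeasB.
- by apply: filterS (mkL2_ae sF) => x ->.
Qed.

Lemma L2_nrm2D_le u v : n2 (u + v) <= 2 * n2 u + 2 * n2 v.
Proof.
have [_ Iu] := L2_sqi u; have [_ Iv] := L2_sqi v.
rewrite (_ : n2 (u + v) = \int[mu]_x sqnormc (L2_fun u x + L2_fun v x)); last first.
  rewrite nrm2_fun; apply: Rint_ae.
  - by apply: meas_sqnormc; exact: (L2_sqi _).1.
  - by apply/meas_sqnormc/cmeasD; exact: (L2_sqi _).1.
  - by apply: filterS (L2_funD u v) => x ->.
rewrite !nrm2_fun -!RintZ// -RintD; [|exact: intgZ..].
apply: le_Rint; [|by apply: intgD; exact: intgZ|by move=> x; exact: sqnormcD_le].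
exact: (sqiD (L2_sqi u) (L2_sqi v)).2.
Qed.

Lemma L2_hilbert : is_hilbert ip.
Proof.
split; [exact: L2_ipDr|exact: L2_ipZr|exact: L2_ipC| |exact: L2_nrm2_eq0|].
  by move=> u; rewrite nrm2_fun; apply: Rint_ge0 => x; exact: sqnormc_ge0.
move=> u_ cu.
have p4 k : 0 < (4^-1 : R) ^+ k by rewrite exprn_gt0// invr_gt0.
have [N NP] := choice (fun k => cu _ (p4 k)).
(* Partial sums make [nk] both nondecreasing and at least [N k]. *)
pose nk k := (\sum_(i < k.+1) N i)%N.
have nkN k : (N k <= nk k)%N by rewrite /nk big_ord_recr/= leq_addl.
have nkS k j : (k <= j)%N -> (nk k <= nk j)%N.
  elim: j => [|j ih]; first by rewrite leqn0 => /eqP ->.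
  rewrite leq_eqVlt => /predU1P[->//|]; rewrite ltnS => /ih /leq_trans; apply.
  by rewrite /nk [leqRHS]big_ord_recr leq_addr.
have [k j kj|l lP] := @L2_fast_complete (fun k => u_ (nk k)).
  by apply/ltW/NP; [exact: leq_trans (nkN k) (nkS _ _ kj)|exact: nkN].
exists l => e e0.
have [k ke] : exists k, (4^-1 : R) ^+ k < e / 4.
  have c0 : (geometric 1 (4^-1 : R)) @ \oo --> 0.
    by apply: cvg_geometric; rewrite ger0_norm ?invr_ge0// invf_lt1// ltr1n.
  have e40 : 0 < e / 4 by rewrite divr_gt0.
  have [k _ /(_ k (leqnn _))] := cvgr_lt _ c0 _ e40.
  by rewrite /geometric/= mul1r => ?; exists k.
exists (N k) => n Nn.
have -> : u_ n - l = (u_ n - u_ (nk k)) + (u_ (nk k) - l) by rewrite addrA subrK.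
apply: le_lt_trans (L2_nrm2D_le _ _) _.
have := NP k n (nk k) Nn (nkN k); have := lP k; lra.
Qed.

End L2_complete.

(** * Invariance of Lebesgue measure under translation and reflection *)

Section lebesgue1.
Context {R : realType}.
Local Notation leb1 := (@lebesgue_measure R).

(** Lebesgue measure is determined by its values on half-open intervals, so a check on them yields
    the change of variables for all nonnegative measurable functions. *)
Lemma pushforward_lebesgue (phi : R -> R) : measurable_fun [set: R] phi ->
  (forall a b : R, a < b -> pushforward leb1 phi (`]a, b]%classic) = (b - a)%:E) ->
  forall f : R -> \bar R, measurable_fun [set: R] f -> (forall x, 0 <= f x)%E ->
  (\int[leb1]_x f (phi x) = \int[leb1]_x f x)%E.
Proof.
move=> mphi phiE f mf f0.
rewrite -(@ge0_integral_pushforward _ _ (measurableTypeR R) (measurableTypeR R) R phi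
  mphi leb1 setT f)//.
apply/esym/eq_measure_integral => A mA _.
pose HB_m := isMeasurableFun.Build _ _ (measurableTypeR R) (measurableTypeR R) phi mphi.
pose phi' : {mfun measurableTypeR R >-> measurableTypeR R} := HB.pack phi HB_m.
apply: (@lebesgue_measure_unique R (pushforward leb1 phi')) => // _ [[a b]/= _ <-].
rewrite /= lebesgue_measure_itv/= lte_fin.
have [ab|ba] := ltP a b; first by rewrite -EFinB -(phiE a b ab).
by rewrite set_itv_ge ?bnd_simp -?leNgt// /pushforward preimage_set0 measure0.
Qed.

Lemma int_shift1 (c : R) (f : R -> \bar R) : measurable_fun [set: R] f ->
  (forall x, 0 <= f x)%E -> (\int[leb1]_x f (x + c)%R = \int[leb1]_x f x)%E.
Proof.
apply: (@pushforward_lebesgue (fun x => x + c)); first exact: measurable_funD.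
move=> a b ab; rewrite /pushforward.
have -> : (fun x : R => x + c) @^-1` `]a, b] = `](a - c), (b - c)]%classic.
  by apply/seteqP; split => x /=; rewrite !in_itv/= ltrBlDr lerBrDr.
rewrite lebesgue_measure_itv/= lte_fin ltrD2r ab -EFinB.
by rewrite opprB addrA subrK.
Qed.

Lemma int_opp1 (f : R -> \bar R) : measurable_fun [set: R] f ->
  (forall x, 0 <= f x)%E -> (\int[leb1]_x f (- x)%R = \int[leb1]_x f x)%E.
Proof.
apply: (@pushforward_lebesgue (fun x => - x)); first exact: measurable_funN.
move=> a b ab; rewrite /pushforward.
have -> : (fun x : R => - x) @^-1` `]a, b] = `[(- b), (- a)[%classic.
  by apply/seteqP; split => x /=; rewrite !in_itv/= lerNl ltrNr andbC.
by rewrite lebesgue_measure_itv/= lte_fin ltrN2 ab -EFinB opprK addrC.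
Qed.

End lebesgue1.

Section rV_integrals.
Context {R : realType}.
Local Notation leb1 := (@lebesgue_measure R).
Local Notation leb := (@lebesgue_rV R).

Definition tail_rV n (x : 'rV[R]_n.+1) : 'rV[R]_n := (uncons_rV x).2.

Lemma tail_cons n t (x : 'rV[R]_n) : tail_rV (cons_rV (t, x)) = x.
Proof. by rewrite /tail_rV cons_rVK. Qed.

Lemma tail_rVE n (x : 'rV[R]_n.+1) i : tail_rV x ord0 i = x ord0 (lift ord0 i).
Proof. by rewrite mxE. Qed.

Lemma measurable_tail n : measurable_fun setT (@tail_rV n).
Proof. exact: (measurableT_comp measurable_snd (@measurable_uncons_rV R n)). Qed.

Lemma ge0_int_rVS n (f : 'rV[R]_n.+1 -> \bar R) : measurable_fun setT f ->
  (forall x, 0 <= f x)%E ->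
  (\int[leb n.+1]_x f x = \int[leb1]_t \int[leb n]_x f (cons_rV (t, x)))%E.
Proof.
move=> mf f0.
transitivity (\int[pushforward (leb1 \x leb n) (@cons_rV R n)]_x f x)%E => //.
rewrite ge0_integral_pushforward//; last exact: measurable_cons_rV.
rewrite preimage_setT.
rewrite (@fubini_tonelli1 _ _ _ _ _ leb1 (leb n) (fun tx => f (cons_rV tx)))//.
by apply: measurableT_comp => //; exact: measurable_cons_rV.
Qed.

(** Fubini-Tonelli by induction on the dimension; translations and the reflection [x |-> - x] are
    the instances in view. *)
Lemma ge0_int_coordwise n (phi : 'I_n -> R -> R) :
  (forall i, measurable_fun setT (phi i)) ->
  (forall i (f : R -> \bar R), measurable_fun [set: R] f -> (forall x, 0 <= f x)%E ->
    (\int[leb1]_x f (phi i x) = \int[leb1]_x f x)%E) ->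
  forall f : 'rV[R]_n -> \bar R, measurable_fun setT f -> (forall x, 0 <= f x)%E ->
  (\int[leb n]_x f (\row_i phi i (x ord0 i)) = \int[leb n]_x f x)%E.
Proof.
elim: n phi => [|n ih] phi mphi iphi f mf f0.
  by apply: eq_integral => x _; congr f; apply/rowP => -[].
have mrow : measurable_fun setT (fun x : 'rV[R]_n.+1 => \row_i phi i (x ord0 i)).
  apply: measurable_fun_rV => i; under eq_fun do rewrite mxE.
  by apply: measurableT_comp => //; exact: measurable_coor.
rewrite (ge0_int_rVS (measurableT_comp mf mrow)) => [|x]; last exact: f0.
rewrite (ge0_int_rVS mf f0).
have consE t x : \row_i phi i (cons_rV (t, x) ord0 i) =
    cons_rV (phi ord0 t, \row_i phi (lift ord0 i) (x ord0 i)).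
  apply/rowP => i; rewrite mxE; case: (unliftP ord0 i) => [j ->|->].
    by rewrite !cons_rVS mxE.
  by rewrite !cons_rV0.
have mfc : measurable_fun setT (fun tx => f (@cons_rV R n tx)).
  exact: (measurableT_comp mf (@measurable_cons_rV R n)).
transitivity (\int[leb1]_t \int[leb n]_x f (cons_rV (phi ord0 t, x)))%E.
  apply: eq_integral => t _; under eq_integral do rewrite /= consE.
  apply: (ih (fun i => phi (lift ord0 i)) _ _ (fun x => f (cons_rV (phi ord0 t, x)))) => //.
  - by move=> i; exact: iphi.
  - by apply: (measurableT_comp mfc); exact: pair1_measurable.
apply: (iphi ord0 (fun t => \int[leb n]_x f (cons_rV (t, x)))%E).
  exact: (measurable_fun_fubini_tonelli_F (fun tx => f (@cons_rV R n tx))).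
by move=> t; exact: integral_ge0.
Qed.

Lemma ge0_int_shift n (a : 'rV[R]_n) (f : 'rV[R]_n -> \bar R) :
  measurable_fun setT f -> (forall x, 0 <= f x)%E ->
  (\int[leb n]_x f (x + a)%R = \int[leb n]_x f x)%E.
Proof.
move=> mf f0; rewrite -[RHS](@ge0_int_coordwise n (fun i t => t + a ord0 i))//.
- by apply: eq_integral => x _; congr f; apply/rowP => i; rewrite !mxE.
- by move=> i; exact: measurable_funD.
- by move=> i; exact: int_shift1.
Qed.

Lemma ge0_int_opp n (f : 'rV[R]_n -> \bar R) :
  measurable_fun setT f -> (forall x, 0 <= f x)%E ->
  (\int[leb n]_x f (- x)%R = \int[leb n]_x f x)%E.
Proof.
move=> mf f0; rewrite -[RHS](@ge0_int_coordwise n (fun i t => - t))//.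
- by apply: eq_integral => x _; congr f; apply/rowP => i; rewrite !mxE.
- by move=> i; exact: measurable_funN.
- by move=> i; exact: int_opp1.
Qed.

Lemma measurable_shift n (a : 'rV[R]_n) : measurable_fun setT (fun x : 'rV[R]_n => x + a).
Proof.
apply: measurable_fun_rV => i; under eq_fun do rewrite mxE.
by apply: measurable_funD => //; exact: measurable_coor.
Qed.

Lemma measurable_opp n : measurable_fun setT (fun x : 'rV[R]_n => - x).
Proof.
apply: measurable_fun_rV => i; under eq_fun do rewrite mxE.
by apply: measurable_funN => //; exact: measurable_coor.
Qed.

Section preserving.
Variables (n : nat) (T : 'rV[R]_n -> 'rV[R]_n).
Hypothesis mT : measurable_fun setT T.
Hypothesis iT : forall f : 'rV[R]_n -> \bar R,
  measurable_fun setT f -> (forall x, 0 <= f x)%E ->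
  (\int[leb n]_x f (T x) = \int[leb n]_x f x)%E.

Lemma intg_pres (f : 'rV[R]_n -> R) : intg (leb n) f -> intg (leb n) (fun x => f (T x)).
Proof.
move=> If; have mf := intg_meas If; apply/integrableP; split.
  by apply/measurable_EFinP; exact: measurableT_comp.
rewrite (iT (f := (fun x => `|(f x)%:E|%E)))//; first by case/integrableP : If.
by apply/measurable_EFinP; exact: measurableT_comp.
Qed.

Lemma Rint_pres (f : 'rV[R]_n -> R) : intg (leb n) f ->
  \int[leb n]_x f (T x) = \int[leb n]_x f x.
Proof.
move=> If; have mf := intg_meas If.
have E (g : 'rV[R]_n -> R) : measurable_fun setT g -> (forall x, 0 <= g x) ->
    \int[leb n]_x g (T x) = \int[leb n]_x g x.
  move=> mg g0; congr fine; rewrite (iT (f := (fun x => (g x)%:E)))//.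
  exact/measurable_EFinP.
(* Preservation is known for nonnegative integrands only, so [f] is written as a difference of two
   of them. *)
have dec (x : R) : x = (`|x| + x) - `|x| by rewrite addrAC subrr add0r.
have In := intg_norm If.
have Ip : intg (leb n) (fun x => `|f x| + f x) by exact: intgD.
transitivity (\int[leb n]_x ((`|f (T x)| + f (T x)) - `|f (T x)|)).
  by apply: eq_Rintegral => x _; exact: dec.
rewrite (RintB (intg_pres Ip) (intg_pres In)).
rewrite (E (fun x => `|f x| + f x)); last 2 first.
- exact: intg_meas Ip.
- by move=> x; rewrite -lerBlDr sub0r -normrN ler_norm.
rewrite (E (fun x => `|f x|))//; last exact: intg_meas In.
by rewrite -RintB//; apply: eq_Rintegral => x _; rewrite -dec.
Qed.

Lemma ae_pres (P : 'rV[R]_n -> Prop) : {ae leb n, forall x, P x} ->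
  {ae leb n, forall x, P (T x)}.
Proof.
move=> [N [mN N0 PN]]; exists (T @^-1` N).
have mNo : measurable (T @^-1` N) by rewrite -[X in measurable X]setTI; exact: mT.
split => //; last by move=> x; exact: PN.
have := iT (f := (fun x => (\1_N x)%:E)) ltac:(by apply/measurable_EFinP) ltac:(by []).
have -> : (\int[leb n]_x (\1_N (T x))%:E = \int[leb n]_x (\1_(T @^-1` N) x)%:E)%E.
  by apply: eq_integral => x _; rewrite !indicE.
by rewrite !integral_indic// !setIT => ->.
Qed.

End preserving.

Lemma intg_shift n (a : 'rV[R]_n) f : intg (leb n) f -> intg (leb n) (fun x => f (x + a)).
Proof. exact: intg_pres (measurable_shift a) (ge0_int_shift a) _. Qed.

Lemma Rint_shift n (a : 'rV[R]_n) f : intg (leb n) f ->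
  \int[leb n]_x f (x + a) = \int[leb n]_x f x.
Proof. exact: Rint_pres (measurable_shift a) (ge0_int_shift a) _. Qed.

Lemma intg_opp n f : intg (leb n) f -> intg (leb n) (fun x => f (- x)).
Proof. exact: intg_pres (@measurable_opp n) (@ge0_int_opp n) _. Qed.

Lemma Rint_opp n f : intg (leb n) f -> \int[leb n]_x f (- x) = \int[leb n]_x f x.
Proof. exact: Rint_pres (@measurable_opp n) (@ge0_int_opp n) _. Qed.

Lemma ae_opp n (P : 'rV[R]_n -> Prop) : {ae leb n, forall x, P x} ->
  {ae leb n, forall x, P (- x)}.
Proof. exact: ae_pres (@measurable_opp n) (@ge0_int_opp n) _. Qed.

Lemma tensor_intg n (u : R -> R) (v : 'rV[R]_n -> R) : intg leb1 u -> intg (leb n) v ->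
  intg (leb n.+1) (fun x => u (x ord0 ord0) * v (tail_rV x)).
Proof.
move=> Iu Iv; have mu := intg_meas Iu; have mv := intg_meas Iv.
have mf : measurable_fun setT (fun x : 'rV[R]_n.+1 => u (x ord0 ord0) * v (tail_rV x)).
  apply: measurable_funM; first by apply: measurableT_comp => //; exact: measurable_coor.
  by apply: measurableT_comp => //; exact: measurable_tail.
apply/integrableP; split; first exact/measurable_EFinP.
rewrite ge0_int_rVS//; last first.
  by apply/measurable_EFinP; exact: measurableT_comp.
rewrite (_ : integral _ _ _ = (\int[leb1]_t (`|u t|%:E * \int[leb n]_x `|v x|%:E))%E).
  have In := intg_norm Iv; rewrite (RintE In).
  rewrite ge0_integralZr//.
  - rewrite (RintE (intg_norm Iu)) -EFinM; exact: ltry.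
  - by apply/measurable_EFinP; exact: measurableT_comp.
  - by rewrite lee_fin Rint_ge0.
apply: eq_integral => t _; rewrite -ge0_integralZl//.
- apply: eq_integral => x _ /=.
  by rewrite cons_rV0 tail_cons normrM EFinM.
- by apply/measurable_EFinP; exact: measurableT_comp.
Qed.

Lemma Rint_tensor n (u : R -> R) (v : 'rV[R]_n -> R) : intg leb1 u -> intg (leb n) v ->
  \int[leb n.+1]_x (u (x ord0 ord0) * v (tail_rV x)) =
  (\int[leb1]_t u t) * (\int[leb n]_x v x).
Proof.
move=> Iu Iv; have It := tensor_intg Iu Iv.
set f := (fun x => _ * _) in It *; have mf := intg_meas It.
have mc : measurable_fun setT (fun tx => f (@cons_rV R n tx)).
  by apply: measurableT_comp => //; exact: measurable_cons_rV.
have Ic : (leb1 \x leb n)%E.-integrable setT (fun tx => (f (@cons_rV R n tx))%:E).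
  apply/integrable12ltyP; first exact/measurable_EFinP.
  have /integrableP[_] := It; rewrite ge0_int_rVS//.
  by apply/measurable_EFinP; exact: measurableT_comp.
rewrite /Rintegral.
transitivity (fine (\int[pushforward (leb1 \x leb n) (@cons_rV R n)]_x (f x)%:E)%E) => //.
rewrite integral_pushforward//; last 2 first.
- exact: measurable_cons_rV.
- exact/measurable_EFinP.
rewrite preimage_setT -(integral12_prod_meas1 Ic) /fubini_F/=.
transitivity (fine (\int[leb1]_t ((u t)%:E * (\int[leb n]_x v x)%:E))%E).
  congr fine; apply: eq_integral => t _; rewrite -(RintE Iv) -integralZl//.
  by apply: eq_integral => x _; rewrite /f cons_rV0 tail_cons EFinM.
by rewrite integralZr// (RintE Iu).
Qed.

Lemma intg_prod n (w : 'I_n -> R -> R) : (forall i, intg leb1 (w i)) ->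
  intg (leb n) (fun x => \prod_i w i (x ord0 i)) /\
  \int[leb n]_x \prod_i w i (x ord0 i) = \prod_i \int[leb1]_t w i t.
Proof.
elim: n w => [|n ih] w Iw.
  have E : (fun x : 'rV[R]_0 => \prod_i w i (x ord0 i)) = cst 1.
    by apply/funext => x; rewrite big_ord0.
  rewrite E big_ord0; split.
    by apply: finite_measure_integrable_cst.
  transitivity (1 * fine (\d_(0 : 'rV[R]_0) [set: 'rV[R]_0] : \bar R)).
    exact: Rintegral_cst.
  by rewrite diracT mulr1.
have E : (fun x : 'rV[R]_n.+1 => \prod_i w i (x ord0 i)) =
    (fun x => w ord0 (x ord0 ord0) * \prod_i w (lift ord0 i) (tail_rV x ord0 i)).
  apply/funext => x; rewrite big_ord_recl; congr *%R.
  by apply: eq_bigr => i _; rewrite tail_rVE.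
have [I1 I2] := ih _ (fun i => Iw (lift ord0 i)).
rewrite E big_ord_recl -I2; split; first exact: (tensor_intg (Iw ord0) I1).
exact: (Rint_tensor (Iw ord0) I1).
Qed.

End rV_integrals.

(** * Open sets and continuous functions on R^n *)

Section topology_rV.
Context {R : realType} {n : nat}.
Local Notation leb1 := (@lebesgue_measure R).
Local Notation leb := (@lebesgue_rV R n).

Definition cube (x : 'rV[R]_n) (r : R) : set 'rV[R]_n :=
  \bigcap_(i in [set: 'I_n]) [set y : 'rV[R]_n | `|x ord0 i - y ord0 i| < r].

Lemma cube_ball x r : 0 < r -> cube x r = ball (x : 'rV[R]_n) r.
Proof.
move=> r0; apply/seteqP; split => y /= xy.
  by split => // i j; rewrite ord1; exact: xy.
by move=> i _; case: xy => _; exact.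
Qed.

Lemma measurable_cube (x : 'rV[R]_n) (r : R) : measurable (cube x r).
Proof.
apply: fin_bigcap_measurable; first exact: finite_finset.
move=> i _; rewrite -[X in measurable X]setTI.
by apply: (measurable_coor i measurableT (measurable_ball (x ord0 i) r)).
Qed.

Lemma open_cube (A : set 'rV[R]_n) x : open A -> A x ->
  exists2 e, 0 < e & cube x e `<=` A.
Proof.
move=> oA Ax; have : nbhs x A by rewrite nbhsE; exists A.
by move=> /nbhs_ballP[e /= e0 eA]; exists e => //; rewrite cube_ball.
Qed.

Lemma open_measurable_rV (A : set 'rV[R]_n) : open A -> measurable A.
Proof.
move=> oA.
(* Cubes with rational centre and radius: [A] is the countable union of those that it contains. *)
pose q2 (q : 'rV[rat]_n * rat) : set 'rV[R]_n := cube (map_mx ratr q.1) (ratr q.2).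
rewrite (_ : A = \bigcup_q (if pselect (q2 q `<=` A) then q2 q else set0)).
  apply: countable_bigcupT_measurable => [|q]; first exact: countableP.
  by case: pselect => /= p; [exact: measurable_cube|exact: measurable0].
apply/seteqP; split => [x Ax|x [q _]]; last by case: pselect => // qA /qA.
have [e e0 xeA] := open_cube oA Ax.
have [r] : exists r : rat, ratr r \in `]0, e / 2[ by apply: rat_in_itvoo; rewrite divr_gt0.
rewrite in_itv/= => /andP[r0 re].
have /choice[q qP] (i : 'I_n) : exists q : rat,
    ratr q \in `](x ord0 i - ratr r), (x ord0 i + ratr r)[.
  by apply: rat_in_itvoo; rewrite ltrBlDr -addrA ltrDl addr_gt0.
have qx i : `|ratr (q i) - x ord0 i| < ratr r.
  by have := qP i; rewrite in_itv/= ltr_distl.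
exists (\row_i q i, r) => //.
have qxc : q2 (\row_i q i, r) x by move=> i _; rewrite /= !mxE; exact: qx.
case: pselect => // -[] y qy; apply: xeA => i _ /=.
have := qy i I; rewrite /= !mxE => qyi.
have -> : x ord0 i - y ord0 i = (x ord0 i - ratr (q i)) + (ratr (q i) - y ord0 i).
  by rewrite addrA subrK.
apply: le_lt_trans (ler_normD _ _) _.
have := qx i; rewrite distrC; lra.
Qed.

Lemma continuous_measurable_rV (f : 'rV[R]_n -> R) : continuous f -> measurable_fun setT f.
Proof.
move=> cf; apply: (measurability _ (RGenOInfty.measurableE R)) => //= _ [_ [x ->] <-].
rewrite setTI; apply: open_measurable_rV; apply: open_comp; last exact: rray_open.
by move=> y _; exact: cf.
Qed.

(** The indicator of the cube in product form, so that [intg_prod] computes its volume. *)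
Definition cube_fun (x : 'rV[R]_n) (r : R) (y : 'rV[R]_n) : R :=
  \prod_i \1_(`](x ord0 i - r), (x ord0 i + r)[%classic : set R) (y ord0 i).

Lemma cube_funE x r y : cube_fun x r y = \1_(cube x r) y.
Proof.
rewrite indicE; have [/set_mem xy|nxy] := boolP (y \in cube x r).
  rewrite /cube_fun big1// => i _; rewrite indicE mem_set//= in_itv/=.
  by rewrite -ltr_distl distrC; exact: xy.
have [i xi] : exists i, ~ `|x ord0 i - y ord0 i| < r.
  apply: contra_notP (negP nxy) => h; apply/mem_set => i _ /=.
  by apply: contrapT => hi; apply: h; exists i.
rewrite /cube_fun (bigD1 i)//= indicE memNset ?mul0r//= in_itv/= -ltr_distl distrC.
exact/negP/negP.
Qed.

Lemma cube_fun_int x r : 0 < r -> intg leb (cube_fun x r) /\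
  \int[leb]_y cube_fun x r y = (2 * r) ^+ n.
Proof.
move=> r0.
have I1 (i : 'I_n) : intg leb1 (\1_(`](x ord0 i - r), (x ord0 i + r)[%classic : set R)).
  exact: integrable_indic_itv.
have [I2 ->] := intg_prod I1; split => //.
transitivity (\prod_(i < n) (2 * r)); last by rewrite prodr_const card_ord.
apply: eq_bigr => i _; rewrite /Rintegral integral_indic//= setIT.
rewrite lebesgue_measure_itv/= lte_fin ltrBlDr -addrA ltrDl addr_gt0//.
by rewrite -EFinB/=; ring.
Qed.

(** A null set contains no cube, since cubes have positive volume. *)
Lemma ae_open (P : 'rV[R]_n -> Prop) (A : set 'rV[R]_n) x : open A -> A x ->
  {ae leb, forall y, P y} -> exists2 y, A y & P y.
Proof.
move=> oA Ax [N [mN N0 PN]]; have [e e0 xeA] := open_cube oA Ax.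
apply: contrapT => h.
have cN : cube x e `<=` N.
  by move=> y /xeA Ay; apply: PN => /= Py; apply: h; exists y.
have : (leb (cube x e) <= 0)%E by rewrite -N0; apply: le_measure; rewrite ?inE//;
  exact: measurable_cube.
have [I1 I2] := cube_fun_int x e0.
have := RintE I1; rewrite I2.
under eq_integral do rewrite cube_funE.
rewrite integral_indic//; last exact: measurable_cube.
by rewrite setIT => ->; rewrite lee_fin leNgt exprn_gt0// mulr_gt0.
Qed.

Lemma ae_continuous_eq (f g : 'rV[R]_n -> R) : continuous f -> continuous g ->
  {ae leb, forall y, f y = g y} -> f = g.
Proof.
move=> cf cg fg; apply/funext => x; apply: contrapT => /eqP fgx.
have oA : open [set y | f y - g y != 0].
  apply: (@open_comp _ _ (fun y => f y - g y) [set t | t != 0]).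
    by move=> y _; apply: continuousB; [exact: cf|exact: cg].
  exact: open_neq.
have [|y /= + fgy] := @ae_open _ _ x oA _ fg; first by rewrite /= subr_eq0.
by rewrite fgy subrr eqxx.
Qed.

End topology_rV.

(** * Uniqueness of the Fourier transform *)

Section sign_iteration.
Context {R : realType}.
Implicit Types y : R.

(** One step of the Newton-Schulz iteration for the sign. As a polynomial it preserves any algebra
    of functions, and on [[-1, 1]] its iterates converge to the sign. *)
Definition newton_sg y := (3 * y - y ^+ 3) / 2.

Lemma newton_sg_bnd y : `|y| <= 1 -> `|newton_sg y| <= 1.
Proof.
rewrite /newton_sg !ler_norml => /andP[a b]; apply/andP; split.
  rewrite ler_pdivlMr// -subr_ge0 (_ : _ - _ = (1 + y) ^+ 2 * (2 - y)); last by ring.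
  by rewrite mulr_ge0 ?sqr_ge0//; lra.
rewrite ler_pdivrMr// -subr_ge0 (_ : _ - _ = (1 - y) ^+ 2 * (2 + y)); last by ring.
by rewrite mulr_ge0 ?sqr_ge0//; lra.
Qed.

Lemma iter_newton_bnd k y : `|y| <= 1 -> `|iter k newton_sg y| <= 1.
Proof. by move=> y1; elim: k => //= k; exact: newton_sg_bnd. Qed.

Lemma iter_newtonN k y : iter k newton_sg (- y) = - iter k newton_sg y.
Proof. by elim: k => //= k ->; rewrite /newton_sg; ring. Qed.

(** [1 - newton_sg u = (1 - u) (1 - (u + u^2) / 2)], and the second factor is at most [1 - y / 2] as
    long as [y <= u <= 1]. *)
Lemma iter_newton_pos k y : 0 < y -> y <= 1 ->
  [/\ y <= iter k newton_sg y, iter k newton_sg y <= 1 &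
      1 - iter k newton_sg y <= (1 - y / 2) ^+ k].
Proof.
move=> y0 y1; elim: k => [|k [ih1 ih2 ih3]]; first by rewrite expr0; split => //=; lra.
rewrite /= /newton_sg; set u := iter k _ y in ih1 ih2 ih3 *.
have uu : 0 <= 1 - u ^+ 2 by nra.
have E : 1 - (3 * u - u ^+ 3) / 2 = (1 - u) * (1 - (u + u ^+ 2) / 2) by field.
split.
- rewrite ler_pdivlMr// -subr_ge0.
  by rewrite (_ : _ - _ = (u - y) * 2 + u * (1 - u ^+ 2)); [nra|ring].
- rewrite -subr_ge0 E mulr_ge0//; nra.
- rewrite E [X in X <= _]mulrC [X in _ <= X]exprS.
  have a1 : 0 <= 1 - (u + u ^+ 2) / 2 by nra.
  have a2 : 1 - (u + u ^+ 2) / 2 <= 1 - y / 2 by nra.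
  by apply: ler_pM a1 _ a2 ih3; rewrite subr_ge0.
Qed.

Lemma iter_newton_cvg y : `|y| <= 1 -> iter k newton_sg y @[k --> \oo] --> Num.sg y.
Proof.
have pos z : 0 < z -> z <= 1 -> iter k newton_sg z @[k --> \oo] --> (1 : R).
  move=> z0 z1; apply/(@cvgrPdist_le _ R^o) => e e0.
  have c0 : (geometric 1 (1 - z / 2)) @ \oo --> 0.
    by apply: cvg_geometric; rewrite ger0_norm; lra.
  have : \forall n \near \oo, geometric 1 (1 - z / 2) n < e by exact: (cvgr_lt _ c0 _ e0).
  apply: filterS => n; rewrite /geometric/= mul1r => ne.
  have [_ a b] := iter_newton_pos n z0 z1.
  by rewrite ger0_norm ?subr_ge0//; apply: le_trans b _; exact: ltW.
rewrite ler_norml => /andP[a b].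
have [y0|y0|->] := ltgtP y 0.
- rewrite ltr0_sg// (_ : (fun k => _) = (fun k => - iter k newton_sg (- y))).
    by apply: cvgN; apply: pos; lra.
  by apply/funext => k; rewrite iter_newtonN opprK.
- by rewrite gtr0_sg//; exact: pos.
- rewrite sgr0 (_ : (fun k => _) = cst 0); first exact: cvg_cst.
  by apply/funext => k; elim: k => //= k ->; rewrite /newton_sg; ring.
Qed.

Lemma sgr_sin (z : R) : `|z| < pi -> Num.sg (sin z) = Num.sg z.
Proof.
rewrite ltr_norml => /andP[a b].
have [z0|z0|->] := ltgtP z 0.
- rewrite (ltr0_sg z0) ltr0_sg// -oppr_gt0 -sinN sin_gt0_pi//.
  by rewrite oppr_gt0 z0/= ltrNl.
- by rewrite (gtr0_sg z0) gtr0_sg// sin_gt0_pi// z0.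
- by rewrite sin0.
Qed.

End sign_iteration.

Section fourier_uniqueness.
Context {R : realType} {n : nat}.
Local Notation leb := (@lebesgue_rV R n).
Local Notation Rn := 'rV[R]_n.
Implicit Types (k P h : Rn -> R) (b c x : Rn).

Lemma dotrDl b c x : dotr (b + c) x = dotr b x + dotr c x.
Proof. by rewrite /dotr -big_split; apply: eq_bigr => i _; rewrite mxE mulrDl. Qed.
Lemma dotrNl b x : dotr (- b) x = - dotr b x.
Proof. by rewrite /dotr -sumrN; apply: eq_bigr => i _; rewrite mxE mulNr. Qed.
Lemma dotrC b x : dotr b x = dotr x b.
Proof. by apply: eq_bigr => i _; rewrite mulrC. Qed.
Lemma dotrDr b c x : dotr x (b + c) = dotr x b + dotr x c.
Proof. by rewrite !(dotrC x) dotrDl. Qed.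
Lemma dotrNr b x : dotr x (- b) = - dotr x b.
Proof. by rewrite !(dotrC x) dotrNl. Qed.
Lemma dotrZl (a : R) b x : dotr (a *: b) x = a * dotr b x.
Proof. by rewrite /dotr mulr_sumr; apply: eq_bigr => i _; rewrite mxE mulrA. Qed.
Lemma dotrZr (a : R) b x : dotr b (a *: x) = a * dotr b x.
Proof. by rewrite dotrC dotrZl dotrC. Qed.
Lemma dotr0l x : dotr 0 x = 0.
Proof. by rewrite -(scale0r (0 : Rn)) dotrZl mul0r. Qed.
Lemma dotr_delta i x : dotr (delta_mx ord0 i) x = x ord0 i.
Proof.
rewrite /dotr (bigD1 i)//= mxE !eqxx mul1r big1 ?addr0// => j ji.
by rewrite mxE (negbTE ji) andbF mul0r.
Qed.

Lemma measurable_dotr b : measurable_fun setT (dotr b).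
Proof.
apply: measurable_sum => i; apply: measurable_funM => //; exact: measurable_coor.
Qed.

Lemma measurable_cosdot b : measurable_fun setT (fun x => cos (dotr b x)).
Proof.
by apply: measurableT_comp (measurable_dotr b); apply: continuous_measurable_fun;
  exact: continuous_cos.
Qed.

Lemma measurable_sindot b : measurable_fun setT (fun x => sin (dotr b x)).
Proof.
by apply: measurableT_comp (measurable_dotr b); apply: continuous_measurable_fun;
  exact: continuous_sin.
Qed.

Lemma intg_bndM P k (C : R) : measurable_fun setT P -> (forall x, `|P x| <= C) ->
  intg leb k -> intg leb (fun x => P x * k x).
Proof.
move=> mP PC Ik; have In := intg_norm Ik.
apply: intg_le (intgZ C In).
  by apply: measurable_funM => //; exact: intg_meas Ik.
by move=> x; rewrite normrM ler_wpM2r.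
Qed.

Lemma cos_le1' (t : R) : `|cos t| <= 1.
Proof. by rewrite ler_norml cos_geN1 cos_le1. Qed.
Lemma sin_le1' (t : R) : `|sin t| <= 1.
Proof. by rewrite ler_norml sin_geN1 sin_le1. Qed.

Definition annih k := intg leb k /\ forall b,
  \int[leb]_x (cos (dotr b x) * k x) = 0 /\ \int[leb]_x (sin (dotr b x) * k x) = 0.

(** Multiplication by [P] keeps the functions with zero Fourier transform. Such [P] form an algebra
    closed under bounded pointwise limits; the aim is to reach every indicator function from cosines
    and sines. *)
Definition multiplier P := [/\ measurable_fun setT P, exists C, forall x, `|P x| <= C &
  forall k, annih k -> annih (fun x => P x * k x)].

Lemma annihZ (a : R) k : annih k -> annih (fun x => a * k x).
Proof.
move=> [Ik kb]; split; first exact: intgZ.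
move=> b; have [c0 s0] := kb b.
have Ic := intg_bndM (measurable_cosdot b) (fun x => cos_le1' _) Ik.
have Is := intg_bndM (measurable_sindot b) (fun x => sin_le1' _) Ik.
split.
  by under eq_Rintegral do rewrite mulrCA; rewrite RintZ// c0 mulr0.
by under eq_Rintegral do rewrite mulrCA; rewrite RintZ// s0 mulr0.
Qed.

Lemma annihD k h : annih k -> annih h -> annih (fun x => k x + h x).
Proof.
move=> [Ik kb] [Ih hb]; split; first exact: intgD.
move=> b; have [c0 s0] := kb b; have [c1 s1] := hb b.
have Ic := fun k => @intg_bndM _ k _ (measurable_cosdot b) (fun x => cos_le1' _).
have Is := fun k => @intg_bndM _ k _ (measurable_sindot b) (fun x => sin_le1' _).
split; under eq_Rintegral do rewrite mulrDr.
  by rewrite (RintD (Ic _ Ik) (Ic _ Ih)) c0 c1 addr0.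
by rewrite (RintD (Is _ Ik) (Is _ Ih)) s0 s1 addr0.
Qed.

Lemma multiplierM P Q : multiplier P -> multiplier Q -> multiplier (fun x => P x * Q x).
Proof.
move=> [mP [C PC] PN] [mQ [D QD] QN]; split.
- exact: measurable_funM.
- exists (C * D) => x; rewrite normrM; apply: ler_pM => //.
- by move=> k /QN /PN; under eq_fun do rewrite mulrA.
Qed.

Lemma multiplierD P Q : multiplier P -> multiplier Q -> multiplier (fun x => P x + Q x).
Proof.
move=> [mP [C PC] PN] [mQ [D QD] QN]; split.
- exact: measurable_funD.
- by exists (C + D) => x; rewrite (le_trans (ler_normD _ _))// lerD.
- move=> k kk; under eq_fun do rewrite mulrDl; apply: annihD; [exact: PN|exact: QN].
Qed.

Lemma multiplierZ (a : R) P : multiplier P -> multiplier (fun x => a * P x).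
Proof.
move=> [mP [C PC] PN]; split.
- exact: measurable_funM.
- by exists (`|a| * C) => x; rewrite normrM ler_wpM2l.
- move=> k kk; under eq_fun do rewrite -mulrA; apply: annihZ; exact: PN.
Qed.

Lemma multiplier1 : multiplier (fun=> 1).
Proof.
split; [exact: measurable_cst|by exists 1 => x; rewrite normr1|move=> k].
by under [X in _ -> annih X]eq_fun do rewrite mul1r.
Qed.

(** Dominated convergence with majorant [C |k|]. *)
Lemma multiplier_lim (P_ : nat -> Rn -> R) P (C : R) : (forall m, multiplier (P_ m)) ->
  (forall m x, `|P_ m x| <= C) -> (forall x, P_ ^~ x @ \oo --> P x) -> multiplier P.
Proof.
move=> mP PC PP.
have mPl : measurable_fun setT P.
  by apply: (@measurable_fun_cvg _ _ _ _ P_) => // m; have [] := mP m.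
have PlC x : `|P x| <= C.
  rewrite -(cvg_lim _ (cvg_norm (PP x)))//; apply: limr_le; last exact: nearW.
  by apply: cvgP; exact: cvg_norm (PP x).
split => //; first by exists C.
move=> k kk; have [Ik kb] := kk; split; first exact: intg_bndM PlC Ik.
have gen (w : Rn -> R) : measurable_fun setT w -> (forall x, `|w x| <= 1) ->
    (forall m, \int[leb]_x (w x * (P_ m x * k x)) = 0) ->
    \int[leb]_x (w x * (P x * k x)) = 0.
  move=> mw w1 w0.
  have mk := intg_meas Ik.
  have [|||||_ _ cv] := @Rint_dct _ _ R leb (fun m x => w x * (P_ m x * k x))
    (fun x => w x * (P x * k x)) (fun x => C * `|k x|).
  - by move=> m; have [mPm _ _] := mP m; do 2 apply: measurable_funM => //.
  - by do 2 apply: measurable_funM => //.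
  - apply: nearW => x; apply: cvgM; first exact: cvg_cst.
    by apply: cvgM; [exact: PP|exact: cvg_cst].
  - by apply: intgZ; exact: intg_norm.
  - apply: nearW => x m; rewrite !normrM -[leRHS]mul1r.
    by apply: ler_pM => //; exact: ler_wpM2r.
  - by rewrite -(cvg_lim _ cv)//; under eq_fun do rewrite w0; rewrite lim_cst.
move=> b; split.
  apply: gen; [exact: measurable_cosdot|by move=> x; exact: cos_le1'|].
  by move=> m; have [_ _ /(_ _ kk)[_ /(_ b)[]]] := mP m.
apply: gen; [exact: measurable_sindot|by move=> x; exact: sin_le1'|].
by move=> m; have [_ _ /(_ _ kk)[_ /(_ b)[]]] := mP m.
Qed.

(** The product formulas turn the factor into shifts of the frequency [b] by [c] and [- c]. *)
Lemma multiplier_cos c : multiplier (fun x => cos (dotr c x)).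
Proof.
split; [exact: measurable_cosdot|by exists 1 => x; exact: cos_le1'|].
move=> k [Ik kb].
split; first exact: intg_bndM (measurable_cosdot c) (fun x => cos_le1' _) Ik.
have Ic b := intg_bndM (measurable_cosdot b) (fun x => cos_le1' _) Ik.
have Is b := intg_bndM (measurable_sindot b) (fun x => sin_le1' _) Ik.
move=> b; split.
- transitivity (\int[leb]_x (2^-1 * (cos (dotr (b + c) x) * k x) +
      2^-1 * (cos (dotr (b - c) x) * k x))).
    apply: eq_Rintegral => x _.
    by rewrite !dotrDl dotrNl cosB cosD; field.
  by rewrite RintD ?RintZ// ?(kb _).1 ?mulr0 ?addr0//; exact: intgZ.
- transitivity (\int[leb]_x (2^-1 * (sin (dotr (b + c) x) * k x) +
      2^-1 * (sin (dotr (b - c) x) * k x))).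
    apply: eq_Rintegral => x _.
    by rewrite !dotrDl dotrNl sinB sinD; field.
  by rewrite RintD ?RintZ// ?(kb _).2 ?mulr0 ?addr0//; exact: intgZ.
Qed.

Lemma multiplier_sin c : multiplier (fun x => sin (dotr c x)).
Proof.
split; [exact: measurable_sindot|by exists 1 => x; exact: sin_le1'|].
move=> k [Ik kb].
split; first exact: intg_bndM (measurable_sindot c) (fun x => sin_le1' _) Ik.
have Ic b := intg_bndM (measurable_cosdot b) (fun x => cos_le1' _) Ik.
have Is b := intg_bndM (measurable_sindot b) (fun x => sin_le1' _) Ik.
move=> b; split.
- transitivity (\int[leb]_x (2^-1 * (sin (dotr (b + c) x) * k x) -
      2^-1 * (sin (dotr (b - c) x) * k x))).
    apply: eq_Rintegral => x _.
    by rewrite !dotrDl dotrNl sinB sinD; field.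
  by rewrite RintB ?RintZ// ?(kb _).2 ?mulr0 ?subr0//; exact: intgZ.
- transitivity (\int[leb]_x (2^-1 * (cos (dotr (b - c) x) * k x) -
      2^-1 * (cos (dotr (b + c) x) * k x))).
    apply: eq_Rintegral => x _.
    by rewrite !dotrDl dotrNl cosB cosD; field.
  by rewrite RintB ?RintZ// ?(kb _).1 ?mulr0 ?subr0//; exact: intgZ.
Qed.

(** The iterates of [newton_sg] are polynomials in the shifted sine, hence multipliers, and they
    converge boundedly to its sign. *)
Lemma multiplier_sgsin c (a : R) : multiplier (fun x => Num.sg (sin (dotr c x - a))).
Proof.
apply: (@multiplier_lim (fun m x => iter m newton_sg (sin (dotr c x - a))) _ 1).
- elim => [|m ih] /=.
    rewrite (_ : (fun x => _) =
      (fun x => cos a * sin (dotr c x) + - sin a * cos (dotr c x))); last first.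
      by apply/funext => x; rewrite sinB; ring.
    by apply: multiplierD; apply: multiplierZ; [exact: multiplier_sin|exact: multiplier_cos].
  rewrite (_ : (fun x => _) = (fun x => (3 / 2) * iter m newton_sg (sin (dotr c x - a)) +
    (- 2^-1) * (iter m newton_sg (sin (dotr c x - a)) *
     (iter m newton_sg (sin (dotr c x - a)) * iter m newton_sg (sin (dotr c x - a)))))).
    apply: multiplierD; apply: multiplierZ => //.
    by do 2 apply: multiplierM => //.
  by apply/funext => x; rewrite /newton_sg; field.
- by move=> m x; apply: iter_newton_bnd; exact: sin_le1'.
- by move=> x; apply: iter_newton_cvg; exact: sin_le1'.
Qed.

(** For large [m] the argument of the sine lies in [(- pi, pi)], where the sine has the sign of its
    argument. *)
Lemma multiplier_sg i (a : R) : multiplier (fun x => Num.sg (x ord0 i - a)).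
Proof.
apply: (@multiplier_lim (fun m x => Num.sg
  (sin (dotr (m.+1%:R^-1 *: delta_mx ord0 i) x - m.+1%:R^-1 * a))) _ 1).
- by move=> m; exact: multiplier_sgsin.
- by move=> m x; rewrite normr_sg lern1; case: (_ != _).
- move=> x; apply: cvg_near_cst.
  exists (Num.trunc (`|x ord0 i - a| / pi)) => // m /= mN.
  rewrite dotrZl dotr_delta -mulrBr sgr_sin.
    by rewrite sgrM gtr0_sg ?invr_gt0// mul1r.
  rewrite normrM gtr0_norm ?invr_gt0// mulrC ltr_pdivrMr// mulrC -ltr_pdivrMr ?pi_gt0//.
  by rewrite (lt_le_trans (truncnS_gt _))// ler_nat ltnS.
Qed.

(** The indicator of the open positive half-line is [(sg + sg^2) / 2], at 0 as well. *)
Lemma multiplier_ray i (a : R) :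
  multiplier (\1_[set x : Rn | a < x ord0 i]).
Proof.
rewrite (_ : \1__ = (fun x : Rn => 2^-1 * Num.sg (x ord0 i - a) +
    2^-1 * (Num.sg (x ord0 i - a) * Num.sg (x ord0 i - a)))).
  by apply: multiplierD; apply: multiplierZ; [|apply: multiplierM]; exact: multiplier_sg.
apply/funext => x; rewrite indicE; have [xa|xa|xa] := ltgtP a (x ord0 i).
- by rewrite gtr0_sg ?subr_gt0//; transitivity (1 : R); [rewrite mem_set|field].
- rewrite ltr0_sg ?subr_lt0//; transitivity (0 : R); last by ring.
  by rewrite memNset//= => ax; have := lt_trans xa ax; rewrite ltxx.
- rewrite xa subrr sgr0; transitivity (0 : R); last by ring.
  by rewrite memNset//= ltxx.
Qed.

Let S : set (set Rn) := [set A | multiplier (\1_A)].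

Let SC A : S A -> S (~` A).
Proof.
rewrite /S/= => mA; rewrite (_ : \1_(~` A) = (fun x => 1 + (-1) * \1_A x)).
  by apply: multiplierD; [exact: multiplier1|exact: multiplierZ].
apply/funext => x; rewrite !indicE in_setC; case: (x \in A) => /=; ring.
Qed.

Let S0 : S set0.
Proof.
rewrite /S/= (_ : \1_set0 = (fun x => 0 * 1)).
  by apply: multiplierZ; exact: multiplier1.
by apply/funext => x; rewrite indic0 mul0r.
Qed.

Let SU A B : S A -> S B -> S (A `|` B).
Proof.
rewrite /S/= => mA mB.
rewrite (_ : \1_(A `|` B) = (fun x => (\1_A x + \1_B x) + (-1) * (\1_A x * \1_B x))).
  apply: multiplierD; first exact: multiplierD.
  by apply: multiplierZ; exact: multiplierM.
apply/funext => x; rewrite !indicE in_setU.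
by case: (x \in A); case: (x \in B) => /=; ring.
Qed.

Let Ssigma : sigma_algebra setT S.
Proof.
split => //; first by move=> A; rewrite setTD; exact: SC.
move=> F SF; apply: (@multiplier_lim (fun m => \1_(\bigcup_(i < m) F i)) _ 1).
- elim => [|m ih].
    by rewrite (_ : \bigcup_(i < 0) F i = set0) //; apply/seteqP; split => // x [].
  by rewrite -[\1__]/(\1__) bigcup_mkord big_ord_recr/= -bigcup_mkord; exact: SU.
- by move=> m x; rewrite ger0_norm// indicE lern1 leq_b1.
- move=> x; apply: cvg_near_cst.
  have [[i _ Fx]|nF] := pselect ((\bigcup_i F i) x).
    exists i.+1 => // m /= im; rewrite !indicE !mem_set//; first by exists i.
    by exists i.
  apply: nearW => m; rewrite !indicE !memNset// => -[i _ Fi]; apply: nF.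
  by exists i.
Qed.

(** The sets whose indicator is a multiplier form a sigma-algebra that contains the half-spaces,
    which generate the measurable sets. *)
Lemma multiplier_indic A : measurable A -> multiplier (\1_A).
Proof.
suff : g_sigma_preimage (fun (i : 'I_n) (x : Rn) => x ord0 i) `<=` S by exact.
apply: smallest_sub; first exact: Ssigma.
elim/big_ind : _ => //; first by move=> X Y hX hY; rewrite subUset.
move=> i _ _ [B mB <-]; rewrite setTI.
suff : <<s @RGenOInfty.G R >> `<=` [set B | S ((fun x : Rn => x ord0 i) @^-1` B)].
  have : (@ocitv R).-sigma.-measurable B by exact: mB.
  by rewrite RGenOInfty.measurableE => GB; apply.
apply: smallest_sub.
  split.
  - by rewrite /= preimage_set0.
  - by move=> A' /= SA; rewrite setTD preimage_setC; exact: SC.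
  - by move=> F SF /=; rewrite preimage_bigcup; by case: Ssigma => _ _; apply.
move=> _ [a ->] /=; rewrite (_ : _ @^-1` _ = [set x : Rn | a < x ord0 i]).
  exact: multiplier_ray.
by apply/seteqP; split => x /=; rewrite in_itv/= andbT.
Qed.

(** Frequency 0 of [\1_A * h] shows that the integral of [h] over every measurable set [A] vanishes;
    the sets where [h] is positive or negative are then null. *)
Theorem fourier_uniqueness h : intg leb h ->
  (forall b, \int[leb]_x (cos (dotr b x) * h x) = 0) ->
  (forall b, \int[leb]_x (sin (dotr b x) * h x) = 0) ->
  {ae leb, forall x, h x = 0}.
Proof.
move=> Ih hc hs; have ah : annih h by split.
have mh := intg_meas Ih.
have key A : measurable A -> intg leb (fun x => \1_A x * h x) /\
    \int[leb]_x (\1_A x * h x) = 0.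
  move=> mA; have [_ _ /(_ _ ah)[IA /(_ 0)[A0 _]]] := multiplier_indic mA; split => //.
  by rewrite -A0; apply: eq_Rintegral => x _; rewrite dotr0l cos0 mul1r.
have half : forall f : Rn -> R, intg leb f -> (forall A, measurable A ->
      intg leb (fun x => \1_A x * f x) /\ \int[leb]_x (\1_A x * f x) = 0) ->
    {ae leb, forall x, f x <= 0}.
  move=> f If fA; have mf := intg_meas If.
  have mA : measurable (f @^-1` `]0, +oo[%classic).
    by rewrite -[X in measurable X]setTI; exact: mf.
  have [Ip ip] := fA _ mA; apply: filterS (Rint_eq0 Ip _ ip) => x; rewrite indicE.
    have [/set_mem/=|nx] := boolP (x \in _).
      by rewrite in_itv/= andbT mul1r => /lt_eqF/eqP h0 /esym.
    move=> _; rewrite leNgt; apply: contra nx => fx; rewrite mem_set//=.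
    by rewrite in_itv/= fx.
  have [/set_mem/=|nx] := boolP (x \in _); last by rewrite mul0r.
  by rewrite in_itv/= andbT mul1r => /ltW.
have h1 := half _ Ih key.
have h2 : {ae leb, forall x, - h x <= 0}.
  apply: half; first exact: intgN.
  move=> A /key[IA A0]; split.
    by under eq_fun do rewrite mulrN; exact: intgN.
  by under eq_Rintegral do rewrite mulrN; rewrite RintN// A0 oppr0.
apply: filterS2 h1 h2 => x a b; apply/eqP; rewrite eq_le a/=.
by rewrite -oppr_le0.
Qed.

End fourier_uniqueness.

Section is_derive_fun.
Context {R : realType}.
Implicit Types (f g : R -> R) (x a b : R).

Lemma idrv_eq f x a b : is_derive x 1 f a -> a = b -> is_derive x 1 f b.
Proof. by move=> ? <-. Qed.

Lemma idrvM f g x a b : is_derive x 1 f a -> is_derive x 1 g b ->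
  is_derive x 1 (fun y => f y * g y) (a * g x + f x * b).
Proof.
move=> fa gb; have := is_deriveM fa gb; congr is_derive.
by rewrite /GRing.scale/= addrC [g x * a]mulrC.
Qed.

Lemma idrvD f g x a b : is_derive x 1 f a -> is_derive x 1 g b ->
  is_derive x 1 (fun y => f y + g y) (a + b).
Proof. by move=> fa gb; exact: is_deriveD fa gb. Qed.

Lemma idrvN f x a : is_derive x 1 f a -> is_derive x 1 (fun y => - f y) (- a).
Proof. by move=> fa; exact: is_deriveN fa. Qed.

Lemma idrv_cst c x : is_derive x 1 (fun _ : R => c : R) 0.
Proof. exact: is_derive_cst. Qed.

Lemma idrv_id x : is_derive x 1 (fun y : R => y) 1.
Proof. exact: is_derive_id. Qed.

Lemma idrvZ c f x a : is_derive x 1 f a -> is_derive x 1 (fun y => c * f y) (c * a).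
Proof.
by move=> fa; apply: idrv_eq (idrvM (idrv_cst c x) fa) _; rewrite mul0r add0r.
Qed.

Lemma idrv_comp f g x a b : is_derive (g x) 1 f a -> is_derive x 1 g b ->
  is_derive x 1 (fun y => f (g y)) (a * b).
Proof. by move=> fa gb; exact: is_derive1_comp. Qed.

End is_derive_fun.

(** * The Fourier transform of the one-dimensional Gaussian *)

Section gauss1.
Context {R : realType}.
Local Notation leb1 := (@lebesgue_measure R).
Implicit Types t k : R.

Definition g1 t : R := expR (- (t ^+ 2 / 2)).

Lemma normal_funE (s : R) t : normal_fun 0 s t = expR (- (t ^+ 2 / (s ^+ 2 *+ 2))).
Proof. by rewrite /normal_fun subr0 mulNr. Qed.

Lemma intg_normal_fun (s : R) : s != 0 -> intg leb1 (normal_fun 0 s).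
Proof.
move=> s0; have := @integrable_normal_pdf R 0 s.
rewrite normal_pdfE// => /(integrableZl measurableT (normal_peak s)^-1).
apply: eq_integrable => // x _; rewrite /= -EFinM mulrA mulVf ?mul1r//.
by rewrite gt_eqF// normal_peak_gt0.
Qed.

Lemma intg_g8 : intg leb1 (fun t => expR (- (t ^+ 2 / 8))).
Proof.
have := @intg_normal_fun 2; rewrite pnatr_eq0 => /(_ isT).
congr intg; apply/funext => t; rewrite normal_funE.
by rewrite (_ : 2 ^+ 2 *+ 2 = 8)//; ring.
Qed.

Lemma g1_ge0 t : 0 <= g1 t. Proof. exact: expR_ge0. Qed.

(** A majorant uniform in the shift [h], for differentiation under the integral sign. Completing the
    square gives [g1 (t + h) <= e exp (- t^2 / 4)], and half of that exponent absorbs the linear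
    factor. *)
Lemma g1_le (C D : R) : 0 <= C -> 0 <= D -> forall t h, `|h| <= 1 ->
  g1 (t + h) * (C + D * `|t + h|) <= expR 1 * (C + D * 3) * expR (- (t ^+ 2 / 8)).
Proof.
move=> C0 D0 t h h1.
have e1 : `|t| <= 2 * expR (t ^+ 2 / 8).
  have := expR_ge1Dx (t ^+ 2 / 8); have := normr_ge0 t.
  have : `|t| ^+ 2 = t ^+ 2 by rewrite real_normK ?num_real.
  set a := `|t|; set e := expR _ => aa a0 ee.
  have : 0 <= (a - 2) ^+ 2 by exact: sqr_ge0.
  nra.
have e2 : `|t + h| <= 3 * expR (t ^+ 2 / 8).
  have := ler_normD t h; have := expR_ge1Dx (t ^+ 2 / 8); have := sqr_ge0 t; lra.
have e3 : C + D * `|t + h| <= (C + D * 3) * expR (t ^+ 2 / 8).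
  have := expR_ge1Dx (t ^+ 2 / 8); have := sqr_ge0 t; have := ler_wpM2l D0 e2; nra.
have e4 : g1 (t + h) <= expR 1 * expR (- (t ^+ 2 / 4)).
  rewrite -expRD ler_expR.
  move: h1; rewrite -ler_sqr ?nnegrE// real_normK ?num_real// expr1n => h1.
  have := sqr_ge0 (t + 2 * h); nra.
apply: le_trans (ler_pM (g1_ge0 _) _ e4 e3) _.
  by rewrite addr_ge0// mulr_ge0.
rewrite mulrACA -expRD; apply: ler_wpM2l; first by rewrite mulr_ge0 ?expR_ge0//; nra.
by rewrite ler_expR; have := sqr_ge0 t; lra.
Qed.

Lemma continuous_g1 : continuous g1.
Proof.
move=> t; apply: continuous_comp; last exact: continuous_expR.
by apply: continuousN; apply: continuousM; [exact: exprn_continuous|exact: cst_continuous].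
Qed.

Lemma measurable_g1 : measurable_fun setT g1.
Proof. by apply: continuous_measurable_fun; exact: continuous_g1. Qed.

Lemma intg_dom8 (f : R -> R) (C : R) : measurable_fun setT f ->
  (forall t, `|f t| <= C * expR (- (t ^+ 2 / 8))) -> intg leb1 f.
Proof. move=> mf fC; apply: (@intg_le _ _ R leb1 (fun t => C * expR (- (t ^+ 2 / 8))) f mf fC).
exact: (intgZ C intg_g8). Qed.

Definition Ic k := \int[leb1]_t (g1 t * cos (k * t)).

Lemma intg_Ic k : intg leb1 (fun t => g1 t * cos (k * t)).
Proof.
apply: (@intg_dom8 _ (expR 1)).
  apply: measurable_funM; first exact: measurable_g1.
  apply: continuous_measurable_fun => t; apply: continuous_comp; last exact: continuous_cos.
  by apply: continuousM; [exact: cst_continuous|exact: cvg_id].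
move=> t; rewrite normrM ger0_norm ?g1_ge0//.
have := @g1_le 1 0 ler01 (lexx _) t 0; rewrite normr0 addr0 mul0r !addr0 mulr1 => /(_ ler01).
have -> : expR 1 * (1 + 0 * 3) = expR 1 :> R by ring.
by apply: le_trans; rewrite ler_piMr ?g1_ge0// ler_norml cos_geN1 cos_le1.
Qed.

Lemma derive_g1 t : is_derive t 1 g1 (- (t * g1 t)).
Proof.
apply: (@idrv_eq _ _ _ (expR (- (t ^+ 2 / 2)) * - ((1 * t + t * 1) * 2^-1))); last first.
  by rewrite /g1; field.
apply: (idrv_comp (f := expR)); apply: idrvN.
apply: (@idrv_eq _ _ _ ((1 * t + t * 1) * 2^-1 + t ^+ 2 * 0)); last by rewrite mulr0 addr0.
by apply: idrvM; exact: (idrvM (idrv_id _) (idrv_id _)).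
Qed.

Lemma derive_cosl (k t : R) : is_derive k 1 (fun k => g1 t * cos (k * t)) (- (t * g1 t * sin (k * t))).
Proof.
apply: (@idrv_eq _ _ _ (g1 t * (- sin (k * t) * (1 * t + k * 0)))); last by ring.
by apply: idrvZ; apply: (idrv_comp (f := cos)); exact: (idrvM (idrv_id k) (idrv_cst t k)).
Qed.

Lemma derive_sing (k t h : R) : is_derive h 1 (fun h => g1 (t + h) * sin (k * (t + h)))
  (g1 (t + h) * (k * cos (k * (t + h)) - (t + h) * sin (k * (t + h)))).
Proof.
have dt : is_derive h 1 (fun h => t + h) 1.
  exact: (idrv_eq (idrvD (idrv_cst t h) (idrv_id h)) (add0r 1)).
apply: (@idrv_eq _ _ _ (- ((t + h) * g1 (t + h)) * 1 * sin (k * (t + h)) +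
  g1 (t + h) * (cos (k * (t + h)) * (k * 1)))); last by ring.
apply: idrvM.
  by apply: (idrv_comp (f := g1)) => //; exact: derive_g1.
Qed.

Let meas_cos (k : R) : measurable_fun [set: R] (fun t => cos (k * t)).
Proof.
apply: continuous_measurable_fun => t; apply: continuous_comp; last exact: continuous_cos.
by apply: continuousM; [exact: cst_continuous|exact: cvg_id].
Qed.

Let meas_sin (k : R) : measurable_fun [set: R] (fun t => sin (k * t)).
Proof.
apply: continuous_measurable_fun => t; apply: continuous_comp; last exact: continuous_sin.
by apply: continuousM; [exact: cst_continuous|exact: cvg_id].
Qed.

Let bnd1 (C D : R) : 0 <= C -> 0 <= D -> forall t,
  g1 t * (C + D * `|t|) <= expR 1 * (C + D * 3) * expR (- (t ^+ 2 / 8)).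
Proof. by move=> C0 D0 t; have := @g1_le C D C0 D0 t 0; rewrite addr0 normr0; apply. Qed.

Lemma intg_sing (k : R) : intg leb1 (fun t => t * g1 t * sin (k * t)).
Proof.
apply: (@intg_dom8 _ (expR 1 * (0 + 1 * 3))).
  by do 2 apply: measurable_funM => //; exact: measurable_g1.
move=> t; apply: le_trans (bnd1 (lexx _) ler01 t).
rewrite add0r mul1r !normrM [`|g1 t|]ger0_norm ?g1_ge0// mulrC [_ * g1 t]mulrC.
by rewrite ler_piMl ?mulr_ge0 ?g1_ge0// ler_norml sin_geN1 sin_le1.
Qed.

Lemma derive_Ic k : is_derive k 1 Ic (- \int[leb1]_t (t * g1 t * sin (k * t))).
Proof.
pose f (k t : R) := g1 t * cos (k * t).
have dE x t : partial1of2 f x t = - (t * g1 t * sin (x * t)).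
  by rewrite partial1of2E; have [_ ->] := derive_cosl x t.
pose G (t : R) := expR 1 * (0 + 1 * 3) * expR (- (t ^+ 2 / 8)).
have IG : intg leb1 G by exact: intgZ intg_g8.
have Ik : (`]k - 1, k + 1[%classic : set R) k by rewrite /= in_itv/=; apply/andP; split; lra.
have Ggt t : 0 <= G t by rewrite !mulr_ge0 ?expR_ge0//; lra.
have dG x t : (`]k - 1, k + 1[%classic : set R) x -> [set: R] t -> `|partial1of2 f x t| <= G t.
  move=> _ _; rewrite dE normrN; apply: le_trans (bnd1 (lexx _) ler01 t).
  rewrite add0r mul1r !normrM [`|g1 t|]ger0_norm ?g1_ge0// mulrC [_ * g1 t]mulrC.
  by rewrite ler_piMl ?mulr_ge0 ?g1_ge0// ler_norml sin_geN1 sin_le1.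
have df x t : (`]k - 1, k + 1[%classic : set R) x -> [set: R] t -> derivable (f ^~ t) x 1.
  by move=> _ _; have [] := derive_cosl x t.
have If x : (`]k - 1, k + 1[%classic : set R) x -> intg leb1 (f x) by move=> _; exact: intg_Ic.
have D1 := derivable_under_integral measurableT Ik If df Ggt IG dG.
have D2 := differentiation_under_integral measurableT Ik If df Ggt IG dG.
split; first exact: D1.
rewrite -derive1E; rewrite D2.
under eq_Rintegral do rewrite dE.
by rewrite RintN//; exact: intg_sing.
Qed.

Lemma Rint_shift1 (c : R) (f : R -> R) : intg leb1 f -> \int[leb1]_t f (t + c) = \int[leb1]_t f t.
Proof.
move=> If; have mf : measurable_fun [set: R] f := intg_meas If.
have E (g : R -> R) : measurable_fun [set: R] g -> (forall x, 0 <= g x) ->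
    \int[leb1]_x g (x + c) = \int[leb1]_x g x.
  move=> mg g0; congr fine; rewrite (@int_shift1 R c (fun x => (g x)%:E))//.
  exact/measurable_EFinP.
have Is (g : R -> R) : intg leb1 g -> intg leb1 (fun x => g (x + c)).
  move=> Ig; have mg : measurable_fun [set: R] g := intg_meas Ig.
  apply/integrableP; split.
    by apply/measurable_EFinP; apply: (measurableT_comp mg); exact: measurable_funD.
  rewrite (@int_shift1 R c (fun x => `|(g x)%:E|)%E)//; first by case/integrableP : Ig.
  by apply/measurable_EFinP; exact: measurableT_comp.
have dec (x : R) : x = (`|x| + x) - `|x| by rewrite addrAC subrr add0r.
have In := intg_norm If.
have Ip : intg leb1 (fun x => `|f x| + f x) by exact: intgD.
transitivity (\int[leb1]_x ((`|f (x + c)| + f (x + c)) - `|f (x + c)|)).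
  by apply: eq_Rintegral => x _; exact: dec.
rewrite (RintB (Is _ Ip) (Is _ In)).
rewrite (E (fun x => `|f x| + f x)); last 2 first.
- exact: intg_meas Ip.
- by move=> x; rewrite -lerBlDr sub0r -normrN ler_norm.
rewrite (E (fun x => `|f x|))//; last exact: intg_meas In.
by rewrite -RintB//; apply: eq_Rintegral => x _; rewrite -dec.
Qed.

(* Translation invariance makes [h |-> int phi (t + h) dt] constant; its derivative
   at [0] is the integral of [phi'], which therefore vanishes. *)
Lemma sing_parts k : \int[leb1]_t (t * g1 t * sin (k * t)) = k * Ic k.
Proof.
pose f (h t : R) := g1 (t + h) * sin (k * (t + h)).
have dE x t : partial1of2 f x t = g1 (t + x) * (k * cos (k * (t + x)) - (t + x) * sin (k * (t + x))).
  by rewrite partial1of2E; have [_ ->] := derive_sing k t x.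
pose G (t : R) := expR 1 * (`|k| + 1 * 3) * expR (- (t ^+ 2 / 8)).
have IG : intg leb1 G by exact: intgZ intg_g8.
have Ik : (`]-1, 1[%classic : set R) 0 by rewrite /= in_itv/=; apply/andP; split; lra.
have Ggt t : 0 <= G t by rewrite !mulr_ge0 ?expR_ge0// addr_ge0//; lra.
have dG x t : (`]-1, 1[%classic : set R) x -> [set: R] t -> `|partial1of2 f x t| <= G t.
  rewrite /= in_itv/= => /andP[xl xr] _; rewrite dE.
  have x1 : `|x| <= 1 by rewrite ler_norml !ltW.
  apply: le_trans (g1_le (normr_ge0 k) ler01 t x1).
  rewrite normrM ger0_norm ?g1_ge0//; apply: ler_wpM2l; first exact: g1_ge0.
  apply: le_trans (ler_normB _ _) _; rewrite !normrM mul1r; apply: lerD.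
    by rewrite ler_piMr// ler_norml cos_geN1 cos_le1.
  by rewrite ler_piMr// ler_norml sin_geN1 sin_le1.
have df x t : (`]-1, 1[%classic : set R) x -> [set: R] t -> derivable (f ^~ t) x 1.
  by move=> _ _; have [] := derive_sing k t x.
have I0 : intg leb1 (fun t => g1 t * sin (k * t)).
  apply: (@intg_dom8 _ (expR 1 * (1 + 0 * 3))).
    by apply: measurable_funM => //; exact: measurable_g1.
  move=> t; apply: le_trans (bnd1 ler01 (lexx _) t).
  rewrite mul0r addr0 mulr1 normrM ger0_norm ?g1_ge0//.
  by rewrite ler_piMr ?g1_ge0// ler_norml sin_geN1 sin_le1.
have If x : (`]-1, 1[%classic : set R) x -> intg leb1 (f x).
  rewrite /= in_itv/= => /andP[xl xr]; apply: (@intg_dom8 _ (expR 1 * (1 + 0 * 3))).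
    apply: (measurableT_comp (f := fun s => g1 s * sin (k * s))).
      by apply: measurable_funM => //; exact: measurable_g1.
    exact: measurable_funD.
  move=> t; have x1 : `|x| <= 1 by rewrite ler_norml !ltW.
  apply: le_trans (g1_le ler01 (lexx 0) t x1).
  rewrite mul0r addr0 mulr1 normrM ger0_norm ?g1_ge0//.
  by rewrite ler_piMr ?g1_ge0// ler_norml sin_geN1 sin_le1.
have := differentiation_under_integral measurableT Ik If df Ggt IG dG.
have -> : (fun x => \int[leb1]_y f x y) = cst (\int[leb1]_t (g1 t * sin (k * t))).
  by apply/funext => x; exact: (Rint_shift1 x I0).
rewrite derive1_cst; under eq_Rintegral do rewrite dE addr0.
have -> : \int[leb1]_t (g1 t * (k * cos (k * t) - t * sin (k * t))) =
    \int[leb1]_t (k * (g1 t * cos (k * t)) - t * g1 t * sin (k * t)).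
  by apply: eq_Rintegral => t _; ring.
rewrite RintB ?RintZ; [|exact: intg_Ic|by apply: intgZ; exact: intg_Ic|exact: intg_sing].
by move/esym/eqP; rewrite subr_eq0 => /eqP <-.
Qed.

Lemma Ic0 : Ic 0 = Num.sqrt (2 * pi).
Proof.
have := @integral_normal_pdf R 0 1; rewrite normal_pdfE ?oner_eq0//.
have I1 : intg leb1 (normal_fun 0 1) by apply: intg_normal_fun; exact: oner_neq0.
have -> : (\int[leb1]_x (normal_peak 1 * normal_fun 0 1 x)%:E)%E =
    (normal_peak 1 * \int[leb1]_x normal_fun 0 1 x)%:E.
  by rewrite -RintZ// RintE//; exact: intgZ.
have -> : \int[leb1]_x normal_fun 0 1 x = Ic 0.
  apply: eq_Rintegral => x _; rewrite normal_funE mul0r cos0 mulr1 /g1.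
  by congr expR; rewrite expr1n mulr2n.
have p0 : 0 < normal_peak (1 : R) by apply: normal_peak_gt0; exact: oner_neq0.
move=> -[] /(congr1 (fun x => (normal_peak (1 : R))^-1 * x)).
rewrite mulrA mulVf ?gt_eqF// mul1r mulr1 => ->.
by rewrite /normal_peak invrK; congr Num.sqrt; rewrite expr1n; ring.
Qed.

(** [Ic] solves [Ic' k = - k Ic k], so [Ic k exp (k^2 / 2)] is constant; its value at 0 is the
    normalisation of the normal density. *)
Lemma IcE k : Ic k = Num.sqrt (2 * pi) * expR (- (k ^+ 2 / 2)).
Proof.
have cstE : Ic k * expR (k ^+ 2 / 2) = Ic 0 * expR (0 ^+ 2 / 2).
  apply: (@is_derive_0_is_cst _ (fun k => Ic k * expR (k ^+ 2 / 2))) => x.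
  apply: (@idrv_eq _ _ _ ((- (x * Ic x)) * expR (x ^+ 2 / 2) +
     Ic x * (expR (x ^+ 2 / 2) * ((1 * x + x * 1) * 2^-1 + x ^+ 2 * 0)))); last by field.
  apply: idrvM; first by rewrite -sing_parts; exact: derive_Ic.
  apply: (idrv_comp (f := expR)).
  by apply: idrvM; exact: (idrvM (idrv_id _) (idrv_id _)).
rewrite -Ic0 expRN -[LHS](mulfK (_ : expR (k ^+ 2 / 2) != 0)) ?gt_eqF ?expR_gt0//.
by rewrite cstE expr0n mul0r expR0 mulr1.
Qed.

End gauss1.

(** * Plancherel theorem *)

Section product_integrals.
Context d1 d2 (T1 : measurableType d1) (T2 : measurableType d2) (R : realType).
Variable m1 : {sigma_finite_measure set T1 -> \bar R}.
Variable m2 : {sigma_finite_measure set T2 -> \bar R}.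

Lemma intg_prodM (u : T1 -> R) (v : T2 -> R) : intg m1 u -> intg m2 v ->
  intg (m1 \x m2)%E (fun z => u z.1 * v z.2).
Proof.
move=> Iu Iv; have mu := intg_meas Iu; have mv := intg_meas Iv.
have mf : measurable_fun setT (fun z : T1 * T2 => u z.1 * v z.2).
  by apply: measurable_funM; [apply: (measurableT_comp mu)|apply: (measurableT_comp mv)].
apply/integrable12ltyP; first exact/measurable_EFinP.
rewrite (_ : integral _ _ _ = (\int[m1]_t (`|u t|%:E * \int[m2]_x `|v x|%:E))%E).
  rewrite (RintE (intg_norm Iv)) ge0_integralZr//.
  - rewrite (RintE (intg_norm Iu)) -EFinM; exact: ltry.
  - by apply/measurable_EFinP; exact: measurableT_comp.
  - by rewrite lee_fin Rint_ge0.
apply: eq_integral => t _; rewrite -ge0_integralZl//.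
- by apply: eq_integral => x _ /=; rewrite normrM EFinM.
- by apply/measurable_EFinP; exact: measurableT_comp.
Qed.

Lemma Rint_fubini (f : T1 * T2 -> R) : intg (m1 \x m2)%E f ->
  \int[m1]_x \int[m2]_y f (x, y) = \int[m2]_y \int[m1]_x f (x, y).
Proof.
move=> If; have F := Fubini If.
have mF := measurable_fubini_F If; have mG := measurable_fubini_G If.
have E1 : (\int[m1]_x (\int[m2]_y f (x, y))%:E = \int[m1]_x \int[m2]_y (f (x, y))%:E)%E.
  apply: ae_eq_integral => //.
    by apply/measurable_EFinP; apply: measurableT_comp => //.
  have := ae_integrable1 If; apply: filterS => x Ix _.
  by rewrite RintE.
have E2 : (\int[m2]_y (\int[m1]_x f (x, y))%:E = \int[m2]_y \int[m1]_x (f (x, y))%:E)%E.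
  apply: ae_eq_integral => //.
    by apply/measurable_EFinP; apply: measurableT_comp => //.
  have := ae_integrable2 If; apply: filterS => x Ix _.
  by rewrite RintE.
rewrite {1}/Rintegral E1 [RHS]/Rintegral E2; congr fine; exact: F.
Qed.

Lemma cint_fubini (f : T1 * T2 -> R[i]) : cintegrable (m1 \x m2)%E f ->
  cintegral m1 (fun x => cintegral m2 (fun y => f (x, y))) =
  cintegral m2 (fun y => cintegral m1 (fun x => f (x, y))).
Proof.
by move=> [I1 I2]; apply: complexP; [exact: (Rint_fubini I1)|exact: (Rint_fubini I2)].
Qed.

End product_integrals.

Section cis.
Context {R : realType}.
Implicit Types s t : R.

Definition cis t : R[i] := cos t +i* sin t.

Lemma cisD s t : cis (s + t) = cis s * cis t.
Proof. by apply: complexP; rewrite !cE/= ?cosD ?sinD//; ring. Qed.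
Lemma cisJ t : Num.conj (cis t) = cis (- t).
Proof. by apply: complexP; rewrite !cE/= ?cosN ?sinN. Qed.
Lemma conjcM (z w : R[i]) : Num.conj (z * w) = Num.conj z * Num.conj w.
Proof. by apply: complexP; rewrite !cE; ring. Qed.
Lemma cis0 : cis 0 = 1.
Proof. by apply: complexP; rewrite /cis/= ?cos0 ?sin0. Qed.
Lemma sqnormc_cis t : sqnormc (cis t) = 1.
Proof. by rewrite /sqnormc/= cos2Dsin2. Qed.
End cis.

Section fourier_gauss.
Context {R : realType} {n : nat}.
Local Notation leb := (@lebesgue_rV R n).
Local Notation Rn := 'rV[R]_n.
Implicit Types (a b p x : Rn) (phi psi : Rn -> R[i]).
Local Notation cint := (cintegral leb).

(** Equivalent to the modulus, and integrable along with the real and imaginary parts without any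
    square root. *)
Definition nabs (z : R[i]) := `|Re z| + `|Im z|.

Lemma nabs_ge0 z : 0 <= nabs z. Proof. by rewrite addr_ge0. Qed.
Lemma sqnormc_nabs z : sqnormc z <= nabs z ^+ 2.
Proof.
rewrite /sqnormc /nabs -[Re z ^+ 2]real_normK ?num_real// -[Im z ^+ 2]real_normK ?num_real//.
by have := normr_ge0 (Re z); have := normr_ge0 (Im z); set u := `|_|; set v := `|_|; nra.
Qed.

Lemma intg_nabs phi : cintegrable leb phi -> intg leb (fun x => nabs (phi x)).
Proof. by move=> [I1 I2]; apply: intgD; exact: intg_norm. Qed.

Lemma cmeas_cis b : cmeasurable (fun x => cis (dotr b x)).
Proof. by split; [exact: measurable_cosdot|exact: measurable_sindot]. Qed.

Lemma cintg_bndM (w : Rn -> R[i]) (C : R) phi : cmeasurable w -> 0 <= C ->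
  (forall x, sqnormc (w x) <= C ^+ 2) -> cintegrable leb phi ->
  cintegrable leb (fun x => w x * phi x).
Proof.
move=> mw C0 wC Ip; apply: (@cintg_le _ _ _ _ (fun x => C * nabs (phi x))).
- by apply: cmeasM => //; exact: cintg_meas Ip.
- by apply: intgZ; exact: intg_nabs.
- move=> x; rewrite sqnormcM exprMn; apply: ler_pM; rewrite ?sqnormc_ge0//.
  exact: sqnormc_nabs.
- by move=> x; rewrite mulr_ge0// nabs_ge0.
Qed.

Lemma cintg_cisM b phi : cintegrable leb phi ->
  cintegrable leb (fun x => cis (dotr b x) * phi x).
Proof.
apply: (@cintg_bndM _ 1); first exact: cmeas_cis; first by [].
by move=> x; rewrite sqnormc_cis expr1n.
Qed.

Lemma cint_shift a phi : cintegrable leb phi -> cint (fun x => phi (x + a)) = cint phi.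
Proof.
by move=> [I1 I2]; apply: complexP; [exact: (Rint_shift a I1)|exact: (Rint_shift a I2)].
Qed.

Lemma cintg_shift a phi : cintegrable leb phi -> cintegrable leb (fun x => phi (x + a)).
Proof. by move=> [I1 I2]; split; [exact: (intg_shift a I1)|exact: (intg_shift a I2)]. Qed.

Definition fnorm : R := (2 * pi) `^ (- (n%:R / 2)).

Lemma fourierE phi p : fourier phi p = fnorm%:C * cint (fun x => cis (- dotr p x) * phi x).
Proof.
rewrite /fourier; congr (_ * _); apply: eq_cint => x; congr (_ * _).
by rewrite /cis cosN sinN.
Qed.

Definition gauss x : R := expR (- (sqnormr x / 2)).

Lemma sqnormr_ge0 x : 0 <= sqnormr x.
Proof. by apply: sumr_ge0 => i _; exact: sqr_ge0. Qed.

Lemma sqnormrN x : sqnormr (- x) = sqnormr x.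
Proof. by rewrite /sqnormr dotrNl dotrNr opprK. Qed.

Lemma sqnormrD x p : sqnormr (x + p) = sqnormr x + 2 * dotr x p + sqnormr p.
Proof. by rewrite /sqnormr !dotrDl !dotrDr (dotrC p x); ring. Qed.

Lemma gauss_prod x : gauss x = \prod_i g1 (x ord0 i).
Proof.
rewrite /gauss /sqnormr /dotr mulr_suml -sumrN expR_sum.
by apply: eq_bigr => i _; rewrite /g1 expr2.
Qed.

Lemma gauss_gt0 x : 0 < gauss x. Proof. exact: expR_gt0. Qed.

Lemma gaussN x : gauss (- x) = gauss x.
Proof. by rewrite /gauss sqnormrN. Qed.

Lemma gauss_le1 x : gauss x <= 1.
Proof. by rewrite /gauss -expR0 ler_expR oppr_le0 mulr_ge0// sqnormr_ge0. Qed.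

Lemma intg_g1 : intg (@lebesgue_measure R) (@g1 R).
Proof.
have := @intg_Ic R 0; congr intg; apply/funext => t; by rewrite mul0r cos0 mulr1.
Qed.

Lemma intg_gauss : intg leb gauss.
Proof.
have [I1 _] := intg_prod (fun _ : 'I_n => intg_g1).
by have -> : gauss = (fun x => \prod_i g1 (x ord0 i)) by apply/funext => x; rewrite gauss_prod.
Qed.

Lemma Rint_gauss_sin b : \int[leb]_x (gauss x * sin (dotr b x)) = 0.
Proof.
have I1 : intg leb (fun x => gauss x * sin (dotr b x)).
  under eq_fun do rewrite mulrC.
  exact: intg_bndM (measurable_sindot b) (fun x => sin_le1' _) intg_gauss.
have := Rint_opp I1; under eq_Rintegral do rewrite gaussN dotrNr sinN mulrN.
rewrite RintN//; lra.
Qed.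

End fourier_gauss.

(** Induction on the dimension through the addition formula; the product of the sine terms drops out
    because the sine integral vanishes by oddness. *)
Lemma Rint_gauss_cos {R : realType} n (b : 'rV[R]_n) :
  \int[@lebesgue_rV R n]_x (gauss x * cos (dotr b x)) =
  Num.sqrt (2 * pi) ^+ n * gauss b.
Proof.
elim: n b => [|n ih] b.
  rewrite expr0 mul1r.
  have E (x : 'rV[R]_0) : gauss x * cos (dotr b x) = gauss b.
    by rewrite /gauss /sqnormr /dotr !big_ord0 cos0 mulr1.
  under eq_Rintegral do rewrite E.
  transitivity (gauss b * fine (\d_(0 : 'rV[R]_0) [set: 'rV[R]_0] : \bar R)).
    exact: Rintegral_cst.
  by rewrite diracT mulr1.
pose b' := tail_rV b; pose b0 := b ord0 ord0.
have dE x : dotr b x = b0 * x ord0 ord0 + dotr b' (tail_rV x).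
  rewrite /dotr big_ord_recl; congr +%R.
  by apply: eq_bigr => i _; rewrite !tail_rVE.
have gE x : gauss x = g1 (x ord0 ord0) * gauss (tail_rV x).
  rewrite !gauss_prod big_ord_recl; congr *%R.
  by apply: eq_bigr => i _; rewrite tail_rVE.
have J1 : intg (@lebesgue_rV R n) (fun x => gauss x * cos (dotr b' x)).
  under eq_fun do rewrite mulrC.
  exact: intg_bndM (measurable_cosdot _) (fun x => cos_le1' _) intg_gauss.
have J2 : intg (@lebesgue_rV R n) (fun x => gauss x * sin (dotr b' x)).
  under eq_fun do rewrite mulrC.
  exact: intg_bndM (measurable_sindot _) (fun x => sin_le1' _) intg_gauss.
have J3 := @intg_Ic R b0.
have J4 : intg (@lebesgue_measure R) (fun t => g1 t * sin (b0 * t)).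
  have I8 := @intg_g1 R.
  apply: (@intg_le _ _ R (@lebesgue_measure R) (@g1 R)) => //.
    apply: measurable_funM; first exact: measurable_g1.
    apply: continuous_measurable_fun => t; apply: continuous_comp; last exact: continuous_sin.
    by apply: continuousM; [exact: cst_continuous|exact: cvg_id].
  by move=> t; rewrite normrM ger0_norm ?g1_ge0// ler_piMr ?g1_ge0// sin_le1'.
transitivity (\int[@lebesgue_rV R n.+1]_x
  ((g1 (x ord0 ord0) * cos (b0 * x ord0 ord0)) *
    (gauss (tail_rV x) * cos (dotr b' (tail_rV x))) -
   (g1 (x ord0 ord0) * sin (b0 * x ord0 ord0)) *
    (gauss (tail_rV x) * sin (dotr b' (tail_rV x))))).
  by apply: eq_Rintegral => x _; rewrite gE dE cosD; ring.
rewrite RintB; [|exact: (tensor_intg J3 J1)|exact: (tensor_intg J4 J2)].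
rewrite (Rint_tensor J3 J1) (Rint_tensor J4 J2) Rint_gauss_sin mulr0 subr0 ih.
rewrite -/(Ic b0) IcE exprS (gauss_prod b) big_ord_recl -/b0.
rewrite (gauss_prod b') -/(g1 b0).
under [in RHS]eq_bigr do rewrite -tail_rVE.
by rewrite mulrACA -exprS.
Qed.

(** * Gaussian coherent states *)

Section coherent_states.
Context {R : realType} {n : nat}.
Local Notation leb := (@lebesgue_rV R n).
Local Notation Rn := 'rV[R]_n.
Implicit Types (a b p x : Rn) (phi psi : Rn -> R[i]).
Local Notation cint := (cintegral leb).
Local Notation L2 := (L2 leb).
Local Notation ip := (@L2_ip _ _ R leb).

Lemma fnorm_sqrt : @fnorm R n * Num.sqrt (2 * pi) ^+ n = 1.
Proof.
have p0 : 0 < 2 * pi :> R by rewrite mulr_gt0// pi_gt0.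
have e0 : - (n%:R / 2) + 2^-1 * n%:R = 0 :> R by field.
rewrite /fnorm -powR12_sqrt ?ltW// -powR_mulrn ?powR_ge0// -powRrM -powRD.
  by rewrite e0 powRr0.
by rewrite e0 eqxx/= gt_eqF.
Qed.

Definition cgauss x : R[i] := (gauss x)%:C.

Lemma cintg_gauss : cintegrable leb cgauss.
Proof. by split; [exact: intg_gauss|exact: intg0]. Qed.

Lemma cint_gauss_cis b :
  cint (fun x => cis (dotr b x) * cgauss x) = (Num.sqrt (2 * pi) ^+ n * gauss b)%:C.
Proof.
apply: complexP => /=.
  rewrite -Rint_gauss_cos; apply: eq_Rintegral => x _; ring.
rewrite -[RHS](Rint_gauss_sin b); apply: eq_Rintegral => x _; ring.
Qed.

(** The Gaussian translated by [a] and modulated by [b]. The symmetric phase [- a.b / 2] is chosen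
    so that the Fourier transform acts as the rotation [(a, b) |-> (b, - a)] with no further
    phase. *)
Definition coh (ab : Rn * Rn) x : R[i] :=
  cis (dotr ab.2 x - dotr ab.1 ab.2 / 2) * cgauss (x - ab.1).

Lemma cohJ a b x : Num.conj (coh (a, b) x) = coh (a, - b) x.
Proof.
rewrite /coh conjcM cisJ; congr (cis _ * _); last by apply: complexP; rewrite !cE//= oppr0.
by rewrite /= dotrNl dotrNr; field.
Qed.

Lemma cintg_coh ab : cintegrable leb (coh ab).
Proof.
rewrite /coh; under eq_fun do rewrite cisD -mulrA.
apply: cintg_cisM; apply: cintgZ; exact: cintg_shift cintg_gauss.
Qed.

Lemma fourier_coh a b p : fourier (coh (a, b)) p = coh (b, - a) p.
Proof.
rewrite fourierE.
have E x : cis (- dotr p x) * coh (a, b) x =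
   cis (dotr a b / 2 - dotr p a) * (cis (dotr (b - p) (x - a)) * cgauss (x - a)).
  rewrite /coh !mulrA -!cisD; congr (cis _ * _).
  by rewrite /= !dotrDl !dotrDr !dotrNl !dotrNr (dotrC b a); field.
rewrite (eq_cint _ E) cintZ; last first.
  exact: (cintg_shift (- a) (cintg_cisM (b - p) cintg_gauss)).
rewrite (cint_shift (- a) (cintg_cisM (b - p) cintg_gauss)) cint_gauss_cis.
rewrite /coh /= mulrCA -rmorphM mulrA fnorm_sqrt mul1r.
have -> : cgauss (p - b) = (gauss (b - p))%:C by rewrite -gaussN opprB.
by congr (cis _ * _); rewrite !dotrNl !dotrNr (dotrC a p) (dotrC b a); field.
Qed.

Lemma cmeas_prodM phi psi : cmeasurable phi -> cmeasurable psi ->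
  cmeasurable (fun z : Rn * Rn => phi z.1 * psi z.2).
Proof.
move=> [a b] [a' b']; apply: (@cmeasM _ _ _ (fun z : Rn * Rn => phi z.1)
  (fun z : Rn * Rn => psi z.2)); split.
- exact: (measurableT_comp a measurable_fst).
- exact: (measurableT_comp b measurable_fst).
- exact: (measurableT_comp a' measurable_snd).
- exact: (measurableT_comp b' measurable_snd).
Qed.

Lemma measurable_dotr2 : measurable_fun setT (fun z : Rn * Rn => dotr z.2 z.1).
Proof.
apply: measurable_sum => i; apply: measurable_funM.
  by apply: (measurableT_comp (measurable_coor i)); exact: measurable_snd.
by apply: (measurableT_comp (measurable_coor i)); exact: measurable_fst.
Qed.

(** Fubini's theorem and the symmetry of the kernel [cis (- x.p)]. *)
Lemma fourier_mult phi psi : cintegrable leb phi -> cintegrable leb psi ->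
  cint (fun p => fourier phi p * psi p) = cint (fun x => phi x * fourier psi x).
Proof.
move=> I1 I2.
pose F (z : Rn * Rn) := cis (- dotr z.2 z.1) * (phi z.1 * psi z.2).
have mcis : cmeasurable (fun z : Rn * Rn => cis (- dotr z.2 z.1)).
  have m := measurable_funN measurable_dotr2.
  have mc : measurable_fun [set: R] (@cos R).
    by apply: continuous_measurable_fun; exact: continuous_cos.
  have ms : measurable_fun [set: R] (@sin R).
    by apply: continuous_measurable_fun; exact: continuous_sin.
  by split; [exact: (measurableT_comp mc m)|exact: (measurableT_comp ms m)].
have IF : cintegrable (leb \x leb)%E F.
  apply: (@cintg_le _ _ _ _ (fun z => nabs (phi z.1) * nabs (psi z.2))).
  - apply: cmeasM => //; exact: cmeas_prodM (cintg_meas I1) (cintg_meas I2).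
  - exact: (intg_prodM (intg_nabs I1) (intg_nabs I2)).
  - move=> z; rewrite /F !sqnormcM sqnormc_cis mul1r exprMn.
    by apply: ler_pM; rewrite ?sqnormc_ge0// sqnormc_nabs.
  - by move=> z; rewrite mulr_ge0 ?nabs_ge0.
have I3 p : cintegrable leb (fun x => cis (- dotr p x) * phi x).
  by under eq_fun do rewrite -dotrNl; exact: cintg_cisM.
have I4 x : cintegrable leb (fun p => cis (- dotr x p) * psi p).
  by under eq_fun do rewrite -dotrNl; exact: cintg_cisM.
transitivity (cint (fun p => cint (fun x => (@fnorm R n)%:C * F (x, p)))).
  apply: eq_cint => p; rewrite fourierE -mulrA [_ * psi p]mulrC -!cintZ//; last exact: cintgZ.
  by apply: eq_cint => x; rewrite /F/=; ring.
rewrite -(cint_fubini (f := fun z => (@fnorm R n)%:C * F z)); last exact: (cintgZ _ IF).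
apply: eq_cint => x; rewrite fourierE [RHS]mulrCA -(cintZ (phi x) (I4 x)).
rewrite -(cintZ _ (cintgZ (phi x) (I4 x))).
by apply: eq_cint => p; rewrite /F/= (dotrC p x); ring.
Qed.

Lemma cfourier_uniqueness phi : cintegrable leb phi ->
  (forall b, cint (fun x => cis (dotr b x) * phi x) = 0) -> {ae leb, forall x, phi x = 0}.
Proof.
move=> Ip p0; have [I1 I2] := Ip.
have Ic b (h : Rn -> R) (Ih : intg leb h) :=
  intg_bndM (measurable_cosdot b) (fun x => cos_le1' _) Ih.
have Is b (h : Rn -> R) (Ih : intg leb h) :=
  intg_bndM (measurable_sindot b) (fun x => sin_le1' _) Ih.
have reE b : \int[leb]_x (cos (dotr b x) * Re (phi x)) -
    \int[leb]_x (sin (dotr b x) * Im (phi x)) = 0.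
  rewrite -RintB; [|exact: Ic|exact: Is].
  transitivity (Re (cint (fun x => cis (dotr b x) * phi x))); last by rewrite p0.
  by apply: eq_Rintegral => x _; rewrite !cE0.
have imE b : \int[leb]_x (cos (dotr b x) * Im (phi x)) +
    \int[leb]_x (sin (dotr b x) * Re (phi x)) = 0.
  rewrite -RintD; [|exact: Ic|exact: Is].
  transitivity (Im (cint (fun x => cis (dotr b x) * phi x))); last by rewrite p0.
  by apply: eq_Rintegral => x _; rewrite !cE0.
have cN b (h : Rn -> R) : \int[leb]_x (cos (dotr (- b) x) * h x) =
    \int[leb]_x (cos (dotr b x) * h x).
  by apply: eq_Rintegral => x _; rewrite dotrNl cosN.
have sN b (h : Rn -> R) : intg leb h -> \int[leb]_x (sin (dotr (- b) x) * h x) =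
    - \int[leb]_x (sin (dotr b x) * h x).
  move=> Ih; rewrite -RintN; last exact: Is.
  by apply: eq_Rintegral => x _; rewrite dotrNl sinN mulNr.
have R0 : {ae leb, forall x, Re (phi x) = 0}.
  apply: fourier_uniqueness => // b.
    by have := reE b; have := reE (- b); rewrite cN sN//; lra.
  by have := imE b; have := imE (- b); rewrite cN sN//; lra.
have M0 : {ae leb, forall x, Im (phi x) = 0}.
  apply: fourier_uniqueness => // b.
    by have := imE b; have := imE (- b); rewrite cN sN//; lra.
  by have := reE b; have := reE (- b); rewrite cN sN//; lra.
by apply: filterS2 R0 M0 => x a b; exact: complexP.
Qed.

Lemma sqi_bnd phi (C : R) : 0 <= C -> (forall x, sqnormc (phi x) <= C ^+ 2) ->
  cintegrable leb phi -> sqi leb phi.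
Proof.
move=> C0 pC Ip; apply: (@sqi_le _ _ _ _ (fun x => C * nabs (phi x))).
- exact: (cintg_meas Ip).
- by apply: intgZ; exact: intg_nabs.
- move=> x; have := pC x; have := sqnormc_nabs (phi x); have := sqnormc_ge0 (phi x).
  have := nabs_ge0 (phi x); set s := sqnormc _; set t := nabs _ => t0 s0 st sC.
  have : s ^+ 2 <= (C * t) ^+ 2 by rewrite exprMn expr2; apply: ler_pM.
  by rewrite ler_sqr// nnegrE mulr_ge0.
Qed.

Lemma sqnormc_coh ab x : sqnormc (coh ab x) = gauss (x - ab.1) ^+ 2.
Proof. by rewrite /coh sqnormcM sqnormc_cis mul1r sqnormcR. Qed.

Lemma sqi_coh ab : sqi leb (coh ab).
Proof.
apply: (@sqi_bnd _ 1) => //; last exact: cintg_coh.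
move=> x; rewrite sqnormc_coh.
by have := gauss_gt0 (x - ab.1); have := gauss_le1 (x - ab.1); nra.
Qed.

Definition Coh ab : L2 := mkL2 leb (coh ab).
Definition rot90 (ab : Rn * Rn) : Rn * Rn := (ab.2, - ab.1).

Lemma coh_uniqueness (w : Rn -> R[i]) : cintegrable leb (fun x => cgauss x * w x) ->
  (forall b, cint (fun x => coh (0, b) x * w x) = 0) -> {ae leb, forall x, w x = 0}.
Proof.
move=> Iw w0.
have g0 b x : coh (0, b) x = cis (dotr b x) * cgauss x.
  by rewrite /coh /= dotr0l mul0r !subr0.
have H b : cint (fun x => cis (dotr b x) * (cgauss x * w x)) = 0.
  by rewrite -(w0 b); apply: eq_cint => x; rewrite g0 mulrA.
have := cfourier_uniqueness Iw H; apply: filterS => x /eqP; rewrite mulf_eq0 => /orP[|/eqP//].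
by rewrite /cgauss eq_complex/= gt_eqF ?gauss_gt0.
Qed.

(** The states with [a = 0] suffice: orthogonality to them says that the Gaussian times [u] has zero
    Fourier transform. *)
Lemma Coh_total : htotal (ip := ip) Coh.
Proof.
move=> u hu; apply: L2_ext.
have Iw : cintegrable leb (fun x => cgauss x * L2_fun u x).
  apply: sqiM; last exact: L2_sqi.
  have := sqi_coh (0, 0); congr sqi; apply/funext => x.
  by rewrite /coh /= !dotr0l mul0r !subr0 cis0 mul1r.
have H b : cint (fun x => coh (0, b) x * L2_fun u x) = 0.
  rewrite -(hu (0, - b)) (ip_fun (sqi_coh (0, - b)) (L2_sqi u))//.
  - by apply: eq_cint => x; rewrite cohJ opprK.
  - exact: mkL2_ae (sqi_coh _).
  - exact: nearW.
have h := coh_uniqueness Iw H; have := L2_fun0 leb.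
by apply: filterS2 h => x -> ->.
Qed.

(** The conjugate of [coh (a, b)] is the Fourier transform of [coh (b, a)], and the multiplication
    formula moves that transform to the other factor. *)
Lemma Coh_gram ab cd : ip (Coh ab) (Coh cd) = ip (Coh (rot90 ab)) (Coh (rot90 cd)).
Proof.
case: ab => a b; case: cd => c e.
apply: (etrans (ip_mk (sqi_coh (a, b)) (sqi_coh (c, e)))).
apply: (etrans _ (esym (ip_mk (sqi_coh (rot90 (a, b))) (sqi_coh (rot90 (c, e)))))).
transitivity (cint (fun x => fourier (coh (b, a)) x * coh (c, e) x)).
  by apply: eq_cint => x; rewrite cohJ fourier_coh.
rewrite fourier_mult; [|exact: cintg_coh..].
by apply: eq_cint => x; rewrite /rot90/= cohJ opprK fourier_coh.
Qed.

End coherent_states.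

(** * The Fourier transform as an isometry of L^2 *)

Section plancherel.
Context {R : realType} {n : nat}.
Local Notation leb := (@lebesgue_rV R n).
Local Notation Rn := 'rV[R]_n.
Implicit Types (a b p x : Rn) (phi psi : Rn -> R[i]).
Local Notation cint := (cintegral leb).
Local Notation L2 := (L2 leb).
Local Notation ip := (@L2_ip _ _ R leb).
Local Notation n2 := (nrm2 ip).
Implicit Types u v w : L2.
Let hil : is_hilbert ip := @L2_hilbert _ _ R leb.

Definition FF_spec (U : L2 -> L2) :=
  [/\ forall c u v, U (c *: u + v) = c *: U u + U v,
      forall u v, ip (U u) (U v) = ip u v,
      forall ab, U (Coh ab) = Coh (rot90 ab) & forall v, exists u, U u = v].

Lemma rot90_total : htotal (ip := ip) (fun ab : Rn * Rn => Coh (rot90 ab)).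
Proof.
move=> u hu; apply: (@Coh_total R n) => -[a b].
by have := hu (- b, a); rewrite /rot90/= opprK.
Qed.

Lemma FF_ex : exists U, FF_spec U.
Proof. exact: (unitary_extension hil (@Coh_gram R n) (@Coh_total R n) rot90_total). Qed.

(** An isometry of classes fixed by its values on coherent states; that it is the integral transform
    on integrable functions is [FF_fourier]. *)
Definition FF : L2 -> L2 := sval (cid FF_ex).

Let FFP : FF_spec FF. Proof. exact: svalP (cid FF_ex). Qed.

Lemma FF_lin c u v : FF (c *: u + v) = c *: FF u + FF v. Proof. by case: FFP. Qed.
Lemma FF_ip u v : ip (FF u) (FF v) = ip u v. Proof. by case: FFP. Qed.
Lemma FF_Coh ab : FF (Coh ab) = Coh (rot90 ab). Proof. by case: FFP. Qed.

Lemma FF_D u v : FF (u + v) = FF u + FF v.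
Proof. by have := FF_lin 1 u v; rewrite !scale1r. Qed.
Lemma FF_0 : FF 0 = 0.
Proof. by have /eqP := FF_D 0 0; rewrite addr0 -subr_eq0 opprD addrA subrr sub0r oppr_eq0 => /eqP. Qed.
Lemma FF_Z c u : FF (c *: u) = c *: FF u.
Proof. by have := FF_lin c u 0; rewrite FF_0 !addr0. Qed.
Lemma FF_B u v : FF (u - v) = FF u - FF v.
Proof. by rewrite FF_D -scaleN1r FF_Z scaleN1r. Qed.
Lemma FF_n2 u : n2 (FF u) = n2 u. Proof. by rewrite /nrm2 FF_ip. Qed.
Lemma FF_inj u v : FF u = FF v -> u = v.
Proof.
move=> uv; apply/eqP; rewrite -subr_eq0; apply/eqP/(nrm2_eq0 hil).
by rewrite -FF_n2 FF_B uv subrr (nrm2_0 hil).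
Qed.

Definition cj u : L2 := mkL2 leb (fun x => Num.conj (L2_fun u x)).

Lemma sqi_cj u : sqi leb (fun x => Num.conj (L2_fun u x)).
Proof. exact: (sqiJ (L2_sqi u)). Qed.

Lemma cj_fun u : {ae leb, forall x, L2_fun (cj u) x = Num.conj (L2_fun u x)}.
Proof. exact: mkL2_ae (sqi_cj u). Qed.

Lemma conjcK2 (z : R[i]) : Num.conj (Num.conj z) = z.
Proof. by apply: complexP; rewrite !cE ?opprK. Qed.

Lemma cj_mk phi : sqi leb phi -> cj (mkL2 leb phi) = mkL2 leb (fun x => Num.conj (phi x)).
Proof.
move=> sp; apply: mkL2_eq; [exact: sqi_cj|exact: (sqiJ sp)|].
by apply: filterS (mkL2_ae sp) => x ->.
Qed.

Lemma cjK u : cj (cj u) = u.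
Proof.
by rewrite [LHS](cj_mk (sqi_cj u)) -[RHS]L2_funK; congr mkL2; apply/funext => x; rewrite conjcK2.
Qed.

Lemma ip_cj u v : ip (cj u) (cj v) = Num.conj (ip u v).
Proof.
apply: (etrans (ip_mk (sqi_cj u) (sqi_cj v))).
have I1 : cintegrable leb (fun x => Num.conj (L2_fun u x) * L2_fun v x).
  exact: (sqiM (sqi_cj u) (L2_sqi v)).
apply: (etrans _ (cintJ I1)); apply: eq_cint => x.
by apply: complexP; rewrite !cE; ring.
Qed.

Lemma cj_Coh a b : cj (Coh (a, b)) = Coh (a, - b).
Proof.
by rewrite [LHS](cj_mk (sqi_coh _)); congr mkL2; apply/funext => x; rewrite cohJ.
Qed.

(** Conjugation by [cj] inverts [FF]. On coherent states this is explicit, and products with them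
    determine a vector by totality. *)
Lemma FFcj u : FF (cj (FF (cj u))) = u.
Proof.
apply/eqP; rewrite -subr_eq0; apply/eqP/(@Coh_total R n) => -[a b].
rewrite (ipDr hil) (ipNr hil); apply/eqP; rewrite subr_eq0; apply/eqP.
have E : Coh (a, b) = FF (cj (FF (cj (Coh (a, b))))).
  by rewrite cj_Coh FF_Coh /rot90/= cj_Coh FF_Coh /rot90/= !opprK.
by rewrite {1}E FF_ip ip_cj FF_ip ip_cj conjcK2.
Qed.

Lemma cjFF u : cj (FF (cj (FF u))) = u.
Proof. by apply: FF_inj; rewrite FFcj. Qed.

(** The pairing without conjugation, for which [FF] is symmetric ([bil_FF]) just as the integral
    transform is in [fourier_mult]. *)
Definition bil u v : R[i] := cint (fun x => L2_fun u x * L2_fun v x).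

Lemma bil_ip u v : bil u v = ip (cj u) v.
Proof.
apply: esym; apply: (etrans (ip_fun (sqi_cj u) (L2_sqi v) (cj_fun u) _)).
  exact: nearW.
by apply: eq_cint => x; rewrite conjcK2.
Qed.

Lemma bil_FF u v : bil u (FF v) = bil (FF u) v.
Proof.
rewrite !bil_ip -[v in RHS]cjFF ip_cj FF_ip.
by rewrite -{1}(cjK (FF v)) ip_cj.
Qed.

Lemma bil_fun u v phi psi : sqi leb phi -> sqi leb psi ->
  {ae leb, forall x, L2_fun u x = phi x} -> {ae leb, forall x, L2_fun v x = psi x} ->
  bil u v = cint (fun x => phi x * psi x).
Proof.
move=> sp sq up vq; apply: cint_ae.
- exact: (cmeasM (L2_sqi u).1 (L2_sqi v).1).
- exact: (cmeasM sp.1 sq.1).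
- by apply: filterS2 up vq => x -> ->.
Qed.

Lemma nabs_cint phi : cintegrable leb phi -> nabs (cint phi) <= 2 * \int[leb]_x nabs (phi x).
Proof.
move=> Ip; have In := intg_nabs Ip; have [I1 I2] := Ip.
have h1 : `|Re (cint phi)| <= \int[leb]_x nabs (phi x).
  apply: le_trans (Rint_norm I1) _; apply: le_Rint => //; first exact: intg_norm.
  by move=> x; rewrite lerDl.
have h2 : `|Im (cint phi)| <= \int[leb]_x nabs (phi x).
  apply: le_trans (Rint_norm I2) _; apply: le_Rint => //; first exact: intg_norm.
  by move=> x; rewrite lerDr.
by rewrite /nabs; lra.
Qed.

Lemma nabsM_le (z w : R[i]) : nabs (z * w) <= nabs z * nabs w.
Proof.
rewrite /nabs !cE0.
have := ler_normB (Re z * Re w) (Im z * Im w).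
have := ler_normD (Re z * Im w) (Im z * Re w).
by rewrite !normrM; lra.
Qed.

Lemma nabs_cis (t : R) : nabs (cis t) <= 2.
Proof.
rewrite /nabs/=; have := cos_le1' t; have := sin_le1' t; lra.
Qed.

Lemma nabs_real (t : R) : nabs t%:C = `|t|.
Proof. by rewrite /nabs/= normr0 addr0. Qed.

Lemma fnorm_ge0 : 0 <= @fnorm R n. Proof. exact: powR_ge0. Qed.

Lemma nabs_fourier phi p : cintegrable leb phi ->
  nabs (fourier phi p) <= @fnorm R n * (4 * \int[leb]_x nabs (phi x)).
Proof.
move=> Ip; rewrite fourierE; apply: le_trans (nabsM_le _ _) _.
rewrite nabs_real ger0_norm ?fnorm_ge0//; apply: ler_wpM2l; first exact: fnorm_ge0.
have I1 : cintegrable leb (fun x => cis (- dotr p x) * phi x).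
  by under eq_fun do rewrite -dotrNl; exact: cintg_cisM.
apply: le_trans (nabs_cint I1) _.
rewrite (_ : 4 = 2 * 2 :> R); last by ring.
rewrite -mulrA; apply: ler_wpM2l => //; rewrite -RintZ; last exact: intg_nabs.
apply: le_Rint; [exact: intg_nabs|by apply: intgZ; exact: intg_nabs|].
move=> x; apply: le_trans (nabsM_le _ _) _.
by apply: ler_wpM2r; [exact: nabs_ge0|exact: nabs_cis].
Qed.

(** The integrand need not be integrable in [p]; a Gaussian in [p] makes it integrable on the
    product, Fubini's theorem gives measurability, and the Gaussian is divided out. *)
Lemma cmeas_fourier phi : cintegrable leb phi -> cmeasurable (fourier phi).
Proof.
move=> Ip.
pose F (z : Rn * Rn) := cis (- dotr z.1 z.2) * (cgauss z.1 * phi z.2).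
have mcis : cmeasurable (fun z : Rn * Rn => cis (- dotr z.1 z.2)).
  have m := measurable_funN (@measurable_dotr2 R n).
  have mc : measurable_fun [set: R] (@cos R).
    by apply: continuous_measurable_fun; exact: continuous_cos.
  have ms : measurable_fun [set: R] (@sin R).
    by apply: continuous_measurable_fun; exact: continuous_sin.
  under eq_fun do rewrite dotrC.
  by split; [exact: (measurableT_comp mc m)|exact: (measurableT_comp ms m)].
have IF : cintegrable (leb \x leb)%E F.
  apply: (@cintg_le _ _ _ _ (fun z => nabs (@cgauss R n z.1) * nabs (phi z.2))).
  - apply: cmeasM => //; exact: cmeas_prodM (cintg_meas cintg_gauss) (cintg_meas Ip).
  - exact: (intg_prodM (intg_nabs cintg_gauss) (intg_nabs Ip)).
  - move=> z; rewrite /F !sqnormcM sqnormc_cis mul1r exprMn.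
    by apply: ler_pM; rewrite ?sqnormc_ge0// sqnormc_nabs.
  - by move=> z; rewrite mulr_ge0 ?nabs_ge0.
have I3 p : cintegrable leb (fun x => cis (- dotr p x) * phi x).
  by under eq_fun do rewrite -dotrNl; exact: cintg_cisM.
pose K p := cint (fun x => F (p, x)).
have mK : cmeasurable K.
  case: IF => I1 I2; split.
    exact: (measurableT_comp (f := fine) _ (measurable_fubini_F I1)).
  exact: (measurableT_comp (f := fine) _ (measurable_fubini_F I2)).
have KE p : K p = cgauss p * cint (fun x => cis (- dotr p x) * phi x).
  rewrite -cintZ//; apply: eq_cint => x; rewrite /F/=; ring.
have -> : fourier phi = (fun p => (@fnorm R n * (gauss p)^-1)%:C * K p).
  apply/funext => p; rewrite fourierE KE rmorphM -mulrA; congr (_ * _).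
  rewrite mulrA -[LHS]mul1r; congr (_ * _).
  by rewrite /cgauss -rmorphM mulVf// gt_eqF ?gauss_gt0.
apply: cmeasM => //; apply: cmeasR; apply: measurable_funM => //.
rewrite (_ : (fun p => _) = (fun p => expR (sqnormr p / 2))); last first.
  by apply/funext => p; rewrite /gauss expRN invrK.
apply: measurableT_comp => //; apply: measurable_funM => //.
apply: measurable_sum => i; apply: measurable_funM; exact: measurable_coor.
Qed.

(** Both sides have the same pairings with the states [coh (0, b)], by [bil_FF] on one side and
    [fourier_mult] on the other, so [coh_uniqueness] applies. *)
Lemma FF_fourier phi : cintegrable leb phi -> sqi leb phi ->
  {ae leb, forall p, L2_fun (FF (mkL2 leb phi)) p = fourier phi p}.
Proof.
move=> Ip sp.
have mf := cmeas_fourier Ip.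
set w := FF (mkL2 leb phi).
have gE b x : coh (0, b) x = cis (dotr b x) * cgauss x.
  by rewrite /coh /= dotr0l mul0r !subr0.
have sg : sqi leb (@cgauss R n).
  have := sqi_coh (0 : Rn, 0); congr sqi; apply/funext => x.
  by rewrite gE dotr0l cis0 mul1r.
have I1 (b : Rn) : cintegrable leb (fun x => coh (0, b) x * L2_fun w x).
  by apply: (sqiM (sqi_coh _)); exact: L2_sqi.
pose C := @fnorm R n * (4 * \int[leb]_x nabs (phi x)).
have C0 : 0 <= C.
  by rewrite !mulr_ge0 ?fnorm_ge0//; apply: Rint_ge0 => x; exact: nabs_ge0.
have bC p : sqnormc (fourier phi p) <= C ^+ 2.
  apply: le_trans (sqnormc_nabs _) _.
  by rewrite ler_sqr ?nnegrE ?nabs_ge0// nabs_fourier.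
have I2 b : cintegrable leb (fun x => coh (0, b) x * fourier phi x).
  under eq_fun do rewrite mulrC.
  exact: (cintg_bndM mf C0 bC (cintg_coh _)).
have Ig : cintegrable leb (fun x => cgauss x * (L2_fun w x - fourier phi x)).
  under eq_fun do rewrite mulrBr -mulN1r.
  apply: cintgD; first exact: (sqiM sg (L2_sqi w)).
  apply: cintgZ; under eq_fun do rewrite mulrC.
  exact: (cintg_bndM mf C0 bC cintg_gauss).
have := coh_uniqueness Ig.
have -> : (forall b, cint (fun x => coh (0, b) x * (L2_fun w x - fourier phi x)) = 0) = True.
  apply/propext; split => // _ b.
  transitivity (cint (fun x => coh (0, b) x * L2_fun w x + (-1) * (coh (0, b) x * fourier phi x))).
    by apply: eq_cint => x; ring.
  rewrite (cintD (I1 b) (cintgZ (-1) (I2 b))) (cintZ (-1) (I2 b)).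
  have -> : cint (fun x => coh (0, b) x * L2_fun w x) = bil (Coh (0, b)) w.
    apply: esym; apply: (bil_fun (sqi_coh _) (L2_sqi w) (mkL2_ae (sqi_coh _))); exact: nearW.
  rewrite bil_FF FF_Coh (bil_fun (sqi_coh _) sp (mkL2_ae (sqi_coh _)) (mkL2_ae sp)).
  rewrite -(fourier_mult (cintg_coh (0, b)) Ip).
  have -> : cint (fun p => fourier (coh (0, b)) p * phi p) = cint (fun x => coh (rot90 (0, b)) x * phi x).
    by apply: eq_cint => x; rewrite fourier_coh.
  by rewrite mulN1r subrr.
move=> /(_ I); apply: filterS => x /eqP; rewrite subr_eq0 => /eqP ->.
by [].
Qed.

Lemma sqi_fourier phi : cintegrable leb phi -> sqi leb phi -> sqi leb (fourier phi).
Proof.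
move=> Ip sp; apply: sqi_ae (FF_fourier Ip sp) (L2_sqi _).
exact: cmeas_fourier.
Qed.

Lemma FF_mk phi : cintegrable leb phi -> sqi leb phi ->
  FF (mkL2 leb phi) = mkL2 leb (fourier phi).
Proof.
move=> Ip sp; rewrite -[LHS]L2_funK; apply: mkL2_eq.
- exact: L2_sqi.
- exact: sqi_fourier.
- exact: FF_fourier.
Qed.

End plancherel.

Section weights.
Context {R : realType}.
Local Notation leb1 := (@lebesgue_measure R).

Lemma intg_lorentz : intg leb1 (fun t : R => (1 + t ^+ 2)^-1).
Proof.
have p0 (t : R) : 0 <= (1 + t ^+ 2)^-1 by rewrite invr_ge0 addr_ge0// sqr_ge0.
have ct : continuous (fun t : R => (1 + t ^+ 2)^-1) := @continuous_oneDsqrV R.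
apply/intg_lty => //; first exact: continuous_measurable_fun.
rewrite (ge0_symfun_integralT p0 ct); last by move=> t /=; rewrite sqrrN.
have -> : [set x : R | (0 <= x)%R] = `[0, +oo[%classic.
  by apply/seteqP; split => x /=; rewrite in_itv/= andbT.
have := @integral0y_oneDsqr R; rewrite /oneDsqr => ->.
by rewrite -EFinM ltry.
Qed.

Variable n : nat.
Local Notation leb := (@lebesgue_rV R n).
Local Notation Rn := 'rV[R]_n.

(** An integrable envelope in product form, so that its integral factorises; it dominates
    [(1 + |x|^2)^{-n}]. *)
Definition lorentz (x : Rn) : R := \prod_i (1 + (x ord0 i) ^+ 2)^-1.

Lemma intg_lorentzn : intg leb lorentz.
Proof. exact: (intg_prod (fun _ => intg_lorentz)).1. Qed.

Lemma lorentz_ge0 x : 0 <= lorentz x.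
Proof. by apply: prodr_ge0 => i _; rewrite invr_ge0 addr_ge0// sqr_ge0. Qed.

Lemma lorentz_le1 x : lorentz x <= 1.
Proof.
apply: prodr_ile1 => i _; have := sqr_ge0 (x ord0 i) => h.
rewrite invr_ge0 invf_le1 ?lerDl//; last by lra.
by rewrite addr_ge0//=; lra.
Qed.

Lemma sqr_coor_le (x : Rn) i : (x ord0 i) ^+ 2 <= sqnormr x.
Proof.
rewrite /sqnormr /dotr (bigD1 i)//= -expr2 lerDl.
by apply: sumr_ge0 => j _; exact: sqr_ge0.
Qed.

Lemma lorentz_bound (x : Rn) : ((1 + sqnormr x) ^+ n)^-1 <= lorentz x.
Proof.
rewrite /lorentz -exprVn -[X in _ ^+ X]card_ord -prodr_const.
apply: ler_prod => i _; have := sqnormr_ge0 x => h; rewrite invr_ge0 addr_ge0//=.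
rewrite lef_pV2 ?posrE ?ltr_pwDl ?sqr_ge0//.
by rewrite lerD2l sqr_coor_le.
Qed.

End weights.

(** * Difference quotients in Fourier space *)

Section sobolev_one.
Context {R : realType} {n : nat}.
Local Notation leb := (@lebesgue_rV R n).
Local Notation Rn := 'rV[R]_n.
Implicit Types (phi psi : Rn -> R[i]) (p x : Rn).
Local Notation cint := (cintegral leb).

Lemma plancherel phi : cintegrable leb phi -> sqi leb phi ->
  \int[leb]_p sqnormc (fourier phi p) = \int[leb]_x sqnormc (phi x).
Proof.
move=> Ip sp; rewrite -(nrm2_mk sp) -FF_n2 FF_mk// nrm2_mk//.
exact: sqi_fourier.
Qed.

Lemma fourier_shift phi (a p : Rn) : cintegrable leb phi ->
  fourier (fun x => phi (x + a)) p = cis (dotr p a) * fourier phi p.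
Proof.
move=> Ip; have I1 : cintegrable leb (fun x => cis (- dotr p x) * phi x).
  by under eq_fun do rewrite -dotrNl; exact: cintg_cisM.
rewrite !fourierE [RHS]mulrCA; congr (_ * _).
rewrite -(cint_shift a I1) -cintZ; last exact: (cintg_shift a I1).
apply: eq_cint => x; rewrite mulrA -cisD; congr (cis _ * _).
by rewrite dotrDr; ring.
Qed.

Lemma fourierB phi psi p : cintegrable leb phi -> cintegrable leb psi ->
  fourier (fun x => phi x - psi x) p = fourier phi p - fourier psi p.
Proof.
move=> I1 I2.
have J1 : cintegrable leb (fun x => cis (- dotr p x) * phi x).
  by under eq_fun do rewrite -dotrNl; exact: cintg_cisM.
have J2 : cintegrable leb (fun x => cis (- dotr p x) * psi x).
  by under eq_fun do rewrite -dotrNl; exact: cintg_cisM.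
rewrite !fourierE -mulrBr; congr (_ * _).
rewrite -[- cint _]mulN1r -(cintZ (-1) J2) -cintD//; last exact: cintgZ.
by apply: eq_cint => x; rewrite mulrBr mulN1r.
Qed.

Lemma sin_div_cvg : (h^-1 * sin h) @[h --> (0 : R)^'] --> (1 : R).
Proof.
have [D E] := @is_derive_sin R 0.
move: D; rewrite /derivable -[lim _]/('D_1 sin 0) E cos0.
apply: cvg_trans; apply: near_eq_cvg; apply: nearW => h /=.
by rewrite sin0 subr0 addr0 /GRing.scale/= mulr1.
Qed.

Lemma cis_diff_cvg (t : R) :
  (m.+1%:R ^+ 2 * sqnormc (cis (m.+1%:R^-1 * t) - 1)) @[m --> \oo] --> t ^+ 2.
Proof.
have E (m : nat) : m.+1%:R ^+ 2 * sqnormc (cis (m.+1%:R^-1 * t) - 1) =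
    (2 * m.+1%:R * sin (m.+1%:R^-1 * (t / 2))) ^+ 2.
  (* Half angles: [|cis (2 s) - 1|^2 = 4 sin^2 s]. *)
  have -> : m.+1%:R^-1 * t = m.+1%:R^-1 * (t / 2) + m.+1%:R^-1 * (t / 2) by field.
  set s := m.+1%:R^-1 * (t / 2).
  rewrite /sqnormc !cE0 /= cosD sinD; have := cos2Dsin2 s.
  set c := cos s; set u := sin s => cu.
  have cE : c ^+ 2 = 1 - u ^+ 2 by lra.
  rewrite (_ : c * c = 1 - u ^+ 2); last by rewrite -expr2.
  have -> : (u * c + c * u + - 0) ^+ 2 = 4 * u ^+ 2 * c ^+ 2 by ring.
  by rewrite cE; ring.
under eq_fun do rewrite E.
suff h : (2 * m.+1%:R * sin (m.+1%:R^-1 * (t / 2))) @[m --> \oo] --> t.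
  by rewrite expr2; under eq_fun do rewrite expr2; exact: (cvgM h h).
have [->|t0] := eqVneq t 0.
  rewrite (_ : (fun m : nat => _) = cst 0); first exact: cvg_cst.
  by apply/funext => m; rewrite mul0r mulr0 sin0 mulr0.
pose u (m : nat) := m.+1%:R^-1 * (t / 2).
have u0 m : u m != 0 by rewrite !mulf_neq0// invr_eq0.
have uc : u @ \oo --> 0.
  rewrite -(mul0r (t / 2)); apply: cvgM; [exact: cvg_harmonic|exact: cvg_cst].
have := (cvgr_dnbhsP _ _ _).1 sin_div_cvg u (conj u0 uc).
move=> h; have h2 : (t * ((u m)^-1 * sin (u m))) @[m --> \oo] --> t * 1.
  by apply: cvgM; [exact: cvg_cst|exact: h].
move: h2; rewrite mulr1; apply: cvg_trans.
apply: near_eq_cvg; apply: nearW => m /=; rewrite -/(u m) mulrA; congr (_ * _).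
rewrite /u; have : m.+1%:R != 0 :> R by rewrite pnatr_eq0.
set k := m.+1%:R => k0; field; exact/andP.
Qed.

(** Difference quotients replace derivatives: a translation multiplies the transform by
    [cis (t p_j)], Plancherel bounds the quotients by the integral of [env], and Fatou's lemma lets
    [t -> 0]. Lipschitz functions such as the cutoff are covered without integration by parts. *)
Lemma fourier_H1 phi (j : 'I_n) (env : Rn -> R) : cintegrable leb phi -> sqi leb phi ->
  intg leb env ->
  (forall t x, 0 < t -> t <= 1 ->
    sqnormc (phi (x + t *: delta_mx ord0 j) - phi x) <= t ^+ 2 * env x) ->
  intg leb (fun p => (p ord0 j) ^+ 2 * sqnormc (fourier phi p)) /\
  \int[leb]_p ((p ord0 j) ^+ 2 * sqnormc (fourier phi p)) <= \int[leb]_x env x.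
Proof.
move=> Ip sp Ie pe.
have mF := cmeas_fourier Ip; have sF := sqi_fourier Ip sp.
pose e : Rn := delta_mx ord0 j.
pose f (m : nat) p := m.+1%:R ^+ 2 * sqnormc (cis (m.+1%:R^-1 * p ord0 j) - 1) *
  sqnormc (fourier phi p).
have key (m : nat) : intg leb (f m) /\ \int[leb]_p f m p <= \int[leb]_x env x.
  pose t : R := m.+1%:R^-1.
  have t0 : 0 < t by rewrite invr_gt0.
  have t1 : t <= 1 by rewrite invf_le1// ler1n.
  have Is := cintg_shift (t *: e) Ip.
  pose psi x := phi (x + t *: e) - phi x.
  have Ipsi : cintegrable leb psi.
    rewrite /psi; under eq_fun do rewrite -mulN1r; apply: cintgD => //; exact: cintgZ.
  have spsi : sqi leb psi.
    apply: (@sqi_le _ _ _ _ (fun x => t ^+ 2 * env x)).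
    - exact: cintg_meas Ipsi.
    - exact: intgZ.
    - by move=> x; exact: pe.
  have fE p : sqnormc (fourier psi p) =
      sqnormc (cis (m.+1%:R^-1 * p ord0 j) - 1) * sqnormc (fourier phi p).
    rewrite fourierB// fourier_shift// -sqnormcM; congr sqnormc.
    by rewrite dotrZr dotrC dotr_delta mulrBl mul1r.
  have fE' p : f m p = m.+1%:R ^+ 2 * sqnormc (fourier psi p).
    by rewrite fE mulrA.
  have Iq : intg leb (fun p => sqnormc (fourier psi p)) by exact: (sqi_fourier Ipsi spsi).2.
  have fm : f m = (fun p => m.+1%:R ^+ 2 * sqnormc (fourier psi p)) by apply/funext.
  split; first by rewrite fm; exact: (intgZ _ Iq).
  rewrite fm RintZ// plancherel//.
  have : \int[leb]_x sqnormc (psi x) <= \int[leb]_x (t ^+ 2 * env x).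
    apply: le_Rint; [exact: spsi.2|exact: intgZ|by move=> x; exact: pe].
  rewrite RintZ// => /(ler_wpM2l (sqr_ge0 (m.+1%:R : R))) h; apply: (le_trans h).
  by rewrite mulrA -exprMn /t divff ?pnatr_eq0// expr1n mul1r.
have lim p : (f m p) @[m --> \oo] --> (p ord0 j) ^+ 2 * sqnormc (fourier phi p).
  by apply: cvgM; [exact: cis_diff_cvg|exact: cvg_cst].
have H : [/\ {ae leb, forall p, 0 <= (p ord0 j) ^+ 2 * sqnormc (fourier phi p)},
    intg leb (fun p => (p ord0 j) ^+ 2 * sqnormc (fourier phi p)) &
    \int[leb]_p ((p ord0 j) ^+ 2 * sqnormc (fourier phi p)) <= \int[leb]_x env x].
  apply: (@fatou_le _ _ _ _ f).
  - by move=> m; exact: intg_meas (key m).1.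
  - apply: measurable_funM; last exact: meas_sqnormc.
    exact: measurable_funX (measurable_coor j).
  - by move=> m p; rewrite mulr_ge0// ?sqnormc_ge0// mulr_ge0// ?sqnormc_ge0// sqr_ge0.
  - by apply: nearW => p; exact: lim.
  - by exists 0%N => m _; rewrite RintE ?lee_fin; have [] := key m.
by case: H.
Qed.

End sobolev_one.

(** * Test functions and Sobolev classes *)

Section h1_class.
Context {R : realType} {n : nat}.
Local Notation leb := (@lebesgue_rV R n).
Local Notation Rn := 'rV[R]_n.
Implicit Types (phi psi : Rn -> R[i]) (p x y : Rn).

Definition w1 p : R := 1 + sqnormr p.

Lemma w1_ge1 p : 1 <= w1 p. Proof. by rewrite lerDl sqnormr_ge0. Qed.

Lemma w1_gt0 p : 0 < w1 p. Proof. exact: lt_le_trans (w1_ge1 p). Qed.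

Lemma sqnormrB_le x y : sqnormr (x + y) <= 2 * sqnormr x + 2 * sqnormr y.
Proof.
have := sqnormr_ge0 (x - y); rewrite !sqnormrD sqnormrN dotrNr; lra.
Qed.

Lemma peetre x y : w1 (x + y) <= 2 * w1 x * w1 y.
Proof.
have := sqnormrB_le x y; have := sqnormr_ge0 x; have := sqnormr_ge0 y.
by rewrite /w1; nra.
Qed.

Lemma measurable_sqnormr : measurable_fun setT (@sqnormr R n).
Proof.
by apply: measurable_sum => i; apply: measurable_funM; exact: measurable_coor.
Qed.

Lemma measurable_w1 : measurable_fun setT w1.
Proof. by apply: measurable_funD; [exact: measurable_cst|exact: measurable_sqnormr]. Qed.

Lemma sqnormr_delta (j : 'I_n) (t : R) : sqnormr (t *: delta_mx ord0 j) = t ^+ 2.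
Proof. by rewrite /sqnormr dotrZl dotrZr dotr_delta mxE !eqxx/=; ring. Qed.

(** A pointwise substitute for [H^1] with decay. It contains Schwartz functions, test functions and
    the cutoff times exponentials or powers of linear forms; the explicit [C] is what makes pairings
    continuous later. *)
Record h1 phi (C : R) : Prop := H1 {
  h1_meas : cmeasurable phi;
  h1_bnd : forall x, sqnormc (phi x) <= C * lorentz x ^+ 2;
  h1_lip : forall (j : 'I_n) t x, 0 < t -> t <= 1 ->
    sqnormc (phi (x + t *: delta_mx ord0 j) - phi x) <= t ^+ 2 * (C * lorentz x ^+ 2) }.

Lemma measurable_lorentz : measurable_fun setT (@lorentz R n).
Proof. apply: intg_meas; exact: intg_lorentzn. Qed.

Lemma intg_lorentz2 : intg leb (fun x => lorentz x ^+ 2).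
Proof.
apply: (intg_le (g := @lorentz R n)); last exact: intg_lorentzn.
  exact: measurable_funX measurable_lorentz.
move=> x; have := lorentz_ge0 x; have := lorentz_le1 x => a b.
by rewrite ger0_norm ?sqr_ge0// expr2 ler_piMr.
Qed.

Lemma lorentz_gt0 x : 0 < lorentz x.
Proof. by apply: prodr_gt0 => i _; rewrite invr_gt0 ltr_pwDl// sqr_ge0. Qed.

Lemma h1_C0 phi C : h1 phi C -> 0 <= C.
Proof.
move=> h; have := le_trans (sqnormc_ge0 _) (h1_bnd h 0).
by rewrite pmulr_lge0// exprn_gt0// lorentz_gt0.
Qed.

Lemma h1_cintg phi C : h1 phi C -> cintegrable leb phi.
Proof.
move=> h; have C0 := h1_C0 h.
apply: (cintg_le (h := fun x => Num.sqrt C * lorentz x)); first exact: h1_meas h.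
  by apply: intgZ; exact: intg_lorentzn.
  by move=> x; rewrite exprMn sqr_sqrtr//; exact: (h1_bnd h).
by move=> x; rewrite mulr_ge0 ?sqrtr_ge0 ?lorentz_ge0.
Qed.

Lemma h1_sqi phi C : h1 phi C -> sqi leb phi.
Proof.
move=> h; apply: (sqi_le (h := fun x => C * lorentz x ^+ 2)); first exact: h1_meas h.
- exact: intgZ intg_lorentz2.
- exact: h1_bnd h.
Qed.

Definition I2 : R := \int[leb]_x lorentz x ^+ 2.

Lemma I2_ge0 : 0 <= I2. Proof. by apply: Rint_ge0 => x; exact: sqr_ge0. Qed.

Lemma h1_n2 phi C : h1 phi C -> \int[leb]_x sqnormc (phi x) <= C * I2.
Proof.
move=> h; rewrite /I2 -RintZ; last exact: intg_lorentz2.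
apply: le_Rint; [exact: (h1_sqi h).2|exact: intgZ intg_lorentz2|exact: h1_bnd h].
Qed.

Lemma intg_sum I (s : seq I) (f : I -> Rn -> R) : (forall i, intg leb (f i)) ->
  intg leb (fun x => \sum_(i <- s) f i x) /\
  \int[leb]_x (\sum_(i <- s) f i x) = \sum_(i <- s) \int[leb]_x f i x.
Proof.
move=> If; elim: s => [|i s [I1 IH]].
  under eq_fun do rewrite big_nil.
  rewrite big_nil (_ : Rintegral _ _ _ = 0); first by split => //; exact: intg0.
  by rewrite Rintegral_cst// mul0r.
have E : (fun x => \sum_(k <- i :: s) f k x) = (fun x => f i x + \sum_(k <- s) f k x).
  by apply/funext => x; rewrite big_cons.
rewrite E.
by split; [exact: intgD|rewrite RintD// big_cons IH].
Qed.

(** [w1] is 1 plus [n] squared coordinates: Plancherel handles the first and [fourier_H1] the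
    others, which gives [n + 1] equal bounds. *)
Lemma h1_fourier phi C : h1 phi C ->
  intg leb (fun p => w1 p * sqnormc (fourier phi p)) /\
  \int[leb]_p (w1 p * sqnormc (fourier phi p)) <= n.+1%:R * (C * I2).
Proof.
move=> h; have Ip := h1_cintg h; have sp := h1_sqi h.
have H j : intg leb (fun p => (p ord0 j) ^+ 2 * sqnormc (fourier phi p)) /\
    \int[leb]_p ((p ord0 j) ^+ 2 * sqnormc (fourier phi p)) <= C * I2.
  rewrite /I2 -RintZ; last exact: intg_lorentz2.
  apply: fourier_H1 => //; first exact: intgZ intg_lorentz2.
  exact: h1_lip h j.
have E p : w1 p * sqnormc (fourier phi p) = sqnormc (fourier phi p) +
    \sum_(j < n) (p ord0 j) ^+ 2 * sqnormc (fourier phi p).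
  by rewrite -mulr_suml mulrDl mul1r.
have If := (sqi_fourier Ip sp).2.
have [Is Es] := intg_sum (index_enum 'I_n) (fun j => (H j).1).
split; first by under eq_fun do rewrite E; exact: intgD.
under eq_Rintegral do rewrite E.
rewrite RintD// Es plancherel//.
have -> : n.+1%:R * (C * I2) = C * I2 + \sum_(j < n) C * I2.
  by rewrite sumr_const card_ord -mulr_natl -addn1 natrD; ring.
apply: lerD; first exact: h1_n2 h.
by apply: ler_sum => j _; case: (H j).
Qed.

Lemma h1Z (c : R[i]) phi C : h1 phi C -> h1 (fun x => c * phi x) (sqnormc c * C).
Proof.
move=> h; split.
- by apply: cmeasM; [exact: cmeas_cst|exact: h1_meas h].
- by move=> x; rewrite sqnormcM -mulrA ler_wpM2l ?sqnormc_ge0//; exact: h1_bnd h x.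
- move=> j t x t0 t1; rewrite -mulrBr sqnormcM -mulrA mulrCA ler_wpM2l ?sqnormc_ge0//.
  exact: h1_lip h j t x t0 t1.
Qed.

Lemma h1D phi psi C D : h1 phi C -> h1 psi D ->
  h1 (fun x => phi x + psi x) (2 * C + 2 * D).
Proof.
move=> h k; split.
- by apply: cmeasD; [exact: h1_meas h|exact: h1_meas k].
- move=> x; have := sqnormcD_le (phi x) (psi x).
  by have := h1_bnd h x; have := h1_bnd k x; lra.
- move=> j t x t0 t1; set e := t *: _.
  have -> : phi (x + e) + psi (x + e) - (phi x + psi x) =
    (phi (x + e) - phi x) + (psi (x + e) - psi x) by ring.
  have := sqnormcD_le (phi (x + e) - phi x) (psi (x + e) - psi x).
  by have := h1_lip h j x t0 t1; have := h1_lip k j x t0 t1; rewrite -/e; lra.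
Qed.

Lemma is_derive_line (f : Rn -> R^o) (x e : Rn) (s : R) :
  differentiable f (x + s *: e) ->
  is_derive s (1 : R) (fun s => f (x + s *: e) : R^o) ('D_e f (x + s *: e)).
Proof.
move=> D; have df := @diff_derivable _ _ _ f _ e D.
have E (h : R) : h^-1 *: ((f \o shift (x + s *: e)) (h *: e) - f (x + s *: e)) =
   h^-1 *: (((fun s => f (x + s *: e) : R^o) \o shift s) (h *: (1 : R)) - f (x + s *: e)).
  congr (_ *: (f _ - _)) => /=.
  by rewrite /shift/= [h *: 1]mulr1 scalerDl addrCA.
split; first by rewrite /derivable -(funext E).
by rewrite /derive -(funext E).
Qed.

Lemma line_mvt (f : Rn -> R^o) (x e : Rn) (t : R) : 0 < t ->
  (forall y, differentiable f y) ->
  exists s, [/\ 0 < s, s < t & f (x + t *: e) - f x = 'D_e f (x + s *: e) * t].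
Proof.
move=> t0 df.
have D (s : R) : is_derive s (1 : R) (fun s => f (x + s *: e) : R^o) ('D_e f (x + s *: e)).
  exact: is_derive_line.
have [|s /[!in_itv]/= /andP[s0 st]] := MVT t0 (fun s _ => D s).
  by apply: derivable_within_continuous => s _; have [] := D s.
by rewrite scale0r addr0 subr0 => h; exists s.
Qed.

(** Only the [j]-th factor changes, and [1 + a^2 <= 4 (1 + (a + s)^2)] for [|s| <= 1]. *)
Lemma lorentz_shift (j : 'I_n) (s : R) x : `|s| <= 1 ->
  lorentz (x + s *: delta_mx ord0 j) <= 4 * lorentz x.
Proof.
move=> s1; rewrite /lorentz (bigD1 j)//= [X in _ <= 4 * X](bigD1 j)//= mulrA.
rewrite !mxE !eqxx mulr1 (eq_bigr (fun i => (1 + x ord0 i ^+ 2)^-1)); last first.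
  by move=> i ij; rewrite !mxE eqxx (negbTE ij) mulr0 addr0.
apply: ler_wpM2r.
  by apply: prodr_ge0 => i _; rewrite invr_ge0 addr_ge0// sqr_ge0.
set a := x ord0 j; rewrite ler_pdivlMr ?ltr_pwDl ?sqr_ge0// mulrC ler_pdivrMr ?ltr_pwDl ?sqr_ge0//.
have : s ^+ 2 <= 1 by rewrite -real_normK ?num_real// expr_le1.
by have := sqr_ge0 (a + 2 * s); nra.
Qed.

Lemma smooth_h1 : exists2 c : R, 0 <= c & forall phi B, smooth phi ->
  (forall s x, (size s <= 1)%N -> w1 x ^+ n.+1 * Num.sqrt (sqnormc (pderivs s phi x)) <= B) ->
  h1 phi (c * B ^+ 2).
Proof.
(* [32 = 2 * 16]: the square of the constant in [lorentz_shift], doubled for the real and imaginary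
   parts. *)
exists 32 => //.
move=> phi B sphi bphi.
have cphi : continuous (fun x => Re (phi x)) /\ continuous (fun x => Im (phi x)).
  by split => x; have [a b] := sphi [::] x; exact: differentiable_continuous.
have B0 : 0 <= B.
  by apply: le_trans (bphi [::] 0 _) => //; rewrite mulr_ge0 ?sqrtr_ge0// exprn_ge0// ltW// w1_gt0.
have bnd s x : (size s <= 1)%N -> sqnormc (pderivs s phi x) <= (B * lorentz x) ^+ 2.
  move=> s1; have := bphi s x s1.
  have w0 := w1_gt0 x; have w := w1_ge1 x; have := lorentz_bound x; rewrite -/(w1 x).
  set q := Num.sqrt _ => h1 h2.
  have q0 : 0 <= q by exact: sqrtr_ge0.
  have -> : sqnormc (pderivs s phi x) = q ^+ 2 by rewrite sqr_sqrtr ?sqnormc_ge0.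
  rewrite ler_pXn2r ?nnegrE ?mulr_ge0 ?lorentz_ge0//.
  apply: (@le_trans _ _ (B / w1 x ^+ n)); last by rewrite ler_wpM2l.
  rewrite ler_pdivlMr ?exprn_gt0// mulrC; apply: le_trans h2.
  by rewrite ler_wpM2r// ler_weXn2l.
split.
- by split; apply: continuous_measurable_rV; [exact: cphi.1|exact: cphi.2].
- move=> x; apply: le_trans (bnd [::] x isT) _; rewrite exprMn.
  rewrite ler_wpM2r ?sqr_ge0// ler_peMl ?sqr_ge0//.
  by have := sqr_ge0 B; lra.
move=> j t x t0 t1; set e := delta_mx ord0 j.
have lb (f : Rn -> R) : (forall y, differentiable (f : Rn -> R^o) y) ->
    (forall y, ('D_e (f : Rn -> R^o) y) ^+ 2 <= (B * lorentz y) ^+ 2) ->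
    (f (x + t *: e) - f x) ^+ 2 <= t ^+ 2 * (16 * B ^+ 2 * lorentz x ^+ 2).
  move=> df bf; have [s [s0 st ->]] := line_mvt x e t0 df.
  rewrite exprMn mulrC ler_wpM2l ?sqr_ge0//; apply: le_trans (bf _) _.
  have : lorentz (x + s *: e) <= 4 * lorentz x.
    by apply: lorentz_shift; rewrite ger0_norm ?(ltW s0)//; lra.
  have := lorentz_ge0 (x + s *: e); set a := lorentz _; set b := lorentz x => a0 ab.
  have : a ^+ 2 <= (4 * b) ^+ 2 by rewrite ler_pXn2r ?nnegrE//; lra.
  rewrite !exprMn => h; have := ler_wpM2l (sqr_ge0 B) h; lra.
have dR y := (sphi [::] y).1; have dI y := (sphi [::] y).2.
have bj y : sqnormc (pderiv j phi y) <= (B * lorentz y) ^+ 2 := bnd [:: j] y isT.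
have L1 := lb _ dR (fun y => le_trans _ (bj y)).
have L2 := lb _ dI (fun y => le_trans _ (bj y)).
rewrite [sqnormc _]/sqnormc !cE0 -/e.
have -> : t ^+ 2 * (32 * B ^+ 2 * lorentz x ^+ 2) =
  t ^+ 2 * (16 * B ^+ 2 * lorentz x ^+ 2) + t ^+ 2 * (16 * B ^+ 2 * lorentz x ^+ 2) by ring.
apply: lerD; [apply: L1|apply: L2] => y; rewrite /sqnormc /pderiv /=.
  by rewrite lerDl sqr_ge0.
by rewrite lerDr sqr_ge0.
Qed.

Lemma schwartz_h1 : exists2 c : R, 0 <= c & forall phi B, schwartz phi ->
  schwartz_bound n.+1 phi B -> h1 phi (c * B ^+ 2).
Proof.
have [c c0 H] := smooth_h1; exists c => // phi B [sphi _] bphi; apply: H => // s x s1.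
by apply: bphi; exact: leq_trans s1 _.
Qed.

End h1_class.

(** * Gaussian test functions and compactly supported test functions *)

Section test_functions.
Context {R : realType} {n : nat}.
Local Notation leb := (@lebesgue_rV R n).
Local Notation Rn := 'rV[R]_n.
Implicit Types (phi psi : Rn -> R[i]) (p x y b : Rn).

Lemma derive_line (f : Rn -> R^o) (x e : Rn) (a : R) :
  is_derive (0 : R) (1 : R) (fun s => f (x + s *: e) : R^o) a -> 'D_e f x = a.
Proof.
move=> [_ <-].
have E (h : R) : h^-1 *: ((f \o shift x) (h *: e) - f x) =
   h^-1 *: (((fun s => f (x + s *: e) : R^o) \o shift 0) (h *: (1 : R)) - f (x + 0 *: e)).
  congr (_ *: (f _ - f _)) => /=; last by rewrite scale0r addr0.
  by rewrite /shift/= [h *: 1]mulr1 addr0 addrC.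
by rewrite /derive (funext E).
Qed.

(** Schwartz functions sufficient to determine a Fourier transform: polynomials times a Gaussian
    times a cosine or sine, generated by clauses under which partial derivatives stay inside the
    class. *)
Inductive gcl : (Rn -> R) -> Prop :=
| gcl_cos b : gcl (fun x => gauss x * cos (dotr b x))
| gcl_sin b : gcl (fun x => gauss x * sin (dotr b x))
| gcl_D f g : gcl f -> gcl g -> gcl (fun x => f x + g x)
| gcl_Z (a : R) f : gcl f -> gcl (fun x => a * f x)
| gcl_X i f : gcl f -> gcl (fun x => x ord0 i * f x).

Lemma differentiable_dotr b x : differentiable (dotr b : Rn -> R^o) x.
Proof.
have -> : dotr b = \sum_(i < n) (fun y => b ord0 i * y ord0 i).
  by apply/funext => y; rewrite fct_sumE.
apply: (@differentiable_sum R Rn R^o) => i.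
by apply: differentiableM => //; exact: differentiable_coord.
Qed.

Lemma differentiable_sqnormr x : differentiable (@sqnormr R n : Rn -> R^o) x.
Proof.
have -> : @sqnormr R n = \sum_(i < n) (fun y => y ord0 i * y ord0 i).
  by apply/funext => y; rewrite fct_sumE.
apply: (@differentiable_sum R Rn R^o) => i.
by apply: differentiableM; exact: differentiable_coord.
Qed.

Lemma diff_comp1 (f : R -> R) (g : Rn -> R) x a : is_derive (g x) 1 f a ->
  differentiable (g : Rn -> R^o) x -> differentiable (fun y => f (g y) : R^o) x.
Proof.
move=> [df _] dg; apply: (@differentiable_comp R Rn R^o R^o g f) => //.
exact/derivable1_diffP.
Qed.

Lemma differentiable_gauss x : differentiable (gauss : Rn -> R^o) x.
Proof.
apply: (@diff_comp1 expR (fun x => - (sqnormr x / 2)) x (expR (- (sqnormr x / 2)))).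
apply: differentiableN; apply: differentiableM => //; exact: differentiable_sqnormr.
Qed.

Lemma gcl_diff f : gcl f -> (forall x, differentiable (f : Rn -> R^o) x) /\
  forall i, gcl (fun x => 'D_(delta_mx ord0 i) (f : Rn -> R^o) x).
Proof.
have gline x i : is_derive (0 : R) (1 : R) (fun s => gauss (x + s *: delta_mx ord0 i)) 
    (- (x ord0 i * gauss x)).
  rewrite /gauss.
  have -> : (fun s : R => expR (- (sqnormr (x + s *: delta_mx ord0 i) / 2))) =
      (fun s : R => expR (- ((sqnormr x + 2 * (s * x ord0 i) + s * s) / 2))).
    apply/funext => s; rewrite sqnormrD dotrZr dotrC dotr_delta sqnormr_delta.
    by rewrite expr2 mulrA.
  apply: idrv_eq.
  rewrite /GRing.scale/= !mul0r !mulr0 !addr0 !add0r !mulr1.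
  by field.
have dline x b i : is_derive (0 : R) (1 : R) (fun s => dotr b (x + s *: delta_mx ord0 i)) (b ord0 i).
  have -> : (fun s : R => dotr b (x + s *: delta_mx ord0 i)) = (fun s => dotr b x + s * b ord0 i).
    by apply/funext => s; rewrite dotrDr dotrZr [dotr b (delta_mx _ _)]dotrC dotr_delta.
  apply: idrv_eq.
  by rewrite /GRing.scale/=; ring.
elim=> {f} [b|b|f g _ [df Df] _ [dg Dg]|a f _ [df Df]|i f gf [df Df]].
- split=> [x|i].
    apply: differentiableM; first exact: differentiable_gauss.
    by apply: (@diff_comp1 cos (dotr b) x); exact: differentiable_dotr.
  rewrite (_ : (fun x => _) = (fun x => (- 1) * (x ord0 i * (gauss x * cos (dotr b x))) +
     (- b ord0 i) * (gauss x * sin (dotr b x)))); last first.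
    apply/funext => x; apply: derive_line; apply: idrv_eq.
    by rewrite scale0r addr0 /GRing.scale/=; ring.
  apply: gcl_D; first by apply: gcl_Z; apply: gcl_X; exact: gcl_cos.
  by apply: gcl_Z; exact: gcl_sin.
- split=> [x|i].
    apply: differentiableM; first exact: differentiable_gauss.
    by apply: (@diff_comp1 sin (dotr b) x); exact: differentiable_dotr.
  rewrite (_ : (fun x => _) = (fun x => (- 1) * (x ord0 i * (gauss x * sin (dotr b x))) +
     (b ord0 i) * (gauss x * cos (dotr b x)))); last first.
    apply/funext => x; apply: derive_line; apply: idrv_eq.
    by rewrite scale0r addr0 /GRing.scale/=; ring.
  apply: gcl_D; first by apply: gcl_Z; apply: gcl_X; exact: gcl_sin.
  by apply: gcl_Z; exact: gcl_cos.
- split=> [x|i]; first exact: differentiableD.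
  rewrite (_ : (fun x => _) = (fun x => 'D_(delta_mx ord0 i) (f : Rn -> R^o) x +
    'D_(delta_mx ord0 i) (g : Rn -> R^o) x)); first exact: gcl_D.
  by apply/funext => x; apply: deriveD; exact: diff_derivable.
- split=> [x|i]; first exact: differentiableZ.
  rewrite (_ : (fun x => _) = (fun x => a * 'D_(delta_mx ord0 i) (f : Rn -> R^o) x)).
    exact: gcl_Z.
  by apply/funext => x; apply: (@deriveZ _ _ R^o); exact: diff_derivable.
- split=> [x|j].
    by apply: differentiableM => //; exact: differentiable_coord.
  rewrite (_ : (fun x => _) = (fun x => x ord0 i * 'D_(delta_mx ord0 j) (f : Rn -> R^o) x +
    (i == j)%:R * f x)); first by apply: gcl_D; [exact: gcl_X|exact: gcl_Z].
  apply/funext => x; apply: derive_line; apply: idrv_eq.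
    apply: (@idrvM _ (fun s => (x + s *: delta_mx ord0 j) ord0 i) _ _ (i == j)%:R).
      rewrite (_ : (fun s => _) = (fun s => x ord0 i + s * (i == j)%:R)); last first.
        by apply/funext => s; rewrite !mxE eqxx.
      by apply: idrv_eq; rewrite /GRing.scale/=; ring.
    by apply: is_derive_line; exact: df.
  by rewrite /= scale0r addr0; ring.
Qed.

Lemma gcl_bnd f : gcl f -> exists C k, 0 <= C /\ forall x, `|f x| <= C * w1 x ^+ k * gauss x.
Proof.
elim=> {f} [b|b|f g _ [C [k [C0 hf]]] _ [D [l [D0 hg]]]|a f _ [C [k [C0 hf]]]|i f _ [C [k [C0 hf]]]].
- exists 1, 0%N; split=> // x; rewrite expr0 !mul1r normrM ger0_norm ?(ltW (gauss_gt0 _))//.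
  by rewrite ler_piMr ?(ltW (gauss_gt0 _))// cos_le1'.
- exists 1, 0%N; split=> // x; rewrite expr0 !mul1r normrM ger0_norm ?(ltW (gauss_gt0 _))//.
  by rewrite ler_piMr ?(ltW (gauss_gt0 _))// sin_le1'.
- exists (C + D), (k + l)%N; split=> [|x]; first exact: addr_ge0.
  apply: le_trans (ler_normD _ _) _; rewrite !mulrDl; have w := w1_ge1 x.
  apply: lerD.
    apply: le_trans (hf x) _; rewrite ler_wpM2r ?(ltW (gauss_gt0 _))// ler_wpM2l//.
    by rewrite ler_weXn2l// leq_addr.
  apply: le_trans (hg x) _; rewrite ler_wpM2r ?(ltW (gauss_gt0 _))// ler_wpM2l//.
  by rewrite ler_weXn2l// leq_addl.
- exists (`|a| * C), k; split=> [|x]; first exact: mulr_ge0.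
  by rewrite normrM -!mulrA ler_wpM2l// mulrA.
- exists C, k.+1; split=> // x; rewrite normrM.
  have h : `|x ord0 i| <= w1 x.
    have := sqr_coor_le x i; have := sqnormr_ge0 x; rewrite /w1 -real_normK ?num_real//.
    have := normr_ge0 (x ord0 i); set a := `|_|; nra.
  by apply: le_trans (ler_pM _ _ h (hf x)) _ => //; rewrite exprS; lra.
Qed.

Lemma w1_gauss_bnd k : exists2 C : R, 0 <= C & forall x, w1 x ^+ k * gauss x <= C.
Proof.
(* From [1 + y <= exp y] at [y = |x|^2 / (2 (k + 1))], raised to the power [k + 1]. *)
exists ((2 * k.+1%:R) ^+ k.+1); first by rewrite exprn_ge0.
move=> x; have w := w1_ge1 x; have r0 := sqnormr_ge0 x.
apply: (@le_trans _ _ (w1 x ^+ k.+1 * gauss x)).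
  by rewrite ler_wpM2r ?(ltW (gauss_gt0 _))// ler_weXn2l.
rewrite /gauss expRN ler_pdivrMr ?expR_gt0//.
have -> : sqnormr x / 2 = (sqnormr x / (2 * k.+1%:R)) * k.+1%:R.
  have : k.+1%:R != 0 :> R by rewrite pnatr_eq0.
  by set q := k.+1%:R => q0; field.
rewrite expRM_natr -exprMn ler_pXn2r ?nnegrE ?mulr_ge0 ?expR_ge0//; last by lra.
apply: le_trans (ler_wpM2l _ (expR_ge1Dx _)); last by rewrite mulr_ge0.
rewrite mulrDr mulr1 mulrCA divff ?mulr1 /w1; last by rewrite mulf_neq0// pnatr_eq0.
rewrite lerD2r; have : 1 <= k.+1%:R :> R by rewrite ler1n.
lra.
Qed.

Lemma fin_bound (P : 'I_n -> R -> Prop) : (forall j C D, P j C -> C <= D -> P j D) ->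
  (forall j, exists2 C, 0 <= C & P j C) -> exists2 C, 0 <= C & forall j, P j C.
Proof.
move=> mono H; have H' j : exists C, 0 <= C /\ P j C by have [C] := H j; exists C.
have [c hc] := choice H'.
exists (\sum_j c j) => [|j]; first by apply: sumr_ge0 => j _; case: (hc j).
apply: mono (hc j).2 _; rewrite (bigD1 j)//= lerDl.
by apply: sumr_ge0 => i _; case: (hc i).
Qed.

Definition rderivs (s : seq 'I_n) (f : Rn -> R) : Rn -> R :=
  foldr (fun i (g : Rn -> R) x => 'D_(delta_mx ord0 i) (g : Rn -> R^o) x) f s.

Lemma pderivs_real s (f : Rn -> R) :
  pderivs s (fun x => (f x)%:C) = (fun x => (rderivs s f x)%:C).
Proof.
elim: s => //= i s ->; apply/funext => x.
by rewrite /pderiv /=; apply: complexP => //=; rewrite derive_cst.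
Qed.

Lemma gcl_rderivs s f : gcl f -> gcl (rderivs s f).
Proof. by move=> gf; elim: s => //= i s IH; exact: (gcl_diff IH).2. Qed.

Lemma gcl_schwartz f : gcl f -> schwartz (fun x => (f x)%:C).
Proof.
move=> gf; split.
  move=> s x; rewrite pderivs_real; split; first exact: (gcl_diff (gcl_rderivs s gf)).1.
  exact: differentiable_cst.
move=> N.
suff H k : forall f, gcl f -> exists2 C, 0 <= C & forall s x, (size s <= k)%N ->
    w1 x ^+ N * `|rderivs s f x| <= C.
  have [C _ hC] := H N f gf; exists C => s x sN.
  by rewrite pderivs_real sqnormcR sqrtr_sqr; exact: hC.
have H0 g : gcl g -> exists2 C, 0 <= C & forall x, w1 x ^+ N * `|g x| <= C.
  move=> /gcl_bnd[C [l [C0 hC]]]; have [D D0 hD] := w1_gauss_bnd (N + l).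
  exists (C * D) => [|x]; first exact: mulr_ge0.
  apply: le_trans (ler_wpM2l C0 (hD x)); apply: le_trans (ler_wpM2l _ (hC x)) _.
    by rewrite exprn_ge0// ltW// w1_gt0.
  by rewrite exprD; lra.
elim: k => [|k IH] {gf}f gf.
  by have [C C0 hC] := H0 f gf; exists C => // -[].
have [C C0 hC] := H0 f gf.
have [||D D0 hD] := @fin_bound (fun j C => forall s x, (size s <= k)%N ->
    w1 x ^+ N * `|rderivs s (rderivs [:: j] f) x| <= C).
- by move=> j a b h ab s x sk; exact: le_trans (h s x sk) ab.
- by move=> j; apply: IH; exact: gcl_rderivs.
exists (C + D) => [|s x]; first exact: addr_ge0.
(* [foldr] differentiates along the last index first, so the bound for [rderivs [:: j] f] is the one
   that applies. *)
case/lastP: s => [_|s j]; first by apply: le_trans (hC x) _; rewrite lerDl.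
rewrite size_rcons ltnS => sk; rewrite /rderivs foldr_rcons.
by apply: le_trans (hD j s x sk) _; rewrite lerDr.
Qed.

Section test.
Variable g : Rn -> R.
Hypothesis tg : test_fun g.

Lemma test_support x : 1 <= sqnormr x -> g x = 0.
Proof.
move=> x1; apply/eqP/negPn/negP => gx; case: tg => _ [_ /(_ x)].
move=> h; have : unit_ball x by apply: h; exact: (@subset_closure _ [set x | g x != 0]).
by rewrite /unit_ball /= ltNge x1.
Qed.

Lemma test_smooth : smooth (fun x => (g x)%:C). Proof. by case: tg. Qed.

Lemma test_rderivs_diff s x : differentiable (rderivs s g : Rn -> R^o) x.
Proof. by have := (test_smooth s x).1; rewrite pderivs_real. Qed.

Lemma test_rderiv0 j x : ~ closure [set x | g x != 0] x -> rderivs [:: j] g x = 0.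
Proof.
move=> nx; rewrite /rderivs /=.
have [->|v0] := eqVneq (delta_mx ord0 j : Rn) 0; first exact: derive0.
rewrite (@near_eq_derive _ _ _ _ (cst 0 : Rn -> R^o))//; first exact: derive_cst.
have : open (~` closure [set x | g x != 0]) by exact/closed_openC/closed_closure.
rewrite openE => /(_ x nx); apply: filterS => y ny; apply/eqP/negPn/negP => gy.
by apply: ny; exact: subset_closure.
Qed.

Lemma test_h1 : exists C, h1 (fun x => (g x)%:C) C.
Proof.
have [c c0 H] := @smooth_h1 R n.
have bnd (f : Rn -> R) : (forall x, differentiable (f : Rn -> R^o) x) ->
    (forall x, ~ closure [set x | g x != 0] x -> f x = 0) ->
    exists2 C, 0 <= C & forall x, w1 x ^+ n.+1 * `|f x| <= C.
  move=> df f0; have [_ [cK sK]] := tg.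
  have cf : continuous f by move=> x; exact: differentiable_continuous (df x).
  have [M [_ hM]] := compact_bounded (continuous_compact (continuous_subspaceT cf) cK).
  pose B := `|M| + 1; have B0 : 0 <= B by rewrite addr_ge0.
  (* On the support [w1 x] is below 2, whence the power of 2. *)
  exists (2 ^+ n.+1 * B) => [|x]; first by rewrite mulr_ge0// exprn_ge0.
  have [Kx|nK] := pselect (closure [set x | g x != 0] x); last first.
    by rewrite f0// normr0 mulr0 mulr_ge0// exprn_ge0.
  have w0 := w1_gt0 x.
  apply: ler_pM; rewrite ?exprn_ge0 ?(ltW w0)//.
    rewrite ler_pXn2r ?nnegrE ?(ltW w0)//; have := sK x Kx; rewrite /unit_ball /= /w1; lra.
  apply: (hM B); first by rewrite /B; have := ler_norm M; lra.
  by exists x.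
have [||C C0 hC] := bnd g; first exact: (test_rderivs_diff [::]).
  move=> x nx; apply/eqP/negPn/negP => gx; apply: nx; exact: subset_closure.
have [||D D0 hD] := @fin_bound (fun j C => forall x, w1 x ^+ n.+1 * `|rderivs [:: j] g x| <= C).
- by move=> j a b h ab x; exact: le_trans (h x) ab.
- by move=> j; apply: bnd; [exact: test_rderivs_diff|exact: test_rderiv0].
exists (c * (C + D) ^+ 2); apply: H; first exact: test_smooth.
move=> s x; rewrite pderivs_real sqnormcR sqrtr_sqr.
case: s => [_|j [_|//]]; first by apply: le_trans (hC x) _; rewrite lerDl.
by apply: le_trans (hD j x) _; rewrite lerDr.
Qed.

End test.
End test_functions.

(** * Fourier transforms of tempered distributions *)

Section fourier_of_distributions.
Context {R : realType} {n : nat}.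
Local Notation leb := (@lebesgue_rV R n).
Local Notation Rn := 'rV[R]_n.
Local Notation L2 := (L2 leb).
Local Notation ip := (@L2_ip _ _ R leb).
Local Notation cint := (cintegral leb).
Implicit Types (phi psi F G : Rn -> R[i]) (p x y b : Rn) (f h : (Rn -> R[i]) -> R[i]).

Lemma schwartz_h1_ex phi : schwartz phi -> exists C, h1 phi C.
Proof.
move=> sp; have [c c0 H] := @schwartz_h1 R n.
by have [B hB] := sp.2 n.+1; exists (c * B ^+ 2); exact: H.
Qed.

Lemma schwartz_cintg phi : schwartz phi -> cintegrable leb phi.
Proof. by move=> /schwartz_h1_ex[C]; exact: h1_cintg. Qed.

Lemma schwartz_sqi phi : schwartz phi -> sqi leb phi.
Proof. by move=> /schwartz_h1_ex[C]; exact: h1_sqi. Qed.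

(** The test functions are a Gaussian times cosines and sines, which together make up the states
    [coh (0, b)]. *)
Lemma is_fourier_unique f F G : is_fourier f F -> is_fourier f G ->
  {ae leb, forall p, F p = G p}.
Proof.
move=> [mF hF] [mG hG].
have Z (k : Rn -> R) : gcl k ->
    cintegrable leb (fun x => (F x - G x) * (k x)%:C) /\ cint (fun x => (F x - G x) * (k x)%:C) = 0.
  move=> gk; have [IF eF] := hF _ (gcl_schwartz gk); have [IG eG] := hG _ (gcl_schwartz gk).
  have E x : (F x - G x) * (k x)%:C = F x * (k x)%:C + (-1) * (G x * (k x)%:C) by ring.
  have IZ := cintgZ (-1) IG.
  rewrite (funext E); split; first exact: cintgD.
  by rewrite cintD// cintZ// -/(distr_of F _) -/(distr_of G _) -eF -eG; ring.
have CE b x : coh (0, b) x * (F x - G x) =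
   (F x - G x) * (gauss x * cos (dotr b x))%:C + 'i * ((F x - G x) * (gauss x * sin (dotr b x))%:C).
  rewrite /coh /= dotr0l mul0r !subr0; apply: complexP; rewrite !cE /=; ring.
have : {ae leb, forall x, F x - G x = 0}.
  apply: coh_uniqueness => [|b].
    have [I0 _] := Z _ (gcl_cos 0).
    rewrite (_ : (fun x => _) = (fun x => (F x - G x) * (gauss x * cos (dotr 0 x))%:C))//.
    by apply/funext => x; rewrite dotr0l cos0 mulr1 mulrC.
  have [I1 e1] := Z _ (gcl_cos b); have [I2 e2] := Z _ (gcl_sin b).
  by rewrite (eq_cint _ (CE b)) cintD ?cintZ ?e1 ?e2 ?mulr0 ?addr0//; exact: cintgZ.
by apply: filterS => x /eqP; rewrite subr_eq0 => /eqP.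
Qed.

Lemma is_fourier_ae f F G : is_fourier f F -> cmeasurable G ->
  {ae leb, forall p, F p = G p} -> is_fourier f G.
Proof.
move=> [mF hF] mG FG; split=> // phi sp; have [IF ->] := hF phi sp.
have mp := cintg_meas (schwartz_cintg sp).
have e : {ae leb, forall p, F p * phi p = G p * phi p} by apply: filterS FG => p ->.
split; first by apply: cintg_ae e IF; exact: cmeasM.
by rewrite /distr_of; apply: cint_ae e; exact: cmeasM.
Qed.

Lemma is_fourierD f : (exists F, is_fourier f F) -> is_fourier f (fourierD f).
Proof. by move=> [F hF]; rewrite /fourierD; exact: (@xgetPex _ _ [set F | is_fourier f F] (ex_intro _ F hF)). Qed.

Lemma fourierD_ae f F : is_fourier f F -> {ae leb, forall p, fourierD f p = F p}.
Proof. by move=> hF; apply: (is_fourier_unique _ hF); apply: is_fourierD; exists F. Qed.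

Lemma is_fourier_L1 phi : cintegrable leb phi -> is_fourier (distr_of phi) (fourier phi).
Proof.
move=> Ip; split=> [|psi sp]; first exact: cmeas_fourier.
have Is := schwartz_cintg sp; rewrite /distr_of.
split; last by rewrite fourier_mult.
pose C := @fnorm R n * (4 * \int[leb]_x nabs (phi x)); have C0 : 0 <= C.
  by apply: le_trans (nabs_fourier 0 Ip); exact: nabs_ge0.
apply: (cintg_bndM (C := C)) => //; first exact: cmeas_fourier.
move=> p; apply: le_trans (sqnormc_nabs _) _.
by rewrite ler_pXn2r ?nnegrE ?nabs_ge0//; exact: nabs_fourier.
Qed.

Lemma is_fourierB f h F G : is_fourier f F -> is_fourier h G ->
  is_fourier (fun phi => f phi - h phi) (fun p => F p - G p).
Proof.
move=> [mF hF] [mG hG]; split=> [|phi sp]; first exact: cmeasB.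
have [IF eF] := hF _ sp; have [IG eG] := hG _ sp.
have E x : (F x - G x) * phi x = F x * phi x + (-1) * (G x * phi x) by ring.
have IZ := cintgZ (-1) IG.
rewrite /distr_of (funext E); split; first exact: cintgD.
rewrite cintD// cintZ// -/(distr_of F _) -/(distr_of G _) -eF -eG; ring.
Qed.

(** The defining duality of [is_fourier] is the symmetry [bil_FF]. *)
Lemma is_fourier_FF (u : L2) : is_fourier (distr_of (L2_fun u)) (L2_fun (FF u)).
Proof.
split=> [|phi sp]; first exact: (L2_sqi _).1.
have Ip := schwartz_cintg sp; have qp := schwartz_sqi sp.
split; first by apply: sqiM => //; exact: L2_sqi.
have qf := sqi_fourier Ip qp; have qu := L2_sqi u; have qF := L2_sqi (FF u).
have e1 : bil u (mkL2 leb (fourier phi)) = cint (fun x => L2_fun u x * fourier phi x).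
  by apply: (bil_fun qu qf); [exact: nearW|exact: mkL2_ae].
have e2 : bil (FF u) (mkL2 leb phi) = cint (fun x => L2_fun (FF u) x * phi x).
  by apply: (bil_fun qF qp); [exact: nearW|exact: mkL2_ae].
have e3 := congr1 (bil u) (esym (FF_mk Ip qp)).
exact: (etrans (esym e1) (etrans e3 (etrans (bil_FF _ _) e2))).
Qed.

Lemma is_fourier_L2P (u : L2) F : cmeasurable F ->
  is_fourier (distr_of (L2_fun u)) F <-> {ae leb, forall p, L2_fun (FF u) p = F p}.
Proof.
move=> mF; split=> [h|e]; first exact: is_fourier_unique (is_fourier_FF u) h.
exact: is_fourier_ae (is_fourier_FF u) mF e.
Qed.

Lemma measurable_sqrt (f : Rn -> R) : measurable_fun setT f ->
  measurable_fun setT (fun x => Num.sqrt (f x)).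
Proof.
move=> mf; apply: (@measurableT_comp _ _ _ _ _ _ (@Num.sqrt R)) => //.
by apply: continuous_measurable_fun; exact: sqrt_continuous.
Qed.

Lemma le_sqrt_sqr (X z : R) : 0 <= X -> 0 <= z -> X <= Num.sqrt X * z -> X <= z ^+ 2.
Proof.
move=> X0 z0; rewrite -{1 3}(sqr_sqrtr X0); have := sqrtr_ge0 X.
move: (Num.sqrt X) => q; rewrite le0r => /orP[/eqP-> _|q0]; first by rewrite expr0n sqr_ge0.
by rewrite expr2 ler_pM2l// => qz; rewrite -expr2 ler_pXn2r ?nnegrE// ltW.
Qed.

(** Cauchy-Schwarz for factors that need not be square-integrable: it is applied to [sqrt A] and
    [sqrt B], whose product dominates [|a b|] almost everywhere. *)
Lemma cs_weight (a b : Rn -> R[i]) (A B : Rn -> R) : cmeasurable a -> cmeasurable b ->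
  intg leb A -> intg leb B -> (forall x, 0 <= A x) -> (forall x, 0 <= B x) ->
  {ae leb, forall x, sqnormc (a x) * sqnormc (b x) <= A x * B x} ->
  cintegrable leb (fun x => Num.conj (a x) * b x) /\
  sqnormc (cint (fun x => Num.conj (a x) * b x)) <= \int[leb]_x A x * \int[leb]_x B x.
Proof.
move=> ma mb IA IB A0 B0 AB.
have sq (D : Rn -> R) : intg leb D -> (forall x, 0 <= D x) ->
    sqi leb (fun x => (Num.sqrt (D x))%:C) /\ (forall x, sqnormc (Num.sqrt (D x))%:C = D x).
  move=> ID D0; have E x : sqnormc (Num.sqrt (D x))%:C = D x by rewrite sqnormcR sqr_sqrtr.
  split=> //; split; last by rewrite (funext E).
  by apply: cmeasR; apply: measurable_sqrt; exact: intg_meas ID.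
have [sA eA] := sq _ IA A0; have [sB eB] := sq _ IB B0.
pose uv x := Num.sqrt (A x) * Num.sqrt (B x).
have uv0 x : 0 <= uv x by rewrite mulr_ge0 ?sqrtr_ge0.
have UVE x : (Num.sqrt (A x))%:C * (Num.sqrt (B x))%:C = (uv x)%:C :> R[i].
  by rewrite -rmorphM.
have Iuv : intg leb uv.
  have J : cintegrable leb (fun x => (uv x)%:C) by rewrite -(funext UVE); exact: sqiM.
  exact: J.1.
have uvAB : (\int[leb]_x uv x) ^+ 2 <= \int[leb]_x A x * \int[leb]_x B x.
  have := rip_cs (L2_hilbert leb) (mkL2 leb (fun x => (Num.sqrt (A x))%:C))
    (mkL2 leb (fun x => (Num.sqrt (B x))%:C)).
  rewrite (nrm2_mk sA) (nrm2_mk sB) (funext eA) (funext eB) (ip_mk sA sB) Re_cint.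
  by congr (_ ^+ 2 <= _); apply: eq_Rintegral => x _; rewrite cReM /= oppr0 mul0r subr0.
pose k x := Num.sqrt (sqnormc (a x) * sqnormc (b x)).
have mk : measurable_fun setT k.
  by apply: measurable_sqrt; apply: measurable_funM; exact: meas_sqnormc.
have kE x : sqnormc (Num.conj (a x) * b x) = k x ^+ 2.
  by rewrite sqnormcM sqnormcJ sqr_sqrtr// mulr_ge0 ?sqnormc_ge0.
have kuv : {ae leb, forall x, k x <= uv x}.
  by apply: filterS AB => x h; rewrite /k /uv -sqrtrM// ler_wsqrtr.
(* The majorant has to hold at every point; the maximum corrects [uv] on a null set. *)
pose h x := Num.max (uv x) (k x).
have Ih : intg leb h.
  have mh : measurable_fun setT h by apply: measurable_maxr => //; exact: intg_meas Iuv.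
  by apply: (intg_ae mh _ Iuv); apply: filterS kuv => x kx; rewrite /h max_l.
have Iab : cintegrable leb (fun x => Num.conj (a x) * b x).
  apply: (cintg_le (h := h)) => //.
  - by apply: cmeasM => //; exact: cmeasJ.
  - move=> x; rewrite kE ler_pXn2r ?nnegrE ?sqrtr_ge0//; first by rewrite /h le_max lexx orbT.
    by rewrite /h le_max uv0.
  - by move=> x; rewrite /h le_max uv0.
split=> //; set I := cint _.
(* Multiplication by the conjugate of the integral makes it real and nonnegative, so only the real
   part of the integrand has to be bounded. *)
have e : sqnormc I = Re (cint (fun x => Num.conj I * (Num.conj (a x) * b x))).
  by rewrite cintZ// /sqnormc !cE0; ring.
have le1 : sqnormc I <= Num.sqrt (sqnormc I) * \int[leb]_x uv x.
  rewrite {1}e Re_cint -RintZ//; apply: le_Rint_ae.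
  - by have [] := cintgZ (Num.conj I) Iab.
  - exact: intgZ.
  - apply: filterS kuv => x kx; apply: (@le_trans _ _ (Num.sqrt (sqnormc I) * k x)); last first.
      by rewrite ler_wpM2l ?sqrtr_ge0.
    apply: (le_trans (ler_norm _)); rewrite -(ler_pXn2r (n := 2)) ?nnegrE ?mulr_ge0 ?sqrtr_ge0//.
    rewrite exprMn sqr_sqrtr ?sqnormc_ge0// -kE -[sqnormc I]sqnormcJ -sqnormcM.
    by rewrite real_normK ?num_real// /sqnormc lerDl sqr_ge0.
apply: le_trans uvAB; apply: le_sqrt_sqr le1; [exact: sqnormc_ge0|exact: Rint_ge0].
Qed.
End fourier_of_distributions.

(** * Closures of test functions, described in Fourier space *)

Section sobolev_class.
Context {R : realType} {n : nat}.
Local Notation leb := (@lebesgue_rV R n).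
Local Notation Rn := 'rV[R]_n.
Local Notation L2 := (L2 leb).
Local Notation cint := (cintegral leb).
Implicit Types (phi psi F G : Rn -> R[i]) (p x y b : Rn) (g : Rn -> R).
Implicit Types (f h : (Rn -> R[i]) -> R[i]) (s : R).

Lemma Rint_zero (u : Rn -> R) : (forall x, u x = 0) -> \int[leb]_x u x = 0.
Proof. by move=> u0; rewrite (funext u0) Rintegral_cst// mul0r. Qed.

Definition wt s p : R := w1 p `^ s.

Lemma wt_gt0 s p : 0 < wt s p. Proof. by rewrite powR_gt0// w1_gt0. Qed.

Lemma wt_ge0 s p : 0 <= wt s p. Proof. exact: powR_ge0. Qed.

Lemma wtN s p : wt (- s) p = (wt s p)^-1. Proof. by rewrite /wt powRN. Qed.

Lemma wtVM s p : wt (- s) p * wt s p = 1.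
Proof. by rewrite wtN mulVf// gt_eqF// wt_gt0. Qed.

Lemma wt_le s p : s <= 1 -> wt s p <= w1 p.
Proof.
move=> s1; rewrite -[X in _ <= X]powRr1; last exact: ltW (w1_gt0 p).
by apply: ler_powR => //; exact: w1_ge1.
Qed.

Lemma measurable_wt s : measurable_fun setT (wt s).
Proof.
apply: (@measurableT_comp _ _ _ _ _ _ (@powR R ^~ s)); last exact: measurable_w1.
exact: measurable_powR.
Qed.

Definition gC g : Rn -> R[i] := fun x => (g x)%:C.

(** What membership in [sobolevB s] says of the Fourier transform alone; [sobolevB_Sob] and
    [Sob_sobolevB] give the correspondence. *)
Record Sob s F : Prop := MkSob {
  sob_meas : cmeasurable F;
  sob_int : intg leb (fun p => wt s p * sqnormc (F p));
  sob_apx : forall e, 0 < e -> exists2 g, test_fun g &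
    \int[leb]_p (wt s p * sqnormc (F p - fourier (gC g) p)) < e }.

Definition wn s F : R := \int[leb]_p (wt s p * sqnormc (F p)).

Lemma wn_ge0 s F : 0 <= wn s F.
Proof. by apply: Rint_ge0 => p; rewrite mulr_ge0 ?wt_ge0 ?sqnormc_ge0. Qed.

Lemma meas_wn s F : cmeasurable F -> measurable_fun setT (fun p => wt s p * sqnormc (F p)).
Proof. by move=> mF; apply: measurable_funM; [exact: measurable_wt|exact: meas_sqnormc]. Qed.

Lemma wn_lin s F G (a b : R[i]) : cmeasurable F -> cmeasurable G ->
  intg leb (fun p => wt s p * sqnormc (F p)) ->
  intg leb (fun p => wt s p * sqnormc (G p)) ->
  intg leb (fun p => wt s p * sqnormc (a * F p + b * G p)) /\
  wn s (fun p => a * F p + b * G p) <= 2 * sqnormc a * wn s F + 2 * sqnormc b * wn s G.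
Proof.
move=> mF mG IF IG; have bd p : wt s p * sqnormc (a * F p + b * G p) <=
    2 * sqnormc a * (wt s p * sqnormc (F p)) + 2 * sqnormc b * (wt s p * sqnormc (G p)).
  have := ler_wpM2l (wt_ge0 s p) (sqnormcD_le (a * F p) (b * G p)).
  by rewrite !sqnormcM; lra.
have IR := intgD (intgZ (2 * sqnormc a) IF) (intgZ (2 * sqnormc b) IG).
have IL : intg leb (fun p => wt s p * sqnormc (a * F p + b * G p)).
  apply: intg_le IR => [|p].
    by apply: meas_wn; apply: cmeasD; apply: cmeasM => //; exact: cmeas_cst.
  by rewrite ger0_norm// mulr_ge0 ?wt_ge0 ?sqnormc_ge0.
split=> //; rewrite /wn -[2 * sqnormc a * _]RintZ// -[2 * sqnormc b * _]RintZ// -RintD; [|exact: intgZ..].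
exact: le_Rint.
Qed.

Lemma h1_wt s phi C : s <= 1 -> h1 phi C ->
  intg leb (fun p => wt s p * sqnormc (fourier phi p)) /\ wn s (fourier phi) <= n.+1%:R * (C * @I2 R n).
Proof.
move=> s1 h; have [I1 b1] := h1_fourier h; have mF := cmeas_fourier (h1_cintg h).
have le p : wt s p * sqnormc (fourier phi p) <= w1 p * sqnormc (fourier phi p).
  by rewrite ler_wpM2r ?sqnormc_ge0// wt_le.
have IL : intg leb (fun p => wt s p * sqnormc (fourier phi p)).
  apply: intg_le I1 => [|p]; first exact: meas_wn.
  by rewrite ger0_norm// mulr_ge0 ?wt_ge0 ?sqnormc_ge0.
by split=> //; apply: le_trans b1; exact: le_Rint.
Qed.

Lemma test_cintg g : test_fun g -> cintegrable leb (gC g).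
Proof. by move=> /test_h1[C]; exact: h1_cintg. Qed.

Lemma test_meas g : test_fun g -> cmeasurable (fourier (gC g)).
Proof. by move=> /test_cintg; exact: cmeas_fourier. Qed.

Lemma test_wt s g : s <= 1 -> test_fun g ->
  intg leb (fun p => wt s p * sqnormc (fourier (gC g) p)).
Proof. by move=> s1 /test_h1[C hC]; have [] := h1_wt s1 hC. Qed.

(** The value at the conjugate of [psi] of the distribution with Fourier transform [F], computed in
    momentum space. It makes sense for every [psi] of class [h1], in particular for cutoffs that are
    not smooth. *)
Definition Lam F psi : R[i] := cint (fun q => Num.conj (fourier psi q) * F q).

Section pairing.
Variable s : R.
Hypothesis s1 : -1 <= s <= 1.

Let s_le : s <= 1. Proof. by case/andP: s1. Qed.
Let sN_le : - s <= 1. Proof. by case/andP: s1; lra. Qed.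

Lemma Lam_cs F psi C : cmeasurable F -> intg leb (fun p => wt s p * sqnormc (F p)) -> h1 psi C ->
  cintegrable leb (fun q => Num.conj (fourier psi q) * F q) /\
  sqnormc (Lam F psi) <= wn (- s) (fourier psi) * wn s F.
Proof.
move=> mF IF h; have [Ip _] := h1_wt sN_le h.
apply: cs_weight => //; first exact: cmeas_fourier (h1_cintg h).
- by move=> p; rewrite mulr_ge0 ?wt_ge0 ?sqnormc_ge0.
- by move=> p; rewrite mulr_ge0 ?wt_ge0 ?sqnormc_ge0.
- by apply: nearW => p; rewrite mulrACA wtVM mul1r.
Qed.

Lemma Lam_bnd F psi C : cmeasurable F -> intg leb (fun p => wt s p * sqnormc (F p)) -> h1 psi C ->
  sqnormc (Lam F psi) <= n.+1%:R * (C * @I2 R n) * wn s F.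
Proof.
move=> mF IF h; apply: le_trans (Lam_cs mF IF h).2 _.
by rewrite ler_wpM2r ?wn_ge0//; exact: (h1_wt sN_le h).2.
Qed.

Lemma Lam_linF F G (a b : R[i]) psi C : cmeasurable F -> cmeasurable G ->
  intg leb (fun p => wt s p * sqnormc (F p)) -> intg leb (fun p => wt s p * sqnormc (G p)) ->
  h1 psi C -> Lam (fun p => a * F p + b * G p) psi = a * Lam F psi + b * Lam G psi.
Proof.
move=> mF mG IF IG h; have [I1 _] := Lam_cs mF IF h; have [J1 _] := Lam_cs mG IG h.
rewrite /Lam -cintZ// -cintZ// -cintD; [|exact: cintgZ..].
by apply: eq_cint => q; ring.
Qed.

Lemma fourier_lin phi psi (a : R[i]) p : cintegrable leb phi -> cintegrable leb psi ->
  fourier (fun x => a * phi x + psi x) p = a * fourier phi p + fourier psi p.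
Proof.
move=> I1 I2.
have J1 : cintegrable leb (fun x => cis (- dotr p x) * phi x).
  by under eq_fun do rewrite -dotrNl; exact: cintg_cisM.
have J2 : cintegrable leb (fun x => cis (- dotr p x) * psi x).
  by under eq_fun do rewrite -dotrNl; exact: cintg_cisM.
rewrite !fourierE mulrCA -mulrDr -(cintZ a J1) -cintD//; last exact: cintgZ.
by congr (_ * _); apply: eq_cint => x; ring.
Qed.

Lemma Lam_lin F phi psi (a : R[i]) C D : cmeasurable F -> intg leb (fun p => wt s p * sqnormc (F p)) ->
  h1 phi C -> h1 psi D ->
  Lam F (fun x => a * phi x + psi x) = Num.conj a * Lam F phi + Lam F psi.
Proof.
move=> mF IF h k; have [I1 _] := Lam_cs mF IF h; have [J1 _] := Lam_cs mF IF k.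
rewrite /Lam -cintZ// -cintD//; last exact: cintgZ.
apply: eq_cint => q; rewrite fourier_lin ?rmorphD ?rmorphM/= ?mulrDl ?mulrA//.
- exact: h1_cintg h.
- exact: h1_cintg k.
Qed.

Lemma Lam_fourier phi psi C D : h1 phi C -> h1 psi D ->
  Lam (fourier phi) psi = cint (fun x => Num.conj (psi x) * phi x).
Proof.
move=> h k; have Ih := h1_cintg h; have Ik := h1_cintg k.
have qh := h1_sqi h; have qk := h1_sqi k.
rewrite /Lam -(ip_mk (sqi_fourier Ik qk) (sqi_fourier Ih qh)) -(ip_mk qk qh).
have e1 := FF_mk Ih qh; have e2 := FF_mk Ik qk.
exact: (etrans (congr2 (@L2_ip _ _ R leb) (esym e2) (esym e1)) (FF_ip _ _)).
Qed.

(** With a test function [g] the pairing is an ordinary integral ([Lam_fourier]), so [Lam F psi] is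
    approximated by such integrals with an error controlled by the Sobolev distance. *)
Lemma Lam_cvg F psi C g : cmeasurable F -> intg leb (fun p => wt s p * sqnormc (F p)) ->
  h1 psi C -> test_fun g ->
  sqnormc (Lam F psi - cint (fun x => Num.conj (psi x) * gC g x)) <=
  n.+1%:R * (C * @I2 R n) * wn s (fun p => F p - fourier (gC g) p).
Proof.
move=> mF IF h tg; have [D k] := test_h1 tg.
have mg := test_meas tg; have Ig := test_wt s_le tg.
have E : (fun p => F p - fourier (gC g) p) = (fun p => 1 * F p + (-1) * fourier (gC g) p).
  by apply/funext => p; ring.
have [Il _] := wn_lin 1 (-1) mF mg IF Ig.
have -> : Lam F psi - cint (fun x => Num.conj (psi x) * gC g x) =
    Lam (fun p => F p - fourier (gC g) p) psi.
  by rewrite E (Lam_linF _ _ mF mg IF Ig h) (Lam_fourier k h); ring.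
by rewrite E; apply: Lam_bnd => //; rewrite -E; exact: cmeasB.
Qed.

(** Pairings of [psi] with real test functions are real, and [Lam F psi] is a limit of them. *)
Lemma Lam_real F psi C : Sob s F -> h1 psi C -> (forall x, Im (psi x) = 0) -> Im (Lam F psi) = 0.
Proof.
move=> [mF IF aF] h rp; set D := n.+1%:R * (C * @I2 R n).
have D0 : 0 <= D by rewrite mulr_ge0// mulr_ge0 ?I2_ge0 ?(h1_C0 h).
apply/eqP; rewrite -sqrf_eq0 eq_le sqr_ge0 andbT.
apply: (@small_le _ _ D) => // e e0; have [g tg ge] := aF e e0.
have b1 := Lam_cvg mF IF h tg; set z := cint _ in b1.
have z0 : Im z = 0.
  rewrite /z Im_cint; apply: Rint_zero => x.
  by rewrite cImM cImJ rp /=; ring.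
have : Im (Lam F psi) ^+ 2 <= sqnormc (Lam F psi - z).
  by rewrite /sqnormc cImD cImN z0 subr0 lerDr sqr_ge0.
move=> h2; apply: le_trans h2 (le_trans b1 _).
by rewrite ler_wpM2l// ltW.
Qed.

End pairing.
End sobolev_class.

Section sobolevB_characterization.
Context {R : realType} {n : nat}.
Local Notation leb := (@lebesgue_rV R n).
Local Notation Rn := 'rV[R]_n.
Local Notation L2 := (L2 leb).
Local Notation cint := (cintegral leb).
Implicit Types (phi psi F G H : Rn -> R[i]) (p x y b : Rn) (g : Rn -> R).
Implicit Types (f h : (Rn -> R[i]) -> R[i]) (s : R).

(** [sobolev_norm] is an extended real that refers to the chosen transform [fourierD]. A strict
    finite bound on it encodes integrability and can be read off any transform [H]. *)
Lemma sob_norm_ltP s h H (e : R) : is_fourier h H -> 0 < e ->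
  (sobolev_norm s h < e%:E)%E <->
  intg leb (fun p => wt s p * sqnormc (H p)) /\ wn s H < e ^+ 2.
Proof.
move=> hH e0; have mH := hH.1; have mD : cmeasurable (fourierD h).
  by apply: (is_fourierD _).1; exists H.
have E : (\int[leb]_p ((1 + sqnormr p) `^ s * sqnormc (fourierD h p))%:E =
    \int[leb]_p (wt s p * sqnormc (H p))%:E)%E.
  apply: ge0_ae_eq_integral => //.
  - by apply/measurable_EFinP; exact: meas_wn.
  - by apply/measurable_EFinP; exact: meas_wn.
  - by move=> p _; rewrite lee_fin mulr_ge0 ?powR_ge0 ?sqnormc_ge0.
  - by move=> p _; rewrite lee_fin mulr_ge0 ?powR_ge0 ?sqnormc_ge0.
  - by apply: filterS (fourierD_ae hH) => p e' _; rewrite e'.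
have fin : intg leb (fun p => wt s p * sqnormc (H p)) ->
    sobolev_norm s h = (Num.sqrt (wn s H))%:E.
  by move=> I; rewrite /sobolev_norm E RintE// poweR_EFin powR12_sqrt// wn_ge0.
have sq : Num.sqrt (wn s H) < e <-> wn s H < e ^+ 2.
  rewrite -(ltr_pXn2r (n := 2)) ?nnegrE ?sqrtr_ge0 ?(ltW e0)//.
  by rewrite sqr_sqrtr ?wn_ge0.
split=> [lt|[I lt]]; last by rewrite fin// lte_fin; apply/sq.
suff I : intg leb (fun p => wt s p * sqnormc (H p)).
  by split=> //; apply/sq; rewrite -lte_fin -fin.
apply/intg_lty; first exact: meas_wn.
  by move=> p; rewrite mulr_ge0 ?wt_ge0 ?sqnormc_ge0.
rewrite -E; apply: (@lty_poweRy _ _ 2^-1); first by rewrite invr_eq0.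
by apply: lt_trans lt _; exact: ltry.
Qed.

Lemma sobolevB_Sob s f : s <= 1 -> sobolevB s f -> Sob s (fourierD f) /\ is_fourier f (fourierD f).
Proof.
move=> s1 [[tf rf ef lf] af]; have hf := is_fourierD ef; split=> //; split; first exact: hf.1.
  have [e ee] : exists e : R, (sobolev_norm s f < e%:E)%E.
    have := lf; case E : (sobolev_norm s f) => [r| |] // _; last by exists 0; rewrite ltNyr.
    by exists (r + 1); rewrite lte_fin ltrDl.
  have ee' : (sobolev_norm s f < (`|e| + 1)%:E)%E.
    by apply: lt_le_trans ee _; rewrite lee_fin; have := ler_norm e; lra.
  have e0 : 0 < `|e| + 1 by rewrite ltr_wpDl.
  by have [] := (sob_norm_ltP s hf e0).1 ee'.
move=> e e0; have se : 0 < Num.sqrt e by rewrite sqrtr_gt0.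
have [g tg lg] := af _ se; exists g => //.
have := (sob_norm_ltP s (is_fourierB hf (is_fourier_L1 (test_cintg tg))) se).1 lg.
by rewrite sqr_sqrtr ?(ltW e0)// => -[].
Qed.

Lemma h1J phi C : h1 phi C -> h1 (fun x => Num.conj (phi x)) C.
Proof.
move=> h; split=> [|x|j t x t0 t1]; first exact/cmeasJ/(h1_meas h).
  by rewrite sqnormcJ; exact: h1_bnd h x.
by rewrite -rmorphB sqnormcJ; exact: h1_lip h j t x t0 t1.
Qed.

(** The inverse Fourier transform of [F], written with the isometry [FF] rather than the integral
    [fourier]: at [fourier phi] the inversion is then the identity [cjFF], without integrability of
    [fourier phi]. *)
Definition inv_distr F (psi : Rn -> R[i]) : R[i] :=
  cint (fun q => Num.conj (L2_fun (FF (cj (mkL2 leb psi))) q) * F q).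

Lemma inv_distr_h1 F psi C : cmeasurable F -> h1 psi C ->
  inv_distr F psi = Lam F (fun x => Num.conj (psi x)).
Proof.
move=> mF h; have h' := h1J h; have q := h1_sqi h; have q' := h1_sqi h'; have I' := h1_cintg h'.
have e : FF (cj (mkL2 leb psi)) = mkL2 leb (fourier (fun x => Num.conj (psi x))).
  exact: (etrans (congr1 FF (cj_mk q)) (FF_mk I' q')).
apply: cint_ae.
- by apply: cmeasM => //; apply: cmeasJ; exact: (L2_sqi _).1.
- by apply: cmeasM => //; apply: cmeasJ; exact: cmeas_fourier.
- by rewrite e; apply: filterS (mkL2_ae (sqi_fourier I' q')) => p ->.
Qed.

Lemma schwartz_w1 phi : schwartz phi -> intg leb (fun x => w1 x * sqnormc (phi x)).
Proof.
move=> sp; have [B hB] := sp.2 n.+1.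
have mp := cintg_meas (schwartz_cintg sp).
apply: (intg_le (g := fun x => B ^+ 2 * lorentz x)); last by apply: intgZ; exact: intg_lorentzn.
  by apply: measurable_funM; [exact: measurable_w1|exact: meas_sqnormc].
move=> x; have := hB [::] x isT; rewrite -/(w1 x) /=.
have W := w1_gt0 x; have W1 := w1_ge1 x.
rewrite ger0_norm ?mulr_ge0 ?sqnormc_ge0 ?(ltW W)//.
rewrite -{2}(sqr_sqrtr (sqnormc_ge0 (phi x))); set q := Num.sqrt _ => hq.
have q0 : 0 <= q by exact: sqrtr_ge0.
have B0 : 0 <= B by apply: le_trans hq; rewrite mulr_ge0// exprn_ge0// ltW.
have hl := lorentz_bound x; rewrite -/(w1 x) in hl.
apply: le_trans (ler_wpM2l (sqr_ge0 B) hl); rewrite ler_pdivlMr ?exprn_gt0//.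
have : (w1 x ^+ n.+1 * q) ^+ 2 <= B ^+ 2.
  by rewrite ler_pXn2r ?nnegrE// mulr_ge0// exprn_ge0// ltW.
apply: le_trans; rewrite exprMn mulrAC ler_wpM2r ?sqr_ge0//.
by rewrite -exprS -exprM ler_weXn2l// muln2 -addnn leq_addr.
Qed.

Lemma Sob_sobolevB s F : -1 <= s <= 1 -> Sob s F -> exists f, sobolevB s f /\ is_fourier f F.
Proof.
move=> s1 sF; have [mF IF aF] := sF; exists (inv_distr F).
have sN : - s <= 1 by case/andP: s1; lra.
have HF : is_fourier (inv_distr F) F.
  split=> // phi sp; have Ip := schwartz_cintg sp; have qp := schwartz_sqi sp.
  have mp := cintg_meas Ip.
  have Ia : intg leb (fun p => wt (- s) p * sqnormc (Num.conj (phi p))).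
    apply: intg_le (schwartz_w1 sp) => [|p]; first by apply: meas_wn; exact: cmeasJ.
    by rewrite ger0_norm ?mulr_ge0 ?wt_ge0 ?sqnormc_ge0// sqnormcJ ler_wpM2r ?sqnormc_ge0// wt_le.
  have I : cintegrable leb (fun p => Num.conj (Num.conj (phi p)) * F p).
    have [|||//] := cs_weight (cmeasJ mp) mF Ia IF.
    - by move=> p; rewrite mulr_ge0 ?wt_ge0 ?sqnormc_ge0.
    - by move=> p; rewrite mulr_ge0 ?wt_ge0 ?sqnormc_ge0.
    - by apply: nearW => p; rewrite mulrACA wtVM mul1r.
  have E p : Num.conj (Num.conj (phi p)) * F p = F p * phi p by rewrite conjcK2 mulrC.
  rewrite (funext E) in I; split=> //.
  have e : FF (cj (mkL2 leb (fourier phi))) = cj (mkL2 leb phi).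
    rewrite -(cjK (FF _)); apply: (congr1 cj).
    exact: (etrans (congr1 (fun u => cj (FF (cj u))) (esym (FF_mk Ip qp))) (cjFF _)).
  apply: cint_ae.
  - by apply: cmeasM => //; apply: cmeasJ; exact: (L2_sqi _).1.
  - exact: cmeasM.
  - rewrite e; apply: filterS2 (cj_fun (mkL2 leb phi)) (mkL2_ae qp) => p -> ->.
    by rewrite conjcK2 mulrC.
split=> //; split; last first.
  move=> e e0; have [g tg lg] := aF (e ^+ 2) (exprn_gt0 _ e0); exists g => //.
  have s_1 : s <= 1 by case/andP: s1.
  apply/(sob_norm_ltP s (is_fourierB HF (is_fourier_L1 (test_cintg tg))) e0); split=> //.
  have [J _] := wn_lin 1 (-1) mF (test_meas tg) IF (test_wt s_1 tg).
  rewrite (_ : (fun p => _) = (fun p => wt s p * sqnormc (1 * F p + -1 * fourier (gC g) p)))//.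
  by apply/funext => p; rewrite mul1r mulN1r.
have [c c0 hc] := @schwartz_h1 R n.
split; last 1 first.
- have e0 : 0 < Num.sqrt (wn s F) + 1 by rewrite ltr_wpDl ?sqrtr_ge0.
  have : (sobolev_norm s (inv_distr F) < (Num.sqrt (wn s F) + 1)%:E)%E.
    apply/(sob_norm_ltP s HF e0); split=> //.
    by rewrite sqrrD sqr_sqrtr ?wn_ge0//; have := sqrtr_ge0 (wn s F); lra.
  by move/lt_trans; apply; exact: ltry.
- split=> [a phi psi sp sq|].
    have [C hC] := schwartz_h1_ex sp; have [D hD] := schwartz_h1_ex sq.
    have hlin := h1D (h1Z a hC) hD.
    rewrite (inv_distr_h1 mF hlin) (inv_distr_h1 mF hC) (inv_distr_h1 mF hD).
    rewrite (_ : (fun x => Num.conj (a * phi x + psi x)) =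
      (fun x => Num.conj a * Num.conj (phi x) + Num.conj (psi x))); last first.
      by apply/funext => x; rewrite rmorphD rmorphM.
    by rewrite (Lam_lin s1 _ mF IF (h1J hC) (h1J hD)) conjcK2.
  exists n.+1, (Num.sqrt (n.+1%:R * (c * @I2 R n) * wn s F)) => phi B sp bp.
  have B0 : 0 <= B.
    by apply: le_trans (bp [::] 0 isT); rewrite mulr_ge0 ?sqrtr_ge0// exprn_ge0// ltW// w1_gt0.
  have h := hc _ _ sp bp; rewrite (inv_distr_h1 mF h).
  have le := Lam_bnd s1 mF IF (h1J h); apply: le_trans (ler_wsqrtr le) _.
  rewrite (_ : _ * wn s F = (n.+1%:R * (c * @I2 R n) * wn s F) * B ^+ 2); last by ring.
  by rewrite sqrtrM ?sqrtr_sqr ?ger0_norm// !mulr_ge0 ?wn_ge0 ?I2_ge0.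
- move=> phi sp rp; have [C hC] := schwartz_h1_ex sp.
  rewrite (inv_distr_h1 mF hC); apply: (Lam_real s1 sF (h1J hC)) => x.
  by rewrite cImJ rp oppr0.
- by exists F.
Qed.
End sobolevB_characterization.

(** * Pointwise evaluation *)

Section cutoff.
Context {R : realType} {n : nat}.
Local Notation leb := (@lebesgue_rV R n).
Local Notation Rn := 'rV[R]_n.
Local Notation cint := (cintegral leb).
Implicit Types (phi psi F G : Rn -> R[i]) (p q x y b : Rn) (g : Rn -> R).

Definition chi1 (t : R) : R := Num.max 0 (Num.min 1 (2 - `|t|)).

Lemma chi1_ge0 t : 0 <= chi1 t. Proof. by rewrite le_max lexx. Qed.

Lemma chi1_le1 t : chi1 t <= 1. Proof. by rewrite ge_max ler01 ge_min lexx. Qed.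

Lemma chi1_eq1 t : `|t| <= 1 -> chi1 t = 1.
Proof. by move=> t1; rewrite /chi1 min_l ?max_r//; lra. Qed.

Lemma chi1_eq0 t : 2 <= `|t| -> chi1 t = 0.
Proof. by move=> t2; rewrite /chi1 max_l// ge_min; apply/orP; right; lra. Qed.

Lemma chi1_lip t u : `|chi1 t - chi1 u| <= `|t - u|.
Proof.
have h (a b : R) : `| Num.max 0 (Num.min 1 a) - Num.max 0 (Num.min 1 b)| <= `|a - b|.
  rewrite /Num.max /Num.min; rewrite ler_norml.
  have h1 := ler_norm (a - b); have := ler_norm (b - a); rewrite [`|b - a|]distrC => h2.
  by case: (ltP 1 a) => h3; case: (ltP 1 b) => h4; case: ltP => h5; case: ltP => h6;
    apply/andP; split; lra.
apply: le_trans (h _ _) _; rewrite (_ : 2 - `|t| - (2 - `|u|) = `|u| - `|t|); last by ring.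
by apply: le_trans (ler_dist_dist _ _) _; rewrite distrC.
Qed.

(** A Lipschitz cutoff, 1 on the unit ball and 0 outside the cube of half-side 2; first difference
    quotients are all that [h1] asks for. *)
Definition chi x : R := \prod_i chi1 (x ord0 i).

Lemma chi_ge0 x : 0 <= chi x. Proof. by apply: prodr_ge0 => i _; exact: chi1_ge0. Qed.

Lemma chi_le1 x : chi x <= 1.
Proof. by apply: prodr_ile1 => i _; rewrite chi1_ge0 chi1_le1. Qed.

Lemma chi_eq1 x : sqnormr x < 1 -> chi x = 1.
Proof.
move=> x1; rewrite /chi big1// => i _; apply: chi1_eq1.
rewrite -(expr_le1 (n := 2))// real_normK ?num_real//.
by apply: le_trans (sqr_coor_le x i) (ltW x1).
Qed.

Lemma chi_eq0 x i : 2 <= `|x ord0 i| -> chi x = 0.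
Proof. by move=> x2; rewrite /chi (bigD1 i)//= chi1_eq0// mul0r. Qed.

Lemma chi_lip j (t : R) x : `|chi (x + t *: delta_mx ord0 j) - chi x| <= `|t|.
Proof.
rewrite /chi (bigD1 j)//= [X in _ - X](bigD1 j)//= !mxE !eqxx mulr1.
rewrite (eq_bigr (fun i => chi1 (x ord0 i))); last first.
  by move=> i ij; rewrite !mxE eqxx (negbTE ij) mulr0 addr0.
set P := \prod_(i | _) _; rewrite -mulrBl normrM.
have P0 : 0 <= P by apply: prodr_ge0 => i _; exact: chi1_ge0.
have P1 : P <= 1 by apply: prodr_ile1 => i _; rewrite chi1_ge0 chi1_le1.
rewrite (ger0_norm P0); have := chi1_lip (x ord0 j + t) (x ord0 j).
rewrite addrAC subrr add0r => h; apply: le_trans h; exact: ler_piMr.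
Qed.

Lemma measurable_chi : measurable_fun setT chi.
Proof.
apply: measurable_prod => i _; apply: (@measurableT_comp _ _ _ _ _ _ chi1).
  apply: measurable_maxr => //; apply: measurable_minr => //.
  by apply: measurable_funB => //; exact: normr_measurable.
exact: measurable_coor.
Qed.

(** Each factor [1 + x_i^2] is at most 10 on the box, and [100 = 10^2]. *)
Lemma lorentz_box x : (forall i, `|x ord0 i| <= 3) -> 1 <= 100 ^+ n * lorentz x ^+ 2.
Proof.
move=> bx; rewrite /lorentz -prodrXl -[X in 100 ^+ X]card_ord -prodr_const -big_split/=.
apply: (big_ind (fun z => 1 <= z)) => [//|a b|i _]; first exact: mulr_ege1.
have : x ord0 i ^+ 2 <= 9.
  by rewrite -real_normK ?num_real//; have := bx i; have := normr_ge0 (x ord0 i); nra.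
have := sqr_ge0 (x ord0 i); set a := _ ^+ 2 => a0 a9.
rewrite exprVn ler_pdivlMr ?exprn_gt0 ?ltr_pwDl// mul1r; nra.
Qed.

(** Outside the box of half-side 3, [x] and its translates by at most 1 along an axis lie where
    [chi] vanishes, so bounds on [m] are needed in the box only. The factor 4 is [2 + 2], from the
    two terms of the product rule. *)
Lemma chi_h1 (m : Rn -> R[i]) (A : R) : cmeasurable m ->
  (forall x, (forall i, `|x ord0 i| <= 3) -> sqnormc (m x) <= A) ->
  (forall j t x, 0 < t -> t <= 1 -> (forall i, `|x ord0 i| <= 3) ->
     sqnormc (m (x + t *: delta_mx ord0 j) - m x) <= t ^+ 2 * A) ->
  h1 (fun x => (chi x)%:C * m x) (4 * 100 ^+ n * A).
Proof.
move=> mm bm lm.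
have A0 : 0 <= A.
  by apply: le_trans (bm 0 _); rewrite ?sqnormc_ge0// => i; rewrite mxE normr0.
have box x : (forall i, `|x ord0 i| <= 3) \/ exists i, 3 < `|x ord0 i|.
  have [|/existsNP[i /negP]] := pselect (forall i, `|x ord0 i| <= 3); first by left.
  by rewrite -ltNge; right; exists i.
have A1 x : (forall i, `|x ord0 i| <= 3) -> 4 * A <= 4 * 100 ^+ n * A * lorentz x ^+ 2.
  move=> bx; have := ler_wpM2l A0 (lorentz_box bx); lra.
have P0 x : 0 <= 4 * 100 ^+ n * A * lorentz x ^+ 2.
  by rewrite mulr_ge0 ?sqr_ge0// mulr_ge0.
have c2 x : chi x ^+ 2 <= 1 by rewrite expr_le1 ?chi_le1 ?chi_ge0.
split.
- by apply: cmeasM => //; apply: cmeasR; exact: measurable_chi.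
- move=> x; case: (box x) => [bx|[i i3]]; last first.
    by rewrite (@chi_eq0 _ i) ?mul0r ?sqnormc0//; lra.
  apply: le_trans (A1 x bx); rewrite sqnormcM sqnormcR.
  by have := bm x bx; have := sqnormc_ge0 (m x); have := c2 x; have := sqr_ge0 (chi x); nra.
- move=> j t x t0 t1; case: (box x) => [bx|[i i3]]; last first.
    rewrite (@chi_eq0 _ i); last first.
      rewrite !mxE eqxx /=; have := ler_normB (x ord0 i + t * (i == j)%:R) (t * (i == j)%:R).
      rewrite addrK; have : `|t * (i == j)%:R| <= 1.
        by rewrite normrM (ger0_norm (ltW t0)); case: (i == j); rewrite ?normr1 ?normr0 ?mulr1 ?mulr0.
      by lra.
    rewrite (@chi_eq0 _ i); last by lra.
    by rewrite !mul0r subrr sqnormc0 mulr_ge0 ?sqr_ge0.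
  set e := t *: _; rewrite (_ : _ - _ =
    (chi (x + e))%:C * (m (x + e) - m x) + (chi (x + e) - chi x)%:C * m x); last first.
    by rewrite rmorphB; ring.
  apply: le_trans (sqnormcD_le _ _) _; rewrite !sqnormcM !sqnormcR.
  have h1 := lm j t x t0 t1 bx; rewrite -/e in h1.
  have h2 : (chi (x + e) - chi x) ^+ 2 <= t ^+ 2.
    by rewrite -real_normK ?num_real// -[X in _ <= X]real_normK ?num_real// ler_pXn2r ?nnegrE// chi_lip.
  have h3 := bm x bx; have h4 := sqnormc_ge0 (m x); have h5 := sqr_ge0 (chi (x + e)).
  have h6 := c2 (x + e); have h7 := sqnormc_ge0 (m (x + e) - m x).
  have h8 := sqr_ge0 t; have h9 := sqr_ge0 (chi (x + e) - chi x).
  apply: (@le_trans _ _ (t ^+ 2 * (4 * A))); last by rewrite ler_wpM2l ?A1.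
  have k1 : chi (x + e) ^+ 2 * sqnormc (m (x + e) - m x) <= t ^+ 2 * A by nra.
  have k2 : (chi (x + e) - chi x) ^+ 2 * sqnormc (m x) <= t ^+ 2 * A by exact: ler_pM.
  lra.
Qed.

Lemma conjR (a : R) : Num.conj (a%:C : R[i]) = a%:C.
Proof. by apply: complexP; rewrite ?cReJ ?cImJ //= oppr0. Qed.

Lemma conj_eq (z w : R[i]) : Re z = Re w -> Im z = - Im w -> z = Num.conj w.
Proof. by move=> e1 e2; apply: complexP; [rewrite cReJ|rewrite cImJ]. Qed.

Lemma sin_sqr_le (u : R) : sin u ^+ 2 <= u ^+ 2.
Proof.
wlog u0 : u / 0 <= u => [H|].
  have [|u0] := leP 0 u; first exact: H.
  by have := H (- u); rewrite sinN !sqrrN; apply; lra.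
have [->|u1] := eqVneq u 0; first by rewrite sin0.
have u2 : 0 < u by rewrite lt_def u1.
have [c _] : exists2 c, c \in `]0, u[%R & sin u - sin 0 = cos c * (u - 0).
  apply: MVT => //; apply: derivable_within_continuous => y _; exact: derivable_sin.
rewrite sin0 !subr0 => ->; rewrite exprMn.
have := sqr_ge0 (cos c); have := cos2Dsin2 c; have := sqr_ge0 (sin c); have := sqr_ge0 u; nra.
Qed.

Lemma cis_lip (u v : R) : sqnormc (cis (u + v) - cis u) <= v ^+ 2.
Proof.
have -> : cis (u + v) - cis u = cis u * (cis v - 1) by rewrite cisD; ring.
rewrite sqnormcM sqnormc_cis mul1r /sqnormc !cE /=.
have e : v = v / 2 + v / 2 by field.
have h := sin_sqr_le (v / 2); have cs := cos2Dsin2 (v / 2).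
rewrite {1 2}e cosD sinD; move: h cs; set c := cos _; set s := sin _ => h cs.
have -> : (c * c - s * s - 1) ^+ 2 + (s * c + c * s - 0) ^+ 2 = 4 * s ^+ 2.
  have -> : c * c = 1 - s ^+ 2 by rewrite -expr2 -cs; ring.
  by have c2 : c ^+ 2 = 1 - s ^+ 2; [rewrite -cs; ring|rewrite (_ : s * c + c * s - 0 = 2 * s * c); [rewrite exprMn c2; ring|ring]].
have -> : v ^+ 2 = 4 * (v / 2) ^+ 2 by field.
lra.
Qed.

(** As [chi] is 1 on the ball, pairing with [psi_ p] evaluates the Fourier transform at [p], up to
    [fnorm]. *)
Definition psi_ p x : R[i] := (chi x)%:C * cis (dotr p x).

Lemma psi_h1 p : exists C, h1 (psi_ p) C.
Proof.
exists (4 * 100 ^+ n * w1 p); apply: chi_h1; first exact: cmeas_cis.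
  by move=> x _; rewrite sqnormc_cis w1_ge1.
move=> j t x t0 t1 _; rewrite dotrDr; apply: le_trans (cis_lip _ _) _.
rewrite dotrZr dotrC dotr_delta exprMn ler_wpM2l ?sqr_ge0//.
by apply: le_trans (sqr_coor_le p j) _; rewrite lerDr.
Qed.

Fact chihat_key : {f | f = fourier (fun x => (chi x)%:C)}.
Proof. by eexists. Qed.
(* Opaque, as unification would otherwise unfold it down to integrals. *)
Definition chihat := sval chihat_key.

Lemma chihatE q : chihat q = fourier (fun x => (chi x)%:C) q.
Proof. by rewrite /chihat (svalP chihat_key). Qed.

Lemma chi_h1C : exists C, h1 (fun x => (chi x)%:C) C.
Proof.
have [C] := psi_h1 0; rewrite /psi_ => h; exists C; move: h.
by congr h1; apply/funext => x; rewrite dotr0l cis0 mulr1.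
Qed.

Lemma psi_fourier p q : fourier (psi_ p) q = chihat (q - p).
Proof.
rewrite chihatE !fourierE; congr (_ * _); apply: eq_cint => x.
rewrite /psi_ mulrCA -cisD mulrC; congr (cis _ * _).
by rewrite dotrDl dotrNl; ring.
Qed.

Fact ev_key : {f : (Rn -> R[i]) -> Rn -> R[i] | f = fun F p => (@fnorm R n)%:C * Lam F (psi_ p)}.
Proof. by eexists. Qed.
(* The continuous representative of [F], opaque as well. *)
Definition ev := sval ev_key.

Lemma evE F p : ev F p = (@fnorm R n)%:C * Lam F (psi_ p).
Proof. by rewrite /ev (svalP ev_key). Qed.

Lemma ev_test g p : test_fun g -> fourier (gC g) p = ev (fourier (gC g)) p.
Proof.
move=> tg; have [C h] := test_h1 tg; have [D k] := psi_h1 p.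
rewrite evE (Lam_fourier h k) fourierE; congr (_ * _); apply: eq_cint => x.
rewrite /psi_ rmorphM /= cisJ.
have [x1|x1] := ltP (sqnormr x) 1; last by rewrite /gC (test_support tg x1) !mulr0.
by rewrite (chi_eq1 x1) conjR mul1r.
Qed.

Lemma sqnormc_ev F p : sqnormc (ev F p) = @fnorm R n ^+ 2 * sqnormc (Lam F (psi_ p)).
Proof. by rewrite evE sqnormcM sqnormcR. Qed.

Section evaluation.
Variable s : R.
Hypothesis s1 : -1 <= s <= 1.
Variable F : Rn -> R[i].
Hypothesis sF : Sob s F.

Lemma ev_approx : exists g_ : nat -> Rn -> R, (forall k, test_fun (g_ k)) /\
  (forall k, wn s (fun p => F p - fourier (gC (g_ k)) p) < k.+1%:R^-1).
Proof.
have H k : exists g, test_fun g /\ wn s (fun p => F p - fourier (gC g) p) < k.+1%:R^-1.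
  have k0 : 0 < k.+1%:R^-1 :> R by rewrite invr_gt0.
  by have [g tg lg] := sob_apx sF k0; exists g.
by have [g_ h] := choice H; exists g_; split=> k; case: (h k).
Qed.

Lemma ev_diff p : exists2 D, 0 <= D & forall g, test_fun g ->
  sqnormc (ev F p - fourier (gC g) p) <= D * wn s (fun p => F p - fourier (gC g) p).
Proof.
have [D k] := psi_h1 p; exists (@fnorm R n ^+ 2 * (n.+1%:R * (D * @I2 R n))).
  by rewrite mulr_ge0 ?sqr_ge0// mulr_ge0// mulr_ge0 ?I2_ge0 ?(h1_C0 k).
move=> g tg; have [C h] := test_h1 tg.
have e : ev F p - fourier (gC g) p = (@fnorm R n)%:C *
    (Lam F (psi_ p) - cint (fun x => Num.conj (psi_ p x) * gC g x)).
  by rewrite (ev_test p tg) !evE (Lam_fourier h k) mulrBr.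
rewrite e sqnormcM sqnormcR -[X in _ <= X]mulrA; apply: ler_wpM2l; first exact: sqr_ge0.
exact: (Lam_cvg s1 (sob_meas sF) (sob_int sF) k tg).
Qed.

Lemma ev_cvg (g_ : nat -> Rn -> R) p : (forall k, test_fun (g_ k)) ->
  (forall k, wn s (fun p => F p - fourier (gC (g_ k)) p) < k.+1%:R^-1) ->
  (Re (fourier (gC (g_ k)) p) @[k --> \oo] --> Re (ev F p)) /\
  (Im (fourier (gC (g_ k)) p) @[k --> \oo] --> Im (ev F p)).
Proof.
move=> tg lg; have [D D0 hD] := ev_diff p.
have b k : sqnormc (ev F p - fourier (gC (g_ k)) p) <= D * k.+1%:R^-1.
  by apply: le_trans (hD _ (tg k)) _; rewrite ler_wpM2l// ltW.
have L : (Num.sqrt (D * k.+1%:R^-1)) @[k --> \oo] --> (0 : R).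
  rewrite -(sqrtr0 R); apply: continuous_cvg; first exact: sqrt_continuous.
  rewrite -(mulr0 D); apply: cvgM; [exact: cvg_cst|exact: cvg_harmonic].
have aux (f : R[i] -> R) : (forall z, `|f z| <= Num.sqrt (sqnormc z)) -> (forall z w, f (z - w) = f z - f w) ->
    f (fourier (gC (g_ k)) p) @[k --> \oo] --> f (ev F p).
  move=> f1 f2; apply/cvgrPdist_le => e e0.
  have [N _ hN] := (cvgrPdist_le _ _).1 L e e0; exists N => // k Nk /=.
  have := hN k Nk; rewrite /= sub0r normrN ger0_norm ?sqrtr_ge0// => h.
  by rewrite -f2; apply: le_trans (f1 _) (le_trans _ h); rewrite ler_wsqrtr.
by split; apply: aux => [z|z w]; rewrite -?sqrtr_sqr ?ler_wsqrtr ?cE0// /sqnormc ?lerDl ?lerDr sqr_ge0.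
Qed.

Lemma ev_meas : cmeasurable (ev F).
Proof.
have [g_ [tg lg]] := ev_approx.
split; [apply: (@measurable_fun_cvg _ _ _ _ (fun k p => Re (fourier (gC (g_ k)) p)))|
        apply: (@measurable_fun_cvg _ _ _ _ (fun k p => Im (fourier (gC (g_ k)) p)))].
- by move=> k; exact: (test_meas (tg k)).1.
- by move=> p _; exact: (ev_cvg p tg lg).1.
- by move=> k; exact: (test_meas (tg k)).2.
- by move=> p _; exact: (ev_cvg p tg lg).2.
Qed.

(** Test functions that approximate [F] in the weighted norm have transforms converging to [ev F] at
    every point; Fatou's lemma identifies the two limits. *)
Lemma ev_ae : {ae leb, forall p, F p = ev F p}.
Proof.
have [g_ [tg lg]] := ev_approx; have s_le : s <= 1 by case/andP: s1.
pose f k p := wt s p * sqnormc (F p - fourier (gC (g_ k)) p).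
have mF := sob_meas sF.
have If k : intg leb (f k).
  have [I _] := wn_lin 1 (-1) mF (test_meas (tg k)) (sob_int sF) (test_wt s_le (tg k)).
  rewrite (_ : f k = (fun p => wt s p * sqnormc (1 * F p + -1 * fourier (gC (g_ k)) p)))//.
  by apply/funext => p; rewrite mul1r mulN1r.
have H (e : R) : 0 < e -> [/\ {ae leb, forall p, 0 <= wt s p * sqnormc (F p - ev F p)},
    intg leb (fun p => wt s p * sqnormc (F p - ev F p)) &
    \int[leb]_p (wt s p * sqnormc (F p - ev F p)) <= e].
  move=> e0; apply: (@fatou_le _ _ _ _ f).
  - by move=> k; exact: intg_meas (If k).
  - by apply: meas_wn; apply: cmeasB => //; exact: ev_meas.
  - by move=> k p; rewrite mulr_ge0 ?wt_ge0 ?sqnormc_ge0.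
  - apply: nearW => p; have [c1 c2] := ev_cvg p tg lg.
    apply: cvgM; first exact: cvg_cst.
    rewrite /sqnormc; apply: cvgD; rewrite expr2.
      have c : (Re (F p - fourier (gC (g_ k)) p)) @[k --> \oo] --> Re (F p - ev F p).
        rewrite !cE0; under eq_fun do rewrite !cE0; apply: cvgB => //; exact: cvg_cst.
      by under eq_fun do rewrite expr2; exact: (cvgM c c).
    have c : (Im (F p - fourier (gC (g_ k)) p)) @[k --> \oo] --> Im (F p - ev F p).
      rewrite !cE0; under eq_fun do rewrite !cE0; apply: cvgB => //; exact: cvg_cst.
    by under eq_fun do rewrite expr2; exact: (cvgM c c).
  - have := (cvgrPdist_le _ _).1 (@cvg_harmonic R) e e0.
    move=> [N _ hN]; exists N => k Nk; rewrite RintE// lee_fin.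
    have := hN k Nk; rewrite sub0r normrN ger0_norm ?invr_ge0// => h.
    exact: le_trans (ltW (lg k)) h.
have [_ I _] := H 1 ltr01.
have Z : \int[leb]_p (wt s p * sqnormc (F p - ev F p)) = 0.
  apply/eqP; rewrite eq_le wn_ge0 andbT; apply: (@small_le _ _ 1) => // e e0.
  by rewrite mul1r; case: (H e e0).
have := Rint_eq0 I _ Z; move=> /(_ (fun p => mulr_ge0 (wt_ge0 s p) (sqnormc_ge0 _))).
apply: filterS => p /eqP; rewrite mulf_eq0 gt_eqF ?wt_gt0//= => /eqP/sqnormc_eq0/eqP.
by rewrite subr_eq0 => /eqP.
Qed.

(** True of the transform of a real test function, and preserved by pointwise limits. *)
Lemma ev_herm p : ev F (- p) = Num.conj (ev F p).
Proof.
have [g_ [tg lg]] := ev_approx.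
have [a b] := ev_cvg p tg lg; have [c d] := ev_cvg (- p) tg lg.
have E k : fourier (gC (g_ k)) (- p) = Num.conj (fourier (gC (g_ k)) p).
  have J : cintegrable leb (fun x => cis (- dotr p x) * gC (g_ k) x).
    by under eq_fun do rewrite -dotrNl; apply: cintg_cisM; exact: test_cintg.
  rewrite !fourierE rmorphM /= conjR; congr (_ * _); apply: etrans (cintJ J).
  apply: eq_cint => x; rewrite dotrNl.
  by rewrite -[RHS]/(Num.conj (cis (- dotr p x) * (g_ k x)%:C)) conjcM cisJ conjR.
have c' : Re (fourier (gC (g_ k)) (- p)) @[k --> \oo] --> Re (ev F p).
  by under eq_fun do rewrite E cReJ; exact: a.
have d' : Im (fourier (gC (g_ k)) (- p)) @[k --> \oo] --> - Im (ev F p).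
  by under eq_fun do rewrite E cImJ; exact: cvgN b.
have e1 := etrans (esym (cvg_lim (@Rhausdorff R) c)) (cvg_lim (@Rhausdorff R) c').
have e2 := etrans (esym (cvg_lim (@Rhausdorff R) d)) (cvg_lim (@Rhausdorff R) d').
exact: (conj_eq (e1 _ _) (e2 _ _)).
Qed.

End evaluation.
End cutoff.

(** * Integrable majorants for the kernels *)

Section one_dim_weights.
Context {R : realType}.
Local Notation leb1 := (@lebesgue_measure R).

(** The fundamental theorem of calculus on [[a k, b k]] bounds the integrals through the primitive,
    and Fatou's lemma passes to the union of the intervals. *)
Lemma intg_FTC (f F h : R -> R) (a b : nat -> R) (C : R) :
  (forall k, a k < b k) ->
  (forall k x, a k <= x <= b k -> {for x, continuous f} /\ is_derive x 1 F (f x)) ->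
  (forall k, F (b k) - F (a k) <= C) ->
  (forall k x, a k <= x <= b k -> h x = f x) ->
  measurable_fun setT h -> (forall x, 0 <= h x) ->
  (forall x, h x != 0 -> exists N, forall k, (N <= k)%N -> a k <= x <= b k) ->
  intg leb1 h.
Proof.
move=> ab hf FC hE mh h0 cov.
pose f_ k x := h x * \1_(`[a k, b k]%classic) x.
have mf k : measurable_fun setT (f_ k).
  by apply: measurable_funM => //; apply: measurable_indic; exact: measurable_itv.
have If k : (\int[leb1]_x (f_ k x)%:E = (F (b k) - F (a k))%:E)%E.
  have cF x : a k <= x <= b k -> {for x, continuous F}.
    move=> xk; apply: differentiable_continuous; apply/derivable1_diffP.
    by have [_ []] := hf k x xk.
  have e : (\int[leb1]_(x in `[a k, b k]) (f x)%:E = (F (b k))%:E - (F (a k))%:E)%E.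
   apply: continuous_FTC2 (ab k) _ _ _.
  - apply: continuous_in_subspaceT => x; rewrite inE /= in_itv /= => xk.
    by have [] := hf k x xk.
  - split.
    + move=> x; rewrite in_itv/= => /andP[ax xb].
      have [|_ []//] := hf k x; by rewrite !ltW.
    + by apply: cvg_at_right_filter; apply: cF; rewrite lexx ltW.
    + by apply: cvg_at_left_filter; apply: cF; rewrite lexx andbT ltW.
  - move=> x; rewrite in_itv/= => /andP[ax xb].
    have [|_ [_ e]] := hf k x; first by rewrite !ltW.
    by rewrite derive1E.
  rewrite EFinB -e [RHS]integral_mkcond; apply: eq_integral => x _.
  rewrite patchE /f_ indicE; case: ifPn => xk; last by rewrite mulr0.
  by rewrite mulr1 (hE k)//; move: xk; rewrite inE /= in_itv.
have f0 k x : 0 <= f_ k x by rewrite /f_ mulr_ge0.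
have [_ I _] : [/\ {ae leb1, forall x, 0 <= h x}, intg leb1 h & \int[leb1]_x h x <= C].
  apply: (@fatou_le _ _ R leb1 f_ h C) => //.
  - apply: nearW => x; apply: cvg_near_cst; have [hx|hx] := eqVneq (h x) 0.
      by apply: nearW => k; rewrite /f_ hx mul0r.
    have [N hN] := cov x hx; exists N => // k Nk /=.
    by rewrite /f_ indicE mem_set ?mulr1//= in_itv/= hN.
  - by exists 0%N => k _; rewrite If lee_fin.
by [].
Qed.

(** The exponents are made for products over coordinates: two factors [- 3/4] give [- 3/2] near 0,
    and three factors [- 4/3] of [h2_] give [- 4] at infinity. *)
Definition h1_ (t : R) := t `^ (- (3 / 4)) * \1_(`]0, 1]%classic) t.
Definition h2_ (t : R) := (1 + t) `^ (- (4 / 3)) * \1_(`[0, +oo[%classic) t.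

Lemma idrv_powR (c x : R) : 0 < x -> is_derive x 1 (fun t : R => t `^ c) (c * x `^ (c - 1)).
Proof. exact: is_derive1_powR. Qed.

Lemma h1__ge0 t : 0 <= h1_ t. Proof. by rewrite mulr_ge0 ?powR_ge0// indicE. Qed.
Lemma h2__ge0 t : 0 <= h2_ t. Proof. by rewrite mulr_ge0 ?powR_ge0// indicE. Qed.

Lemma continuous_powR (c x : R) : 0 < x -> {for x, continuous (fun t : R => t `^ c)}.
Proof.
move=> x0; apply: differentiable_continuous; apply/derivable1_diffP.
by have [] := idrv_powR c x0.
Qed.

Lemma measurable_powRr (c : R) : measurable_fun setT (fun t : R => t `^ c).
Proof. exact: measurable_powR. Qed.

Lemma intg_h1_ : intg leb1 h1_.
Proof.
(* [k.+2] rather than [k.+1], since the left end point has to stay strictly below 1. *)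
apply: (@intg_FTC (fun t => t `^ (- (3 / 4))) (fun t => 4 * t `^ (1 / 4)) h1_
  (fun k => k.+2%:R^-1) (fun=> 1) 4).
- by move=> k; rewrite invf_lt1 ?ltr1n.
- move=> k x /andP[ax _]; have x0 : 0 < x by apply: lt_le_trans ax; rewrite invr_gt0.
  split; first exact: continuous_powR.
  apply: (idrv_eq (idrvZ 4 (idrv_powR _ x0))).
  by rewrite mulrA (_ : 4 * (1 / 4) = 1) ?mul1r; [congr (_ `^ _); field|field].
- by move=> k; rewrite powR1 mulr1 gerBl mulr_ge0// powR_ge0.
- move=> k x /andP[ax x1]; rewrite /h1_ indicE mem_set ?mulr1//= in_itv/= x1 andbT.
  by apply: lt_le_trans ax; rewrite invr_gt0.
- apply: measurable_funM; first exact: measurable_powRr.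
  by apply: measurable_indic; exact: measurable_itv.
- exact: h1__ge0.
- move=> x; rewrite /h1_ mulf_eq0 negb_or indicE => /andP[_].
  case: (boolP (x \in _)) => [|_]; last by rewrite eqxx.
  rewrite inE /= in_itv/= => /andP[x0 x1] _.
  have [N hN] : exists N : nat, x^-1 <= N%:R.
    by exists (Num.trunc x^-1).+1; exact: ltW (truncnS_gt _).
  exists N => k Nk; rewrite x1 andbT.
  rewrite -(invrK x) lef_pV2 ?posrE ?invr_gt0//.
  by apply: le_trans hN _; rewrite ler_nat ltnW// ltnW// ltnS.
Qed.

Lemma intg_h2_ : intg leb1 h2_.
Proof.
apply: (@intg_FTC (fun t => (1 + t) `^ (- (4 / 3))) (fun t => - 3 * (1 + t) `^ (- (1 / 3))) h2_
  (fun=> 0) (fun k => k.+1%:R) 3).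
- by move=> k.
- move=> k x /andP[ax _]; have x0 : 0 < 1 + x by lra.
  have d1 := idrvD (idrv_cst (1 : R) x) (idrv_id x).
  split.
    apply: (@continuous_comp _ _ _ (fun t : R => 1 + t) (fun t => t `^ (- (4 / 3)))).
      by apply: differentiable_continuous; apply/derivable1_diffP; have [] := d1.
    exact: continuous_powR.
  apply: (idrv_eq (idrvZ (- 3) (idrv_comp (idrv_powR _ x0) d1))).
  by rewrite add0r mulr1 mulrA (_ : - 3 * - (1 / 3) = 1) ?mul1r; [congr (_ `^ _); field|field].
- move=> k; rewrite addr0 powR1 mulr1 opprK mulNr -lerBrDr subrr oppr_le0.
  by rewrite mulr_ge0// powR_ge0.
- by move=> k x /andP[ax x1]; rewrite /h2_ indicE mem_set ?mulr1//= in_itv/= ax.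
- apply: measurable_funM; last by apply: measurable_indic; exact: measurable_itv.
  apply: (@measurableT_comp _ _ _ _ _ _ (@powR R ^~ _)); first exact: measurable_powRr.
  exact: measurable_funD.
- exact: h2__ge0.
- move=> x; rewrite /h2_ mulf_eq0 negb_or indicE => /andP[_].
  case: (boolP (x \in _)) => [|_]; last by rewrite eqxx.
  rewrite inE /= in_itv/= andbT => x0 _; exists (Num.trunc x).+1 => k Nk; rewrite x0 /=.
  by apply: le_trans (ltW (truncnS_gt _)) _; rewrite ler_nat ltnW// ltnS.
Qed.

Lemma intg_opp1 (f : R -> R) : (forall x, 0 <= f x) -> intg leb1 f -> intg leb1 (fun t => f (- t)).
Proof.
move=> f0 If; have mf := intg_meas If; apply/intg_lty => //.
  by apply: (measurableT_comp mf); exact: measurable_funN.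
rewrite (@int_opp1 _ (fun x => (f x)%:E)) ?RintE ?ltry//; first exact/measurable_EFinP.
Qed.

Definition sw (t : R) := h1_ t + h1_ (- t) + (h2_ t + h2_ (- t)).

Lemma intg_sw : intg leb1 sw.
Proof.
apply: intgD; apply: intgD; [exact: intg_h1_| |exact: intg_h2_|].
  exact: intg_opp1 h1__ge0 intg_h1_.
exact: intg_opp1 h2__ge0 intg_h2_.
Qed.

Lemma sw_ge0 t : 0 <= sw t.
Proof. by rewrite addr_ge0// addr_ge0 ?h1__ge0 ?h2__ge0. Qed.

Lemma sw_low t : t != 0 -> `|t| <= 1 -> `|t| `^ (- (3 / 4)) <= sw t.
Proof.
move=> t0 t1; rewrite /sw; have := h2__ge0 t; have := h2__ge0 (- t).
have [tp|tn] := ltP 0 t.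
  have := h1__ge0 (- t); rewrite (ger0_norm (ltW tp)).
  have -> : h1_ t = t `^ (- (3 / 4)); last by lra.
  by rewrite /h1_ indicE mem_set ?mulr1//= in_itv/= tp -(ger0_norm (ltW tp)).
have tn' : t < 0 by rewrite lt_def eq_sym t0.
have := h1__ge0 t; rewrite (ltr0_norm tn').
have -> : h1_ (- t) = (- t) `^ (- (3 / 4)); last by lra.
by rewrite /h1_ indicE mem_set ?mulr1//= in_itv/= oppr_gt0 tn' -(ltr0_norm tn').
Qed.

Lemma sw_high t : (1 + `|t|) `^ (- (4 / 3)) <= sw t.
Proof.
rewrite /sw; have := h1__ge0 t; have := h1__ge0 (- t).
have H u : 0 <= u -> h2_ u = (1 + u) `^ (- (4 / 3)).
  by move=> u0; rewrite /h2_ indicE mem_set ?mulr1//= in_itv/= u0.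
have [tp|tn] := leP 0 t.
  by have := h2__ge0 (- t); rewrite (ger0_norm tp) (H t)//; lra.
by have := h2__ge0 t; rewrite (ltr0_norm tn) (H (- t)) ?oppr_ge0 ?(ltW tn)//; lra.
Qed.

End one_dim_weights.

Section weights_rV.
Context {R : realType} {n : nat}.
Local Notation leb := (@lebesgue_rV R n).
Local Notation Rn := 'rV[R]_n.
Implicit Types (p q x : Rn).

Definition nrm q : R := Num.sqrt (sqnormr q).

Lemma nrm_ge0 q : 0 <= nrm q. Proof. exact: sqrtr_ge0. Qed.

Lemma nrm_sqr q : nrm q ^+ 2 = sqnormr q. Proof. by rewrite sqr_sqrtr// sqnormr_ge0. Qed.

Lemma nrm_coor q i : `|q ord0 i| <= nrm q.
Proof. by rewrite -sqrtr_sqr ler_wsqrtr// sqr_coor_le. Qed.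

(** A single integrable function that dominates [|q|^{-3/2}] for [|q| <= 1] when [n >= 2] (off the
    coordinate hyperplanes), and [|q|^{-4}] for [|q| >= 1] up to the factor 16 when [n <= 3]. *)
Definition Sw q : R := \prod_i sw (q ord0 i).

Lemma intg_Sw : intg leb Sw. Proof. exact: (intg_prod (fun _ => intg_sw)).1. Qed.

Lemma Sw_ge0 q : 0 <= Sw q. Proof. by apply: prodr_ge0 => i _; exact: sw_ge0. Qed.

(** A product integrand with the indicator of [{0}] in coordinate [i] and Lorentz factors in the
    others has integral 0. *)
Lemma ae_coor_neq0 : {ae leb, forall q, forall i, q ord0 i != 0}.
Proof.
have H (i : 'I_n) : {ae leb, forall q, q ord0 i != 0}.
  pose w (k : 'I_n) (t : R) : R := if k == i then \1_[set 0] t else (1 + t ^+ 2)^-1.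
  have I0 : (\int[@lebesgue_measure R]_t (\1_[set 0] t)%:E = 0)%E.
    by rewrite integral_indic// setIT; exact: lebesgue_measure_set1.
  have Iw k : intg (@lebesgue_measure R) (w k).
    rewrite /w; case: eqP => _; last exact: intg_lorentz.
    apply/intg_lty => //; first exact: measurable_indic.
    by rewrite I0.
  have [Ip Ep] := intg_prod Iw.
  have Z : \int[leb]_x \prod_k w k (x ord0 k) = 0.
    by rewrite Ep (bigD1 i)//= /w eqxx /Rintegral I0 mul0r.
  have w0 x : 0 <= \prod_k w k (x ord0 k).
    apply: prodr_ge0 => k _; rewrite /w; case: eqP => _ //.
    by rewrite invr_ge0 addr_ge0// sqr_ge0.
  have := Rint_eq0 Ip w0 Z.
  apply: filterS => q /eqP; rewrite prodf_seq_eq0 => /hasP[k _ /= wk].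
  apply/negP => /eqP qi; move: wk; rewrite /w; case: (k =P i) => [->|_].
    by rewrite qi indicE mem_set// oner_eq0.
  by rewrite invr_eq0 gt_eqF// ltr_pwDl// sqr_ge0.
exact: filter_forall.
Qed.

(** Every [|q_i|] is at most [|q|], so each factor of [Sw] is at least [a]; as [a >= 1],
    [a ^ n >= a ^ 2]. *)
Lemma Sw_low q : (1 < n)%N -> (forall i, q ord0 i != 0) -> nrm q <= 1 ->
  nrm q `^ (- (3 / 2)) <= Sw q.
Proof.
move=> n1 q0 q1; pose a := nrm q `^ (- (3 / 4)).
have [i0] : exists i : 'I_n, true by exists (Ordinal (ltnW n1)).
move=> _; have nq : 0 < nrm q by apply: lt_le_trans (nrm_coor q i0); rewrite normr_gt0.
have a1 : 1 <= a.
  have e : 1 = 1 `^ (3 / 4) :> R by rewrite powR1.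
  by rewrite /a powRN invf_ge1 ?powR_gt0// [X in _ <= X]e ge0_ler_powR ?nnegrE ?nrm_ge0//; lra.
apply: (@le_trans _ _ (a ^+ n)).
  apply: (@le_trans _ _ (a ^+ 2)); last by rewrite ler_weXn2l.
  by rewrite /a -powR_mulrn ?powR_ge0// -powRrM (_ : - (3 / 4) * 2%:R = - (3 / 2)) //; field.
rewrite /Sw -[X in a ^+ X]card_ord -prodr_const; apply: ler_prod => i _.
rewrite (le_trans ler01 a1) /=; apply: le_trans (sw_low (q0 i) _); last exact: le_trans (nrm_coor q i) q1.
rewrite /a !powRN lef_pV2 ?posrE ?powR_gt0 ?normr_gt0//.
by rewrite ge0_ler_powR ?nnegrE ?nrm_ge0 ?nrm_coor//; lra.
Qed.

(** [1 + |q_i| <= 2 |q|], so each factor of [Sw] is at least [a]; as [a <= 1],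
    [a ^ n >= a ^ 3 = (2 |q|)^{-4}], and [16 = 2 ^ 4]. *)
Lemma Sw_high q : (n <= 3)%N -> 1 <= nrm q -> nrm q ^- 4 <= 16 * Sw q.
Proof.
move=> n3 q1; pose a := (2 * nrm q) `^ (- (4 / 3)).
have nq : 0 < 2 * nrm q by lra.
have a0 : 0 <= a by exact: powR_ge0.
have a1 : a <= 1.
  have e : 1 = 1 `^ (4 / 3) :> R by rewrite powR1.
  rewrite /a powRN invf_le1 ?powR_gt0// [X in X <= _]e.
  by rewrite ge0_ler_powR ?nnegrE//; lra.
apply: (@le_trans _ _ (16 * a ^+ n)).
  apply: (@le_trans _ _ (16 * a ^+ 3)); last by rewrite ler_wpM2l// ler_wiXn2l.
  have -> : a ^+ 3 = (2 * nrm q) ^- 4.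
    rewrite -powR_mulrn// /a -powRrM (_ : - (4 / 3) * 3%:R = - 4%:R); last by field.
    by rewrite powRN powR_mulrn// ltW.
  have -> : (2 * nrm q) ^+ 4 = 16 * nrm q ^+ 4 by ring.
  by move: (nrm q ^+ 4) => z; rewrite (invfM 16 z) mulrA divff// mul1r.
rewrite ler_wpM2l// /Sw -[X in a ^+ X]card_ord -prodr_const; apply: ler_prod => i _.
rewrite a0 /=; apply: le_trans (sw_high _).
have t0 : 0 < 1 + `|q ord0 i| by rewrite ltr_pwDl.
rewrite /a !powRN lef_pV2 ?posrE ?powR_gt0//.
have le : 1 + `|q ord0 i| <= 2 * nrm q by have := nrm_coor q i; lra.
by rewrite ge0_ler_powR ?nnegrE ?(ltW t0) ?(ltW nq)//; lra.
Qed.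

End weights_rV.

(** * Bounds for evaluation at a point *)

Section evaluation_bounds.
Context {R : realType} {n : nat}.
Local Notation leb := (@lebesgue_rV R n).
Local Notation Rn := 'rV[R]_n.
Local Notation cint := (cintegral leb).
Implicit Types (phi psi F G : Rn -> R[i]) (p q x y b : Rn) (g : Rn -> R).

Lemma intg_le_ae (u v : Rn -> R) : measurable_fun setT u -> {ae leb, forall x, `|u x| <= v x} ->
  intg leb v -> intg leb u.
Proof.
move=> mu uv Iv; apply: (intg_le (g := fun x => Num.max `|u x| (v x))) => //.
  by move=> x; rewrite le_max lexx.
have mw : measurable_fun setT (fun x => Num.max `|u x| (v x)).
  apply: measurable_maxr; last exact: intg_meas Iv.
  exact: (measurableT_comp (@normr_measurable R setT) mu).
by apply: (intg_ae mw _ Iv); apply: filterS uv => x ?; rewrite max_r.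
Qed.

Lemma nabs_sqrt (z : R[i]) : nabs z <= 2 * Num.sqrt (sqnormc z).
Proof.
have h (a b : R) : `|a| <= Num.sqrt (a ^+ 2 + b ^+ 2).
  by rewrite -sqrtr_sqr ler_wsqrtr// lerDl sqr_ge0.
have := h (Re z) (Im z); have := h (Im z) (Re z); rewrite /nabs /sqnormc [_ ^+ 2 + _]addrC; lra.
Qed.

(** The pointwise counterpart of [fourier_H1]: the bound of a transform by an [L^1] norm is applied
    to difference quotients. *)
Lemma h1_decay phi C : h1 phi C -> exists2 D, 0 <= D &
  forall q, w1 q * sqnormc (fourier phi q) <= D.
Proof.
move=> h; have Ip := h1_cintg h; have C0 := h1_C0 h.
pose I1 := \int[leb]_x lorentz x; have I10 : 0 <= I1 by apply: Rint_ge0 => x; exact: lorentz_ge0.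
pose D1 := (@fnorm R n * (4 * \int[leb]_x nabs (phi x))) ^+ 2.
pose D0 := (@fnorm R n * (4 * (2 * Num.sqrt C * I1))) ^+ 2.
exists (D1 + n%:R * D0) => [|q]; first by apply: addr_ge0; [exact: sqr_ge0|apply: mulr_ge0 => //; exact: sqr_ge0].
have f0 := @fnorm_ge0 R n.
have sq (z : R[i]) (d : R) : nabs z <= d -> sqnormc z <= d ^+ 2.
  move=> zd; apply: le_trans (sqnormc_nabs z) _; have := nabs_ge0 z => z0.
  by rewrite ler_pXn2r ?nnegrE//; exact: le_trans zd.
rewrite /w1 mulrDl mul1r; apply: lerD; first by apply: sq; exact: nabs_fourier.
rewrite /sqnormr /dotr mulr_suml -[X in X%:R * _]card_ord mulr_natl -sumr_const.
apply: ler_sum => j _; rewrite -expr2.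
have L : (m.+1%:R ^+ 2 * sqnormc (cis (m.+1%:R^-1 * q ord0 j) - 1) * sqnormc (fourier phi q))
    @[m --> \oo] --> q ord0 j ^+ 2 * sqnormc (fourier phi q).
  by apply: cvgM; [exact: cis_diff_cvg|exact: cvg_cst].
rewrite -(cvg_lim (@Rhausdorff R) L); apply: limr_le; first by apply/cvg_ex; eexists; exact: L.
apply: nearW => m; pose t : R := m.+1%:R^-1.
have t0 : 0 < t by rewrite invr_gt0.
have t1 : t <= 1 by rewrite invf_le1// ler1n.
pose e : Rn := delta_mx ord0 j; pose psi x := phi (x + t *: e) - phi x.
have Is := cintg_shift (t *: e) Ip.
have Ipsi : cintegrable leb psi.
  rewrite /psi; under eq_fun do rewrite -mulN1r; apply: cintgD => //; exact: cintgZ.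
have fE : sqnormc (cis (m.+1%:R^-1 * q ord0 j) - 1) * sqnormc (fourier phi q) = sqnormc (fourier psi q).
  rewrite fourierB// fourier_shift// -sqnormcM; congr sqnormc.
  by rewrite dotrZr dotrC dotr_delta mulrBl mul1r.
rewrite -mulrA fE; have tm : m.+1%:R * t = 1 by rewrite divff ?pnatr_eq0.
have np : \int[leb]_x nabs (psi x) <= t * (2 * Num.sqrt C * I1).
  rewrite /I1 mulrA -RintZ; last exact: intg_lorentzn.
  apply: le_Rint; [exact: intg_nabs|apply: intgZ; exact: intg_lorentzn|move=> x].
  apply: le_trans (nabs_sqrt _) _; rewrite -mulrA mulrCA -!mulrA ler_wpM2l//.
  have l0 := lorentz_ge0 x.
  rewrite -(ler_pXn2r (n := 2)) ?nnegrE ?mulr_ge0 ?sqrtr_ge0 ?(ltW t0)//.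
  rewrite sqr_sqrtr ?sqnormc_ge0// !exprMn sqr_sqrtr// mulrCA.
  exact: (h1_lip h j x t0 t1).
have := sq _ _ (nabs_fourier q Ipsi) => h1.
have : sqnormc (fourier psi q) <= t ^+ 2 * D0.
  apply: le_trans h1 _; rewrite /D0 -exprMn ler_pXn2r ?nnegrE.
  - by apply: le_trans (ler_wpM2l f0 (ler_wpM2l (ler0n R 4) np)) _; lra.
  - by [].
  - by rewrite !mulr_ge0// Rint_ge0// => x; exact: nabs_ge0.
  - by rewrite !mulr_ge0 ?sqrtr_ge0 ?(ltW t0).
move/(ler_wpM2l (sqr_ge0 (m.+1%:R : R))) => h2; apply: le_trans h2 _.
by rewrite mulrA -exprMn tm expr1n mul1r.
Qed.

Lemma wtH p : wt 2^-1 p = Num.sqrt (w1 p).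
Proof. by rewrite /wt powR12_sqrt// ltW// w1_gt0. Qed.

Lemma wtH_peetre p q : wt 2^-1 (p + q) <= 2 * wt 2^-1 p * wt 2^-1 q.
Proof.
rewrite !wtH; have a := w1_gt0 p; have b := w1_gt0 q; have c := w1_gt0 (p + q).
have h := peetre p q.
rewrite -(@ler_pXn2r _ 2) ?nnegrE ?mulr_ge0 ?sqrtr_ge0//.
rewrite !exprMn !sqr_sqrtr ?(ltW a) ?(ltW b) ?(ltW c)//.
by apply: le_trans h _; have := mulr_gt0 a b; nra.
Qed.

Lemma w1N p : w1 (- p) = w1 p. Proof. by rewrite /w1 sqnormrN. Qed.

Lemma wtN_arg s p : wt s (- p) = wt s p. Proof. by rewrite /wt w1N. Qed.

(** Peetre's inequality for [p = q + (p - q)], solved for the inverse weights. *)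
Lemma wtVH_peetre p q : wt (- 2^-1) q <= 2 * wt (- 2^-1) p * wt 2^-1 (q - p).
Proof.
have := wtH_peetre q (p - q); rewrite [q + _]addrC subrK -(wtN_arg _ (p - q)) opprB !wtN => h.
have a := wt_gt0 2^-1 p; have b := wt_gt0 2^-1 q.
rewrite -[(wt 2^-1 q)^-1]mul1r ler_pdivrMr// -(ler_pM2l a) mulr1.
apply: le_trans h _; rewrite le_eqVlt; apply/orP; left; apply/eqP.
by field; rewrite gt_eqF.
Qed.

Definition chiK : R := \int[leb]_q (w1 q * sqnormc (chihat q)).

Lemma intg_chiK p : intg leb (fun q => w1 (q - p) * sqnormc (chihat (q - p))) /\
  \int[leb]_q (w1 (q - p) * sqnormc (chihat (q - p))) = chiK.
Proof.
have [C h] := @chi_h1C R n; have [I _] := h1_fourier h.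
rewrite -(funext (@chihatE R n)) in I.
by split; [exact: (intg_shift (- p) I)|exact: (Rint_shift (- p) I)].
Qed.

Lemma chiK_ge0 : 0 <= chiK.
Proof. by apply: Rint_ge0 => q; rewrite mulr_ge0 ?sqnormc_ge0// ltW// w1_gt0. Qed.

Let sm : -1 <= (- 2^-1 : R) <= 1. Proof. by apply/andP; split; lra. Qed.
Let sp : -1 <= (2^-1 : R) <= 1. Proof. by apply/andP; split; lra. Qed.

(** Cauchy-Schwarz in [Lam]; by Peetre's inequality, moving the weight of the shifted cutoff from
    [q] to [q - p] costs [2 wt 2^-1 p]. *)
Lemma ev_bndF F p : Sob (- 2^-1) F ->
  sqnormc (ev F p) <= @fnorm R n ^+ 2 * (2 * chiK * wt 2^-1 p * wn (- 2^-1) F).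
Proof.
move=> sF; have [D k] := psi_h1 p; rewrite sqnormc_ev; apply: ler_wpM2l; first exact: sqr_ge0.
apply: le_trans (Lam_cs sm (sob_meas sF) (sob_int sF) k).2 _.
apply: ler_wpM2r; first exact: wn_ge0.
have [I e] := intg_chiK p; have h1 : 2^-1 <= (1 : R) by lra.
rewrite opprK (_ : 2 * chiK * wt 2^-1 p = 2 * wt 2^-1 p * chiK); last by ring.
rewrite -e /wn -(RintZ _ I); apply: le_Rint; [exact: (h1_wt h1 k).1|exact: intgZ|move=> q].
rewrite psi_fourier mulrA ler_wpM2r ?sqnormc_ge0//.
apply: le_trans (_ : _ <= wt 2^-1 (p + (q - p))) _; first by rewrite addrC subrK.
apply: le_trans (wtH_peetre _ _) _.
by rewrite ler_wpM2l ?mulr_ge0 ?wt_ge0// wt_le.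
Qed.

Lemma nrm0_eq q : (exists i, q ord0 i != 0) -> 0 < nrm q.
Proof. by move=> [i qi]; apply: lt_le_trans (nrm_coor q i); rewrite normr_gt0. Qed.

Lemma measurable_nrm : measurable_fun setT (@nrm R n).
Proof. exact: measurable_sqrt measurable_sqnormr. Qed.

Lemma measurable_nrmV : measurable_fun setT (fun q => (@nrm R n q)^-1).
Proof.
rewrite (_ : (fun q => _) = (fun q => nrm q `^ (-1))); last first.
  by apply/funext => q; rewrite powRN powRr1// nrm_ge0.
apply: (@measurableT_comp _ _ _ _ _ _ (@powR R ^~ _)); first exact: measurable_powR.
exact: measurable_nrm.
Qed.

Hypothesis n1 : (1 < n)%N.

Lemma nrm_ae : {ae leb, forall q, 0 < nrm q}.
Proof.
apply: filterS ae_coor_neq0 => q h; apply: nrm0_eq; exists (Ordinal (ltnW n1)); exact: h.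
Qed.

(** The singular part of [1/|q|], integrable by comparison with [Sw]. *)
Definition low_inv q : R := (nrm q)^-1 * \1_[set q | nrm q < 1] q.

Lemma low_inv_ge0 q : 0 <= low_inv q.
Proof. by rewrite mulr_ge0 ?invr_ge0 ?nrm_ge0// indicE. Qed.

Lemma low_inv_le : {ae leb, forall q, low_inv q <= Sw q}.
Proof.
apply: filterS ae_coor_neq0 => q q0; rewrite /low_inv indicE.
case: (boolP (q \in _)) => [|_]; last by rewrite mulr0 Sw_ge0.
rewrite inE /= mulr1 => q1; apply: le_trans (Sw_low n1 q0 (ltW q1)).
have nq : 0 < nrm q by apply: nrm0_eq; exists (Ordinal (ltnW n1)).
rewrite -[(nrm q)^-1](powR_inv1 (nrm_ge0 q)) !powRN lef_pV2 ?posrE ?powR_gt0//.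
by rewrite -[X in X <= _]/(nrm q `^ (3/2)) ger_powR ?nq ?(ltW q1)//; lra.
Qed.

Lemma measurable_low_inv : measurable_fun setT low_inv.
Proof.
have mn := measurable_nrm.
apply: measurable_funM; first exact: measurable_nrmV.
apply: measurable_indic; rewrite -[X in measurable X]setTI.
by rewrite (_ : [set q | nrm q < 1] = nrm @^-1` `]-oo, 1[%classic)//; exact: mn.
Qed.

Lemma intg_low_inv : intg leb low_inv.
Proof.
apply: intg_le_ae measurable_low_inv _ (@intg_Sw R n).
by apply: filterS low_inv_le => q; rewrite ger0_norm ?low_inv_ge0.
Qed.

Lemma sqr_nrm_w1 q : 1 <= nrm q -> w1 q <= 2 * nrm q ^+ 2.
Proof.
move=> q1; rewrite nrm_sqr /w1 -nrm_sqr.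
have : 1 <= nrm q ^+ 2 by rewrite expr_ge1// nrm_ge0.
lra.
Qed.

Lemma invr_nrm_le q : 1 <= nrm q -> (nrm q)^-1 <= 2 * wt (- 2^-1) q.
Proof.
move=> q1; have W := wt_gt0 2^-1 q; rewrite wtN.
rewrite -[X in _ <= X]invrK invfM invrK lef_pV2 ?posrE ?mulr_gt0 ?invr_gt0//; last by lra.
rewrite mulrC ler_pdivrMr// wtH -(ler_pXn2r (n := 2)) ?nnegrE ?sqrtr_ge0//; last by lra.
rewrite sqr_sqrtr ?(ltW (w1_gt0 _))// exprMn.
by apply: le_trans (sqr_nrm_w1 q1) _; rewrite mulrC ler_wpM2l ?sqr_ge0//; lra.
Qed.

(** For [|q| >= 1], [1/|q|] is at most [2 wt (- 2^-1) q] and Peetre's inequality applies. For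
    [|q| < 1] it is unbounded, but there [w1 p <= 4 w1 (q - p)], so the decay of [X] supplies the
    factor in [p]. *)
Lemma nrmV_split p q (X D : R) : 0 <= D -> 0 <= X -> w1 (q - p) * X <= D ->
  (nrm q)^-1 * X <=
    (4 * D * wt (- 2^-1) p) * low_inv q + (4 * wt (- 2^-1) p) * (w1 (q - p) * X).
Proof.
move=> D0 X0 h2; have W0 := wt_ge0 (- 2^-1) p.
have V0 := w1_gt0 (q - p); have L0 := low_inv_ge0 q.
have [q1|q1] := ltP (nrm q) 1.
  have eL : low_inv q = (nrm q)^-1 by rewrite /low_inv indicE mem_set ?mulr1.
  have n0 : 0 <= (nrm q)^-1 by rewrite invr_ge0 nrm_ge0.
  apply: (@le_trans _ _ (4 * D * wt (- 2^-1) p * low_inv q)); last first.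
    by rewrite lerDl !mulr_ge0 ?(ltW V0).
  rewrite eL mulrC; apply: ler_wpM2r; first exact: n0.
  have hp : w1 p <= 4 * w1 (q - p).
    have := peetre q (p - q); rewrite [q + _]addrC subrK -(w1N (p - q)) opprB => h1.
    have : w1 q <= 2.
      have : nrm q ^+ 2 <= 1 by rewrite expr_le1 ?nrm_ge0 ?(ltW q1).
      by rewrite nrm_sqr /w1; lra.
    by have := w1_gt0 q; nra.
  have hw : 1 <= w1 p * wt (- 2^-1) p.
    rewrite wtN; have A := wt_gt0 2^-1 p; rewrite ler_pdivlMr// mul1r.
    by apply: wt_le; lra.
  have h3 : w1 p * X <= 4 * D.
    by apply: (@le_trans _ _ (4 * w1 (q - p) * X)); [rewrite ler_wpM2r|rewrite -mulrA ler_wpM2l].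
  apply: (@le_trans _ _ ((w1 p * wt (- 2^-1) p) * X)); first by rewrite ler_peMl.
  by rewrite mulrAC; apply: ler_wpM2r; [exact: W0|exact: h3].
apply: (@le_trans _ _ (4 * wt (- 2^-1) p * (w1 (q - p) * X))); last first.
  by rewrite lerDr mulr_ge0// mulr_ge0// mulr_ge0.
rewrite mulrA; apply: ler_wpM2r; first exact: X0.
apply: le_trans (invr_nrm_le q1) _; have h4 := ler_wpM2l (ler0n R 2) (wtVH_peetre p q); apply: le_trans h4 _.
have : wt 2^-1 (q - p) <= w1 (q - p) by apply: wt_le; lra.
by move/(ler_wpM2l W0); lra.
Qed.

Lemma chihat_nrm_spec : exists2 C, 0 <= C & forall p,
  intg leb (fun q => (nrm q)^-1 * sqnormc (chihat (q - p))) /\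
  \int[leb]_q ((nrm q)^-1 * sqnormc (chihat (q - p))) <= C * wt (- 2^-1) p.
Proof.
have [C h] := @chi_h1C R n; have [D D0 hD] := h1_decay h.
pose J := \int[leb]_q low_inv q; have J0 : 0 <= J by apply: Rint_ge0 => q; exact: low_inv_ge0.
exists (4 * D * J + 4 * chiK) => [|p]; first by rewrite addr_ge0 ?mulr_ge0 ?chiK_ge0.
have [Ik ek] := intg_chiK p.
have hD' q : w1 q * sqnormc (chihat q) <= D by rewrite chihatE.
have bd q := nrmV_split D0 (sqnormc_ge0 (chihat (q - p))) (hD' (q - p)).
have IR := intgD (intgZ (4 * D * wt (- 2^-1) p) intg_low_inv) (intgZ (4 * wt (- 2^-1) p) Ik).
have IL : intg leb (fun q => (nrm q)^-1 * sqnormc (chihat (q - p))).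
  apply: intg_le IR => [|q]; last first.
    by rewrite ger0_norm; [exact: bd|rewrite mulr_ge0 ?sqnormc_ge0// invr_ge0 nrm_ge0].
  apply: measurable_funM; first exact: measurable_nrmV.
  have mc : cmeasurable (@chihat R n).
    by rewrite (funext (@chihatE R n)); exact: cmeas_fourier (h1_cintg h).
  apply: (measurableT_comp (meas_sqnormc mc)); exact: measurable_shift.
split=> //; apply: le_trans (le_Rint IL IR bd) _.
rewrite RintD; [|exact: intgZ intg_low_inv|exact: intgZ].
by rewrite !RintZ ?ek//; [rewrite -/J; lra|exact: intg_low_inv].
Qed.

Definition chiL : R := sval (cid2 chihat_nrm_spec).

Lemma chiL_ge0 : 0 <= chiL. Proof. by rewrite /chiL; case: cid2. Qed.

Lemma chihat_nrm p : intg leb (fun q => (nrm q)^-1 * sqnormc (chihat (q - p))) /\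
  \int[leb]_q ((nrm q)^-1 * sqnormc (chihat (q - p))) <= chiL * wt (- 2^-1) p.
Proof. by rewrite /chiL; case: cid2 => C C0 /= h; exact: h. Qed.

Lemma nrm_le_wt q : nrm q <= wt 2^-1 q.
Proof. by rewrite wtH ler_wsqrtr// lerDr. Qed.

Lemma intg_nrm_sob G : cmeasurable G -> intg leb (fun p => wt 2^-1 p * sqnormc (G p)) ->
  intg leb (fun p => nrm p * sqnormc (G p)).
Proof.
move=> mG; apply: intg_le => [|p].
  by apply: measurable_funM; [exact: measurable_nrm|exact: meas_sqnormc].
by rewrite ger0_norm ?mulr_ge0 ?nrm_ge0 ?sqnormc_ge0// ler_wpM2r ?sqnormc_ge0// nrm_le_wt.
Qed.

(** Cauchy-Schwarz with weights [1/|q|] and [|q|] instead of powers of [1 + |q|^2]: the integral of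
    [|q| |G q|^2] is bounded by the norm of [K_m] uniformly in [m] ([Kset_G_le]). *)
Lemma ev_bndG G p : Sob 2^-1 G ->
  sqnormc (ev G p) <= @fnorm R n ^+ 2 * (chiL * wt (- 2^-1) p * \int[leb]_q (nrm q * sqnormc (G q))).
Proof.
move=> sG; have [D k] := psi_h1 p; rewrite sqnormc_ev; apply: ler_wpM2l; first exact: sqr_ge0.
have [I le] := chihat_nrm p; have mG := sob_meas sG; have J := intg_nrm_sob mG (sob_int sG).
have E q : (nrm q)^-1 * sqnormc (chihat (q - p)) = (nrm q)^-1 * sqnormc (fourier (psi_ p) q).
  by rewrite psi_fourier.
rewrite (funext E) in I; rewrite (eq_Rintegral _ (fun q _ => E q)) in le.
have P q : 0 <= nrm q * sqnormc (G q) by rewrite mulr_ge0 ?nrm_ge0 ?sqnormc_ge0.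
apply: le_trans (ler_wpM2r (Rint_ge0 _ P) le).
apply: (cs_weight (cmeas_fourier (h1_cintg k)) mG I J _ P _).2.
- by move=> q; rewrite mulr_ge0 ?sqnormc_ge0// invr_ge0 nrm_ge0.
- apply: filterS nrm_ae => q q0.
  by rewrite mulrACA mulVf ?mul1r// gt_eqF.
Qed.
End evaluation_bounds.

(** * The spaces K_m *)

Section hermitian_parts.
Context {R : realType} {n : nat}.
Local Notation leb := (@lebesgue_rV R n).
Local Notation Rn := 'rV[R]_n.
Local Notation L2 := (L2 leb).
Local Notation ip := (@L2_ip _ _ R leb).
Local Notation n2 := (nrm2 ip).
Local Notation cint := (cintegral leb).
Implicit Types (V W F G : Rn -> R[i]) (p q : Rn) (u v : L2).

(** With [ha], the decomposition [V = hs V + i ha V] into Hermitian functions, which in momentum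
    space is the splitting of a function into real and imaginary parts. *)
Definition hs V p : R[i] := (2^-1)%:C * (V p + Num.conj (V (- p))).
Definition ha V p : R[i] := (2^-1)%:C * (Num.conj 'i * (V p - Num.conj (V (- p)))).

Definition herm V := {ae leb, forall p, V (- p) = Num.conj (V p)}.

Lemma Re_hs V p : Re (hs V p) = (Re (V p) + Re (V (- p))) / 2.
Proof. rewrite /hs !cE; ring. Qed.
Lemma Im_hs V p : Im (hs V p) = (Im (V p) - Im (V (- p))) / 2.
Proof. rewrite /hs !cE; ring. Qed.
Lemma Re_ha V p : Re (ha V p) = (Im (V p) + Im (V (- p))) / 2.
Proof. rewrite /ha !cE; ring. Qed.
Lemma Im_ha V p : Im (ha V p) = (Re (V (- p)) - Re (V p)) / 2.
Proof. rewrite /ha !cE; ring. Qed.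

Lemma hs_ha V p : V p = hs V p + 'i * ha V p.
Proof.
apply: complexP; first by rewrite cReD Re_iM Re_hs Im_ha; field.
by rewrite cImD Im_iM Im_hs Re_ha; field.
Qed.

Lemma herm_hs V p : hs V (- p) = Num.conj (hs V p).
Proof. by apply: complexP; rewrite ?cReJ ?cImJ ?Re_hs ?Im_hs opprK; field. Qed.
Lemma herm_ha V p : ha V (- p) = Num.conj (ha V p).
Proof. by apply: complexP; rewrite ?cReJ ?cImJ ?Re_ha ?Im_ha opprK; field. Qed.

Lemma sqi_opp V : sqi leb V -> sqi leb (fun p => V (- p)).
Proof.
move=> [[m1 m2] I]; split; last exact: intg_opp I.
by split; [apply: (measurableT_comp m1)|apply: (measurableT_comp m2)]; exact: measurable_opp.
Qed.

Lemma sqi_hs V : sqi leb V -> sqi leb (hs V).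
Proof. by move=> qV; apply: sqiZ; apply: sqiD => //; apply: sqiJ; exact: sqi_opp. Qed.

Lemma sqi_ha V : sqi leb V -> sqi leb (ha V).
Proof.
by move=> qV; apply: sqiZ; apply: sqiZ; apply: sqiB => //; apply: sqiJ; exact: sqi_opp.
Qed.

Lemma herm_unique A B V : herm A -> herm B -> {ae leb, forall p, V p = A p + 'i * B p} ->
  {ae leb, forall p, hs V p = A p} /\ {ae leb, forall p, ha V p = B p}.
Proof.
move=> hA hB e; have e' := ae_opp e.
have H : {ae leb, forall p, V p = A p + 'i * B p /\ V (- p) = Num.conj (A p) + 'i * Num.conj (B p)}.
  apply: filterS2 (filterI hA hB) (filterI e e') => p [a b] [c d]; split=> //.
  by rewrite d a b.
split; apply: filterS H => p [c d]; apply: complexP; rewrite ?Re_hs ?Im_hs ?Re_ha ?Im_ha c d !cE0; by field.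
Qed.

(** The reflection [p |-> - p] preserves the measure and conjugates the integrand. *)
Lemma int_herm_real A B : herm A -> herm B -> sqi leb A -> sqi leb B ->
  Im (cint (fun p => Num.conj (A p) * B p)) = 0.
Proof.
move=> hA hB qA qB; have I := sqiM (sqiJ qA) qB.
rewrite Im_cint; set k := fun p => _.
have Ik : intg leb k := I.2.
have e : \int[leb]_p k p = \int[leb]_p (- k p).
  rewrite -(Rint_opp Ik); apply: Rint_ae.
  - exact: intg_meas (intg_opp Ik).
  - exact: intg_meas (intgN Ik).
  - by apply: filterS2 hA hB => p a b; rewrite /k a b !cE0; ring.
by move: e; rewrite RintN//; lra.
Qed.

Definition rint (A B : Rn -> R[i]) : R := \int[leb]_p Re (Num.conj (A p) * B p).

Lemma conjM_split (a b c d : R[i]) : Num.conj (a + 'i * b) * (c + 'i * d) =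
  (Num.conj a * c + Num.conj b * d) + ('i * (Num.conj a * d) + (- 'i) * (Num.conj b * c)).
Proof. apply: complexP; rewrite !cE0; ring. Qed.

(** Expanding both functions gives four pairings of Hermitian functions, all real: the diagonal ones
    form the real part and the mixed ones the imaginary part. *)
Lemma cint_split V W : sqi leb V -> sqi leb W ->
  Re (cint (fun p => Num.conj (V p) * W p)) = rint (hs V) (hs W) + rint (ha V) (ha W) /\
  Im (cint (fun p => Num.conj (V p) * W p)) = rint (hs V) (ha W) - rint (ha V) (hs W).
Proof.
move=> qV qW; have qa := sqi_hs qV; have qb := sqi_ha qV; have qc := sqi_hs qW; have qd := sqi_ha qW.
have ha' X : herm (hs X) by apply: nearW => p; exact: herm_hs.
have hb' X : herm (ha X) by apply: nearW => p; exact: herm_ha.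
have Iac := sqiM (sqiJ qa) qc; have Ibd := sqiM (sqiJ qb) qd.
have Iad := sqiM (sqiJ qa) qd; have Ibc := sqiM (sqiJ qb) qc.
have z1 := int_herm_real (ha' V) (ha' W) qa qc; have z2 := int_herm_real (hb' V) (hb' W) qb qd.
have z3 := int_herm_real (ha' V) (hb' W) qa qd; have z4 := int_herm_real (hb' V) (ha' W) qb qc.
have E p : Num.conj (V p) * W p = (Num.conj (hs V p) * hs W p + Num.conj (ha V p) * ha W p) +
   ('i * (Num.conj (hs V p) * ha W p) + (- 'i) * (Num.conj (ha V p) * hs W p)).
  by rewrite {1}(hs_ha V p) {1}(hs_ha W p); exact: conjM_split.
rewrite (eq_cint _ E) cintD; [|exact: cintgD|by apply: cintgD; exact: cintgZ].
rewrite cintD// cintD; [|exact: cintgZ..]; rewrite !cintZ//.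
rewrite !cE0 z1 z2 z3 z4 /rint !Re_cint; split; ring.
Qed.

Lemma ip_parts u v : Re (ip u v) = rint (hs (L2_fun (FF u))) (hs (L2_fun (FF v))) +
    rint (ha (L2_fun (FF u))) (ha (L2_fun (FF v))) /\
  Im (ip u v) = rint (hs (L2_fun (FF u))) (ha (L2_fun (FF v))) -
    rint (ha (L2_fun (FF u))) (hs (L2_fun (FF v))).
Proof. by rewrite -FF_ip; apply: cint_split; exact: L2_sqi. Qed.

Lemma rint_sqr A : rint A A = \int[leb]_p sqnormc (A p).
Proof. by apply: eq_Rintegral => p _; rewrite /sqnormc !cE0; ring. Qed.

Lemma nrm2_parts u : n2 u = \int[leb]_p sqnormc (hs (L2_fun (FF u)) p) +
  \int[leb]_p sqnormc (ha (L2_fun (FF u)) p).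
Proof. by rewrite /nrm2 (ip_parts u u).1 !rint_sqr. Qed.

Lemma hs_lin V W X (a : R) : {ae leb, forall p, X p = a%:C * V p + W p} ->
  {ae leb, forall p, hs X p = a%:C * hs V p + hs W p}.
Proof.
move=> e; apply: filterS2 e (ae_opp e) => p e1 e2.
by apply: complexP; rewrite !cE ?Re_hs ?Im_hs ?e1 ?e2 !cE; field.
Qed.

Lemma ha_lin V W X (a : R) : {ae leb, forall p, X p = a%:C * V p + W p} ->
  {ae leb, forall p, ha X p = a%:C * ha V p + ha W p}.
Proof.
move=> e; apply: filterS2 e (ae_opp e) => p e1 e2.
by apply: complexP; rewrite !cE ?Re_ha ?Im_ha ?e1 ?e2 !cE; field.
Qed.

Definition FFi u := cj (FF (cj u)).

Lemma FFiK u : FF (FFi u) = u. Proof. exact: FFcj. Qed.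

Lemma FFKi u : FFi (FF u) = u. Proof. exact: cjFF. Qed.

Lemma FF_linR u v (a : R[i]) :
  {ae leb, forall p, L2_fun (FF (a *: u + v)) p = a * L2_fun (FF u) p + L2_fun (FF v) p}.
Proof.
rewrite FF_lin; apply: filterS2 (L2_funD (a *: FF u) (FF v)) (L2_funZ a (FF u)) => p -> ->.
by [].
Qed.
End hermitian_parts.

(** * K_m as a closed real subspace of pairs of Hermitian functions *)

Section K_spaces.
Context {R : realType} {n : nat}.
Local Notation leb := (@lebesgue_rV R n).
Local Notation Rn := 'rV[R]_n.
Local Notation L2 := (L2 leb).
Local Notation ip := (@L2_ip _ _ R leb).
Local Notation n2 := (nrm2 ip).
Local Notation cint := (cintegral leb).
Implicit Types (V W F G : Rn -> R[i]) (p q : Rn) (u v : L2) (m : R).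
Implicit Types (f g : (Rn -> R[i]) -> R[i]).

Let sm : -1 <= (- 2^-1 : R) <= 1. Proof. by apply/andP; split; lra. Qed.
Let sp : -1 <= (2^-1 : R) <= 1. Proof. by apply/andP; split; lra. Qed.

Lemma nrm_le_omega m p : nrm p <= omega m p.
Proof. by rewrite /omega ler_wsqrtr// lerDr sqr_ge0. Qed.

Lemma omega_ge0 m p : 0 <= omega m p. Proof. exact: sqrtr_ge0. Qed.

Lemma omegaN m p : omega m (- p) = omega m p. Proof. by rewrite /omega sqnormrN. Qed.

Lemma omega_sqr m p : omega m p ^+ 2 = m ^+ 2 + sqnormr p.
Proof. by rewrite sqr_sqrtr// addr_ge0 ?sqr_ge0 ?sqnormr_ge0. Qed.

Lemma omega_le m p : 0 <= m -> omega m p <= (1 + m) * wt 2^-1 p.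
Proof.
move=> m0; have W := wt_ge0 2^-1 p; have a := sqnormr_ge0 p.
rewrite -(@ler_pXn2r _ 2) ?nnegrE ?omega_ge0 ?mulr_ge0//; last by lra.
rewrite omega_sqr exprMn wtH sqr_sqrtr ?(ltW (w1_gt0 p))// /w1.
by have := sqr_ge0 m; nra.
Qed.

Lemma measurable_omega m : measurable_fun setT (@omega R n m).
Proof.
by apply: measurable_sqrt; apply: measurable_funD => //; exact: measurable_sqnormr.
Qed.

Lemma measurable_omega_pow m s : measurable_fun setT (fun p => @omega R n m p `^ s).
Proof.
apply: (@measurableT_comp _ _ _ _ _ _ (@powR R ^~ s)); first exact: measurable_powR.
exact: measurable_omega.
Qed.

Definition om_ m s F p : R[i] := (omega m p `^ s)%:C * F p.

Lemma om_meas m s F : cmeasurable F -> cmeasurable (om_ m s F).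
Proof. by move=> mF; apply: cmeasM => //; apply: cmeasR; exact: measurable_omega_pow. Qed.

Lemma om_sqr m F p : sqnormc (om_ m 2^-1 F p) = omega m p * sqnormc (F p).
Proof. by rewrite sqnormcM sqnormcR powR12_sqrt ?omega_ge0// sqr_sqrtr ?omega_ge0. Qed.

Lemma omV_sqr m F p : sqnormc (om_ m (- 2^-1) F p) = (omega m p)^-1 * sqnormc (F p).
Proof. by rewrite sqnormcM sqnormcR powRN powR12_sqrt ?omega_ge0// exprVn sqr_sqrtr ?omega_ge0. Qed.

Lemma om_K m F p : 0 < omega m p -> om_ m 2^-1 (om_ m (- 2^-1) F) p = F p /\
  om_ m (- 2^-1) (om_ m 2^-1 F) p = F p.
Proof.
move=> o0; have e : (omega m p `^ 2^-1) * (omega m p `^ (- 2^-1)) = 1.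
  by rewrite powRN mulfV// gt_eqF// powR_gt0.
rewrite /om_ !mulrA -!rmorphM /= [omega m p `^ (- 2^-1) * _]mulrC e.
by rewrite mul1r.
Qed.

Lemma om_herm m s F : herm F -> herm (om_ m s F).
Proof. by apply: filterS => p e; rewrite /om_ omegaN e conjcM conjR. Qed.

Lemma om_ae m s F G : {ae leb, forall p, F p = G p} -> {ae leb, forall p, om_ m s F p = om_ m s G p}.
Proof. by apply: filterS => p e; rewrite /om_ e. Qed.

Lemma Sob_ae s F G : {ae leb, forall p, F p = G p} -> cmeasurable G -> Sob s F -> Sob s G.
Proof.
move=> e mG [mF IF aF]; split=> //.
  by apply: intg_ae IF; [exact: meas_wn|apply: filterS e => p ->].
move=> r r0; have [g tg lg] := aF r r0; exists g => //; apply: le_lt_trans lg.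
rewrite le_eqVlt; apply/orP; left; apply/eqP.
have mg := test_meas tg.
by apply: Rint_ae; [apply: meas_wn; exact: cmeasB..|apply: filterS e => p ->].
Qed.

Lemma Sob_herm s F : -1 <= s <= 1 -> Sob s F -> herm F.
Proof.
move=> s1 sF; have e := ev_ae s1 sF; apply: filterS2 e (ae_opp e) => p a b.
exact: (etrans b (etrans (ev_herm s1 sF p) (congr1 Num.conj (esym a)))).
Qed.

Lemma intg_omG m G : 0 <= m -> cmeasurable G -> intg leb (fun p => wt 2^-1 p * sqnormc (G p)) ->
  sqi leb (om_ m 2^-1 G).
Proof.
move=> m0 mG IG; split; first exact: om_meas.
rewrite (funext (om_sqr m G)); apply: intg_le (intgZ (1 + m) IG) => [|p].
  by apply: measurable_funM; [exact: measurable_omega|exact: meas_sqnormc].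
rewrite ger0_norm ?mulr_ge0 ?omega_ge0 ?sqnormc_ge0// mulrA.
by rewrite ler_wpM2r ?sqnormc_ge0//; exact: omega_le.
Qed.

Hypothesis n1 : (1 < n)%N.

Lemma omega_ae m : {ae leb, forall p, 0 < omega m p}.
Proof. by apply: filterS (nrm_ae n1) => p; move/lt_le_trans; apply; exact: nrm_le_omega. Qed.

Definition cF0 : R := 2 + @fnorm R n ^+ 2 * (2 * @chiK R n) * 2 * \int[leb]_q low_inv q.

Lemma cF0_ge0 : 0 <= cF0.
Proof.
rewrite addr_ge0// mulr_ge0//; last by apply: Rint_ge0 => q; exact: low_inv_ge0.
by rewrite mulr_ge0// mulr_ge0 ?sqr_ge0// mulr_ge0// chiK_ge0.
Qed.

Lemma wtH_le2 p : nrm p < 1 -> wt 2^-1 p <= 2.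
Proof.
move=> p1; apply: le_trans (wt_le p _) _; first by lra.
have : nrm p ^+ 2 <= 1 by rewrite expr_le1 ?nrm_ge0 ?(ltW p1).
by rewrite nrm_sqr /w1; lra.
Qed.

(** For [|p| >= 1] the weight [1/|p|] is comparable to the Sobolev weight; for [|p| < 1] the
    pointwise bound [ev_bndF] is integrated against [1/|p|]. This is what makes [Q] bounded on the
    first component. *)
Lemma intg_F0 F : Sob (- 2^-1) F -> intg leb (fun p => (nrm p)^-1 * sqnormc (F p)) /\
  \int[leb]_p ((nrm p)^-1 * sqnormc (F p)) <= cF0 * wn (- 2^-1) F.
Proof.
move=> sF; have [mF IF _] := sF; have W0 := wn_ge0 (- 2^-1) F.
pose k := @fnorm R n ^+ 2 * (2 * @chiK R n) * 2 * wn (- 2^-1) F.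
have k0 : 0 <= k.
  rewrite mulr_ge0// mulr_ge0// mulr_ge0 ?sqr_ge0// mulr_ge0//; exact: chiK_ge0.
have bd : {ae leb, forall p, (nrm p)^-1 * sqnormc (F p) <=
    2 * (wt (- 2^-1) p * sqnormc (F p)) + k * low_inv p}.
  apply: filterS (ev_ae sm sF) => p e.
  have S0 := sqnormc_ge0 (F p); have L0 := low_inv_ge0 p; have w0 := wt_ge0 (- 2^-1) p.
  have [p1|p1] := ltP (nrm p) 1.
    have eL : low_inv p = (nrm p)^-1 by rewrite /low_inv indicE mem_set ?mulr1.
    apply: (@le_trans _ _ (k * low_inv p)); last first.
      by rewrite lerDr mulr_ge0// mulr_ge0.
    rewrite eL mulrC; apply: ler_wpM2r; first by rewrite -eL.
    rewrite e; apply: le_trans (ev_bndF p sF) _; rewrite /k.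
    have := wtH_le2 p1; have f0 := sqr_ge0 (@fnorm R n); have c0 := @chiK_ge0 R n.
    move=> w2; apply: (@le_trans _ _ (@fnorm R n ^+ 2 * (2 * @chiK R n * 2 * wn (- 2^-1) F))).
      apply: ler_wpM2l; first exact: f0.
      apply: ler_wpM2r; first exact: W0.
      by apply: ler_wpM2l; [rewrite mulr_ge0|exact: w2].
    by rewrite !mulrA.
  apply: (@le_trans _ _ (2 * (wt (- 2^-1) p * sqnormc (F p)))); last by rewrite lerDl mulr_ge0.
  by rewrite mulrA; apply: ler_wpM2r => //; exact: invr_nrm_le.
have IR := intgD (intgZ 2 IF) (intgZ k (intg_low_inv n1)).
have IL : intg leb (fun p => (nrm p)^-1 * sqnormc (F p)).
  apply: intg_le_ae IR; last first.
    by apply: filterS bd => p h; rewrite ger0_norm// mulr_ge0 ?invr_ge0 ?nrm_ge0 ?sqnormc_ge0.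
  by apply: measurable_funM; [exact: measurable_nrmV|exact: meas_sqnormc].
split=> //; apply: le_trans (le_Rint_ae IL IR bd) _.
rewrite RintD; [|exact: intgZ|exact: intgZ (intg_low_inv n1)].
rewrite (RintZ 2 IF) (RintZ k (intg_low_inv n1)) -/(wn _ F) /cF0 /k.
by move: (wn _ F) (\int[leb]_q _) => w J; lra.
Qed.

Lemma sqi_omF m F : Sob (- 2^-1) F -> sqi leb (om_ m (- 2^-1) F).
Proof.
move=> sF; have [I _] := intg_F0 sF; split; first exact/om_meas/(sob_meas sF).
rewrite (funext (omV_sqr m F)); apply: intg_le_ae I.
  rewrite -(funext (omV_sqr m F)); exact/meas_sqnormc/om_meas/(sob_meas sF).
apply: filterS (nrm_ae n1) => p p0.
rewrite ger0_norm ?mulr_ge0 ?invr_ge0 ?omega_ge0 ?sqnormc_ge0//.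
have o0 : 0 < omega m p := lt_le_trans p0 (nrm_le_omega m p).
by rewrite ler_wpM2r ?sqnormc_ge0// lef_pV2 ?posrE// nrm_le_omega.
Qed.

Lemma sqi_omG m G : 0 <= m -> Sob 2^-1 G -> sqi leb (om_ m 2^-1 G).
Proof. by move=> m0 sG; apply: intg_omG m0 (sob_meas sG) (sob_int sG). Qed.

Lemma omega_powE m s f F : sobolev s f -> is_fourier f F -> sqi leb (om_ m s F) -> forall s',
  s' = s -> omega_pow m s' f = FFi (mkL2 leb (om_ m s F)).
Proof.
move=> _ hF qF _ ->; have hD := fourierD_ae hF.
have mD : cmeasurable (om_ m s (fourierD f)).
  by apply: om_meas; apply: (is_fourierD _).1; exists F.
have eD := om_ae m s hD; have eM := mkL2_ae qF.
rewrite /omega_pow; apply: xget_unique => [|u /=].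
  apply/is_fourier_L2P => //; rewrite FFiK.
  by apply: filterS2 eM eD => p -> <-.
move/(is_fourier_L2P _ mD) => h; rewrite -(FFKi u); apply: (congr1 (@FFi R n)).
apply: L2_ext; apply: filterS2 h (filterI eM eD) => p -> [-> ->].
by [].
Qed.

Lemma FF_FFi (a b : L2) : FF (FFi a + 'i *: FFi b) = a + 'i *: b.
Proof.
have e : FF ('i *: FFi b) = 'i *: b := etrans (FF_Z _ _) (congr1 (fun x => 'i *: x) (FFiK b)).
exact: etrans (FF_D _ _) (congr2 +%R (FFiK a) e).
Qed.

Definition emb m F G : L2 := FFi (mkL2 leb (om_ m (- 2^-1) F)) + 'i *: FFi (mkL2 leb (om_ m 2^-1 G)).

(** [FK] and [GK] recover the pair from the vector, so that membership in [K_m] can be stated as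
    [Kset], without an existential. *)
Definition FK m u : Rn -> R[i] := om_ m 2^-1 (hs (L2_fun (FF u))).
Definition GK m u : Rn -> R[i] := om_ m (- 2^-1) (ha (L2_fun (FF u))).

Lemma FK_meas m u : cmeasurable (FK m u).
Proof. exact: om_meas (sqi_hs (L2_sqi _)).1. Qed.

Lemma GK_meas m u : cmeasurable (GK m u).
Proof. exact: om_meas (sqi_ha (L2_sqi _)).1. Qed.

Section pair.
Variables (m : R) (F G : Rn -> R[i]).
Hypotheses (m0 : 0 <= m) (sF : Sob (- 2^-1) F) (sG : Sob 2^-1 G).

Lemma emb_parts : {ae leb, forall p, hs (L2_fun (FF (emb m F G))) p = om_ m (- 2^-1) F p} /\
  {ae leb, forall p, ha (L2_fun (FF (emb m F G))) p = om_ m 2^-1 G p}.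
Proof.
apply: herm_unique; [exact: om_herm (Sob_herm sm sF)|exact: om_herm (Sob_herm sp sG)|].
have qF := sqi_omF m sF; have qG := sqi_omG m0 sG.
rewrite /emb (FF_FFi (mkL2 leb (om_ m (- 2^-1) F)) (mkL2 leb (om_ m 2^-1 G))).
apply: filterS2 (L2_funD (mkL2 leb (om_ m (- 2^-1) F)) ('i *: mkL2 leb (om_ m 2^-1 G)))
  (filterI (L2_funZ 'i (mkL2 leb (om_ m 2^-1 G))) (filterI (mkL2_ae qF) (mkL2_ae qG))).
by move=> p -> [-> [-> ->]].
Qed.

Lemma FK_emb : {ae leb, forall p, F p = FK m (emb m F G) p}.
Proof.
apply: filterS2 emb_parts.1 (omega_ae m) => p e o0.
by rewrite /FK /om_ e -/(om_ m 2^-1 (om_ m (- 2^-1) F) p) (om_K F o0).1.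
Qed.

Lemma GK_emb : {ae leb, forall p, G p = GK m (emb m F G) p}.
Proof.
apply: filterS2 emb_parts.2 (omega_ae m) => p e o0.
by rewrite /GK /om_ e -/(om_ m (- 2^-1) (om_ m 2^-1 G) p) (om_K G o0).2.
Qed.
End pair.

Lemma emb_ae m F G F' G' : 0 <= m -> Sob (- 2^-1) F -> Sob 2^-1 G -> Sob (- 2^-1) F' -> Sob 2^-1 G' ->
  {ae leb, forall p, F p = F' p} -> {ae leb, forall p, G p = G' p} -> emb m F G = emb m F' G'.
Proof.
move=> m0 sF sG sF' sG' eF eG; rewrite /emb.
by rewrite (mkL2_eq (sqi_omF m sF) (sqi_omF m sF') (om_ae m _ eF))
  (mkL2_eq (sqi_omG m0 sG) (sqi_omG m0 sG') (om_ae m _ eG)).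
Qed.

Lemma embK m u : 0 <= m -> Sob (- 2^-1) (FK m u) -> Sob 2^-1 (GK m u) -> emb m (FK m u) (GK m u) = u.
Proof.
move=> m0 sF sG; apply: FF_inj; rewrite /emb.
rewrite (FF_FFi (mkL2 leb (om_ m (- 2^-1) (FK m u))) (mkL2 leb (om_ m 2^-1 (GK m u)))); apply: L2_ext.
have qF := sqi_omF m sF; have qG := sqi_omG m0 sG.
apply: filterS2 (L2_funD (mkL2 leb (om_ m (- 2^-1) (FK m u))) ('i *: mkL2 leb (om_ m 2^-1 (GK m u))))
  (filterI (L2_funZ 'i (mkL2 leb (om_ m 2^-1 (GK m u))))
    (filterI (filterI (mkL2_ae qF) (mkL2_ae qG)) (omega_ae m))).
move=> p -> [-> [[-> ->] o0]].
by rewrite (om_K _ o0).1 (om_K _ o0).2 [RHS]hs_ha.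
Qed.

Lemma sobolevB_F f : sobolevB (- 2^-1) f -> Sob (- 2^-1) (fourierD f) /\ is_fourier f (fourierD f).
Proof. by apply: sobolevB_Sob; case/andP: sm. Qed.

Lemma sobolevB_G f : sobolevB 2^-1 f -> Sob 2^-1 (fourierD f) /\ is_fourier f (fourierD f).
Proof. by apply: sobolevB_Sob; case/andP: sp. Qed.

Lemma omega_pow_emb m f g : 0 <= m -> sobolevB (- 2^-1) f -> sobolevB 2^-1 g ->
  omega_pow m (- 2^-1) f + 'i *: omega_pow m 2^-1 g = emb m (fourierD f) (fourierD g).
Proof.
move=> m0 bf bg; have [sF hF] := sobolevB_F bf; have [sG hG] := sobolevB_G bg.
rewrite (omega_powE bf.1 hF (sqi_omF m sF) erefl).
by rewrite (omega_powE bg.1 hG (sqi_omG m0 sG) erefl).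
Qed.

Definition Kset m u := Sob (- 2^-1) (FK m u) /\ Sob 2^-1 (GK m u).

Lemma Kset_emb m F G : 0 <= m -> Sob (- 2^-1) F -> Sob 2^-1 G -> Kset m (emb m F G).
Proof.
move=> m0 sF sG; split.
  by apply: Sob_ae (FK_emb m0 sF sG) _ sF; exact: FK_meas.
by apply: Sob_ae (GK_emb m0 sF sG) _ sG; exact: GK_meas.
Qed.

Lemma Sob_dist s F : -1 <= s <= 1 -> Sob s F -> exists f,
  [/\ sobolevB s f, Sob s (fourierD f) & {ae leb, forall p, fourierD f p = F p}].
Proof.
move=> s1 sF; have [f [bf hf]] := Sob_sobolevB s1 sF; exists f; split=> //.
  by apply: (sobolevB_Sob _ bf).1; case/andP: s1.
exact: fourierD_ae hf.
Qed.

Lemma KspaceP m u : 0 <= m -> Kspace m u <-> Kset m u.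
Proof.
move=> m0; split=> [[f [g [bf bg ->]]]|[sF sG]].
  have [sF hF] := sobolevB_F bf; have [sG hG] := sobolevB_G bg.
  by rewrite omega_pow_emb//; exact: Kset_emb.
have [f [bf sf ef]] := Sob_dist sm sF; have [g [bg sg eg]] := Sob_dist sp sG.
exists f, g; split=> //; rewrite omega_pow_emb// -{1}(embK m0 sF sG).
by apply: emb_ae => //; [apply: filterS ef => p ->|apply: filterS eg => p ->].
Qed.

Lemma rderivs_lin (a b : R) (g h : Rn -> R) s : test_fun g -> test_fun h ->
  rderivs s (fun x => a * g x + b * h x) = (fun x => a * rderivs s g x + b * rderivs s h x).
Proof.
move=> tg th; elim: s => //= i s ->; apply/funext => x.
have dg := diff_derivable (v := delta_mx ord0 i) (test_rderivs_diff tg s x).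
have dh := diff_derivable (v := delta_mx ord0 i) (test_rderivs_diff th s x).
apply: etrans (deriveD (f := fun x => a * rderivs s g x : R^o) (g := fun x => b * rderivs s h x : R^o) _ _) _.
- exact: (derivableZ (f := rderivs s g : Rn -> R^o)).
- exact: (derivableZ (f := rderivs s h : Rn -> R^o)).
- exact: congr2 (deriveZ a dg) (deriveZ b dh).
Qed.

Lemma test_lin (a b : R) (g h : Rn -> R) : test_fun g -> test_fun h ->
  test_fun (fun x => a * g x + b * h x).
Proof.
move=> tg th; split.
  move=> s x; rewrite pderivs_real rderivs_lin//; split; last exact: differentiable_cst.
  apply: differentiableD.
    exact: (differentiableZ (f := rderivs s g : Rn -> R^o)) (test_rderivs_diff tg s x).
  exact: (differentiableZ (f := rderivs s h : Rn -> R^o)) (test_rderivs_diff th s x).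
have [_ [cg sg]] := tg; have [_ [ch sh]] := th.
have sub : closure [set x | a * g x + b * h x != 0] `<=`
    closure [set x | g x != 0] `|` closure [set x | h x != 0].
  rewrite -closureU; apply: closure_subset => x /=.
  apply: contra_neqP => /not_orP[/negP g0 /negP h0].
  by rewrite !negbK in g0 h0; rewrite (eqP g0) (eqP h0) !mulr0 addr0.
split; last by move=> x /sub[/sg|/sh].
apply: (subclosed_compact _ (compactU cg ch) sub); exact: closed_closure.
Qed.

Lemma comb_lt (a b X Y z : R) : 0 <= a -> 0 <= b -> X < z -> Y < z ->
  a * X + b * Y <= (a + b) * z.
Proof. by move=> a0 b0 /ltW Xz /ltW Yz; rewrite mulrDl lerD// ler_wpM2l. Qed.

Lemma Sob_lin s F G (a b : R) : -1 <= s <= 1 -> Sob s F -> Sob s G ->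
  Sob s (fun p => a%:C * F p + b%:C * G p).
Proof.
move=> s1 sF sG; have [mF IF aF] := sF; have [mG IG aG] := sG.
have [Il _] := wn_lin a%:C b%:C mF mG IF IG.
split=> //.
  by apply: cmeasD; apply: cmeasM => //; exact: cmeas_cst.
move=> e e0; pose k := 2 * a ^+ 2 + 2 * b ^+ 2 + 1.
have k0 : 0 < k by rewrite ltr_wpDl// addr_ge0// mulr_ge0// sqr_ge0.
have [g tg lg] := aF (e / k) (divr_gt0 e0 k0); have [h th lh] := aG (e / k) (divr_gt0 e0 k0).
exists (fun x => a * g x + b * h x); first exact: test_lin.
have s_1 : s <= 1 by case/andP: s1.
have E p : a%:C * F p + b%:C * G p - fourier (gC (fun x => a * g x + b * h x)) p =
    a%:C * (1 * F p + -1 * fourier (gC g) p) + b%:C * (1 * G p + -1 * fourier (gC h) p).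
  have Ig := test_cintg tg; have Ih := test_cintg th.
  (* The summand 0 gives the shape [a phi + psi] of [fourier_lin], which is used twice. *)
  have -> : gC (fun x => a * g x + b * h x) = (fun x => a%:C * gC g x + (b%:C * gC h x + 0)).
    by apply/funext => x; rewrite /gC addr0 -!rmorphM -rmorphD.
  have I0 : cintegrable leb (fun _ : Rn => 0 : R[i]) by split; exact: intg0.
  rewrite fourier_lin//; last by apply: cintgD => //; exact: cintgZ.
  rewrite fourier_lin//.
  have -> : fourier (fun _ : Rn => 0 : R[i]) p = 0.
    rewrite fourierE (eq_cint _ (fun x => mulr0 _)).
    by rewrite /cintegral Rint_zero// mulr0.
  by ring.
rewrite (funext (fun p => congr1 (fun z => wt s p * sqnormc z) (E p))).
have [I1 _] := wn_lin 1 (-1) mF (test_meas tg) IF (test_wt s_1 tg).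
have [J1 _] := wn_lin 1 (-1) mG (test_meas th) IG (test_wt s_1 th).
have m1 X (x : Rn -> R) : cmeasurable X -> test_fun x -> cmeasurable (fun p => 1 * X p + -1 * fourier (gC x) p).
  move=> mX tx; have mt := test_meas tx.
  by apply: cmeasD; apply: cmeasM => //; exact: cmeas_cst.
have [_] := wn_lin a%:C b%:C (m1 _ _ mF tg) (m1 _ _ mG th) I1 J1.
have B X (x : Rn -> R) : \int[leb]_p (wt s p * sqnormc (X p - fourier (gC x) p)) < e / k ->
    wn s (fun p => 1 * X p + -1 * fourier (gC x) p) < e / k.
  by rewrite /wn; congr (_ < _); apply: eq_Rintegral => p _; rewrite mul1r mulN1r.
move=> h1; apply: le_lt_trans h1 _; rewrite !sqnormcR.
have := B _ _ lg; have := B _ _ lh; move: (wn _ _) (wn _ _) => X Y hX hY.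
apply: (@le_lt_trans _ _ ((2 * a ^+ 2 + 2 * b ^+ 2) * (e / k))).
  exact: (comb_lt (mulr_ge0 (ler0n R 2) (sqr_ge0 a)) (mulr_ge0 (ler0n R 2) (sqr_ge0 b)) hY hX).
by rewrite mulrCA gtr_pMr// ltr_pdivrMr// mul1r /k ltrDl.
Qed.

Lemma om_linR m s V W X (a : R) : {ae leb, forall p, X p = a%:C * V p + W p} ->
  {ae leb, forall p, a%:C * om_ m s V p + 1%:C * om_ m s W p = om_ m s X p}.
Proof. by apply: filterS => p e; rewrite /om_ e; ring. Qed.

Lemma FK_lin m u v (a : R) :
  {ae leb, forall p, a%:C * FK m u p + 1%:C * FK m v p = FK m (a%:C *: u + v) p}.
Proof. by apply: om_linR; apply: hs_lin; exact: FF_linR. Qed.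

Lemma GK_lin m u v (a : R) :
  {ae leb, forall p, a%:C * GK m u p + 1%:C * GK m v p = GK m (a%:C *: u + v) p}.
Proof. by apply: om_linR; apply: ha_lin; exact: FF_linR. Qed.

Lemma Kset_lin m u v (a : R) : Kset m u -> Kset m v -> Kset m (a%:C *: u + v).
Proof.
move=> [sF sG] [sF' sG']; split.
  by apply: Sob_ae (FK_lin m u v a) (FK_meas _ _) _; exact: Sob_lin.
by apply: Sob_ae (GK_lin m u v a) (GK_meas _ _) _; exact: Sob_lin.
Qed.

Lemma test0 : test_fun (fun _ : Rn => 0 : R).
Proof.
have E s : rderivs s (fun _ : Rn => 0 : R) = fun=> 0.
  by elim: s => //= i s ->; apply/funext => x; rewrite derive_cst.
split; first by move=> s x; rewrite pderivs_real E; split; exact: differentiable_cst.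
have -> : [set x : Rn | (0 : R) != 0] = set0 by apply/seteqP; split=> x //=; rewrite eqxx.
by rewrite closure0; split=> //; exact: compact0.
Qed.

(** Stated for a map [T] so as to serve for [FK m] and [GK m] alike: a test function close to
    [T (x_ N)] is close to [T v], because [T] is bounded for the weighted norm. *)
Lemma Sob_closed s (T : L2 -> Rn -> R[i]) (c : R) (x_ : nat -> L2) v : -1 <= s <= 1 -> 0 <= c ->
  (forall u, cmeasurable (T u)) ->
  (forall u v (a : R), {ae leb, forall p, a%:C * T u p + 1%:C * T v p = T (a%:C *: u + v) p}) ->
  (forall u, intg leb (fun p => wt s p * sqnormc (T u p)) /\ wn s (T u) <= c * n2 u) ->
  (forall k : nat, Sob s (T (x_ k))) -> hlim ip x_ v -> Sob s (T v).
Proof.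
move=> s1 c0 mT lT bT sT lim; split; [exact: mT|exact: (bT v).1|move=> e e0].
have s_1 : s <= 1 by case/andP: s1.
have d0 : 0 < e / (4 * (c + 1)) by rewrite divr_gt0// mulr_gt0// ltr_wpDl.
have [N hN] := lim _ d0; have {}hN := hN N (leqnn N).
have e4 : 0 < e / 4 by rewrite divr_gt0.
have [g tg lg] := sob_apx (sT N) e4; exists g => //.
have mg := test_meas tg.
have [I1 _] := wn_lin 1 (-1) (mT (x_ N)) mg (bT _).1 (test_wt s_1 tg).
have m1 : cmeasurable (fun p => 1 * T (x_ N) p + -1 * fourier (gC g) p).
  by apply: cmeasD; apply: cmeasM => //; exact: cmeas_cst.
pose w := (-1)%:C *: x_ N + v.
have [_ b] := wn_lin 1 1 (mT w) m1 (bT w).1 I1.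
have E : {ae leb, forall p, T v p - fourier (gC g) p =
    1 * T w p + 1 * (1 * T (x_ N) p + -1 * fourier (gC g) p)}.
  by apply: filterS (lT (x_ N) v (-1)) => p <-; rewrite rmorphN rmorph1; ring.
have -> : \int[leb]_p (wt s p * sqnormc (T v p - fourier (gC g) p)) =
    wn s (fun p => 1 * T w p + 1 * (1 * T (x_ N) p + -1 * fourier (gC g) p)).
  apply: Rint_ae; first by apply: meas_wn; exact: cmeasB.
    by apply: meas_wn; apply: cmeasD; apply: cmeasM => //; exact: cmeas_cst.
  by apply: filterS E => p ->.
have l2 : wn s (fun p => 1 * T (x_ N) p + -1 * fourier (gC g) p) < e / 4.
  by move: lg; rewrite /wn; congr (_ < _); apply: eq_Rintegral => p _; rewrite mul1r mulN1r.
have l1 : wn s (T w) < e / 4.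
  have nw : n2 w = n2 (x_ N - v).
    rewrite (nrm2BC (L2_hilbert leb)); congr (n2 _); rewrite /w rmorphN rmorph1 scaleN1r addrC.
    by [].
  apply: le_lt_trans (bT w).2 _; rewrite nw.
  apply: (@le_lt_trans _ _ ((c + 1) * n2 (x_ N - v))).
    by rewrite ler_wpM2r ?(nrm2_ge0 (L2_hilbert leb))// lerDl.
  have c1 : 0 < c + 1 by rewrite ltr_wpDl.
  rewrite -ltr_pdivlMl//; apply: lt_le_trans hN _.
  by rewrite le_eqVlt; apply/orP; left; apply/eqP; field; rewrite gt_eqF.
have n1' : sqnormc (1 : R[i]) = 1 by rewrite /sqnormc /= expr0n addr0 expr1n.
apply: le_lt_trans b _; rewrite n1' mulr1.
by move: l1 l2; move: (wn s (T w)) (wn s _) => X Y; lra.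
Qed.

Lemma FK_wn m u : 0 <= m -> intg leb (fun p => wt (- 2^-1) p * sqnormc (FK m u p)) /\
  wn (- 2^-1) (FK m u) <= (1 + m) * n2 u.
Proof.
move=> m0; have qh := sqi_hs (L2_sqi (FF u)).
have bd p : wt (- 2^-1) p * sqnormc (FK m u p) <= (1 + m) * sqnormc (hs (L2_fun (FF u)) p).
  rewrite /FK om_sqr mulrA; apply: ler_wpM2r; first exact: sqnormc_ge0.
  rewrite wtN ler_pdivrMl ?wt_gt0// mulrC; exact: omega_le.
have IR := intgZ (1 + m) qh.2.
have IL : intg leb (fun p => wt (- 2^-1) p * sqnormc (FK m u p)).
  apply: intg_le IR => [|p]; first by apply: meas_wn; exact: FK_meas.
  by rewrite ger0_norm ?mulr_ge0 ?wt_ge0 ?sqnormc_ge0.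
split=> //; apply: le_trans (le_Rint IL IR bd) _.
rewrite (RintZ _ qh.2); apply: ler_wpM2l; first by lra.
by rewrite nrm2_parts lerDl Rint_ge0// => p; exact: sqnormc_ge0.
Qed.

(** [sqrt (1 + |p|^2) <= (1 + 1/m) w_m]. The constant degenerates as [m -> 0]; it serves closedness
    at fixed [m], while the final estimate goes through [Kset_G_le]. *)
Lemma GK_wn m u : 0 < m -> intg leb (fun p => wt 2^-1 p * sqnormc (GK m u p)) /\
  wn 2^-1 (GK m u) <= (1 + m^-1) * n2 u.
Proof.
move=> m0; have qh := sqi_ha (L2_sqi (FF u)).
have i0 : 0 < m^-1 by rewrite invr_gt0.
have bd p : wt 2^-1 p * sqnormc (GK m u p) <= (1 + m^-1) * sqnormc (ha (L2_fun (FF u)) p).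
  rewrite /GK omV_sqr mulrA; apply: ler_wpM2r; first exact: sqnormc_ge0.
  have a := sqnormr_ge0 p.
  have o0 : 0 < omega m p by rewrite sqrtr_gt0 ltr_pwDl// exprn_gt0.
  rewrite ler_pdivrMr// wtH -(@ler_pXn2r _ 2) ?nnegrE ?sqrtr_ge0 ?mulr_ge0 ?(ltW o0)//; last by lra.
  rewrite sqr_sqrtr ?(ltW (w1_gt0 p))// exprMn omega_sqr /w1.
  have e : m^-1 * m = 1 by rewrite mulVf// gt_eqF.
  have e2 : m^-1 ^+ 2 * m ^+ 2 = 1 by rewrite -exprMn e expr1n.
  have := sqr_ge0 m^-1; have := sqr_ge0 m; set r := m^-1 in i0 e e2 *; nra.
have IR := intgZ (1 + m^-1) qh.2.
have IL : intg leb (fun p => wt 2^-1 p * sqnormc (GK m u p)).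
  apply: intg_le IR => [|p]; first by apply: meas_wn; exact: GK_meas.
  by rewrite ger0_norm ?mulr_ge0 ?wt_ge0 ?sqnormc_ge0.
split=> //; apply: le_trans (le_Rint IL IR bd) _.
rewrite (RintZ _ qh.2); apply: ler_wpM2l; first by lra.
by rewrite nrm2_parts lerDr Rint_ge0// => p; exact: sqnormc_ge0.
Qed.

Lemma Kset_closed m (x_ : nat -> L2) v : 0 < m -> (forall k, Kset m (x_ k)) -> hlim ip x_ v -> Kset m v.
Proof.
move=> m0 Kx lim; split.
  apply: (@Sob_closed _ (FK m) (1 + m) x_) => //; first by lra.
  - exact: FK_meas.
  - exact: FK_lin.
  - by move=> u; apply: FK_wn; exact: ltW.
  - by move=> k; exact: (Kx k).1.
apply: (@Sob_closed _ (GK m) (1 + m^-1) x_) => //.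
- by rewrite addr_ge0// invr_ge0 ltW.
- exact: GK_meas.
- exact: GK_lin.
- by move=> u; exact: GK_wn.
- by move=> k; exact: (Kx k).2.
Qed.

Lemma Kset0 m : Kset m 0.
Proof.
have z : {ae leb, forall p, L2_fun (FF (0 : L2)) p = 0}.
  by rewrite FF_0; exact: L2_fun0.
have Z s : Sob s (fun _ : Rn => 0 : R[i]).
  split=> [| |e e0]; first exact: cmeas_cst.
    rewrite (_ : (fun p => _) = fun=> 0); first exact: intg0.
    by apply/funext => p; rewrite sqnormc0 mulr0.
  exists (fun=> 0); first exact: test0.
  rewrite Rint_zero// => p; rewrite (_ : fourier _ p = 0) ?subr0 ?sqnormc0 ?mulr0//.
  by rewrite fourierE (eq_cint _ (fun x => mulr0 _)) /cintegral Rint_zero// mulr0.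
split; [apply: (Sob_ae _ (FK_meas m 0) (Z _))|apply: (Sob_ae _ (GK_meas m 0) (Z _))].
  apply: filterS2 z (ae_opp z) => p a b.
  by rewrite /FK /om_ /hs a b rmorph0 addr0 !mulr0.
apply: filterS2 z (ae_opp z) => p a b.
by rewrite /GK /om_ /ha a b rmorph0 subr0 !mulr0.
Qed.

Lemma Kset_rs m : real_subspace (Kset m).
Proof. by split=> [|a h k]; [exact: Kset0|exact: Kset_lin]. Qed.
End K_spaces.

(** * K_m meets i K_m trivially *)

Section entire_functions.
Context {R : realType}.
Implicit Types (a b : nat -> R) (h k : nat -> R -> R) (x y w : R).

(** Coefficients of entire functions of exponential type, whose [n]-th derivatives are bounded by
    [C M^n] on bounded sets. *)
Definition eseq a := exists C M, [/\ 0 <= C, 0 <= M & forall j, `|a j| <= C * M ^+ j / j`!%:R].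

Definition esum_ a x : R := limn (pseries a x).

Lemma eseq_term a C M x : (forall j, `|a j| <= C * M ^+ j / j`!%:R) ->
  forall j, `|a j * x ^+ j| <= C * exp_coeff (M * `|x|) j.
Proof.
move=> H j; rewrite normrM normrX /exp_coeff /= exprMn.
have := ler_wpM2r (exprn_ge0 j (normr_ge0 x)) (H j).
by rewrite mulrAC !mulrA [C * M ^+ j * _ / _]mulrAC.
Qed.

Lemma eseq_cvg a x : eseq a -> cvgn (pseries a x).
Proof.
move=> [C [M [C0 M0 H]]]; apply: normed_cvg.
apply: (@series_le_cvg _ _ (fun j => C * exp_coeff (M * `|x|) j)) => [j|j|j|].
- exact: normr_ge0.
- by rewrite mulr_ge0// exp_coeff_ge0// mulr_ge0.
- exact: eseq_term H j.
- by apply: is_cvg_seriesZ; exact: is_cvg_series_exp_coeff.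
Qed.

Lemma esum_bnd a C M x : (forall j, `|a j| <= C * M ^+ j / j`!%:R) -> 0 <= C -> 0 <= M ->
  `|esum_ a x| <= C * expR (M * `|x|).
Proof.
move=> H C0 M0; have ea : eseq a by exists C, M.
have cn : cvgn [normed pseries a x].
  apply: (@series_le_cvg _ _ (fun j => C * exp_coeff (M * `|x|) j)) => [j|j|j|].
  - exact: normr_ge0.
  - by rewrite mulr_ge0// exp_coeff_ge0// mulr_ge0.
  - exact: eseq_term H j.
  - by apply: is_cvg_seriesZ; exact: is_cvg_series_exp_coeff.
apply: le_trans (lim_series_norm cn) _.
have cE : cvgn (series (exp_coeff (M * `|x|))) := is_cvg_series_exp_coeff _.
have -> : C * expR (M * `|x|) = limn (series (fun j => C * exp_coeff (M * `|x|) j)).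
  exact/esym/(lim_seriesZ C cE).
apply: lim_series_le; [exact: cn|by apply: is_cvg_seriesZ|].
by move=> j; exact: eseq_term H j.
Qed.

(** Differentiation multiplies [C] by [M] and leaves [M] alone; iteration gives the bounds asked for
    in [analytic_seq]. *)
Lemma diffs_bnd a C M : (forall j, `|a j| <= C * M ^+ j / j`!%:R) ->
  forall j, `|pseries_diffs a j| <= (C * M) * M ^+ j / j`!%:R.
Proof.
move=> H j; rewrite /pseries_diffs normrM ger0_norm//.
apply: le_trans (ler_wpM2l (ler0n R j.+1) (H j.+1)) _.
have := pnatr_eq0 R j.+1; have : j`!%:R != 0 :> R by rewrite pnatr_eq0 -lt0n fact_gt0.
rewrite factS natrM exprS; set p := j`!%:R; set q := j.+1%:R => p0 q0.
have q1 : q != 0 by rewrite q0.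
by rewrite le_eqVlt; apply/orP; left; apply/eqP; field; exact/andP.
Qed.

Lemma eseq_diffs a : eseq a -> eseq (pseries_diffs a).
Proof.
move=> [C [M [C0 M0 H]]]; exists (C * M), M; split=> //; first exact: mulr_ge0.
exact: diffs_bnd.
Qed.

Lemma esum_derive a x : eseq a -> is_derive x (1 : R) (esum_ a) (esum_ (pseries_diffs a) x).
Proof.
move=> ea; apply: (@pseries_snd_diffs _ _ (`|x| + 1)).
- exact: eseq_cvg.
- by apply: eseq_cvg; exact: eseq_diffs.
- by apply: eseq_cvg; do 2 apply: eseq_diffs.
- by rewrite [X in _ < X]ger0_norm ?ltrDl// addr_ge0.
Qed.

(* [h n] is the [n]-th derivative of [h 0]. *)
Record analytic_seq h : Prop := AnalyticSeq {
  an_der : forall n x, is_derive x (1 : R) (h n) (h n.+1 x);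
  an_bnd : forall r, exists C M, [/\ 0 <= C, 0 <= M & forall n x, `|x| <= r -> `|h n x| <= C * M ^+ n] }.

Lemma analytic_esum a : eseq a -> analytic_seq (fun n => esum_ (iter n (@pseries_diffs R) a)).
Proof.
move=> ea; split=> [n x|r].
  by rewrite iterS; apply: esum_derive; elim: n => //= n IH; exact: eseq_diffs.
have [C [M [C0 M0 H]]] := ea; exists (C * expR (M * `|r|)), M; split=> //.
  by rewrite mulr_ge0// expR_ge0.
move=> n x xr.
have Hn j : `|iter n (@pseries_diffs R) a j| <= (C * M ^+ n) * M ^+ j / j`!%:R.
  elim: n j => [|n IH] j; first by rewrite expr0 mulr1; exact: H.
  by rewrite iterS exprSr mulrA; exact: diffs_bnd.
apply: le_trans (esum_bnd x Hn _ M0) _; first by rewrite mulr_ge0// exprn_ge0.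
rewrite mulrAC; apply: ler_wpM2r; first exact: exprn_ge0.
apply: ler_wpM2l => //; rewrite ler_expR ler_wpM2l//; apply: le_trans xr _; exact: ler_norm.
Qed.

(** The [n]-th derivative of [h i * k j] by the Leibniz rule in recursive form, free of binomial
    coefficients. *)
Fixpoint prodD h k (n i j : nat) x : R :=
  if n is n'.+1 then prodD h k n' i.+1 j x + prodD h k n' i j.+1 x else h i x * k j x.

Lemma analytic_prod h k : analytic_seq h -> analytic_seq k -> analytic_seq (fun n => prodD h k n 0 0).
Proof.
move=> ah ak; split=> [n x|r].
  suff H i j : is_derive x (1 : R) (prodD h k n i j) (prodD h k n.+1 i j x) by exact: H.
  elim: n i j => [|n IH] i j /=.
    exact: (idrv_eq (idrvM (an_der ah i x) (an_der ak j x))).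
  exact: idrvD (IH _ _) (IH _ _).
have [C [M [C0 M0 H]]] := an_bnd ah r; have [D [N [D0 N0 K]]] := an_bnd ak r.
exists (C * D), (M + N); split; [exact: mulr_ge0|exact: addr_ge0|move=> n x xr].
suff P i j : `|prodD h k n i j x| <= C * D * (M ^+ i * N ^+ j) * (M + N) ^+ n.
  by have := P 0%N 0%N; rewrite !expr0 !mulr1.
elim: n i j => [|n IH] i j /=.
  rewrite expr0 mulr1 normrM mulrACA.
  by apply: ler_pM => //; [exact: H|exact: K].
apply: le_trans (ler_normD _ _) _; apply: le_trans (lerD (IH _ _) (IH _ _)) _.
by rewrite le_eqVlt; apply/orP; left; apply/eqP; rewrite !exprS; ring.
Qed.

Lemma analytic_sub h k : analytic_seq h -> analytic_seq k -> analytic_seq (fun n x => h n x - k n x).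
Proof.
move=> ah ak; split=> [n x|r].
  exact: idrvD (an_der ah n x) (idrvN (an_der ak n x)).
have [C [M [C0 M0 H]]] := an_bnd ah r; have [D [N [D0 N0 K]]] := an_bnd ak r.
exists (C + D), (M + N); split; [exact: addr_ge0|exact: addr_ge0|move=> n x xr].
apply: le_trans (ler_normB _ _) _; rewrite mulrDl; apply: lerD.
  apply: le_trans (H n x xr) _; apply: ler_wpM2l => //.
  by apply: lerXn2r; rewrite ?nnegrE ?addr_ge0// lerDl.
apply: le_trans (K n x xr) _; apply: ler_wpM2l => //.
by apply: lerXn2r; rewrite ?nnegrE ?addr_ge0// lerDr.
Qed.

Definition affine_seq (mu nu : R) (n : nat) x : R :=
  match n with 0 => mu + nu * x | 1 => nu | _ => 0 end.

Lemma analytic_affine mu nu : analytic_seq (affine_seq mu nu).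
Proof.
split=> [[|[|n]] x|r] /=.
- apply: (idrv_eq (idrvD (idrv_cst mu x) (idrvZ nu (idrv_id x)))).
  by rewrite add0r mulr1.
- exact: idrv_cst.
- exact: idrv_cst.
- exists (`|mu| + `|nu| * (`|r| + 1)), 1; split=> //.
  move=> n x xr; rewrite expr1n mulr1.
  have a := normr_ge0 mu; have b := normr_ge0 nu; have c := normr_ge0 r; have d := ler_norm r.
  case: n => [|[|n]] /=; last by rewrite normr0 addr_ge0// mulr_ge0// addr_ge0.
    apply: le_trans (ler_normD _ _) _; rewrite lerD2l normrM ler_wpM2l//; lra.
  by nra.
Qed.

Lemma analytic_zero_local h c d : analytic_seq h -> (forall x, c < x -> x < d -> h 0%N x = 0) ->
  forall n x, c < x -> x < d -> h n x = 0.
Proof.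
move=> ah h0; elim=> [//|n IH] x cx xd.
have [_ <-] := an_der ah n x.
rewrite (@near_eq_derive _ _ _ _ (cst 0 : R -> R)) ?derive_cst//.
have : x \in `]c, d[ by rewrite in_itv/= cx xd.
move/near_in_itvoo; apply: filterS => y; rewrite in_itv/= => /andP[cy yd].
exact: IH.
Qed.

(** All derivatives vanish at the midpoint [x0]. The bounds [C M^n] propagate this over a step [dl]
    that does not depend on the point, and finitely many steps reach [x]. *)
Lemma analytic_identity h c d : analytic_seq h -> c < d -> (forall x, c < x -> x < d -> h 0%N x = 0) ->
  forall x, h 0%N x = 0.
Proof.
move=> ah cd h0 x; pose x0 := (c + d) / 2; pose r := `|x| + `|x0|.
have z0 n : h n x0 = 0 by apply: (analytic_zero_local ah h0); rewrite /x0; lra.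
have [C [M [C0 M0 H]]] := an_bnd ah r; pose N := M + 1; pose dl := (2 * N)^-1.
have N0 : 0 < N by rewrite ltr_wpDl.
have dl0 : 0 < dl by rewrite invr_gt0 mulr_gt0.
have cont n : continuous (h n).
  by move=> y; apply: differentiable_continuous; apply/derivable1_diffP; have [] := an_der ah n y.
have step y z : `|y| <= r -> `|z| <= r -> `|y - z| <= dl -> (forall n, h n y = 0) ->
    forall n, h n z = 0.
  move=> yr zr yz hy n.
  (* Taylor's estimate by induction on [j]: each use of the mean value theorem costs one derivative,
     a factor [N], and gains a distance at most [dl = 1 / (2 N)], in all a factor [1/2]. *)
  have P j m t : `|t| <= r -> `|y - t| <= dl -> `|h m t| <= C * N ^+ m * 2^-1 ^+ j.
    elim: j m t => [|j IH] m t tr yt.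
      rewrite expr0 mulr1; apply: le_trans (H m t tr) _; apply: ler_wpM2l => //.
      by apply: lerXn2r; rewrite ?nnegrE ?(ltW N0)// lerDl.
    have [->|ty] := eqVneq t y; first by rewrite hy normr0 mulr_ge0 ?exprn_ge0 ?mulr_ge0 ?exprn_ge0 ?(ltW N0).
    have [s [s1 s2 e]] : exists s, [/\ `|s| <= r, `|y - s| <= dl & h m t = h m.+1 s * (t - y)].
      have M1 (u v : R) : u < v -> exists2 s, s \in `]u, v[%R & h m v - h m u = h m.+1 s * (v - u).
        move=> uv; apply: MVT => // [s _|]; first exact: an_der.
        exact: continuous_subspaceT.
      move: yr tr yt; rewrite !ler_norml => /andP[y1 y2] /andP[t1 t2] /andP[d1 d2].
      case: (ltgtP y t) ty => // [yt|ty] _.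
        have [s] := M1 _ _ yt; rewrite in_itv/= => /andP[s1 s2]; rewrite hy subr0 => e.
        exists s; split=> //; rewrite ler_norml; apply/andP; split; lra.
      have [s] := M1 _ _ ty; rewrite in_itv/= => /andP[s1 s2]; rewrite hy => e.
      exists s; split; [rewrite ler_norml; apply/andP; split; lra..|].
      by apply: oppr_inj; rewrite -[- h m t]add0r e; ring.
    rewrite e normrM; apply: le_trans (ler_pM _ _ (IH m.+1 s s1 s2) (_ : _ <= dl)) _ => //.
      by rewrite distrC.
    rewrite /dl !exprS le_eqVlt; apply/orP; left; apply/eqP; field.
    by rewrite gt_eqF.
  apply/eqP; rewrite -normr_eq0 eq_le normr_ge0 andbT.
  apply: (@small_le _ _ (C * N ^+ n)) => [|e e0]; first by rewrite mulr_ge0// exprn_ge0// ltW.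
  have j0 : 0 <= e^-1 by rewrite invr_ge0 ltW.
  apply: le_trans (P (Num.trunc e^-1).+1 n z zr yz) _; apply: ler_wpM2l.
    by rewrite mulr_ge0// exprn_ge0// ltW.
  rewrite exprVn -[X in _ <= X]invrK lef_pV2 ?posrE ?invr_gt0 ?exprn_gt0//.
  apply: le_trans (ltW (truncnS_gt _)) _.
  by rewrite -natrX ler_nat; apply: ltnW; exact: ltn_expl.
(* A point within [j + 1] steps of [x0] is within one step of a point of the same segment at [j]
   steps. *)
have chain j z : `|z| <= r -> `|x0 - z| <= j%:R * dl -> forall n, h n z = 0.
  elim: j z => [|j IH] z zr.
    rewrite mul0r normr_le0 subr_eq0 => /eqP <-; exact: z0.
  move=> xz; have j1 : 0 < j.+1%:R :> R by [].
  pose y := x0 + (z - x0) * (j%:R / j.+1%:R).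
  have ej : j.+1%:R = j%:R + 1 :> R by rewrite -addn1 natrD.
  have jj : 0 <= (j%:R / j.+1%:R : R) <= 1.
    by rewrite divr_ge0//= ler_pdivrMr// mul1r ej lerDl.
  have x0r : `|x0| <= r by rewrite /r lerDr.
  have yr : `|y| <= r.
    rewrite /y; move: jj zr x0r; set q := j%:R / _ => /andP[q0 q1].
    rewrite !ler_norml => /andP[a1 a2] /andP[b1 b2]; apply/andP; split; nra.
  have e1 : x0 - y = (x0 - z) * (j%:R / j.+1%:R) by rewrite /y; ring.
  have e2 : y - z = (x0 - z) * j.+1%:R^-1.
    have e3 : j%:R / j.+1%:R = 1 - j.+1%:R^-1 :> R.
      by rewrite -[j%:R](addrK 1) -ej mulrBl divff ?gt_eqF// mul1r.
    by rewrite /y e3; ring.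
  apply: (step y) => //.
    by rewrite e2 normrM [`|_^-1|]ger0_norm ?invr_ge0// ler_pdivrMr// mulrC.
  apply: IH => //; rewrite e1 normrM [`|_ / _|]ger0_norm; last by case/andP: jj.
  apply: le_trans (ler_wpM2r _ xz) _; first by case/andP: jj.
  have q0 : j.+1%:R != 0 :> R by rewrite gt_eqF.
  by rewrite mulrAC mulrCA divff// mulr1.
apply: (chain (Num.trunc (`|x0 - x| / dl)).+1); first by rewrite /r lerDl.
rewrite -ler_pdivrMr//; exact: ltW (truncnS_gt _).
Qed.

Lemma entire_sqrt a b (mu nu : R) : eseq a -> eseq b -> 0 < nu ->
  (forall w, 0 < w -> esum_ a w ^+ 2 = (mu + nu * w) * esum_ b w ^+ 2) ->
  forall w, esum_ b w = 0.
Proof.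
move=> ea eb nu0 H.
have ha := analytic_esum ea; have hb := analytic_esum eb.
pose h := fun n x => prodD (fun n => esum_ (iter n (@pseries_diffs R) a)) (fun n => esum_ (iter n (@pseries_diffs R) a)) n 0 0 x -
  prodD (affine_seq mu nu) (fun n => prodD (fun n => esum_ (iter n (@pseries_diffs R) b)) (fun n => esum_ (iter n (@pseries_diffs R) b)) n 0 0) n 0 0 x.
have ah : analytic_seq h.
  by apply: analytic_sub; [exact: analytic_prod|apply: analytic_prod; [exact: analytic_affine|exact: analytic_prod]].
have h0 x : h 0%N x = esum_ a x ^+ 2 - (mu + nu * x) * esum_ b x ^+ 2 by rewrite /h /= !expr2.
have Z := @analytic_identity h 0 1 ah ltr01.
have {}Z x : esum_ a x ^+ 2 = (mu + nu * x) * esum_ b x ^+ 2.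
  apply/eqP; rewrite -subr_eq0 -h0; apply/eqP; apply: Z => y y0 _.
  by rewrite h0 H// subrr.
(* [mu + nu x] is negative for [x < d], which forces [esum_ b] to vanish on [(d - 1, d)]; the
   identity theorem extends this to the line. *)
pose d := - (mu / nu); move=> w; apply: (@analytic_identity _ (d - 1) d hb) => [|x _ xd].
  by rewrite gtrBl.
have neg : mu + nu * x < 0.
  have : nu * x < nu * d by rewrite ltr_pM2l.
  by rewrite /d mulrN mulrCA divff ?gt_eqF// mulr1; lra.
have := Z x; have := sqr_ge0 (esum_ a x); have s0 := sqr_ge0 (esum_ b x) => a0 e.
apply/eqP; rewrite -sqrf_eq0 eq_le s0 andbT; move: e a0 neg s0; move: (esum_ a x ^+ 2) (_ ^+ 2) => A B -> a0 neg B0.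
by move: a0; rewrite nmulr_rge0.
Qed.
End entire_functions.

(** * Power series along rays and anti-locality *)

Section power_series_pairing.
Context {R : realType} {n : nat}.
Local Notation leb := (@lebesgue_rV R n).
Local Notation Rn := 'rV[R]_n.
Local Notation cint := (cintegral leb).
Implicit Types (phi psi F G : Rn -> R[i]) (p q x y e : Rn).

Definition l1 e : R := \sum_i `|e ord0 i|.

Lemma l1_ge0 e : 0 <= l1 e. Proof. by apply: sumr_ge0. Qed.

Lemma coor_l1 e i : `|e ord0 i| <= l1 e.
Proof. by rewrite /l1 (bigD1 i)//= lerDl; apply: sumr_ge0. Qed.

Lemma dotr_box e x (c : R) : (forall i, `|x ord0 i| <= c) -> `|dotr e x| <= c * l1 e.
Proof.
move=> xc; rewrite /dotr /l1 mulr_sumr; apply: le_trans (ler_norm_sum _ _ _) _.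
by apply: ler_sum => i _; rewrite normrM mulrC ler_wpM2r.
Qed.

Lemma dotr_box_shift e x j t : (forall i, `|x ord0 i| <= 3) -> 0 < t -> t <= 1 ->
  `|dotr e (x + t *: delta_mx ord0 j)| <= 4 * l1 e.
Proof.
move=> bx t0 t1; apply: dotr_box => i; rewrite !mxE eqxx /=.
apply: le_trans (ler_normD _ _) _; have := bx i.
have : `|t * (i == j)%:R| <= 1.
  by rewrite normrM (ger0_norm (ltW t0)); case: (i == j); rewrite ?normr1 ?normr0 ?mulr1 ?mulr0.
by lra.
Qed.

Lemma measurable_compdotr (f : R -> R) e : measurable_fun setT f ->
  measurable_fun setT (fun x => f (dotr e x)).
Proof. by move=> mf; apply: (measurableT_comp mf); exact: measurable_dotr. Qed.

(** [B] bounds [e . x] on the box of half-side 3 enlarged by a step of length 1, the region in which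
    [chi_h1] examines the function. *)
Lemma chi_ridge_h1 (f : R -> R) e (L : R) : measurable_fun setT f ->
  let B := 1 + 4 * l1 e in
  (forall a b, `|a| <= B -> `|b| <= B -> `|f a - f b| <= L * `|a - b|) ->
  (forall a, `|a| <= B -> `|f a| <= L * B) ->
  h1 (fun x => (chi x)%:C * (f (dotr e x))%:C) (4 * 100 ^+ n * (L * B) ^+ 2).
Proof.
move=> mf B fL fB; have l0 := l1_ge0 e; have B0 : 0 <= B by rewrite /B; lra.
have zB : `|0 : R| <= B by rewrite normr0.
have L0 : 0 <= L * B := le_trans (normr_ge0 (f 0)) (fB 0 zB).
have L1 : 0 <= L.
  have B1 : 0 < B by rewrite /B; lra.
  by move: L0; rewrite pmulr_lge0.
apply: chi_h1; first by apply: cmeasR; exact: measurable_compdotr.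
- move=> x bx; rewrite sqnormcR -real_normK ?num_real//; apply: lerXn2r; rewrite ?nnegrE//.
  by apply: fB; have := dotr_box e bx; rewrite /B; lra.
- move=> j t x t0 t1 bx; rewrite -rmorphB sqnormcR -real_normK ?num_real// -exprMn.
  apply: lerXn2r; rewrite ?nnegrE ?mulr_ge0 ?(ltW t0)//.
  apply: le_trans (fL _ _ _ _) _.
  + by have := dotr_box_shift e j bx t0 t1; rewrite /B; lra.
  + by have := dotr_box e bx; rewrite /B; lra.
  have -> : dotr e (x + t *: delta_mx ord0 j) - dotr e x = t * e ord0 j.
    by rewrite dotrDr dotrZr [dotr e (delta_mx _ _)]dotrC dotr_delta addrAC subrr add0r.
  rewrite normrM (ger0_norm (ltW t0)) mulrCA ler_wpM2l ?(ltW t0)// ler_wpM2l//.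
  by have := coor_l1 e j; rewrite /B; lra.
Qed.

Lemma pow_lip (B : R) k a b : `|a| <= B -> `|b| <= B ->
  `|a ^+ k.+1 - b ^+ k.+1| <= k.+1%:R * B ^+ k * `|a - b|.
Proof.
move=> aB bB; have B0 : 0 <= B by exact: le_trans aB.
elim: k => [|k IH]; first by rewrite !expr1 expr0 mul1r mul1r.
have -> : a ^+ k.+2 - b ^+ k.+2 = a * (a ^+ k.+1 - b ^+ k.+1) + b ^+ k.+1 * (a - b).
  by rewrite !exprS; ring.
apply: le_trans (ler_normD _ _) _; rewrite !normrM normrX.
have h1 : `|a| * `|a ^+ k.+1 - b ^+ k.+1| <= B * (k.+1%:R * B ^+ k * `|a - b|) by exact: ler_pM.
have h2 : `|b| ^+ k.+1 * `|a - b| <= B ^+ k.+1 * `|a - b|.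
  by rewrite ler_wpM2r// lerXn2r ?nnegrE.
apply: le_trans (lerD h1 h2) _; rewrite le_eqVlt; apply/orP; left; apply/eqP.
by rewrite -[k.+2]addn1 natrD exprS; ring.
Qed.

(** Pairing with [mom e k] gives the [k]-th moment in direction [e], that is, up to constants, the
    [k]-th Taylor coefficient of the Fourier transform along the ray. *)
Definition mom e k x : R[i] := (chi x)%:C * ((dotr e x) ^+ k)%:C.

Lemma mom_h1 e k : h1 (mom e k) (4 * 100 ^+ n * (k.+1%:R * (1 + 4 * l1 e) ^+ k * (1 + 4 * l1 e)) ^+ 2).
Proof.
have l0 := l1_ge0 e; set B := 1 + 4 * l1 e; have B1 : 1 <= B by rewrite /B; lra.
apply: (@chi_ridge_h1 (fun s => s ^+ k)) => [|a b aB bB|a aB].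
- exact: measurable_funX.
- case: k => [|k]; first by rewrite !expr0 subrr normr0 mulr_ge0.
  apply: le_trans (pow_lip k aB bB) _; apply: ler_wpM2r => //.
  apply: ler_pM => //; rewrite ?exprn_ge0 ?ler_nat//; [lra|].
  by rewrite exprS ler_peMl ?exprn_ge0//; lra.
- rewrite normrX; apply: (@le_trans _ _ (B ^+ k)); first by apply: lerXn2r; rewrite ?nnegrE//; lra.
  have Bk : 0 <= B ^+ k by rewrite exprn_ge0//; lra.
  have k1 : 1 <= k.+1%:R :> R by rewrite ler1n.
  rewrite -/B -mulrA; apply: (le_trans (ler_peMr Bk B1)); apply: ler_peMl k1.
  by apply: mulr_ge0 => //; lra.
Qed.

Section series_fun.
Variables (f : R -> R) (ka : nat -> R).
Hypothesis fE : forall s, series (fun k => ka k * s ^+ k) @ \oo --> f s.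
Hypothesis ka_le : forall k, `|ka k| <= (k`!%:R)^-1.
Hypothesis mf : measurable_fun setT f.

Definition rem N s : R := f s - series (fun k => ka k * s ^+ k) N.

Definition exp_rem N (B : R) : R := expR B - series (exp_coeff B) N.

Lemma exp_rem_cvg B : exp_rem N B @[N --> \oo] --> (0 : R).
Proof.
rewrite -(subrr (expR B)); apply: cvgB; first exact: cvg_cst.
exact: is_cvg_series_exp_coeff.
Qed.

Lemma exp_rem_ge0 N B : 0 <= B -> 0 <= exp_rem N B.
Proof.
move=> B0; rewrite subr_ge0; apply: nondecreasing_cvgn_le; last exact: is_cvg_series_exp_coeff.
by apply: nondecreasing_series => i _ _; rewrite exp_coeff_ge0.
Qed.

(** On [[-B, B]] the function [t^k / k!] has Lipschitz constant [B^{k-1} / (k-1)!]; the shift of the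
    index is why [rem N.+1] is compared with [exp_rem N]. *)
Lemma rem_lip N B a b : 0 <= B -> `|a| <= B -> `|b| <= B ->
  `|rem N.+1 a - rem N.+1 b| <= exp_rem N B * `|a - b|.
Proof.
move=> B0 aB bB.
have D : (series (fun k => ka k * a ^+ k) M - series (fun k => ka k * a ^+ k) N.+1 -
  (series (fun k => ka k * b ^+ k) M - series (fun k => ka k * b ^+ k) N.+1)) @[M --> \oo] -->
  rem N.+1 a - rem N.+1 b.
  by apply: cvgB; apply: cvgB; [exact: fE|exact: cvg_cst|exact: fE|exact: cvg_cst].
have Dn := @cvg_norm _ _ _ _ eventually_filter _ _ D.
rewrite -(cvg_lim (@Rhausdorff R) Dn); apply: limr_le; first by apply/cvg_ex; eexists; exact: Dn.
exists N.+1 => // M /= NM; rewrite !sub_series_geq// -sumrB.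
apply: le_trans (ler_norm_sum _ _ _) _.
apply: (@le_trans _ _ (\sum_(N.+1 <= k < M) exp_coeff B k.-1 * `|a - b|)).
  rewrite big_nat_cond [X in _ <= X]big_nat_cond; apply: ler_sum => k /andP[/andP[k0 _] _].
  case: k k0 => // k _; rewrite -mulrBr normrM.
  apply: le_trans (ler_pM _ _ (ka_le k.+1) (pow_lip k aB bB)) _ => //.
  rewrite mulrA /exp_coeff /= ler_wpM2r// factS natrM invfM.
  have : k.+1%:R != 0 :> R by rewrite pnatr_eq0.
  set q := k.+1%:R; move: (k`!%:R^-1) => z q0.
  by rewrite le_eqVlt; apply/orP; left; apply/eqP; field.
rewrite -mulr_suml ler_wpM2r// /exp_rem.
case: M NM => // M NM; rewrite big_add1 /= -sub_series_geq; last by rewrite -ltnS.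
rewrite lerD2r; apply: nondecreasing_cvgn_le; last exact: is_cvg_series_exp_coeff.
by apply: nondecreasing_series => i _ _; rewrite exp_coeff_ge0.
Qed.

Lemma rem0 N : rem N.+1 0 = 0.
Proof.
have E M : series (fun k => ka k * 0 ^+ k) M.+1 = ka 0%N.
  rewrite /series /= big_nat_recl// big1 ?expr0 ?mulr1 ?addr0// => i _.
  by rewrite expr0n mulr0.
have : series (fun k => ka k * 0 ^+ k) @ \oo --> ka 0%N.
  apply: cvg_near_cst; exists 1%N => // -[//|M] _ /=; exact: E.
have f0 := @fE 0; move=> c0.
by rewrite /rem E -(cvg_lim (@Rhausdorff R) f0) (cvg_lim (@Rhausdorff R) c0) subrr.
Qed.

Lemma rem_h1 N e : h1 (fun x => (chi x)%:C * (rem N.+1 (dotr e x))%:C)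
  (4 * 100 ^+ n * (exp_rem N (1 + 4 * l1 e) * (1 + 4 * l1 e)) ^+ 2).
Proof.
have l0 := l1_ge0 e; set B := 1 + 4 * l1 e; have B1 : 1 <= B by rewrite /B; lra.
have B0 : 0 <= B by lra.
apply: (@chi_ridge_h1 (rem N.+1)) => [|a b aB bB|a aB]; last first.
- have := rem_lip N B0 aB (_ : `|0 : R| <= B); rewrite normr0 rem0 !subr0 => /(_ B0) h.
  apply: le_trans h _; apply: ler_wpM2l => //; last first.
- exact: exp_rem_ge0.
- exact: rem_lip.
- apply: measurable_funB => //; apply: measurable_sum => k.
apply: measurable_funM; first exact: measurable_cst.
exact: measurable_funX.
Qed.

Section ray.
Variables (s : R) (F : Rn -> R[i]).
Hypothesis s1 : -1 <= s <= 1.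
Hypothesis sF : Sob s F.
Local Notation Lam := (@Lam R n).

Lemma part_h1 e N : exists C, h1 (fun x => (chi x)%:C * (series (fun k => ka k * (dotr e x) ^+ k) N)%:C) C /\
  Lam F (fun x => (chi x)%:C * (series (fun k => ka k * (dotr e x) ^+ k) N)%:C) =
  \sum_(0 <= k < N) (ka k)%:C * Lam F (mom e k).
Proof.
elim: N => [|N [C [hC eC]]].
  have hm := mom_h1 e 0.
  (* The empty sum, written as [- mom + mom] to have the shape required by [Lam_lin]. *)
  have e0 : (fun x => (chi x)%:C * (series (fun k => ka k * (dotr e x) ^+ k) 0)%:C) =
      (fun x : Rn => (-1) * mom e 0 x + mom e 0 x).
    by apply/funext => x; rewrite /series /= big_geq// mulr0 mulN1r addNr.
  eexists; rewrite e0; split; first exact: h1D (h1Z (-1) hm) hm.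
  by rewrite (Lam_lin s1 (-1) (sob_meas sF) (sob_int sF) hm hm) big_geq// rmorphN rmorph1 mulN1r addNr.
have eS : (fun x => (chi x)%:C * (series (fun k => ka k * (dotr e x) ^+ k) N.+1)%:C) =
    (fun x : Rn => (ka N)%:C * mom e N x + (chi x)%:C * (series (fun k => ka k * (dotr e x) ^+ k) N)%:C).
  apply/funext => x; rewrite /mom seriesSr rmorphD rmorphM/=; ring.
have hm := mom_h1 e N.
eexists; rewrite eS; split; first exact: h1D (h1Z (ka N)%:C hm) hC.
rewrite (Lam_lin s1 (ka N)%:C (sob_meas sF) (sob_int sF) hm hC) eC conjR.
by rewrite big_nat_recr//= addrC.
Qed.

Lemma fun_h1 e : exists C, h1 (fun x => (chi x)%:C * (f (dotr e x))%:C) C.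
Proof.
have [C [hC _]] := part_h1 e 1; eexists.
have -> : (fun x => (chi x)%:C * (f (dotr e x))%:C) = (fun x : Rn => (chi x)%:C * (rem 1 (dotr e x))%:C +
   (chi x)%:C * (series (fun k => ka k * (dotr e x) ^+ k) 1)%:C).
  by apply/funext => x; rewrite /rem rmorphB/=; ring.
exact: h1D (rem_h1 0 e) hC.
Qed.

Lemma Lam_rem e N : Lam F (fun x => (chi x)%:C * (f (dotr e x))%:C) - \sum_(0 <= k < N.+1) (ka k)%:C * Lam F (mom e k)
  = Lam F (fun x => (chi x)%:C * (rem N.+1 (dotr e x))%:C).
Proof.
have [C [hC <-]] := part_h1 e N.+1; have hr := rem_h1 N e.
have -> : (fun x => (chi x)%:C * (f (dotr e x))%:C) = (fun x : Rn => 1 * ((chi x)%:C * (rem N.+1 (dotr e x))%:C) +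
   (chi x)%:C * (series (fun k => ka k * (dotr e x) ^+ k) N.+1)%:C).
  by apply/funext => x; rewrite /rem rmorphB/=; ring.
by rewrite (Lam_lin s1 1 (sob_meas sF) (sob_int sF) hr hC) rmorph1 mul1r addrK.
Qed.

(** The [h1] constant of the cut-off remainder is a multiple of [exp_rem N ^ 2], which tends to 0,
    and it bounds [Lam]; so the pairing can be taken term by term. *)
Lemma Lam_series e : series (fun k => ka k * Re (Lam F (mom e k))) @ \oo -->
  Re (Lam F (fun x => (chi x)%:C * (f (dotr e x))%:C)).
Proof.
set z := Lam F _; rewrite -cvg_shiftS.
pose K := n.+1%:R * @I2 R n * wn s F * (4 * 100 ^+ n * (1 + 4 * l1 e) ^+ 2).
have K0 : 0 <= K.
  rewrite /K; apply: mulr_ge0; first by rewrite mulr_ge0 ?wn_ge0// mulr_ge0// I2_ge0.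
  by rewrite mulr_ge0 ?sqr_ge0// mulr_ge0// exprn_ge0.
pose E N := Num.sqrt K * exp_rem N (1 + 4 * l1 e).
have B0 : 0 <= 1 + 4 * l1 e by have := l1_ge0 e; lra.
have E0 N : 0 <= E N by rewrite mulr_ge0 ?sqrtr_ge0 ?exp_rem_ge0.
have bd N : `|Re z - series (fun k => ka k * Re (Lam F (mom e k))) N.+1| <= E N.
  have -> : Re z - series (fun k => ka k * Re (Lam F (mom e k))) N.+1 =
     Re (z - \sum_(0 <= k < N.+1) (ka k)%:C * Lam F (mom e k)).
    rewrite cReD cReN Re_sum /series /=; congr (_ - _); apply: eq_bigr => k _.
    by rewrite mul0r subr0; exact: erefl.
  rewrite Lam_rem; set y := Lam F _.
  have hy : sqnormc y <= E N ^+ 2.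
    apply: le_trans (Lam_bnd s1 (sob_meas sF) (sob_int sF) (rem_h1 N e)) _.
    rewrite /E [X in _ <= X]exprMn sqr_sqrtr// le_eqVlt; apply/orP; left; apply/eqP.
    by rewrite /K; ring.
  have r2 : Re y ^+ 2 <= E N ^+ 2 by apply: le_trans hy; rewrite /sqnormc lerDl sqr_ge0.
  by rewrite -(ler_pXn2r (n := 2)) ?nnegrE// real_normK ?num_real.
have Ec : E N @[N --> \oo] --> (0 : R).
  by rewrite -(mulr0 (Num.sqrt K)); apply: cvgM; [exact: cvg_cst|exact: exp_rem_cvg].
apply/cvgrPdist_le => eps e0.
have /cvgrPdist_le/(_ eps e0) := Ec.
apply: filterS => N; rewrite sub0r normrN ger0_norm// => h.
exact: le_trans (bd N) h.
Qed.
End ray.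
End series_fun.

Section rays.
Variables (s : R) (F : Rn -> R[i]).
Hypothesis s1 : -1 <= s <= 1.
Hypothesis sF : Sob s F.
Local Notation Lam := (@Lam R n).

Lemma mom_scale t e k : Lam F (mom (t *: e) k) = (t ^+ k)%:C * Lam F (mom e k).
Proof.
have hm := mom_h1 e k.
(* The multiple [t^k mom e k] in the shape [a phi + psi] of [Lam_lin]. *)
have E : mom (t *: e) k = (fun x => (t ^+ k - 1)%:C * mom e k x + mom e k x).
  apply/funext => x; rewrite /mom dotrC dotrZr dotrC exprMn rmorphM rmorphB/= rmorph1; ring.
rewrite E (Lam_lin s1 _ (sob_meas sF) (sob_int sF) hm hm) conjR rmorphB rmorph1 /=.
by rewrite mulrBl mul1r subrK.
Qed.

(** Absorbs the factor [k + 1] of the moment bound into geometric growth, as [eseq] demands. *)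
Lemma succ_le_pow2 k : k.+1%:R <= 2 ^+ k :> R.
Proof.
elim: k => [|k IH]; first by rewrite expr0.
have h : 1 <= k.+1%:R :> R by rewrite ler1n.
by rewrite -[k.+2]addn1 natrD exprS; lra.
Qed.

Lemma mom_bnd e : exists C M, [/\ 0 <= C, 1 <= M & forall k, `|Re (Lam F (mom e k))| <= C * M ^+ k].
Proof.
set B := 1 + 4 * l1 e; have B1 : 1 <= B by have := l1_ge0 e; rewrite /B; lra.
have B0 : 0 <= B by lra.
pose K := n.+1%:R * @I2 R n * wn s F * (4 * 100 ^+ n * B ^+ 2).
have K0 : 0 <= K.
  rewrite /K; apply: mulr_ge0; first by rewrite mulr_ge0 ?wn_ge0// mulr_ge0// I2_ge0.
  by rewrite mulr_ge0 ?sqr_ge0// mulr_ge0// exprn_ge0.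
exists (Num.sqrt K), (2 * B); split; [exact: sqrtr_ge0|lra|move=> k].
set y := Lam F _.
have E0 : 0 <= Num.sqrt K * (k.+1%:R * B ^+ k).
  by rewrite mulr_ge0 ?sqrtr_ge0// mulr_ge0// exprn_ge0.
have hy : sqnormc y <= (Num.sqrt K * (k.+1%:R * B ^+ k)) ^+ 2.
  apply: le_trans (Lam_bnd s1 (sob_meas sF) (sob_int sF) (mom_h1 e k)) _.
  rewrite -/B [X in _ <= X]exprMn sqr_sqrtr// le_eqVlt; apply/orP; left; apply/eqP.
  by rewrite /K; ring.
have r2 : Re y ^+ 2 <= (Num.sqrt K * (k.+1%:R * B ^+ k)) ^+ 2.
  by apply: le_trans hy; rewrite /sqnormc lerDl sqr_ge0.
have h : `|Re y| <= Num.sqrt K * (k.+1%:R * B ^+ k).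
  by rewrite -(ler_pXn2r (n := 2)) ?nnegrE// real_normK ?num_real.
apply: le_trans h _; rewrite ler_wpM2l ?sqrtr_ge0// exprMn ler_wpM2r ?exprn_ge0//.
exact: succ_le_pow2.
Qed.

Lemma series_double (c_ : nat -> R) N : series c_ N.*2 = series (fun j => c_ j.*2 + c_ j.*2.+1) N.
Proof.
elim: N => [|N IH]; first by rewrite double0 /series /= !big_geq.
by rewrite doubleS !seriesSr IH addrA.
Qed.

Lemma cvg_double (c_ : nat -> R) (l : R) : series c_ @ \oo --> l ->
  series (fun j => c_ j.*2 + c_ j.*2.+1) @ \oo --> l.
Proof.
move=> h; have -> : series (fun j => c_ j.*2 + c_ j.*2.+1) = (fun N => series c_ N.*2).
  by apply/funext => N; rewrite series_double.
apply: cvg_comp h => /= A [N _ hN]; exists N => // k /= Nk; apply: hN => /=.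
by apply: leq_trans Nk _; rewrite -addnn leq_addr.
Qed.

Lemma fact_double j : (j`! <= (j.*2)`!)%N.
Proof. by apply: leq_fact; rewrite -addnn leq_addr. Qed.

Definition cos_ka (k : nat) : R := (~~ odd k)%:R * (-1) ^+ k./2 * (k`!%:R)^-1.
Definition sin_ka (k : nat) : R := (odd k)%:R * (-1) ^+ k.-1./2 * (k`!%:R)^-1.

Lemma cos_ser (t : R) : series (fun k => cos_ka k * t ^+ k) @ \oo --> cos t.
Proof.
have -> : (fun k => cos_ka k * t ^+ k) = cos_coeff t.
  by apply/funext => k; rewrite /cos_ka /cos_coeff /= mulrAC.
by rewrite unlock; exact: is_cvg_series_cos_coeff.
Qed.

Lemma sin_ser (t : R) : series (fun k => sin_ka k * t ^+ k) @ \oo --> sin t.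
Proof.
have -> : (fun k => sin_ka k * t ^+ k) = sin_coeff t.
  by apply/funext => k; rewrite /sin_ka /sin_coeff /= mulrAC.
by rewrite unlock; exact: is_cvg_series_sin_coeff.
Qed.

Lemma cos_ka_le k : `|cos_ka k| <= (k`!%:R)^-1.
Proof.
rewrite /cos_ka !normrM normfV !normr_nat normrX normrN normr1 expr1n mulr1.
by case: odd; rewrite /= ?mul0r ?mul1r ?invr_ge0.
Qed.

Lemma sin_ka_le k : `|sin_ka k| <= (k`!%:R)^-1.
Proof.
rewrite /sin_ka !normrM normfV !normr_nat normrX normrN normr1 expr1n mulr1.
by case: odd; rewrite /= ?mul0r ?mul1r ?invr_ge0.
Qed.

Lemma mcos : measurable_fun [set: R] (@cos R).
Proof. by apply: continuous_measurable_fun; exact: continuous_cos. Qed.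

Lemma msin : measurable_fun [set: R] (@sin R).
Proof. by apply: continuous_measurable_fun; exact: continuous_sin. Qed.

Lemma ImCC (a b : R) : Im (a%:C * b%:C) = 0.
Proof. by rewrite !cE; ring. Qed.

Lemma ridge_parts (w : R) (a b : R[i]) : Im a = 0 -> Im b = 0 ->
  Re (w%:C * (Num.conj 'i * b + a)) = w * Re a /\ Im (w%:C * (Num.conj 'i * b + a)) = - (w * Re b).
Proof. by move=> r1 r2; split; rewrite !cE r1 r2; ring. Qed.

Lemma ev_parts p : (Re (ev F p) = @fnorm R n * Re (Lam F (fun x => (chi x)%:C * (cos (dotr p x))%:C))) /\
  (Im (ev F p) = - (@fnorm R n * Re (Lam F (fun x => (chi x)%:C * (sin (dotr p x))%:C)))).
Proof.
have [C hc] := fun_h1 cos_ser cos_ka_le mcos s1 sF p.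
have [D hs] := fun_h1 sin_ser sin_ka_le msin s1 sF p.
have E : psi_ p = (fun x => 'i * ((chi x)%:C * (sin (dotr p x))%:C) + (chi x)%:C * (cos (dotr p x))%:C).
  by apply/funext => x; rewrite /psi_ /cis; apply: complexP; rewrite !cE /=; ring.
rewrite evE E (Lam_lin s1 'i (sob_meas sF) (sob_int sF) hs hc).
have r1 := Lam_real s1 sF hc (fun x => ImCC _ _).
have r2 := Lam_real s1 sF hs (fun x => ImCC _ _).
exact: (ridge_parts (@fnorm R n) r1 r2).
Qed.

Lemma ReRM (a : R) (z : R[i]) : Re (a%:C * z) = a * Re z.
Proof. by rewrite !cE; ring. Qed.

Lemma ImRM (a : R) (z : R[i]) : Im (a%:C * z) = a * Im z.
Proof. by rewrite !cE; ring. Qed.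

Lemma mom_scaleR t e k : Re (Lam F (mom (t *: e) k)) = t ^+ k * Re (Lam F (mom e k)).
Proof. by rewrite mom_scale ReRM. Qed.

Lemma even_term (t x y : R) j : cos_ka j.*2 * (t ^+ j.*2 * x) + cos_ka j.*2.+1 * (t ^+ j.*2.+1 * y) =
  cos_ka j.*2 * x * (t ^+ 2) ^+ j.
Proof.
by rewrite {2}/cos_ka /= odd_double /= !mul0r addr0 -exprM mul2n mulrCA mulrC.
Qed.

Lemma odd_term (t x y : R) j : sin_ka j.*2 * (t ^+ j.*2 * x) + sin_ka j.*2.+1 * (t ^+ j.*2.+1 * y) =
  t * (sin_ka j.*2.+1 * y * (t ^+ 2) ^+ j).
Proof.
rewrite {1}/sin_ka odd_double !mul0r add0r -exprM mul2n exprS; ring.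
Qed.

(** The cosine series keeps even moments only, so consecutive terms taken in pairs form a power
    series in [t^2]; [(2 j)! >= j!] gives the bound of [eseq]. *)
Lemma ray_even e : exists2 a, eseq a & forall t, Re (ev F (t *: e)) = @fnorm R n * esum_ a (t ^+ 2).
Proof.
have [C [M [C0 M1 h]]] := mom_bnd e; have M0 : 0 <= M by lra.
exists (fun j => cos_ka j.*2 * Re (Lam F (mom e j.*2))).
  exists C, (M ^+ 2); split; rewrite ?exprn_ge0// => j.
  rewrite normrM -exprM mul2n mulrC; apply: ler_pM => //.
  apply: le_trans (cos_ka_le _) _; rewrite lef_pV2 ?posrE ?ltr0n ?fact_gt0// ler_nat.
  exact: fact_double.
move=> t; rewrite (ev_parts _).1; congr (_ * _); apply/esym.
have H := cvg_double (@Lam_series _ _ cos_ser cos_ka_le mcos s F s1 sF (t *: e)).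
apply: (cvg_lim (@Rhausdorff R)); apply: cvg_trans H.
apply: near_eq_cvg; near=> N; apply: eq_bigr => j _.
exact: etrans (f_equal2 (fun a b => cos_ka j.*2 * a + cos_ka j.*2.+1 * b)
  (mom_scaleR t e j.*2) (mom_scaleR t e j.*2.+1)) (even_term _ _ _ _).
Unshelve. all: by end_near. Qed.

(** The sine series keeps odd moments, from which a factor [t] is taken out; for [t != 0] the limit
    can be divided by it. *)
Lemma ray_odd e : exists2 b, eseq b & forall t, t != 0 -> Im (ev F (t *: e)) = - (@fnorm R n * (t * esum_ b (t ^+ 2))).
Proof.
have [C [M [C0 M1 h]]] := mom_bnd e; have M0 : 0 <= M by lra.
exists (fun j => sin_ka j.*2.+1 * Re (Lam F (mom e j.*2.+1))).
  exists (C * M), (M ^+ 2); split; rewrite ?mulr_ge0 ?exprn_ge0// => j.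
  rewrite normrM -exprM mul2n mulrC -[X in _ <= X / _]mulrA -exprS; apply: ler_pM => //.
  apply: le_trans (sin_ka_le _) _; rewrite lef_pV2 ?posrE ?ltr0n ?fact_gt0// ler_nat.
  by apply: leq_trans (fact_double j) _; exact: leq_fact.
move=> t t0; rewrite (ev_parts _).2; congr (- (_ * _)); apply/esym.
have H := cvg_double (@Lam_series _ _ sin_ser sin_ka_le msin s F s1 sF (t *: e)).
apply: (mulfI (invr_neq0 t0)); rewrite mulKf//.
apply: (cvg_lim (@Rhausdorff R)). 
have H' := cvgM (cvg_cst t^-1) H.
apply: cvg_trans; last exact: (H' _ _).
apply: near_eq_cvg; near=> N; rewrite /pseries /series /= mulr_sumr; apply: eq_bigr => j _.
rewrite -[RHS](mulKf t0); congr (t^-1 * _).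
exact: etrans (f_equal2 (fun a b => sin_ka j.*2 * a + sin_ka j.*2.+1 * b)
  (mom_scaleR t e j.*2) (mom_scaleR t e j.*2.+1)) (odd_term _ _ _ _).
Unshelve. all: by end_near. Qed.

(** [9 = 3^2] comes from the box, and [20 = 2 * 9 + 2] from splitting the increment into two
    products. *)
Lemma psi_diff_h1 p q : h1 (fun x => (-1) * psi_ q x + psi_ p x) (4 * 100 ^+ n * (20 * l1 (p - q) ^+ 2 * w1 p)).
Proof.
have L0 := l1_ge0 (p - q); have W1 := w1_ge1 p.
have L2 : 0 <= l1 (p - q) ^+ 2 by exact: sqr_ge0.
have -> : (fun x => (-1) * psi_ q x + psi_ p x) = (fun x => (chi x)%:C * (cis (dotr p x) - cis (dotr q x))).
  by apply/funext => x; rewrite /psi_; ring.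
have bd x : (forall i, `|x ord0 i| <= 3) -> sqnormc (cis (dotr p x) - cis (dotr q x)) <= 9 * l1 (p - q) ^+ 2.
  move=> bx; have -> : dotr p x = dotr q x + dotr (p - q) x by rewrite dotrDl dotrNl; ring.
  apply: le_trans (cis_lip _ _) _.
  have -> : 9 * l1 (p - q) ^+ 2 = (3 * l1 (p - q)) ^+ 2 by ring.
  by rewrite -real_normK ?num_real//; apply: lerXn2r; rewrite ?nnegrE ?mulr_ge0//; exact: dotr_box.
apply: chi_h1.
- by apply: cmeasB; exact: cmeas_cis.
- move=> x bx; apply: le_trans (bd x bx) _; nra.
move=> j t x t0 t1 bx.
have dd y : dotr y (x + t *: delta_mx ord0 j) = dotr y x + t * y ord0 j.
  by rewrite dotrDr dotrZr [dotr y (delta_mx _ _)]dotrC dotr_delta.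
rewrite !dd !cisD.
have -> : cis (dotr p x) * cis (t * p ord0 j) - cis (dotr q x) * cis (t * q ord0 j) -
   (cis (dotr p x) - cis (dotr q x)) =
   (cis (dotr p x) - cis (dotr q x)) * (cis (t * p ord0 j) - 1) +
   cis (dotr q x) * (cis (t * p ord0 j) - cis (t * q ord0 j)) by ring.
apply: le_trans (sqnormcD_le _ _) _; rewrite !sqnormcM sqnormc_cis mul1r.
have h1' := bd x bx.
have h2 : sqnormc (cis (t * p ord0 j) - 1) <= (t * p ord0 j) ^+ 2.
  by have := cis_lip 0 (t * p ord0 j); rewrite add0r cis0.
have h3 : sqnormc (cis (t * p ord0 j) - cis (t * q ord0 j)) <= (t * (p - q) ord0 j) ^+ 2.
  have -> : t * p ord0 j = t * q ord0 j + t * (p - q) ord0 j by rewrite !mxE; ring.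
  exact: cis_lip.
have h4 : p ord0 j ^+ 2 <= w1 p by apply: le_trans (sqr_coor_le p j) _; rewrite lerDr.
have h5 : (p - q) ord0 j ^+ 2 <= l1 (p - q) ^+ 2.
  by rewrite -real_normK ?num_real//; apply: lerXn2r; rewrite ?nnegrE//; exact: coor_l1.
have h6 := ler_pM (sqnormc_ge0 _) (sqnormc_ge0 _) h1' h2.
move: h3 h4 h5 h6 W1 L2; rewrite !exprMn.
move: (sqnormc _) (sqnormc _ * _) ((p - q) ord0 j ^+ 2) (l1 _ ^+ 2) (w1 p) (p ord0 j ^+ 2) (sqr_ge0 t).
move: (t ^+ 2) => T A B C D E W T0 h3 h4 h5 h6 W1 L2.
have g1 := ler_wpM2l T0 h5.
have g2 := ler_wpM2l (mulr_ge0 T0 L2) h4.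
have g3 := ler_wpM2l (mulr_ge0 T0 L2) W1.
lra.
Qed.

Lemma ev_lip p : exists2 K, 0 <= K & forall q, sqnormc (ev F p - ev F q) <= K * l1 (p - q) ^+ 2.
Proof.
exists (@fnorm R n ^+ 2 * (n.+1%:R * (4 * 100 ^+ n * (20 * w1 p) * @I2 R n) * wn s F)).
  rewrite mulr_ge0 ?sqr_ge0// mulr_ge0 ?wn_ge0// mulr_ge0// mulr_ge0 ?I2_ge0//.
  by rewrite mulr_ge0 ?mulr_ge0 ?exprn_ge0// ltW// w1_gt0.
move=> q; have [C hp] := psi_h1 p; have [D hq] := psi_h1 q.
have e : ev F p - ev F q = (@fnorm R n)%:C * Lam F (fun x => (-1) * psi_ q x + psi_ p x).
  rewrite (Lam_lin s1 (-1) (sob_meas sF) (sob_int sF) hq hp) !evE rmorphN rmorph1 mulN1r -mulrBr.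
  by congr (_ * _); rewrite addrC.
rewrite e sqnormcM sqnormcR -[X in _ <= X]mulrA; apply: ler_wpM2l; first exact: sqr_ge0.
apply: le_trans (Lam_bnd s1 (sob_meas sF) (sob_int sF) (psi_diff_h1 p q)) _.
by rewrite le_eqVlt; apply/orP; left; apply/eqP; ring.
Qed.

Lemma near_l1 p (d : R) : 0 < d -> \forall q \near p, l1 (p - q) <= d.
Proof.
move=> d0; have e0 : 0 < d / n.+1%:R by rewrite divr_gt0.
apply/nbhs_ballP; exists (d / n.+1%:R) => //= q [_ h]; rewrite /l1.
apply: (@le_trans _ _ (\sum_(i < n) d / n.+1%:R)).
  by apply: ler_sum => i _; rewrite !mxE; exact: ltW (h ord0 i).
rewrite sumr_const card_ord -[_ *+ n]mulr_natr -mulrA ler_piMr ?(ltW d0)//.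
by rewrite mulrC ler_pdivrMr// mul1r ler_nat.
Qed.

Lemma ev_continuous : continuous (fun p => Re (ev F p)) /\ continuous (fun p => Im (ev F p)).
Proof.
have H (T : R[i] -> R) : (forall z w, `|T z - T w| ^+ 2 <= sqnormc (z - w)) -> continuous (fun p => T (ev F p)).
  move=> hT p; have [K K0 hK] := ev_lip p; apply/(@cvgrPdist_le _ _ _ (nbhs p) (nbhs_filter p)) => e e0.
  pose S := Num.sqrt K + 1; have S0 : 0 < S by rewrite ltr_wpDl ?sqrtr_ge0.
  have d0 : 0 < e / S by rewrite divr_gt0.
  apply: filterS (near_l1 p d0) => q hq.
  have l0 := l1_ge0 (p - q).
  have b1 : `|T (ev F p) - T (ev F q)| ^+ 2 <= (S * l1 (p - q)) ^+ 2.
    apply: le_trans (hT _ _) (le_trans (hK q) _).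
    rewrite [X in _ <= X]exprMn ler_wpM2r ?sqr_ge0// -{1}(sqr_sqrtr K0).
    by apply: lerXn2r; rewrite ?nnegrE ?sqrtr_ge0 ?(ltW S0)// /S lerDl.
  have b2 : `|T (ev F p) - T (ev F q)| <= S * l1 (p - q).
    by rewrite -(ler_pXn2r (n := 2)) ?nnegrE ?mulr_ge0 ?(ltW S0).
  by apply: le_trans b2 _; rewrite mulrC -ler_pdivlMr.
split; apply: H => z w; rewrite real_normK ?num_real//.
- by rewrite -cReN -cReD /sqnormc lerDl sqr_ge0.
- by rewrite -cImN -cImD /sqnormc lerDr sqr_ge0.
Qed.
End rays.

Lemma continuous_omega m : continuous (@omega R n m).
Proof.
move=> p; apply: (@continuous_comp _ _ _ (fun p => m ^+ 2 + sqnormr p) (@Num.sqrt R)); last exact: sqrt_continuous.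
have H : continuous (fun q : Rn => \sum_(i < n) q ord0 i * q ord0 i).
  apply: (@continuous_big _ _ _ _ _ add_continuous) => i _ q.
  by apply: (@cvgM R Rn (nbhs q) _ (fun q => q ord0 i) (fun q => q ord0 i)); exact: (@coord_continuous R 1 n ord0 i q).
by apply: (@cvgD R R Rn (nbhs p) _ (fun=> m ^+ 2) _ _ _ (cvg_cst _)); exact: (H p).
Qed.

(** The equation holds almost everywhere while the argument runs along single rays. Both sides have
    continuous representatives, so it holds at every point, and the parameter 1 on the ray through
    [p] gives [ev G p = 0]. *)
Lemma antiloc m s s' F G : (1 < n)%N -> -1 <= s <= 1 -> -1 <= s' <= 1 -> Sob s F -> Sob s' G ->
  {ae leb, forall p, F p = (omega m p)%:C * G p} ->
  {ae leb, forall p, F p = 0 /\ G p = 0}.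
Proof.
move=> n1 s1 s1' sF sG FG.
have [cF1 cF2] := ev_continuous s1 sF; have [cG1 cG2] := ev_continuous s1' sG.
have co := continuous_omega (m := m).
have ae : {ae leb, forall p, ev F p = (omega m p)%:C * ev G p}.
  by apply: filterS3 FG (ev_ae s1 sF) (ev_ae s1' sG) => p e a b; rewrite -a e b.
have cR : continuous (fun p => omega m p * Re (ev G p)).
  by move=> q; apply: (@cvgM R Rn (nbhs q) _ (omega m) _ _ _ (co q)); exact: cG1.
have cI : continuous (fun p => omega m p * Im (ev G p)).
  by move=> q; apply: (@cvgM R Rn (nbhs q) _ (omega m) _ _ _ (co q)); exact: cG2.
have aR : {ae leb, forall p, Re (ev F p) = omega m p * Re (ev G p)}.
  by apply: filterS ae => q ->; rewrite ReRM.
have aI : {ae leb, forall p, Im (ev F p) = omega m p * Im (ev G p)}.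
  by apply: filterS ae => q ->; rewrite ImRM.
have e1 := ae_continuous_eq cF1 cR aR; have e2 := ae_continuous_eq cF2 cI aI.
have f0 : 0 < @fnorm R n by rewrite powR_gt0// mulr_gt0// pi_gt0.
have G0 p : 0 < nrm p -> ev G p = 0.
  move=> p0; have nu0 : 0 < sqnormr p by rewrite sqrtr_gt0 in p0.
  have ot t : omega m (t *: p) ^+ 2 = m ^+ 2 + sqnormr p * t ^+ 2.
    by rewrite omega_sqr /sqnormr dotrZr [dotr (t *: p) _]dotrC dotrZr; ring.
  have [a ea Ha] := ray_even s1 sF p; have [b eb Hb] := ray_even s1' sG p.
  have [c ec Hc] := ray_odd s1 sF p; have [d ed Hd] := ray_odd s1' sG p.
  have b0 : esum_ b 1 = 0.
    apply: (entire_sqrt ea eb nu0 (mu := m ^+ 2)) => w w0.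
    have tw : Num.sqrt w ^+ 2 = w by rewrite sqr_sqrtr// ltW.
    have := f_equal (fun h => h (Num.sqrt w *: p)) e1; rewrite /= Ha Hb tw => h.
    have g : esum_ a w = omega m (Num.sqrt w *: p) * esum_ b w.
      by apply: (mulfI (lt0r_neq0 f0)); rewrite h; ring.
    by rewrite g exprMn ot tw.
  have d0 : esum_ d 1 = 0.
    apply: (entire_sqrt ec ed nu0 (mu := m ^+ 2)) => w w0.
    have tw : Num.sqrt w ^+ 2 = w by rewrite sqr_sqrtr// ltW.
    have t0 : Num.sqrt w != 0 by rewrite gt_eqF// sqrtr_gt0.
    have := f_equal (fun h => h (Num.sqrt w *: p)) e2; rewrite /= (Hc _ t0) (Hd _ t0) tw => h.
    have g : esum_ c w = omega m (Num.sqrt w *: p) * esum_ d w.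
      apply: (mulfI t0); apply: (mulfI (lt0r_neq0 f0)); apply: oppr_inj; rewrite h; ring.
    by rewrite g exprMn ot tw.
  have h1 := Hb 1; have h2 := Hd 1 (oner_neq0 _).
  move: h1 h2; rewrite scale1r expr1n b0 d0 !mulr0 oppr0 => r i0; by apply: complexP; rewrite ?r ?i0 ?cRe0 ?cIm0.
have Gae : {ae leb, forall p, G p = 0}.
  by apply: filterS2 (ev_ae s1' sG) (nrm_ae n1) => p e p0; rewrite e; exact: G0 p0.
by apply: filterS2 FG Gae => p -> ->; rewrite mulr0.
Qed.

Lemma FF_iE u : {ae leb, forall p, L2_fun (FF ('i *: u)) p = 'i * L2_fun (FF u) p}.
Proof. by rewrite FF_Z; exact: L2_funZ. Qed.

Lemma hs_i V W : {ae leb, forall p, W p = 'i * V p} ->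
  {ae leb, forall p, hs W p = - ha V p /\ ha W p = hs V p}.
Proof.
move=> e; apply: filterS2 e (ae_opp e) => p e1 e2.
by split; apply: complexP; rewrite ?cReN ?cImN ?Re_hs ?Im_hs ?Re_ha ?Im_ha e1 e2 !cE; field.
Qed.

(** Multiplication by ['i] exchanges the Hermitian parts up to a sign, and [w^{1/2} = w w^{-1/2}].
    The term with coefficient 0 puts the second equation into the shape of [Sob_lin]. *)
Lemma FK_i m u : (1 < n)%N ->
  {ae leb, forall p, FK m u p = (omega m p)%:C * GK m ('i *: u) p /\
    FK m ('i *: u) p = (omega m p)%:C * ((- 1)%:C * GK m u p + 0%:C * GK m u p)}.
Proof.
move=> n1; apply: filterS2 (hs_i (FF_iE u)) (omega_ae n1 m) => p [e1 e2] o0.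
have w : (omega m p `^ 2^-1)%:C = (omega m p)%:C * (omega m p `^ (- 2^-1))%:C.
  rewrite -rmorphM; congr (_%:C); rewrite -{2}[omega m p]powRr1 ?omega_ge0// -powRD; last first.
    by rewrite (gt_eqF o0) implybT.
  by congr (_ `^ _); lra.
rewrite /FK /GK /om_ e1 e2 w; split; first by rewrite mulrA.
by rewrite rmorphN rmorph1 rmorph0; ring.
Qed.

Lemma om_eq0 m s F p : 0 < omega m p -> om_ m s F p = 0 -> F p = 0.
Proof.
move=> o0 /(congr1 (fun z => ((omega m p `^ s)^-1)%:C * z)).
rewrite /om_ mulr0 mulrA -rmorphM mulVf ?rmorph1 ?mul1r//.
by rewrite gt_eqF// powR_gt0.
Qed.

(** [FK_i] supplies two equations [F = w G]; [antiloc] annihilates [FK m u] by the first and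
    [GK m u] by the second. *)
Lemma Kset_inter m (u : L2 leb) : (1 < n)%N -> Kset m u -> Kset m ('i *: u) -> u = 0.
Proof.
move=> n1 [sF sG] [sF' sG']; have e := FK_i m u n1.
have s1 : -1 <= (- 2^-1 : R) <= 1 by apply/andP; split; lra.
have s2 : -1 <= (2^-1 : R) <= 1 by apply/andP; split; lra.
have e1 : {ae leb, forall p, FK m u p = (omega m p)%:C * GK m ('i *: u) p}.
  by apply: filterS e => p [].
have a1 := antiloc n1 s1 s2 sF sG' e1.
have e2 : {ae leb, forall p, FK m ('i *: u) p = (omega m p)%:C * ((- 1)%:C * GK m u p + 0%:C * GK m u p)}.
  by apply: filterS e => p [].
have a2 := antiloc n1 s1 s2 sF' (Sob_lin (-1) 0 s2 sG sG) e2.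
have F0 : FF (0 : L2 leb) = 0 :=
  etrans (f_equal FF (esym (subrr (0 : L2 leb)))) (etrans (FF_B 0 0) (subrr _)).
apply: FF_inj; rewrite F0; apply: L2_ext.
have z : {ae leb, forall p, L2_fun (FF u) p = 0}.
  apply: filterS3 a1 a2 (omega_ae n1 m) => p [h1 _] [_ h2] o0.
  rewrite hs_ha (om_eq0 o0 h1).
  have /(om_eq0 o0) -> : GK m u p = 0; last by rewrite mulr0 addr0.
  move: h2; rewrite rmorph0 mul0r addr0 rmorphN rmorph1 mulN1r => /eqP.
  by rewrite oppr_eq0 => /eqP.
by apply: filterS2 (L2_fun0 leb) z => p -> ->.
Qed.
End power_series_pairing.

(** * Hilbert-Schmidt sums over standard subspaces *)

Section hilbert_schmidt_real.
Context {R : realType} {H : lmodType R[i]} {ip : H -> H -> R[i]} (hip : is_hilbert ip).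
Implicit Types (K L E : set H) (h k x y u : H).
Local Notation n2 := (nrm2 ip).
Local Notation rip u v := (Re (ip u v)).

Definition separating K := forall u, K u -> K ('i *: u) -> u = 0.

Lemma rs_D K h k : real_subspace K -> K h -> K k -> K (h + k).
Proof. by move=> rK Kh Kk; have := rK.2 1 _ _ Kh Kk; rewrite scale1r. Qed.

Lemma rs_Z K (a : R) h : real_subspace K -> K h -> K (a%:C *: h).
Proof. by move=> rK Kh; have := rK.2 a _ _ Kh rK.1; rewrite addr0. Qed.

Lemma rs_B K h k : real_subspace K -> K h -> K k -> K (h - k).
Proof.
move=> rK Kh Kk; apply: rs_D => //.
by have := rs_Z (- 1) rK Kk; rewrite rmorphN rmorph1 scaleN1r.
Qed.

Lemma rs_sum K (I : Type) (s : seq I) (f : I -> H) : real_subspace K ->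
  (forall i, K (f i)) -> K (\sum_(i <- s) f i).
Proof.
move=> rK Kf; elim: s => [|i s IH]; first by rewrite big_nil; exact: rK.1.
by rewrite big_cons; exact: rs_D.
Qed.

Lemma decomp_unique K h k h' k' : real_subspace K -> separating K ->
  K h -> K k -> K h' -> K k' -> h + 'i *: k = h' + 'i *: k' -> h = h' /\ k = k'.
Proof.
move=> rK sK Kh Kk Kh' Kk' e.
have e1 : h - h' = 'i *: (k' - k).
  by rewrite scalerBr; apply/eqP; rewrite subr_eq addrAC -subr_eq opprK e addrC.
have k0 : k' - k = 0.
  by apply: sK; [exact: rs_B|rewrite -e1; exact: rs_B].
move: e1; rewrite k0 scaler0 => /eqP; rewrite subr_eq0 => /eqP ->; split=> //.
by move/eqP: k0; rewrite subr_eq0 => /eqP.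
Qed.

(** Uniqueness of the decomposition makes any [phi h k] a function of [h + i k]; this is the
    existence behind the definite descriptions [tomita] and [complex_ext]. *)
Lemma ext_exists K (phi : H -> H -> H) : real_subspace K -> separating K ->
  exists B : H -> H, forall h k, K h -> K k -> B (h + 'i *: k) = phi h k.
Proof.
move=> rK sK.
have P x : exists y, forall h k, K h -> K k -> x = h + 'i *: k -> y = phi h k.
  have [[h [k [Kh Kk xe]]]|N] := pselect (exists h k, [/\ K h, K k & x = h + 'i *: k]).
    exists (phi h k) => h' k' Kh' Kk' xe'.
    by have [-> ->] := decomp_unique rK sK Kh Kk Kh' Kk' (etrans (esym xe) xe').
  by exists 0 => h k Kh Kk xe; case: N; exists h, k.
by have [B hB] := choice P; exists B => h k Kh Kk; exact: hB.
Qed.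

Lemma tomitaE K h k : real_subspace K -> separating K -> K h -> K k ->
  tomita K (h + 'i *: k) = h - 'i *: k.
Proof.
move=> rK sK; have [B hB] := ext_exists (fun h k => h - 'i *: k) rK sK.
by have := @xgetPex _ (@id H) [set s : H -> H | forall h k, K h -> K k -> s (h + 'i *: k) = h - 'i *: k]
  (ex_intro _ B hB); exact.
Qed.

Lemma complex_extE K (A : H -> H) h k : real_subspace K -> separating K -> K h -> K k ->
  complex_ext K A (h + 'i *: k) = A h + 'i *: A k.
Proof.
move=> rK sK; have [B hB] := ext_exists (fun h k => A h + 'i *: A k) rK sK.
by have := @xgetPex _ (@id H) [set B : H -> H | forall h k, K h -> K k -> B (h + 'i *: k) = A h + 'i *: A k]
  (ex_intro _ B hB); exact.
Qed.

Section span.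
Variable K : set H.
Hypotheses (rK : real_subspace K) (sK : separating K).
Local Notation X := (complex_span K).
Local Notation sip := (tomita_ip ip K).

(** The parts lie in [K] for every argument, with value 0 off the span, which spares membership
    hypotheses later. *)
Lemma span_parts : exists hh kk : H -> H, (forall x, K (hh x)) /\ (forall x, K (kk x)) /\
  forall x, X x -> x = hh x + 'i *: kk x.
Proof.
have P x : exists y : H * H, K y.1 /\ K y.2 /\ (X x -> x = y.1 + 'i *: y.2).
  have [[h [k [Kh Kk ->]]]|N] := pselect (X x); first by exists (h, k).
  by exists (0, 0); split; [exact: rK.1|split=> //; exact: rK.1].
have [f hf] := choice P; exists (fun x => (f x).1), (fun x => (f x).2).
by split; [move=> x; case: (hf x)|split=> x; case: (hf x) => _ []].
Qed.

(** Mixed contributions cancel between the two terms of [tomita_ip]: on the span it is twice the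
    complexification of the real product of [K]. *)
Lemma sipE h k h' k' : K h -> K k -> K h' -> K k' ->
  sip (h + 'i *: k) (h' + 'i *: k') =
  (2 * (rip h h' + rip k k')) +i* (2 * (rip h k' - rip k h')).
Proof.
move=> Kh Kk Kh' Kk'; rewrite /tomita_ip !tomitaE// !(ipE hip).
rewrite (ipC hip h h') (ipC hip k k') (ipC hip h k') (ipC hip k h').
by apply: complexP; rewrite !cE0 /=; ring.
Qed.

Lemma sip_nrm h k : K h -> K k -> Re (sip (h + 'i *: k) (h + 'i *: k)) = 2 * (n2 h + n2 k).
Proof. by move=> Kh Kk; rewrite sipE. Qed.

Lemma scale_parts (a b : R) h k : (a +i* b) *: (h + 'i *: k) =
  (a%:C *: h - b%:C *: k) + 'i *: (a%:C *: k + b%:C *: h).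
Proof.
have -> : a +i* b = a%:C + b%:C * 'i by apply: complexP; rewrite !cE /=; ring.
rewrite scalerDl !scalerDr !scalerA.
have -> : b%:C * 'i * 'i = - b%:C :> R[i] by apply: complexP; rewrite !cE /=; ring.
rewrite scaleNr [ 'i * a%:C]mulrC [ 'i * b%:C]mulrC.
by rewrite [(b%:C * 'i) *: h - _]addrC addrACA.
Qed.

Lemma rip_comb (a b a' b' : R) h k h' k' :
  rip (a%:C *: h + b%:C *: k) (a'%:C *: h' + b'%:C *: k') =
  a * a' * rip h h' + a * b' * rip h k' + (b * a' * rip k h' + b * b' * rip k k').
Proof. by rewrite (ipDl hip) !(ipDr hip) !cReD !(rip_Zl hip) !(rip_Zr hip); ring. Qed.

Section finite_family.
Variables (hh kk : H -> H).
Hypotheses (Khh : forall x, K (hh x)) (Kkk : forall x, K (kk x)).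
Hypothesis partsE : forall x, X x -> x = hh x + 'i *: kk x.
Variables (l : H -> R) (c : R).
Hypothesis c0 : 0 <= c.
Hypothesis lin : forall (a : R) h k, K h -> K k -> l (a%:C *: h + k) = a * l h + l k.
Hypothesis bnd : forall k, K k -> l k ^+ 2 <= c * n2 k.

Lemma lin0 : l 0 = 0.
Proof. by have := lin 1 rK.1 rK.1; rewrite scaler0 addr0; lra. Qed.

Lemma lin_sum (s : seq H) (f : H -> H) : (forall i, K (f i)) ->
  l (\sum_(i <- s) f i) = \sum_(i <- s) l (f i).
Proof.
move=> Kf; elim: s => [|i s IH]; first by rewrite !big_nil lin0.
rewrite !big_cons -IH; have := lin 1 (Kf i) (rs_sum s rK Kf).
by rewrite scale1r mul1r.
Qed.

Lemma lin_comb (a b : R) h k : K h -> K k -> l (a%:C *: h + b%:C *: k) = a * l h + b * l k.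
Proof.
move=> Kh Kk; rewrite (lin a Kh (rs_Z b rK Kk)).
by have := lin b Kk rK.1; rewrite addr0 lin0 addr0 => ->.
Qed.

Definition orthon (s : seq H) := forall e f, e \in s -> f \in s -> sip e f = (e == f)%:R.

Lemma on_bound (s : seq H) : uniq s -> (forall e, e \in s -> X e) -> orthon s ->
  \sum_(e <- s) (l (hh e) ^+ 2 + l (kk e) ^+ 2) <= c / 2.
Proof.
move=> us Xs os; set S := \sum_(e <- s) _.
have S0 : 0 <= S by apply: sumr_ge0 => e _; rewrite addr_ge0// sqr_ge0.
(* [f e + i g e] is [e] multiplied by the conjugate of [l (hh e) + i l (kk e)]. *)
pose f e := (l (hh e))%:C *: hh e + (l (kk e))%:C *: kk e.
pose g e := (l (hh e))%:C *: kk e + (- l (kk e))%:C *: hh e.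
have Kf e : K (f e) by apply: rK.2 => //; exact: rs_Z.
have Kg e : K (g e) by apply: rK.2 => //; exact: rs_Z.
pose hy := \sum_(e <- s) f e; pose ky := \sum_(e <- s) g e.
have lhy : l hy = S.
  by rewrite lin_sum//; apply: eq_bigr => e _; rewrite lin_comb// !expr2.
have AB e e' : e \in s -> e' \in s -> rip (hh e) (hh e') + rip (kk e) (kk e') = (e == e')%:R / 2 /\
    rip (hh e) (kk e') - rip (kk e) (hh e') = 0.
  move=> es es'; have := os _ _ es es'; rewrite {1}(partsE (Xs _ es)) {1}(partsE (Xs _ es')) sipE//.
  move=> /eqP; rewrite eq_complex /= => /andP[/eqP h1 /eqP h2].
  have h3 : Re ((e == e')%:R : R[i]) = (e == e')%:R by case: (e == e').
  have h4 : Im ((e == e')%:R : R[i]) = 0 by case: (e == e').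
  by rewrite h3 in h1; rewrite h4 in h2; split; lra.
have fg e e' : e \in s -> e' \in s -> rip (f e) (f e') + rip (g e) (g e') =
    (l (hh e) * l (hh e') + l (kk e) * l (kk e')) * ((e == e')%:R / 2).
  move=> es es'; have [A B] := AB _ _ es es'; rewrite -A /f /g !rip_comb.
  have B' : rip (hh e) (kk e') = rip (kk e) (hh e') by lra.
  by rewrite B'; ring.
(* The [1/2] reflects the 2 of [sipE]: a unit vector [h + i k] has [n2 h + n2 k = 1/2]. *)
have nn : n2 hy + n2 ky = S / 2.
  rewrite /nrm2 /hy /ky !(ip_suml hip) !Re_sum -big_split /= mulr_suml.
  apply: eq_big_seq => e es; rewrite !(ip_sumr hip) !Re_sum -big_split /=.
  rewrite (eq_big_seq _ (fun e' es' => fg e e' es es')) (bigD1_seq e)//= eqxx big1 ?addr0.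
    have -> : (true%:R : R) = 1 by [].
    by rewrite !expr2; ring.
  by move=> e' ne; rewrite eq_sym (negbTE ne) mul0r mulr0.
have b := bnd (rs_sum s rK Kf); rewrite -/hy lhy in b.
have n0 := nrm2_ge0 hip ky.
have SS : S * S <= c * (S / 2) by rewrite -expr2; apply: le_trans b _; rewrite ler_wpM2l// -nn lerDl.
have [Sz|Sp] := eqVneq S 0; first by rewrite Sz divr_ge0.
have Sp' : 0 < S by rewrite lt_def Sp S0.
by rewrite -(ler_pM2r Sp'); apply: le_trans SS _; rewrite mulrA mulrAC.
Qed.
End finite_family.

Lemma sipC x y : X x -> X y -> sip y x = Num.conj (sip x y).
Proof.
move=> [h [k [Kh Kk ->]]] [h' [k' [Kh' Kk' ->]]]; rewrite !sipE//.
apply: complexP; rewrite ?cReJ ?cImJ /=.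
  by rewrite (ripC hip h' h) (ripC hip k' k).
by rewrite (ripC hip h' k) (ripC hip k' h); ring.
Qed.

Lemma span_ZR (a : R) x : X x -> X (a%:C *: x).
Proof.
move=> [h [k [Kh Kk ->]]]; exists (a%:C *: h), (a%:C *: k).
by split; [exact: rs_Z|exact: rs_Z|rewrite scalerDr !scalerA mulrC].
Qed.

Lemma sip_ZR (a : R) x y : X x -> X y -> sip x (a%:C *: y) = a%:C * sip x y.
Proof.
move=> [h [k [Kh Kk ->]]] [h' [k' [Kh' Kk' ->]]].
have -> : a%:C *: (h' + 'i *: k') = a%:C *: h' + 'i *: (a%:C *: k').
  by rewrite scalerDr !scalerA mulrC.
rewrite !sipE//; try exact: rs_Z.
by apply: complexP; rewrite /= !(rip_Zr hip); ring.
Qed.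

Lemma sip_gt0 x : X x -> x != 0 -> 0 < Re (sip x x) /\ Im (sip x x) = 0.
Proof.
move=> [h [k [Kh Kk ->]]] x0; rewrite sipE//=; split; last by rewrite (ripC hip h k) subrr mulr0.
have a := nrm2_ge0 hip h; have b := nrm2_ge0 hip k.
rewrite lt_def; apply/andP; split; last by rewrite mulr_ge0// addr_ge0.
apply: contraNneq x0; rewrite -/(n2 h) -/(n2 k) => e.
have h0 : h = 0 by apply: (nrm2_eq0 hip); lra.
have k0 : k = 0 by apply: (nrm2_eq0 hip); lra.
by rewrite h0 k0 scaler0 addr0.
Qed.

(** [hs_norm] refers to a basis picked by choice, so one must exist. Zorn's lemma gives a maximal
    orthonormal set; a nonzero vector orthogonal to it could be normalised and added. *)
Lemma basis_exists : exists E, orthonormal_basis X sip E.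
Proof.
pose P := [set E : set H | E `<=` X /\ forall e f, E e -> E f -> sip e f = (e == f)%:R].
have [F FP tF|A [[AX oA] mA]] := @Zorn_bigcup H P.
  split; first by move=> x [E FE Ex]; exact: (FP _ FE).1.
  move=> e f [E FE Ee] [E' FE' E'f].
  by have [EE|EE] := tF _ _ FE FE'; [apply: (FP _ FE').2 => //; exact: EE|apply: (FP _ FE).2 => //; exact: EE].
exists A; split=> // x Xx x0; apply: contrapT => /eqP xn.
have [c0 ci] := sip_gt0 Xx xn; set c := Re (sip x x) in c0.
pose y := ((Num.sqrt c)^-1)%:C *: x; have Xy : X y by exact: span_ZR.
have yE e : A e -> sip e y = 0.
  by move=> Ae; rewrite sip_ZR ?x0 ?mulr0//; exact: AX.
have Ey e : A e -> sip y e = 0.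
  by move=> Ae; rewrite (sipC (AX _ Ae) Xy) yE// rmorph0.
have yy : sip y y = 1.
  rewrite {2}/y sip_ZR// (sipC Xx Xy) {1}/y sip_ZR// rmorphM /=.
  have -> : sip x x = c%:C by apply: complexP; rewrite ?cReC ?cImC.
  rewrite !conjR -!rmorphM.
  have s0 : Num.sqrt c != 0 by rewrite gt_eqF// sqrtr_gt0.
  rewrite -{3}(sqr_sqrtr (ltW c0)) expr2.
  by rewrite (_ : _ * _ = 1) ?rmorph1//; field.
have Ne e : A e -> (e == y) = false.
  by move=> Ae; apply/negP => /eqP ey; have := yE _ Ae; rewrite ey yy => /eqP; rewrite oner_eq0.
apply: (mA (A `|` [set y])).
  rewrite properEneq; split; last by move=> z; left.
  apply/eqP => e; have Ay : A y by rewrite e; right.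
  by have := Ne _ Ay; rewrite eqxx.
split; first by move=> z [/AX//|->].
move=> e f [Ae|->] [Af|->].
- exact: oA.
- by rewrite yE// Ne.
- by rewrite Ey// eq_sym Ne.
- by rewrite yy eqxx.
Qed.

Section operator.
Variables (T0 T : H -> H) (Cb : R).
Hypothesis T0K : forall k, K k -> K (T0 k).
Hypothesis T0lin : forall (a : R) h k, K h -> K k -> T0 (a%:C *: h + k) = a%:C *: T0 h + T0 k.
Hypothesis T0bnd : forall k, K k -> n2 (T0 k) <= Cb * n2 k.
Hypothesis TE : forall h k, K h -> K k -> T (h + 'i *: k) = T0 h + 'i *: T0 k.

Lemma T00 : T0 0 = 0.
Proof. by have := T0lin (-1) rK.1 rK.1; rewrite scaler0 addr0 rmorphN rmorph1 scaleN1r addNr. Qed.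

Lemma T0comb (a b : R) h k : K h -> K k -> T0 (a%:C *: h + b%:C *: k) = a%:C *: T0 h + b%:C *: T0 k.
Proof.
move=> Kh Kk; rewrite (T0lin a Kh (rs_Z b rK Kk)).
by have := T0lin b Kk rK.1; rewrite addr0 T00 addr0 => ->.
Qed.

Lemma T_bounded : bounded_operator X sip T.
Proof.
split.
- by move=> _ [h [k [Kh Kk ->]]]; exists (T0 h), (T0 k); split; [exact: T0K|exact: T0K|exact: TE].
- move=> [a b] _ _ [h [k [Kh Kk ->]]] [h' [k' [Kh' Kk' ->]]].
  have N (u : H) : - (b%:C *: u) = (- b)%:C *: u by rewrite rmorphN scaleNr.
  have D u v : K u -> K v -> T0 (u + v) = T0 u + T0 v.
    by move=> Ku Kv; have := T0lin 1 Ku Kv; rewrite !scale1r.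
  have Kc (a' b' : R) u v : K u -> K v -> K (a'%:C *: u + b'%:C *: v).
    by move=> Ku Kv; apply: rK.2 => //; exact: rs_Z.
  have E (u v u' v' : H) : u + 'i *: v + (u' + 'i *: v') = u + u' + 'i *: (v + v').
    by rewrite scalerDr addrACA.
  have K1 := Kc a (- b) _ _ Kh Kk; have K2 := Kc a b _ _ Kk Kh.
  rewrite (TE Kh Kk) (TE Kh' Kk') !scale_parts !N !E (TE (rs_D rK K1 Kh') (rs_D rK K2 Kk')).
  by rewrite (D _ _ K1 Kh') (D _ _ K2 Kk') (T0comb _ _ Kh Kk) (T0comb _ _ Kk Kh).
- exists (Num.sqrt Cb) => _ [h [k [Kh Kk ->]]].
  rewrite (TE Kh Kk) /hnorm !sip_nrm//; try exact: T0K.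
  have a := T0bnd Kh; have b := T0bnd Kk.
  have nh := nrm2_ge0 hip h; have nk := nrm2_ge0 hip k.
  have th := nrm2_ge0 hip (T0 h); have tk := nrm2_ge0 hip (T0 k).
  have [C0|C0] := leP 0 Cb.
    rewrite -sqrtrM//; apply: ler_wsqrtr; rewrite mulrCA ler_pM2l// mulrDr; exact: lerD.
  have -> : 2 * (n2 (T0 h) + n2 (T0 k)) = 0.
    by have := mulr_le0_ge0 (ltW C0) nh; have := mulr_le0_ge0 (ltW C0) nk; lra.
  by rewrite sqrtr0 mulr_ge0 ?sqrtr_ge0.
Qed.

(** The sum over [E] is the supremum over finite subsets, each of them a finite orthonormal family
    to which the hypothesis applies; the factor 2 is that of [sip_nrm]. *)
Lemma hs_sum_le E (B : R) (hh kk : H -> H) : (forall x, K (hh x)) -> (forall x, K (kk x)) ->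
  (forall x, X x -> x = hh x + 'i *: kk x) -> orthonormal_basis X sip E ->
  (forall s, uniq s -> (forall e, e \in s -> X e) -> orthon s ->
    \sum_(e <- s) (n2 (T0 (hh e)) + n2 (T0 (kk e))) <= B) ->
  (hs_sum sip T E <= (2 * B)%:E)%E.
Proof.
move=> Khh Kkk pE [EX oE _] bd; apply: ub_ereal_sup => _ [A [fA AE] <-].
rewrite fsbig_finite//= sumEFin lee_fin.
have AP (e : H) : e \in finmap.enum_fset (fset_set A) -> A e.
  by move=> he; apply: set_mem; rewrite -(in_fset_set fA e); exact: he.
rewrite (eq_big_seq (fun e => 2 * (n2 (T0 (hh e)) + n2 (T0 (kk e))))).
  rewrite -mulr_sumr ler_pM2l//; apply: bd => //.
  - exact: finmap.fset_uniq.
  - by move=> e /AP/AE/EX.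
  - by move=> e f /AP/AE Ee /AP/AE Ef; exact: oE.
move=> e /AP/AE/EX Xe; rewrite {1}(pE _ Xe) TE// /hnorm sip_nrm ?sqr_sqrtr//; try exact: T0K.
by rewrite mulr_ge0// addr_ge0// (nrm2_ge0 hip).
Qed.
End operator.
End span.

(** * The real adjoint and the defect of a bounded real-linear map *)

Section adjoint.
Variables (K L : set H) (Q : H -> H) (Cq : R).
Hypotheses (rK : real_subspace K) (rL : real_subspace L) (sK : separating K) (sL : separating L).
Hypothesis clK : forall (x_ : nat -> H) v, (forall n : nat, K (x_ n)) -> hlim ip x_ v -> K v.
Hypothesis QL : forall k, K k -> L (Q k).
Hypothesis Qlin : forall (a : R) h k, K h -> K k -> Q (a%:C *: h + k) = a%:C *: Q h + Q k.
Hypothesis Cq0 : 0 <= Cq.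
Hypothesis Qbnd : forall k, K k -> n2 (Q k) <= Cq * n2 k.

Local Notation Qd := (real_adjoint ip K L Q).

(** [riesz] on the closed space [K], applied to [Re <h, Q .>], provides an adjoint; the definite
    description then has this property. *)
Lemma adjointP h : L h -> K (Qd h) /\ forall k, K k -> rip (Qd h) k = rip h (Q k).
Proof.
have ex u : exists v, L u -> K v /\ forall k, K k -> rip v k = rip u (Q k).
  have [Lu|N] := pselect (L u); last by exists 0.
  have C0 : 0 <= n2 u * Cq by rewrite mulr_ge0// (nrm2_ge0 hip).
  have [||v Kv hv] := @riesz _ _ _ hip K (fun k => rip u (Q k)) (n2 u * Cq) C0 rK clK.
  - by move=> a x y Kx Ky; rewrite Qlin// (ipDr hip) cReD (rip_Zr hip).
  - move=> k Kk; apply: le_trans (rip_cs hip _ _) _; rewrite -mulrA ler_wpM2l ?(nrm2_ge0 hip)//.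
    exact: Qbnd.
  by exists v.
have [B hB] := choice ex; move: h.
exact: (@xgetPex _ (@id H) [set B : H -> H | forall h, L h -> K (B h) /\
    forall k, K k -> rip (B h) k = rip h (Q k)] (ex_intro _ B hB)).
Qed.

Lemma rip_eq u v : K u -> K v -> (forall k, K k -> rip u k = rip v k) -> u = v.
Proof.
move=> Ku Kv e; apply/eqP; rewrite -subr_eq0; apply/eqP/(nrm2_eq0 hip).
by rewrite /nrm2 (ipDl hip) (ipNl hip) cReD cReN e ?subrr//; exact: rs_B.
Qed.

Lemma adjoint_lin (a : R) h k : L h -> L k -> Qd (a%:C *: h + k) = a%:C *: Qd h + Qd k.
Proof.
move=> Lh Lk; have [Kh eh] := adjointP Lh; have [Kk ek] := adjointP Lk.
have [Ks es] := adjointP (rL.2 a _ _ Lh Lk).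
apply: rip_eq => // [|v Kv]; first exact: rK.2.
by rewrite es// !(ipDl hip) !cReD !(rip_Zl hip) eh// ek.
Qed.

Lemma adjoint_bnd h : L h -> n2 (Qd h) <= Cq * n2 h.
Proof.
move=> Lh; have [Kd ed] := adjointP Lh; have e := ed _ Kd.
have nd := nrm2_ge0 hip (Qd h); have nh := nrm2_ge0 hip h.
have b : n2 (Qd h) * n2 (Qd h) <= n2 h * (Cq * n2 (Qd h)).
  rewrite -expr2 {1}/nrm2 e; apply: le_trans (rip_cs hip _ _) _.
  by apply: ler_wpM2l => //; exact: Qbnd.
have [z|z] := eqVneq (n2 (Qd h)) 0; first by rewrite z mulr_ge0.
have p : 0 < n2 (Qd h) by rewrite lt_def z nd.
by rewrite -(ler_pM2r p); apply: le_trans b _; rewrite mulrA [n2 h * _]mulrC.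
Qed.

Definition defect h := h - Qd (Q h).

Lemma defectK k : K k -> K (defect k).
Proof. by move=> Kk; apply: rs_B => //; exact: (adjointP (QL Kk)).1. Qed.

Lemma defect_lin (a : R) h k : K h -> K k -> defect (a%:C *: h + k) = a%:C *: defect h + defect k.
Proof.
move=> Kh Kk; rewrite /defect Qlin// adjoint_lin; try exact: QL.
by rewrite scalerBr opprD addrACA.
Qed.

Lemma defect_bnd k : K k -> n2 (defect k) <= (2 + 2 * (Cq * Cq)) * n2 k.
Proof.
move=> Kk; have := nrm2D_le hip k (- Qd (Q k)); rewrite (nrm2N hip).
have a := adjoint_bnd (QL Kk); have b := ler_wpM2l Cq0 (Qbnd Kk); rewrite /defect.
by move: (n2 _) (n2 _) (n2 _) (n2 _) a b => A B C D a b; lra.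
Qed.

Lemma defect_rip h v : K h -> K v -> rip (defect h) v = rip h v - rip (Q h) (Q v).
Proof.
move=> Kh Kv; rewrite /defect (ipDl hip) (ipNl hip) cReD cReN.
by rewrite ((adjointP (QL Kh)).2 _ Kv).
Qed.

Lemma defect_ext h k : K h -> K k ->
  h + 'i *: k - complex_ext L Qd (complex_ext K Q (h + 'i *: k)) = defect h + 'i *: defect k.
Proof.
move=> Kh Kk; rewrite !complex_extE//; try exact: QL.
by rewrite scalerBr opprD addrACA.
Qed.
End adjoint.
End hilbert_schmidt_real.

(** * The symplectomorphism Q and its defect *)

Section symplecto.
Context {R : realType} {n : nat}.
Local Notation leb := (@lebesgue_rV R n).
Local Notation Rn := 'rV[R]_n.
Local Notation L2 := (L2 leb).
Local Notation ip := (@L2_ip _ _ R leb).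
Local Notation n2 := (nrm2 ip).
Local Notation omega := (@omega R n).
Implicit Types (F G A B : Rn -> R[i]) (p : Rn) (m : R) (u v w : L2).
Hypothesis n1 : (1 < n)%N.

Lemma omega_massless : omega 0 = @nrm R n.
Proof. by apply/funext => p; rewrite /omega expr0n add0r. Qed.

Let le00 : (0 : R) <= 0. Proof. exact: lexx. Qed.

Lemma measurable_omegaV m : measurable_fun setT (fun p => (omega m p)^-1).
Proof.
rewrite (_ : (fun p => (omega m p)^-1) = (fun p => omega m p `^ (-1))); first exact: measurable_omega_pow.
by apply/funext => p; rewrite powR_inv1// omega_ge0.
Qed.

Lemma meas_reconj A B : cmeasurable A -> cmeasurable B ->
  measurable_fun setT (fun p => Re (Num.conj (A p) * B p)).
Proof. by move=> mA mB; have [] : cmeasurable (fun p => Num.conj (A p) * B p) by exact: cmeasM (cmeasJ mA) mB. Qed.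

Lemma reconj_om (a b : R) (z w : R[i]) : Re (Num.conj (a%:C * z) * (b%:C * w)) = (a * b) * Re (Num.conj z * w).
Proof. by rewrite !cE; ring. Qed.

Lemma reconj_congr (a b c : R) (z w z' w' : R[i]) : z' = a%:C * z -> w' = b%:C * w -> a * b = c ->
  Re (Num.conj z' * w') = c * Re (Num.conj z * w).
Proof. by move=> -> -> <-; exact: reconj_om. Qed.

Lemma lin_congr (a : R) (x y z x' y' z' w : R[i]) : x' = x -> y' = y -> z' = z ->
  a%:C * x' + 1%:C * y' = z' -> a%:C * x + 1%:C * y = w -> z = w.
Proof. by move=> -> -> -> ->. Qed.

Lemma om_pows m p : 0 < omega m p ->
  [/\ omega m p `^ (- 2^-1) * omega m p `^ 2^-1 = 1,
      omega m p `^ (- 2^-1) * omega m p `^ (- 2^-1) = (omega m p)^-1 &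
      omega m p `^ 2^-1 * omega m p `^ 2^-1 = omega m p].
Proof.
move=> o0; have s : omega m p `^ 2^-1 * omega m p `^ 2^-1 = omega m p.
  by rewrite powR12_sqrt ?(ltW o0)// -expr2 sqr_sqrtr// ltW.
have q0 : omega m p `^ 2^-1 != 0 by rewrite gt_eqF// powR_gt0.
by rewrite !powRN; split; rewrite ?mulVf// -invfM s.
Qed.

Section pairing.
Variables (m : R) (F G F' G' : Rn -> R[i]).
Hypotheses (m0 : 0 <= m) (sF : Sob (- 2^-1) F) (sG : Sob 2^-1 G) (sF' : Sob (- 2^-1) F') (sG' : Sob 2^-1 G').
Let mF := sob_meas sF. Let mG := sob_meas sG. Let mF' := sob_meas sF'. Let mG' := sob_meas sG'.

(** The factor [w^{-1/2}] of one component always meets [w^{1/2}] of the other, so the mass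
    cancels. *)
Lemma emb_im : Im (ip (emb m F G) (emb m F' G')) = rint F G' - rint G F'.
Proof.
have [a b] := emb_parts n1 m0 sF sG; have [a' b'] := emb_parts n1 m0 sF' sG'.
rewrite (ip_parts _ _).2; congr (_ - _).
- apply: Rint_ae.
  + by apply: meas_reconj; [exact: (sqi_hs (L2_sqi _)).1|exact: (sqi_ha (L2_sqi _)).1].
  + exact: meas_reconj.
  + apply: filterS3 a b' (omega_ae n1 m) => p e e' o0; rewrite e e' reconj_om.
    by have [-> _ _] := om_pows o0; rewrite mul1r.
- apply: Rint_ae.
  + by apply: meas_reconj; [exact: (sqi_ha (L2_sqi _)).1|exact: (sqi_hs (L2_sqi _)).1].
  + exact: meas_reconj.
  + apply: filterS3 b a' (omega_ae n1 m) => p e e' o0; rewrite e e' reconj_om mulrC.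
    by have [h _ _] := om_pows o0; rewrite [X in _ * X]mulrC h mulr1.
Qed.

Lemma emb_re : Re (ip (emb m F G) (emb m F' G')) =
  \int[leb]_p ((omega m p)^-1 * Re (Num.conj (F p) * F' p)) + \int[leb]_p (omega m p * Re (Num.conj (G p) * G' p)).
Proof.
have [a b] := emb_parts n1 m0 sF sG; have [a' b'] := emb_parts n1 m0 sF' sG'.
have mo := @measurable_omega R n m.
rewrite (ip_parts _ _).1; congr (_ + _).
- apply: Rint_ae.
  + by apply: meas_reconj; exact: (sqi_hs (L2_sqi _)).1.
  + by apply: measurable_funM; [exact: measurable_omegaV|exact: meas_reconj].
  + apply: filterS3 a a' (omega_ae n1 m) => p e e' o0.
    have [_ h _] := om_pows o0; exact: reconj_congr e e' h.
- apply: Rint_ae.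
  + by apply: meas_reconj; exact: (sqi_ha (L2_sqi _)).1.
  + by apply: measurable_funM => //; exact: meas_reconj.
  + apply: filterS3 b b' (omega_ae n1 m) => p e e' o0.
    have [_ _ h] := om_pows o0; exact: reconj_congr e e' h.
Qed.
End pairing.

Definition Qf m u : L2 := emb 0 (FK m u) (GK m u).

Lemma Qf_F m u : Kset m u -> {ae leb, forall p, FK m u p = FK 0 (Qf m u) p} /\
  {ae leb, forall p, GK m u p = GK 0 (Qf m u) p}.
Proof. by move=> [sF sG]; split; [exact: FK_emb|exact: GK_emb]. Qed.

Lemma Qf_K m u : Kset m u -> Kset 0 (Qf m u).
Proof. by move=> [sF sG]; exact: Kset_emb. Qed.

Lemma Kset_eq m u v : 0 <= m -> Kset m u -> Kset m v ->
  {ae leb, forall p, FK m u p = FK m v p} -> {ae leb, forall p, GK m u p = GK m v p} -> u = v.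
Proof.
move=> m0 [sF sG] [sF' sG'] eF eG.
rewrite -(embK n1 m0 sF sG) -(embK n1 m0 sF' sG'); exact: emb_ae.
Qed.

Lemma Qf_lin m (a : R) u v : 0 <= m -> Kset m u -> Kset m v ->
  Qf m (a%:C *: u + v) = a%:C *: Qf m u + Qf m v.
Proof.
move=> m0 Ku Kv; have Ks := Kset_lin a Ku Kv.
have [e1 e2] := Qf_F Ku; have [f1 f2] := Qf_F Kv; have [g1 g2] := Qf_F Ks.
apply: (Kset_eq le00 (Qf_K Ks) (Kset_lin a (Qf_K Ku) (Qf_K Kv))).
- apply: filterS3 (filterI e1 f1) (filterI g1 (FK_lin m u v a)) (FK_lin 0 (Qf m u) (Qf m v) a) => p [x y] [z w] t.
  exact: lin_congr x y z w t.
- apply: filterS3 (filterI e2 f2) (filterI g2 (GK_lin m u v a)) (GK_lin 0 (Qf m u) (Qf m v) a) => p [x y] [z w] t.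
  exact: lin_congr x y z w t.
Qed.

Lemma Qf_im m u v : 0 <= m -> Kset m u -> Kset m v -> Im (ip (Qf m u) (Qf m v)) = Im (ip u v).
Proof.
move=> m0 [sF sG] [sF' sG']; rewrite /Qf (emb_im le00 sF sG sF' sG').
by rewrite -{3}(embK n1 m0 sF sG) -{3}(embK n1 m0 sF' sG') (emb_im m0 sF sG sF' sG').
Qed.

Lemma Qf_inj m u v : 0 <= m -> Kset m u -> Kset m v -> Qf m u = Qf m v -> u = v.
Proof.
move=> m0 Ku Kv e; have [e1 e2] := Qf_F Ku; have [f1 f2] := Qf_F Kv.
rewrite e in e1 e2; apply: (Kset_eq m0 Ku Kv).
- by apply: filterS2 e1 f1 => p -> ->.
- by apply: filterS2 e2 f2 => p -> ->.
Qed.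

Lemma Qf_surj m w : 0 <= m -> Kset 0 w -> exists2 u, Kset m u & Qf m u = w.
Proof.
move=> m0 Kw; have [sF sG] := Kw; have Ku := Kset_emb n1 m0 sF sG; exists (emb m (FK 0 w) (GK 0 w)); first exact: Ku.
have [e1 e2] := Qf_F Ku; apply: (Kset_eq le00 (Qf_K Ku) Kw).
- by apply: filterS2 e1 (FK_emb n1 m0 sF sG) => p <- ->.
- by apply: filterS2 e2 (GK_emb n1 m0 sF sG) => p <- ->.
Qed.

Lemma Qf_dist m f g : 0 <= m -> sobolevB (- 2^-1) f -> sobolevB 2^-1 g ->
  Qf m (omega_pow m (- 2^-1) f + 'i *: omega_pow m 2^-1 g) =
  omega_pow 0 (- 2^-1) f + 'i *: omega_pow 0 2^-1 g.
Proof.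
move=> m0 bf bg; have [sF _] := sobolevB_F bf; have [sG _] := sobolevB_G bg.
apply: etrans (f_equal (Qf m) (omega_pow_emb n1 m0 bf bg)) _.
apply: etrans _ (esym (omega_pow_emb n1 le00 bf bg)).
have [sF' sG'] := Kset_emb n1 m0 sF sG.
apply: (emb_ae n1 le00 sF' sG' sF sG).
- by apply: filterS (FK_emb n1 m0 sF sG) => p /esym.
- by apply: filterS (GK_emb n1 m0 sF sG) => p /esym.
Qed.

(** [Qmap] is a definite description: [Qf m] satisfies it, and the formula it contains fixes the
    values on [K_m]. *)
Lemma QmapE m u : 0 <= m -> Kset m u -> Qmap m u = Qf m u.
Proof.
move=> m0 Ku.
pose P := [set Q : L2 -> L2 | symplectomorphism ip (Kspace m) (Kspace 0) Q /\
  forall f g, sobolevB (- 2^-1) f -> sobolevB 2^-1 g ->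
    Q (omega_pow m (- 2^-1) f + 'i *: omega_pow m 2^-1 g) =
    omega_pow 0 (- 2^-1) f + 'i *: omega_pow 0 2^-1 g].
have KP v : Kspace m v <-> Kset m v := KspaceP n1 v m0.
have KP0 v : Kspace 0 v <-> Kset 0 v := KspaceP n1 v le00.
have PQ : P (Qf m).
  split; last by move=> f g; exact: Qf_dist.
  split; [split| |].
  - by move=> v /KP Kv; apply/KP0; exact: Qf_K.
  - by move=> v w; rewrite !inE => /KP Kv /KP Kw; exact: Qf_inj.
  - by move=> w /KP0 /(Qf_surj m0)[v Kv <-]; exists v => //; exact/KP.
  - by move=> a v w /KP Kv /KP Kw; exact: Qf_lin.
  - by move=> v w /KP Kv /KP Kw; exact: Qf_im.
have [_ h] := @xgetPex _ (@id L2) P (ex_intro _ _ PQ).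
have [f [g [bf bg ->]]] := (KP u).2 Ku.
by rewrite /Qmap (h f g bf bg) Qf_dist.
Qed.

Lemma intg_omG2 m G : 0 <= m -> Sob 2^-1 G -> intg leb (fun p => omega m p * sqnormc (G p)).
Proof. by move=> m0 sG; rewrite -(funext (om_sqr m G)); exact: (sqi_omG m0 sG).2. Qed.

Lemma intg_omF2 m F : Sob (- 2^-1) F -> intg leb (fun p => (omega m p)^-1 * sqnormc (F p)).
Proof. by move=> sF; rewrite -(funext (omV_sqr m F)); exact: (sqi_omF n1 m sF).2. Qed.

Lemma nrm2_emb m F G : 0 <= m -> Sob (- 2^-1) F -> Sob 2^-1 G ->
  n2 (emb m F G) = \int[leb]_p ((omega m p)^-1 * sqnormc (F p)) + \int[leb]_p (omega m p * sqnormc (G p)).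
Proof.
move=> m0 sF sG; rewrite /nrm2 (emb_re m0 sF sG sF sG).
have e (z : R[i]) : Re (Num.conj z * z) = sqnormc z by rewrite /sqnormc !cE0; ring.
by congr (_ + _); apply: eq_Rintegral => p _; rewrite e.
Qed.

Lemma omVF_ge0 m F : 0 <= \int[leb]_p ((omega m p)^-1 * sqnormc (F p)).
Proof. by apply: Rint_ge0 => p; rewrite mulr_ge0 ?invr_ge0 ?omega_ge0 ?sqnormc_ge0. Qed.

Lemma omG_ge0 m G : 0 <= \int[leb]_p (omega m p * sqnormc (G p)).
Proof. by apply: Rint_ge0 => p; rewrite mulr_ge0 ?omega_ge0 ?sqnormc_ge0. Qed.

Lemma Kset_nrm2 m u : 0 <= m -> Kset m u ->
  n2 u = \int[leb]_p ((omega m p)^-1 * sqnormc (FK m u p)) + \int[leb]_p (omega m p * sqnormc (GK m u p)).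
Proof. by move=> m0 [sF sG]; rewrite -(nrm2_emb m0 sF sG) (embK n1 m0 sF sG). Qed.

(** [|p| <= w_m] gives the constant 1, independent of [m]. *)
Lemma Kset_G_le m u : 0 <= m -> Kset m u ->
  intg leb (fun p => nrm p * sqnormc (GK m u p)) /\ \int[leb]_p (nrm p * sqnormc (GK m u p)) <= n2 u.
Proof.
move=> m0 Ku; have [sF sG] := Ku; have I := intg_omG2 m0 sG.
have I0 := intg_omG2 le00 sG.
rewrite omega_massless in I0.
split=> //; apply: (@le_trans _ _ (\int[leb]_p (omega m p * sqnormc (GK m u p)))).
  by apply: le_Rint => // p; apply: ler_wpM2r; [exact: sqnormc_ge0|exact: nrm_le_omega].
rewrite (Kset_nrm2 m0 Ku) lerDr; exact: omVF_ge0.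
Qed.

Lemma Qf_bnd m u : 0 <= m -> Kset m u -> n2 (Qf m u) <= (@cF0 R n * (1 + m) + 1) * n2 u.
Proof.
move=> m0 Ku; have [sF sG] := Ku; rewrite /Qf (nrm2_emb le00 sF sG).
rewrite omega_massless.
have [_ b1] := intg_F0 n1 sF; have [_ b2] := Kset_G_le m0 Ku; have [_ b3] := FK_wn u m0.
have c0 := @cF0_ge0 R n; have b4 := ler_wpM2l c0 b3.
rewrite mulrDl mul1r -mulrA; apply: lerD b2; exact: le_trans b1 b4.
Qed.
End symplecto.

(** * Pointwise bounds for the kernels *)

Section weights.
Context {R : realType}.
Implicit Types m r w S W : R.

Definition kF r w : R := r^-1 - w^-1.
Definition kG r w : R := w - r.
(** Chosen with [bF] so that [kF^2 <= aF bF]. Near 0 the kernel is shared evenly, since [kF^2 w] is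
    of order [r^{-2}], not integrable in dimension 2. For [r >= 1] the weight [1/w] goes to the
    factor controlled by the norm, which leaves a weight at most [m^4 r^{-5}]. *)
Definition aF r w : R := if r < 1 then kF r w else kF r w ^+ 2 * w.
Definition bF r w : R := if r < 1 then kF r w else w^-1.
Definition aG r w : R := kG r w ^+ 2 / w.
(** [sqrt m] comes from [kF_low], [m] from [kG_le] and [m^4] from the square of [kG_le2];
    [32 = 2 * 16] with the 16 of [Sw_high]. *)
Definition Pm m : R := 32 * (Num.sqrt m + m + m ^+ 4).

Lemma Pm_ge m : 0 < m -> [/\ Num.sqrt m * 2 <= Pm m, m <= Pm m, m ^+ 4 * 32 <= Pm m & m ^+ 4 * 16 <= Pm m].
Proof.
move=> m0; have a0 := sqrtr_ge0 m; have b : 0 <= m ^+ 4 by rewrite exprn_ge0// ltW.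
by rewrite /Pm; split; lra.
Qed.

Section pointwise.
Variables m r w S W : R.
Hypotheses (m0 : 0 < m) (r0 : 0 < r) (w0 : 0 <= w) (wE : w ^+ 2 = m ^+ 2 + r ^+ 2).
Hypotheses (W1 : 1 <= W) (rW : r <= W) (Slow : r <= 1 -> r `^ (- (3 / 2)) <= S) (S0 : 0 <= S).
Hypotheses (Shigh : 1 <= r -> r ^- 4 <= 16 * S) (W2 : r < 1 -> W <= 2) (Wr : 1 <= r -> W <= 2 * r).

Lemma rw_le : r <= w.
Proof. by rewrite -(ler_pXn2r (n := 2)) ?nnegrE ?(ltW r0)// wE lerDr sqr_ge0. Qed.

Lemma w_gt0 : 0 < w. Proof. exact: lt_le_trans r0 rw_le. Qed.

Lemma mw_le : m <= w.
Proof. by rewrite -(ler_pXn2r (n := 2)) ?nnegrE ?(ltW m0)// wE lerDl sqr_ge0. Qed.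

Lemma kG_ge0 : 0 <= kG r w. Proof. by rewrite subr_ge0 rw_le. Qed.

Lemma kG_le : kG r w <= m.
Proof.
rewrite lerBlDl -(ler_pXn2r (n := 2)) ?nnegrE ?addr_ge0 ?(ltW m0) ?(ltW r0)// wE.
by have := mulr_gt0 r0 m0; nra.
Qed.

Lemma kG_le2 : kG r w <= m ^+ 2 / r.
Proof.
rewrite ler_pdivlMr// /kG; have := rw_le; have : (w - r) * (w + r) = m ^+ 2 by rewrite -subr_sqr wE; ring.
have := w_gt0; nra.
Qed.

Lemma kFE : kF r w = kG r w / (r * w).
Proof. rewrite /kF /kG; have := w_gt0; move=> w1; field; by rewrite !gt_eqF. Qed.

Lemma kF_ge0 : 0 <= kF r w.
Proof. by rewrite kFE divr_ge0 ?kG_ge0// mulr_ge0// ltW. Qed.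

Lemma powR_three_halves : r `^ (- (3 / 2)) = (r * Num.sqrt r)^-1.
Proof.
rewrite powRN; congr (_^-1); have -> : (3 / 2 : R) = 1 + 2^-1 by field.
by rewrite powRD ?(gt_eqF r0) ?implybT// powRr1 ?(ltW r0)// powR12_sqrt// ltW.
Qed.

(** [w - r <= m] and, as [m r <= m^2 + r^2], [w >= sqrt (m r)]; hence
    [(w - r) / (r w) <= sqrt m / (r sqrt r)]. *)
Lemma kF_low : kF r w <= Num.sqrt m * r `^ (- (3 / 2)).
Proof.
rewrite powR_three_halves kFE.
have a0 : 0 < Num.sqrt m by rewrite sqrtr_gt0.
have b0 : 0 < Num.sqrt r by rewrite sqrtr_gt0.
have w1 := w_gt0.
have h : Num.sqrt m * Num.sqrt r <= w.
  rewrite -(ler_pXn2r (n := 2)) ?nnegrE ?mulr_ge0 ?ltW// exprMn !sqr_sqrtr ?ltW// wE.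
  by have := sqr_ge0 (m - r); have := mulr_gt0 m0 r0; nra.
rewrite ler_pdivrMr ?mulr_gt0//.
have -> : Num.sqrt m * (r * Num.sqrt r)^-1 * (r * w) = Num.sqrt m * (w / Num.sqrt r).
  by field; rewrite !gt_eqF.
apply: le_trans kG_le _.
rewrite -{1}(sqr_sqrtr (ltW m0)) expr2 ler_pM2l// ler_pdivlMr//.
Qed.

Lemma S_low1 : r < 1 -> 1 <= S.
Proof.
move=> r1; apply: le_trans (Slow (ltW r1)); rewrite powR_three_halves.
have b1 : Num.sqrt r <= 1 by rewrite -sqrtr1 ler_wsqrtr// ltW.
have b0 : 0 < Num.sqrt r by rewrite sqrtr_gt0.
rewrite invf_ge1 ?mulr_gt0//; apply: le_trans (_ : 1 * 1 <= _); last by rewrite mulr1.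
by apply: ler_pM => //; exact: ltW.
Qed.

Lemma aF_bnd : 0 <= aF r w /\ aF r w * W <= Pm m * S.
Proof.
have [a1 a2 a3 a4] := Pm_ge m0; have k0 := kF_ge0; have w1 := w_gt0.
rewrite /aF; case: ltP => r1.
  split=> //; have h := le_trans kF_low (ler_wpM2l (sqrtr_ge0 m) (Slow (ltW r1))).
  apply: (@le_trans _ _ (Num.sqrt m * S * 2)).
    by apply: ler_pM => //; [exact: le_trans ler01 W1|exact: W2].
  by rewrite mulrAC ler_wpM2r.
have W0 : 0 <= W := le_trans ler01 W1.
split; first by rewrite mulr_ge0 ?sqr_ge0// ltW.
have e : kF r w ^+ 2 * w = kG r w ^+ 2 / (r ^+ 2 * w).
  by rewrite kFE; field; rewrite !gt_eqF.
rewrite e; have kk : kG r w ^+ 2 <= (m ^+ 2 / r) ^+ 2.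
  by apply: lerXn2r; rewrite ?nnegrE ?kG_ge0 ?kG_le2// divr_ge0 ?sqr_ge0// ltW.
have d : (r ^+ 2 * w)^-1 <= (r ^+ 3)^-1.
  by rewrite lef_pV2 ?posrE ?mulr_gt0 ?exprn_gt0// (exprSr r 2) ler_pM2l ?exprn_gt0// rw_le.
have d0 : 0 <= (r ^+ 2 * w)^-1 by rewrite invr_ge0 mulr_ge0 ?sqr_ge0// ltW.
have h1 : kG r w ^+ 2 / (r ^+ 2 * w) * W <= (m ^+ 2 / r) ^+ 2 * (r ^+ 3)^-1 * (2 * r).
  apply: ler_pM => //; [|exact: ler_pM (sqr_ge0 _) d0 kk d|exact: Wr].
  by rewrite mulr_ge0 ?sqr_ge0.
have e2 : (m ^+ 2 / r) ^+ 2 * (r ^+ 3)^-1 * (2 * r) = 2 * m ^+ 4 * r ^- 4.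
  by field; rewrite gt_eqF.
rewrite e2 in h1; apply: le_trans h1 _.
have m4 : 0 <= 2 * m ^+ 4 by rewrite mulr_ge0// exprn_ge0// ltW.
apply: le_trans (ler_wpM2l m4 (Shigh r1)) _.
have -> : 2 * m ^+ 4 * (16 * S) = (m ^+ 4 * 32) * S by ring.
by rewrite ler_wpM2r.
Qed.

Lemma aG_bnd : 0 <= aG r w /\ aG r w * W^-1 <= Pm m * S.
Proof.
have [a1 a2 a3 a4] := Pm_ge m0; have k0 := kG_ge0; have w1 := w_gt0.
have W0 : 0 < W := lt_le_trans ltr01 W1.
have g0 : 0 <= aG r w by rewrite divr_ge0 ?sqr_ge0// ltW.
split=> //; have [r1|r1] := ltP r 1.
  have h : aG r w <= m.
    rewrite /aG ler_pdivrMr//; rewrite expr2; apply: ler_pM => //; first exact: kG_le.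
    exact: le_trans kG_le mw_le.
  have Wi : W^-1 <= 1 by rewrite invf_le1.
  apply: (@le_trans _ _ (m * 1)); first by apply: ler_pM => //; rewrite invr_ge0 ltW.
  by apply: ler_pM => //; [exact: ltW|exact: S_low1].
have kk : kG r w ^+ 2 <= (m ^+ 2 / r) ^+ 2.
  by apply: lerXn2r; rewrite ?nnegrE ?kG_ge0 ?kG_le2// divr_ge0 ?sqr_ge0// ltW.
have d : w^-1 <= r^-1 by rewrite lef_pV2 ?posrE// rw_le.
have d' : W^-1 <= r^-1 by rewrite lef_pV2 ?posrE.
have h1 : aG r w * W^-1 <= (m ^+ 2 / r) ^+ 2 * r^-1 * r^-1.
  apply: ler_pM => //; first by rewrite invr_ge0 ltW.
  by apply: ler_pM => //; rewrite ?sqr_ge0// invr_ge0 ltW.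
have e2 : (m ^+ 2 / r) ^+ 2 * r^-1 * r^-1 = m ^+ 4 * r ^- 4.
  by field; rewrite gt_eqF.
rewrite e2 in h1; apply: le_trans h1 _.
have m4 : 0 <= m ^+ 4 by rewrite exprn_ge0// ltW.
apply: le_trans (ler_wpM2l m4 (Shigh r1)) _.
by rewrite mulrA ler_wpM2r.
Qed.

Lemma bF_bnd : 0 <= bF r w /\ bF r w <= (if r < 1 then aF r w else 0) + w^-1.
Proof.
rewrite /bF /aF; have k0 := kF_ge0; have w1 := w_gt0.
have wi : 0 <= w^-1 by rewrite invr_ge0.
by case: ltP => r1; split=> //; rewrite ?add0r// lerDl.
Qed.

Lemma kF_split : kF r w ^+ 2 <= aF r w * bF r w.
Proof.
rewrite /aF /bF; case: ltP => r1; first by rewrite expr2.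
by rewrite mulfK// gt_eqF// w_gt0.
Qed.

Lemma kG_split : kG r w ^+ 2 <= aG r w * w.
Proof. by rewrite /aG divfK// gt_eqF// w_gt0. Qed.
End pointwise.
End weights.

(** * Estimate of the defect of one vector *)

Section estimates.
Context {R : realType} {n : nat}.
Local Notation leb := (@lebesgue_rV R n).
Local Notation Rn := 'rV[R]_n.
Local Notation L2 := (L2 leb).
Local Notation ip := (@L2_ip _ _ R leb).
Local Notation n2 := (nrm2 ip).
Local Notation omega := (@omega R n).
Local Notation cint := (cintegral leb).
Implicit Types (F G : Rn -> R[i]) (p : Rn) (m : R) (u v w h : L2) (k a b : Rn -> R).

Lemma cs_point (c x y a b : R) : 0 <= x -> 0 <= y -> c ^+ 2 <= a * b ->
  c ^+ 2 * x * y <= (a * x) * (b * y).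
Proof.
move=> x0 y0 h; have -> : (a * x) * (b * y) = (a * b) * (x * y) by ring.
have -> : c ^+ 2 * x * y = c ^+ 2 * (x * y) by ring.
by apply: ler_wpM2r => //; exact: mulr_ge0.
Qed.

Lemma weighted_cs k a b F F' : measurable_fun setT k -> cmeasurable F -> cmeasurable F' ->
  (forall p, 0 <= a p) -> (forall p, 0 <= b p) ->
  intg leb (fun p => a p * sqnormc (F p)) -> intg leb (fun p => b p * sqnormc (F' p)) ->
  {ae leb, forall p, k p ^+ 2 <= a p * b p} ->
  intg leb (fun p => k p * Re (Num.conj (F p) * F' p)) /\
  (\int[leb]_p (k p * Re (Num.conj (F p) * F' p))) ^+ 2 <=
    \int[leb]_p (a p * sqnormc (F p)) * \int[leb]_p (b p * sqnormc (F' p)).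
Proof.
move=> mk mF mF' a0 b0 Ia Ib kab.
have mkF : cmeasurable (fun p => (k p)%:C * F p) by apply: cmeasM => //; exact: cmeasR.
have H : {ae leb, forall p, sqnormc ((k p)%:C * F p) * sqnormc (F' p) <=
    (a p * sqnormc (F p)) * (b p * sqnormc (F' p))}.
  apply: filterS kab => p h; rewrite sqnormcM sqnormcR.
  exact: cs_point (sqnormc_ge0 _) (sqnormc_ge0 _) h.
have [|| I B] := cs_weight mkF mF' Ia Ib _ _ H.
- by move=> p; rewrite mulr_ge0 ?sqnormc_ge0.
- by move=> p; rewrite mulr_ge0 ?sqnormc_ge0.
have E p : Re (Num.conj ((k p)%:C * F p) * F' p) = k p * Re (Num.conj (F p) * F' p).
  by rewrite !cE; ring.
have I1 : intg leb (fun p => Re (Num.conj ((k p)%:C * F p) * F' p)) := I.1.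
rewrite (funext E) in I1; split=> //.
apply: le_trans B; rewrite -(funext E) -Re_cint; move: (cint _) => z.
by rewrite /sqnormc lerDl sqr_ge0.
Qed.

Hypotheses (n1 : (1 < n)%N) (n3 : (n <= 3)%N).

(** The absolute values give nonnegative weights at every point, including [p = 0], where [0^-1 = 0]
    makes [kF] negative for [m > 0]. *)
Definition AF m p : R := `|aF (nrm p) (omega m p)|.
Definition BF m p : R := `|bF (nrm p) (omega m p)|.
Definition AG m p : R := `|aG (nrm p) (omega m p)|.

Lemma measurable_kF m : measurable_fun setT (fun p => kF (nrm p) (omega m p)).
Proof. by apply: measurable_funB; [exact: measurable_nrmV|exact: measurable_omegaV]. Qed.

Lemma measurable_kG m : measurable_fun setT (fun p => kG (nrm p) (omega m p)).
Proof. by apply: measurable_funB; [exact: measurable_omega|exact: measurable_nrm]. Qed.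

Lemma measurable_AF m : measurable_fun setT (AF m).
Proof.
apply: (measurableT_comp (@normr_measurable R setT)).
apply: measurable_fun_ifT; first by apply: measurable_fun_ltr => //; exact: measurable_nrm.
- exact: measurable_kF.
- by apply: measurable_funM; [apply: measurable_funX; exact: measurable_kF|exact: measurable_omega].
Qed.

Lemma measurable_BF m : measurable_fun setT (BF m).
Proof.
apply: (measurableT_comp (@normr_measurable R setT)).
apply: measurable_fun_ifT; first by apply: measurable_fun_ltr => //; exact: measurable_nrm.
- exact: measurable_kF.
- exact: measurable_omegaV.
Qed.

Lemma measurable_AG m : measurable_fun setT (AG m).
Proof.
apply: (measurableT_comp (@normr_measurable R setT)).
by apply: measurable_funM; [apply: measurable_funX; exact: measurable_kG|exact: measurable_omegaV].
Qed.

Lemma weights_ae m : 0 < m -> {ae leb, forall p,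
  [/\ AF m p * wt 2^-1 p <= Pm m * Sw p, AG m p * wt (- 2^-1) p <= Pm m * Sw p,
      BF m p <= AF m p + (omega m p)^-1,
      kF (nrm p) (omega m p) ^+ 2 <= AF m p * BF m p &
      kG (nrm p) (omega m p) ^+ 2 <= AG m p * omega m p]}.
Proof.
move=> m0; apply: filterS2 (nrm_ae n1) (ae_coor_neq0 (R := R) (n := n)) => p r0 c0.
have wE : omega m p ^+ 2 = m ^+ 2 + nrm p ^+ 2 by rewrite omega_sqr nrm_sqr.
have w0 := omega_ge0 m p.
have W1 : 1 <= wt 2^-1 p by rewrite wtH -sqrtr1 ler_wsqrtr// w1_ge1.
have rW := nrm_le_wt p; have S0 := Sw_ge0 p.
have Slow := Sw_low n1 c0; have Shigh := @Sw_high R n p n3.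
have W2 := @wtH_le2 R n p.
have Wr : 1 <= nrm p -> wt 2^-1 p <= 2 * nrm p.
  move=> r1; rewrite -(ler_pXn2r (n := 2)) ?nnegrE ?wt_ge0 ?mulr_ge0 ?(ltW r0)//.
  by rewrite wtH sqr_sqrtr ?(ltW (w1_gt0 p))// /w1 -nrm_sqr; clear -r1; nra.
have [a1 a2] := aF_bnd m0 r0 w0 wE W1 Slow S0 Shigh W2 Wr.
have [g1 g2] := aG_bnd m0 r0 w0 wE W1 rW Slow S0 Shigh.
have [b1 b2] := bF_bnd r0 w0 wE.
have eF : AF m p = aF (nrm p) (omega m p) by rewrite /AF ger0_norm.
have eB : BF m p = bF (nrm p) (omega m p) by rewrite /BF ger0_norm.
have eG : AG m p = aG (nrm p) (omega m p) by rewrite /AG ger0_norm.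
rewrite eF eB eG; split.
- exact: a2.
- by rewrite wtN.
- by apply: le_trans b2 _; rewrite lerD2r; case: ifP.
- exact: (kF_split r0 w0 wE).
- exact: (kG_split r0 w0 wE).
Qed.

Definition K1 : R := @fnorm R n ^+ 2 * (2 * @chiK R n).
Definition K2 : R := @fnorm R n ^+ 2 * chiL n1.

Lemma K1_ge0 : 0 <= K1.
Proof. by rewrite mulr_ge0 ?sqr_ge0// mulr_ge0// chiK_ge0. Qed.

Lemma K2_ge0 : 0 <= K2.
Proof. by rewrite mulr_ge0 ?sqr_ge0//; exact: chiL_ge0. Qed.

Lemma FK_ev m u p : 0 <= m -> Kset m u ->
  sqnormc (ev (FK m u) p) <= (K1 * (1 + m) * wt 2^-1 p) * n2 u.
Proof.
move=> m0 Ku; have [sF sG] := Ku; apply: le_trans (ev_bndF p sF) _.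
have [_ b] := FK_wn u m0; have k0 := K1_ge0; have W0 := wt_ge0 2^-1 p.
have -> : @fnorm R n ^+ 2 * (2 * @chiK R n * wt 2^-1 p * wn (- 2^-1) (FK m u)) =
   (K1 * wt 2^-1 p) * wn (- 2^-1) (FK m u) by rewrite /K1 !mulrA.
apply: le_trans (ler_wpM2l (mulr_ge0 k0 W0) b) _.
by rewrite [K1 * (1 + m) * _]mulrAC !mulrA.
Qed.

Lemma GK_ev m u p : 0 <= m -> Kset m u ->
  sqnormc (ev (GK m u) p) <= (K2 * wt (- 2^-1) p) * n2 u.
Proof.
move=> m0 Ku; have [sF sG] := Ku; apply: le_trans (ev_bndG n1 p sG) _.
have [_ b] := Kset_G_le n1 m0 Ku; have k0 := K2_ge0; have W0 := wt_ge0 (- 2^-1) p.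
apply: le_trans (ler_wpM2l (mulr_ge0 k0 W0) b).
by rewrite /K2 !mulrA.
Qed.

Let sm : -1 <= (- 2^-1 : R) <= 1. Proof. by apply/andP; split; lra. Qed.
Let sp : -1 <= (2^-1 : R) <= 1. Proof. by apply/andP; split; lra. Qed.

Lemma mul_chain (A W z c N P S : R) : 0 <= A -> 0 <= c -> 0 <= N -> z <= c * W * N -> A * W <= P * S ->
  A * z <= c * P * N * S.
Proof.
move=> A0 c0 N0 zW AW; apply: le_trans (ler_wpM2l A0 zW) _.
have -> : A * (c * W * N) = (c * N) * (A * W) by ring.
have -> : c * P * N * S = (c * N) * (P * S) by ring.
by apply: ler_wpM2l => //; exact: mulr_ge0.
Qed.

Lemma AF_ge0 m p : 0 <= AF m p. Proof. exact: normr_ge0. Qed.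
Lemma BF_ge0 m p : 0 <= BF m p. Proof. exact: normr_ge0. Qed.
Lemma AG_ge0 m p : 0 <= AG m p. Proof. exact: normr_ge0. Qed.

Definition cFm m : R := K1 * (1 + m).

Lemma cFm_ge0 m : 0 <= m -> 0 <= cFm m.
Proof. by move=> m0; rewrite mulr_ge0 ?K1_ge0// addr_ge0. Qed.

Lemma AF_ae m u : 0 < m -> Kset m u ->
  {ae leb, forall p, AF m p * sqnormc (FK m u p) <= cFm m * Pm m * n2 u * Sw p}.
Proof.
move=> m0 Ku; have [sF sG] := Ku.
apply: filterS2 (weights_ae m0) (ev_ae sm sF) => p [a _ _ _ _] e.
apply: mul_chain (AF_ge0 m p) (cFm_ge0 (ltW m0)) (nrm2_ge0 (L2_hilbert _) u) _ a.
rewrite {1}e; exact: FK_ev (ltW m0) Ku.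
Qed.

Lemma AG_ae m u : 0 < m -> Kset m u ->
  {ae leb, forall p, AG m p * sqnormc (GK m u p) <= K2 * Pm m * n2 u * Sw p}.
Proof.
move=> m0 Ku; have [sF sG] := Ku.
apply: filterS2 (weights_ae m0) (ev_ae sp sG) => p [_ a _ _ _] e.
apply: mul_chain (AG_ge0 m p) K2_ge0 (nrm2_ge0 (L2_hilbert _) u) _ a.
rewrite {1}e; exact: GK_ev (ltW m0) Ku.
Qed.

Definition IS : R := \int[leb]_p Sw p.

Lemma IS_ge0 : 0 <= IS. Proof. by apply: Rint_ge0 => p; exact: Sw_ge0. Qed.

Lemma NF_int m u : 0 < m -> Kset m u -> intg leb (fun p => AF m p * sqnormc (FK m u p)).
Proof.
move=> m0 Ku; apply: intg_le_ae (intgZ (cFm m * Pm m * n2 u) (@intg_Sw R n)).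
  by apply: measurable_funM; [exact: measurable_AF|exact/meas_sqnormc/FK_meas].
by apply: filterS (AF_ae m0 Ku) => p h; rewrite ger0_norm// mulr_ge0 ?AF_ge0 ?sqnormc_ge0.
Qed.

Lemma NG_int m u : 0 < m -> Kset m u -> intg leb (fun p => AG m p * sqnormc (GK m u p)).
Proof.
move=> m0 Ku; apply: intg_le_ae (intgZ (K2 * Pm m * n2 u) (@intg_Sw R n)).
  by apply: measurable_funM; [exact: measurable_AG|exact/meas_sqnormc/GK_meas].
by apply: filterS (AG_ae m0 Ku) => p h; rewrite ger0_norm// mulr_ge0 ?AG_ge0 ?sqnormc_ge0.
Qed.

Definition CF m : R := cFm m * Pm m * IS + 1.

(** [BF <= AF + 1/w]: the first term is integrated by the pointwise bound, the second is part of the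
    norm of [u]. *)
Lemma BF_int m u : 0 < m -> Kset m u -> intg leb (fun p => BF m p * sqnormc (FK m u p)) /\
  \int[leb]_p (BF m p * sqnormc (FK m u p)) <= CF m * n2 u.
Proof.
move=> m0 Ku; have [sF sG] := Ku; have IA := intgZ (cFm m * Pm m * n2 u) (@intg_Sw R n).
have Io := intg_omF2 n1 m sF; have IR := intgD IA Io.
have bd : {ae leb, forall p, BF m p * sqnormc (FK m u p) <=
    cFm m * Pm m * n2 u * Sw p + (omega m p)^-1 * sqnormc (FK m u p)}.
  apply: filterS2 (weights_ae m0) (AF_ae m0 Ku) => p [_ _ b _ _] a.
  apply: le_trans (ler_wpM2r (sqnormc_ge0 _) b) _; rewrite mulrDl.
  by apply: lerD => //.
have IB : intg leb (fun p => BF m p * sqnormc (FK m u p)).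
  apply: intg_le_ae IR; first by apply: measurable_funM; [exact: measurable_BF|exact/meas_sqnormc/FK_meas].
  by apply: filterS bd => p h; rewrite ger0_norm// mulr_ge0 ?BF_ge0 ?sqnormc_ge0.
split=> //; apply: le_trans (le_Rint_ae IB IR bd) _.
rewrite (RintD IA Io) (RintZ _ (@intg_Sw R n)) -/IS.
rewrite /CF [X in _ <= X]mulrDl mul1r; apply: lerD; first by rewrite [X in _ <= X]mulrAC.
by rewrite (Kset_nrm2 n1 (ltW m0) Ku) lerDl; exact: omG_ge0.
Qed.

Definition NF m u : R := \int[leb]_p (AF m p * sqnormc (FK m u p)).
Definition NG m u : R := \int[leb]_p (AG m p * sqnormc (GK m u p)).

Lemma NF_ge0 m u : 0 <= NF m u.
Proof. by apply: Rint_ge0 => p; rewrite mulr_ge0 ?AF_ge0 ?sqnormc_ge0. Qed.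
Lemma NG_ge0 m u : 0 <= NG m u.
Proof. by apply: Rint_ge0 => p; rewrite mulr_ge0 ?AG_ge0 ?sqnormc_ge0. Qed.

Lemma omG_int_le m u : 0 <= m -> Kset m u -> \int[leb]_p (omega m p * sqnormc (GK m u p)) <= n2 u.
Proof. by move=> m0 Ku; rewrite (Kset_nrm2 n1 m0 Ku) lerDr; exact: omVF_ge0. Qed.

Lemma Kset_re m u v : 0 <= m -> Kset m u -> Kset m v -> Re (ip u v) =
  \int[leb]_p ((omega m p)^-1 * Re (Num.conj (FK m u p) * FK m v p)) +
  \int[leb]_p (omega m p * Re (Num.conj (GK m u p) * GK m v p)).
Proof.
move=> m0 [sF sG] [sF' sG'].
exact: etrans (f_equal2 (fun x y => Re (ip x y)) (esym (embK n1 m0 sF sG)) (esym (embK n1 m0 sF' sG')))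
  (emb_re n1 m0 sF sG sF' sG').
Qed.

Lemma Qf_re m u v : Kset m u -> Kset m v -> Re (ip (Qf m u) (Qf m v)) =
  \int[leb]_p ((nrm p)^-1 * Re (Num.conj (FK m u p) * FK m v p)) +
  \int[leb]_p (nrm p * Re (Num.conj (GK m u p) * GK m v p)).
Proof.
move=> [sF sG] [sF' sG']; have le00 : (0 : R) <= 0 := lexx _.
have := emb_re n1 le00 sF sG sF' sG'; rewrite omega_massless; exact.
Qed.

Lemma wre_int k F F' : measurable_fun setT k -> cmeasurable F -> cmeasurable F' -> (forall p, 0 <= k p) ->
  intg leb (fun p => k p * sqnormc (F p)) -> intg leb (fun p => k p * sqnormc (F' p)) ->
  intg leb (fun p => k p * Re (Num.conj (F p) * F' p)).
Proof.
move=> mk mF mF' k0 I I'; apply: (weighted_cs mk mF mF' k0 k0 I I' _).1.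
by apply: aeW => p; rewrite expr2.
Qed.

Lemma mass_diff (a b c d : R) : (a + b) - (c + d) = - (c - a) + (b - d).
Proof. by ring. Qed.

Lemma rip_diff m u v : 0 < m -> Kset m u -> Kset m v ->
  Re (ip u v) - Re (ip (Qf m u) (Qf m v)) =
  - (\int[leb]_p (kF (nrm p) (omega m p) * Re (Num.conj (FK m u p) * FK m v p))) +
  \int[leb]_p (kG (nrm p) (omega m p) * Re (Num.conj (GK m u p) * GK m v p)).
Proof.
move=> m0 Ku Kv; have [sF sG] := Ku; have [sF' sG'] := Kv; have m0' := ltW m0.
have mF := FK_meas m u; have mG := GK_meas m u; have mF' := FK_meas m v; have mG' := GK_meas m v.
have I1 := wre_int (measurable_omegaV m) mF mF' (fun p => _ : 0 <= (omega m p)^-1) (intg_omF2 n1 m sF) (intg_omF2 n1 m sF').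
have I2 := wre_int (measurable_omega m) mG mG' (omega_ge0 m) (intg_omG2 m0' sG) (intg_omG2 m0' sG').
have J1 := wre_int (@measurable_nrmV R n) mF mF' (fun p => _ : 0 <= (nrm p)^-1) (intg_F0 n1 sF).1 (intg_F0 n1 sF').1.
have J2 := wre_int (@measurable_nrm R n) mG mG' (@nrm_ge0 R n) (Kset_G_le n1 m0' Ku).1 (Kset_G_le n1 m0' Kv).1.
rewrite (Kset_re m0' Ku Kv) (Qf_re Ku Kv) mass_diff -(RintB (J1 _) (I1 _)) -?(RintB I2 J2).
- congr (- _ + _); apply: eq_Rintegral => p _; exact: esym (mulrBl _ _ _).
- by move=> p; rewrite invr_ge0 nrm_ge0.
- by move=> p; rewrite invr_ge0 omega_ge0.
Qed.

(** [N^2 <= 2 x^2 + 2 y^2], after which one factor [N] cancels; [1 <= c] lets the same constant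
    serve both terms. *)
Lemma defect_alg (N x y a b c d : R) : 0 <= N -> N = - x + y -> x ^+ 2 <= a * (c * N) -> y ^+ 2 <= b * N ->
  0 <= a -> 0 <= b -> 1 <= c -> N <= 2 * c * (a + b).
Proof.
move=> N0 e hx hy a0 b0 c1.
have h : N * N <= (2 * c * (a + b)) * N.
  have h1 : (- x + y) ^+ 2 <= 2 * x ^+ 2 + 2 * y ^+ 2 by have := sqr_ge0 (x + y); lra.
  rewrite -e expr2 in h1; apply: le_trans h1 _.
  have h3 : b * N <= c * (b * N) by rewrite ler_peMl// mulr_ge0.
  by lra.
have [z|z] := eqVneq N 0; first by rewrite z !mulr_ge0 ?addr_ge0//; lra.
have Np : 0 < N by rewrite lt_def z N0.
by rewrite -(ler_pM2r Np).
Qed.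

Lemma CF_ge1 m : 0 < m -> 1 <= CF m.
Proof.
move=> m0; rewrite lerDr mulr_ge0 ?IS_ge0// mulr_ge0 ?(cFm_ge0 (ltW m0))//.
by have [_ h _ _] := Pm_ge m0; apply: le_trans h; exact: ltW.
Qed.

(** [t] is tested against itself. Cauchy-Schwarz leaves [AF] and [AG] on [h] and puts [BF] and [w]
    on [t], where they are bounded by [n2 t]; one factor [n2 t] then cancels. *)
Lemma defect_est m h t : 0 < m -> Kset m h -> Kset m t ->
  (forall v, Kset m v -> Re (ip t v) = Re (ip h v) - Re (ip (Qf m h) (Qf m v))) ->
  n2 t <= 2 * CF m * (NF m h + NG m h).
Proof.
move=> m0 Kh Kt ht; have e := etrans (ht t Kt) (rip_diff m0 Kh Kt).
have [IB bB] := BF_int m0 Kt; have [sF sG] := Kh; have [sF' sG'] := Kt; have m0' := ltW m0.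
have W := weights_ae m0.
have w1 : {ae leb, forall p, kF (nrm p) (omega m p) ^+ 2 <= AF m p * BF m p}.
  by apply: filterS W => p [].
have w2 : {ae leb, forall p, kG (nrm p) (omega m p) ^+ 2 <= AG m p * omega m p}.
  by apply: filterS W => p [].
have [_ c1] := weighted_cs (measurable_kF m) (FK_meas m h) (FK_meas m t) (AF_ge0 m) (BF_ge0 m) (NF_int m0 Kh) IB w1.
have [_ c2] := weighted_cs (measurable_kG m) (GK_meas m h) (GK_meas m t) (AG_ge0 m) (omega_ge0 m) (NG_int m0 Kh)
  (intg_omG2 m0' sG') w2.
have d1 := le_trans c1 (ler_wpM2l (NF_ge0 m h) bB).
have d2 := le_trans c2 (ler_wpM2l (NG_ge0 m h) (omG_int_le m0' Kt)).
exact: defect_alg (nrm2_ge0 (L2_hilbert _) t) e d1 d2 (NF_ge0 m h) (NG_ge0 m h) (CF_ge1 m0).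
Qed.
End estimates.

(** * Sums over finite orthonormal families *)

Section sums.
Context {R : realType} {n : nat}.
Local Notation leb := (@lebesgue_rV R n).
Local Notation Rn := 'rV[R]_n.
Local Notation L2 := (L2 leb).
Local Notation ip := (@L2_ip _ _ R leb).
Local Notation n2 := (nrm2 ip).
Implicit Types (F G : Rn -> R[i]) (p : Rn) (m : R) (u v : L2).
Hypotheses (n1 : (1 < n)%N) (n3 : (n <= 3)%N).
Let sm : -1 <= (- 2^-1 : R) <= 1. Proof. by apply/andP; split; lra. Qed.
Let sp : -1 <= (2^-1 : R) <= 1. Proof. by apply/andP; split; lra. Qed.

Lemma Lam_ae F G psi : cmeasurable F -> cmeasurable G -> cintegrable leb psi ->
  {ae leb, forall p, F p = G p} -> Lam F psi = Lam G psi.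
Proof.
move=> mF mG Ip FG; have mp := cmeasJ (cmeas_fourier Ip).
have [a1 a2] := cmeasM mp mF; have [b1 b2] := cmeasM mp mG.
apply: complexP; rewrite /Lam /cintegral /=.
- by apply: Rint_ae => //; apply: filterS FG => p ->.
- by apply: Rint_ae => //; apply: filterS FG => p ->.
Qed.

(** [FK] and [GK] are linear up to null sets only; the representatives [ev] are linear at each
    point, as needed to apply [on_bound] at fixed [p]. *)
Lemma ev_linR s F G X (a : R) p : -1 <= s <= 1 -> Sob s F -> Sob s G -> cmeasurable X ->
  {ae leb, forall p, a%:C * F p + 1%:C * G p = X p} ->
  ev X p = a%:C * ev F p + ev G p.
Proof.
move=> s1 sF sG mX e; have [C k] := psi_h1 p.
have [mF IF _] := sF; have [mG IG _] := sG.
have ml : cmeasurable (fun p => a%:C * F p + 1%:C * G p).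
  by apply: cmeasD; apply: cmeasM => //; exact: cmeas_cst.
have E : Lam X (psi_ p) = a%:C * Lam F (psi_ p) + 1%:C * Lam G (psi_ p).
  exact: etrans (esym (Lam_ae ml mX (h1_cintg k) e)) (Lam_linF s1 a%:C 1%:C mF mG IF IG k).
rewrite !evE E rmorph1 mul1r mulrDr; congr (_ + _); exact: mulrCA.
Qed.

Lemma Re_lin (a : R) (z w x : R[i]) : x = a%:C * z + w ->
  Re x = a * Re z + Re w /\ Im x = a * Im z + Im w.
Proof. by move=> ->; rewrite !cE; split; ring. Qed.

Section family.
Variables (m : R) (hh kk : L2 -> L2).
Hypothesis m0 : 0 < m.
Hypotheses (Khh : forall x, Kset m (hh x)) (Kkk : forall x, Kset m (kk x)).
Local Notation X := (complex_span (Kset m : set L2)).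
Hypothesis partsE : forall x, X x -> x = hh x + 'i *: kk x.
Variable s : seq L2.
Hypotheses (us : uniq s) (Xs : forall e, e \in s -> X e) (os : @orthon R _ ip (Kset m) s).

(** The real and imaginary parts of [V] are two bounded real functionals, each contributing
    [c / 2]. *)
Lemma pointwise_sum (V : L2 -> R[i]) (c : R) : 0 <= c ->
  (forall (a : R) h k, Kset m h -> Kset m k -> V (a%:C *: h + k) = a%:C * V h + V k) ->
  (forall h, Kset m h -> sqnormc (V h) <= c * n2 h) ->
  \sum_(e <- s) (sqnormc (V (hh e)) + sqnormc (V (kk e))) <= c.
Proof.
move=> c0 lV bV.
have rK : real_subspace (Kset m : set L2) by exact: Kset_rs.
have sK : separating (Kset m : set L2) by move=> u; exact: Kset_inter.
have bR h : Kset m h -> Re (V h) ^+ 2 <= c * n2 h.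
  by move=> Kh; apply: le_trans (bV _ Kh); rewrite lerDl sqr_ge0.
have bI h : Kset m h -> Im (V h) ^+ 2 <= c * n2 h.
  by move=> Kh; apply: le_trans (bV _ Kh); rewrite lerDr sqr_ge0.
have lR (a : R) h k : Kset m h -> Kset m k -> Re (V (a%:C *: h + k)) = a * Re (V h) + Re (V k).
  by move=> Kh Kk; have [] := Re_lin (lV a h k Kh Kk).
have lI (a : R) h k : Kset m h -> Kset m k -> Im (V (a%:C *: h + k)) = a * Im (V h) + Im (V k).
  by move=> Kh Kk; have [] := Re_lin (lV a h k Kh Kk).
have h1 := on_bound (L2_hilbert _) rK sK Khh Kkk partsE c0 lR bR us Xs os.
have h2 := on_bound (L2_hilbert _) rK sK Khh Kkk partsE c0 lI bI us Xs os.
have -> : \sum_(e <- s) (sqnormc (V (hh e)) + sqnormc (V (kk e))) =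
    \sum_(e <- s) (Re (V (hh e)) ^+ 2 + Re (V (kk e)) ^+ 2) +
    \sum_(e <- s) (Im (V (hh e)) ^+ 2 + Im (V (kk e)) ^+ 2).
  by rewrite -big_split; apply: eq_bigr => e _; rewrite /sqnormc addrACA.
by rewrite (splitr c); exact: lerD h1 h2.
Qed.

Lemma Rint_seq (T : eqType) (r : seq T) (f : T -> Rn -> R) : (forall e, intg leb (f e)) ->
  intg leb (fun p => \sum_(e <- r) f e p) /\ \int[leb]_p \sum_(e <- r) f e p = \sum_(e <- r) \int[leb]_p f e p.
Proof.
move=> If; elim: r => [|e r [I E]].
  rewrite (_ : (fun p => \sum_(e <- [::]) f e p) = (fun=> 0)); last by apply/funext => p; rewrite big_nil.
  by split; [exact: intg0|rewrite big_nil Rint_zero].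
rewrite (_ : (fun p => \sum_(e' <- e :: r) f e' p) = (fun p => f e p + \sum_(e' <- r) f e' p)); last first.
  by apply/funext => p; rewrite big_cons.
by split; [exact: intgD|rewrite RintD// E big_cons].
Qed.

(** The bound at fixed [p] concerns the whole family at once and is integrated afterwards; this
    keeps it free of the number of vectors. *)
Lemma weighted_sum (A W : Rn -> R) (V : L2 -> Rn -> R[i]) (c P : R) : (forall p, 0 <= A p) -> 0 <= c ->
  (forall p, 0 <= W p) ->
  (forall p (a : R) h k, Kset m h -> Kset m k -> V (a%:C *: h + k) p = a%:C * V h p + V k p) ->
  (forall p h, Kset m h -> sqnormc (V h p) <= (c * W p) * n2 h) ->
  {ae leb, forall p, A p * W p <= P * Sw p} ->
  (forall h, Kset m h -> intg leb (fun p => A p * sqnormc (V h p))) ->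
  \sum_(e <- s) (\int[leb]_p (A p * sqnormc (V (hh e) p)) + \int[leb]_p (A p * sqnormc (V (kk e) p))) <=
  c * P * @IS R n.
Proof.
move=> A0 c0 W0 lV bV AW IV.
pose f e p := A p * sqnormc (V (hh e) p) + A p * sqnormc (V (kk e) p).
have If e : intg leb (f e) by exact: intgD (IV _ (Khh e)) (IV _ (Kkk e)).
have [I E] := Rint_seq s If.
rewrite (eq_bigr (fun e => \int[leb]_p f e p)); last first.
  by move=> e _; exact: esym (RintD (IV _ (Khh e)) (IV _ (Kkk e))).
rewrite -E -RintZ; last exact: intg_Sw.
apply: le_Rint_ae => //; first exact: intgZ (@intg_Sw R n).
apply: filterS AW => p h.
have -> : \sum_(e <- s) f e p = A p * \sum_(e <- s) (sqnormc (V (hh e) p) + sqnormc (V (kk e) p)).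
  rewrite mulr_sumr; apply: eq_bigr => e _; exact: esym (mulrDr _ _ _).
have b := pointwise_sum (mulr_ge0 c0 (W0 p)) (lV p) (bV p).
apply: le_trans (ler_wpM2l (A0 p) b) _.
have -> : A p * (c * W p) = c * (A p * W p) by ring.
have -> : c * P * Sw p = c * (P * Sw p) by ring.
exact: ler_wpM2l.
Qed.

Lemma NF_sum : \sum_(e <- s) (NF m (hh e) + NF m (kk e)) <= @cFm R n m * Pm m * @IS R n.
Proof.
have E h : Kset m h -> intg leb (fun p => AF m p * sqnormc (ev (FK m h) p)) /\
    NF m h = \int[leb]_p (AF m p * sqnormc (ev (FK m h) p)).
  move=> Kh; have [sF sG] := Kh; have e := ev_ae sm sF.
  have mA : measurable_fun setT (fun p => AF m p * sqnormc (FK m h p)).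
    by apply: measurable_funM; [exact: measurable_AF|exact/meas_sqnormc/FK_meas].
  have mE : measurable_fun setT (fun p => AF m p * sqnormc (ev (FK m h) p)).
    by apply: measurable_funM; [exact: measurable_AF|exact/meas_sqnormc/(ev_meas sm sF)].
  have eA : {ae leb, forall p, AF m p * sqnormc (FK m h p) = AF m p * sqnormc (ev (FK m h) p)}.
    by apply: filterS e => p {1}->.
  by split; [exact: intg_ae mE eA (NF_int n1 n3 m0 Kh)|exact: Rint_ae mA mE eA].
have -> : \sum_(e <- s) (NF m (hh e) + NF m (kk e)) = \sum_(e <- s)
   (\int[leb]_p (AF m p * sqnormc (ev (FK m (hh e)) p)) + \int[leb]_p (AF m p * sqnormc (ev (FK m (kk e)) p))).
  by apply: eq_bigr => e _; rewrite (E _ (Khh e)).2 (E _ (Kkk e)).2.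
apply: (@weighted_sum (AF m) (wt 2^-1) (fun h => ev (FK m h))).
- exact: AF_ge0.
- exact: cFm_ge0 (ltW m0).
- exact: wt_ge0.
- by move=> p a h k [sF _] [sF' _]; apply: ev_linR sm sF sF' (FK_meas _ _) (FK_lin m h k a).
- by move=> p h Kh; exact: FK_ev (ltW m0) Kh.
- by apply: filterS (weights_ae n1 n3 m0) => p [].
- by move=> h Kh; exact: (E h Kh).1.
Qed.

Lemma NG_sum : \sum_(e <- s) (NG m (hh e) + NG m (kk e)) <= K2 n1 * Pm m * @IS R n.
Proof.
have E h : Kset m h -> intg leb (fun p => AG m p * sqnormc (ev (GK m h) p)) /\
    NG m h = \int[leb]_p (AG m p * sqnormc (ev (GK m h) p)).
  move=> Kh; have [sF sG] := Kh; have e := ev_ae sp sG.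
  have mA : measurable_fun setT (fun p => AG m p * sqnormc (GK m h p)).
    by apply: measurable_funM; [exact: measurable_AG|exact/meas_sqnormc/GK_meas].
  have mE : measurable_fun setT (fun p => AG m p * sqnormc (ev (GK m h) p)).
    by apply: measurable_funM; [exact: measurable_AG|exact/meas_sqnormc/(ev_meas sp sG)].
  have eA : {ae leb, forall p, AG m p * sqnormc (GK m h p) = AG m p * sqnormc (ev (GK m h) p)}.
    by apply: filterS e => p {1}->.
  by split; [exact: intg_ae mE eA (NG_int n1 n3 m0 Kh)|exact: Rint_ae mA mE eA].
have -> : \sum_(e <- s) (NG m (hh e) + NG m (kk e)) = \sum_(e <- s)
   (\int[leb]_p (AG m p * sqnormc (ev (GK m (hh e)) p)) + \int[leb]_p (AG m p * sqnormc (ev (GK m (kk e)) p))).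
  by apply: eq_bigr => e _; rewrite (E _ (Khh e)).2 (E _ (Kkk e)).2.
apply: (@weighted_sum (AG m) (wt (- 2^-1)) (fun h => ev (GK m h))).
- exact: AG_ge0.
- exact: K2_ge0.
- exact: wt_ge0.
- by move=> p a h k [_ sG] [_ sG']; apply: ev_linR sp sG sG' (GK_meas _ _) (GK_lin m h k a).
- by move=> p h Kh; exact: GK_ev (ltW m0) Kh.
- by apply: filterS (weights_ae n1 n3 m0) => p [].
- by move=> h Kh; exact: (E h Kh).1.
Qed.
End family.
End sums.

(** * The Hilbert-Schmidt bound and its limit *)

Section main.
Context {R : realType} {n : nat}.
Local Notation leb := (@lebesgue_rV R n).
Local Notation L2 := (L2 leb).
Local Notation ip := (@L2_ip _ _ R leb).
Local Notation n2 := (nrm2 ip).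
Implicit Types (m : R) (u v : L2).
Hypotheses (n1 : (1 < n)%N) (n3 : (n <= 3)%N).

Lemma Kspace_Kset m : 0 <= m -> Kspace m = (Kset m : set L2).
Proof. by move=> m0; apply/funext => u; apply/propext; exact: (KspaceP n1 u m0). Qed.

Definition hs_bound m : R := 2 * @CF R n m * ((@cFm R n m + K2 n1) * Pm m * @IS R n).

(** The bound is given for every orthonormal basis, because [hs_norm] evaluates the sum in one
    picked by choice. *)
Lemma main_bound m : 0 < m ->
  bounded_operator (complex_span (Kspace m)) (tomita_ip ip (Kspace m)) (one_sub_QdagQ m) /\
  (exists E, orthonormal_basis (complex_span (Kspace m)) (tomita_ip ip (Kspace m)) E) /\
  forall E, orthonormal_basis (complex_span (Kspace m)) (tomita_ip ip (Kspace m)) E ->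
    (hs_sum (tomita_ip ip (Kspace m)) (one_sub_QdagQ m) E <= (2 * hs_bound m)%:E)%E.
Proof.
move=> m0; have m0' := ltW m0; have z0 : (0 : R) <= 0 := lexx _.
have hip := L2_hilbert leb.
have rK : real_subspace (Kset m : set L2) by exact: Kset_rs.
have rL : real_subspace (Kset 0 : set L2) by exact: Kset_rs.
have sK : separating (Kset m : set L2) by move=> u; exact: Kset_inter.
have sL : separating (Kset 0 : set L2) by move=> u; exact: Kset_inter.
have clK (x_ : nat -> L2) v : (forall k : nat, Kset m (x_ k)) -> hlim ip x_ v -> Kset m v.
  exact: Kset_closed m0.
have QL (k : L2) : Kset m k -> Kset 0 (Qmap m k) by move=> Kk; rewrite (QmapE n1 m0' Kk); exact: (Qf_K n1 Kk).
have Qlin (a : R) (h k : L2) : Kset m h -> Kset m k -> Qmap m (a%:C *: h + k) = a%:C *: Qmap m h + Qmap m k.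
  move=> Kh Kk; rewrite (QmapE n1 m0' Kh) (QmapE n1 m0' Kk) (QmapE n1 m0' (Kset_lin a Kh Kk)).
  exact: (Qf_lin n1 a m0' Kh Kk).
pose Cq := @cF0 R n * (1 + m) + 1.
have Cq0 : 0 <= Cq by rewrite addr_ge0// mulr_ge0 ?cF0_ge0// addr_ge0.
have Qbnd (k : L2) : Kset m k -> n2 (Qmap m k) <= Cq * n2 k.
  by move=> Kk; rewrite (QmapE n1 m0' Kk); exact: (Qf_bnd n1 m0' Kk).
pose T0 : L2 -> L2 := @defect R _ ip (Kset m) (Kset 0) (Qmap m).
have T0K (k : L2) : Kset m k -> Kset m (T0 k) by exact: (defectK hip rK clK QL Qlin Cq0 Qbnd).
have T0lin (a : R) (h k : L2) : Kset m h -> Kset m k -> T0 (a%:C *: h + k) = a%:C *: T0 h + T0 k.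
  exact: (defect_lin hip rK rL clK QL Qlin Cq0 Qbnd).
have T0bnd (k : L2) : Kset m k -> n2 (T0 k) <= (2 + 2 * (Cq * Cq)) * n2 k.
  exact: (defect_bnd hip rK clK QL Qlin Cq0 Qbnd).
have T0rip (h v : L2) : Kset m h -> Kset m v -> Re (ip (T0 h) v) = Re (ip h v) - Re (ip (Qf m h) (Qf m v)).
  move=> Kh Kv; rewrite -(QmapE n1 m0' Kh) -(QmapE n1 m0' Kv).
  exact: (defect_rip hip rK clK QL Qlin Cq0 Qbnd).
have TE (h k : L2) : Kset m h -> Kset m k -> one_sub_QdagQ m (h + 'i *: k) = T0 h + 'i *: T0 k.
  move=> Kh Kk; rewrite /one_sub_QdagQ /Qdag (Kspace_Kset m0') (Kspace_Kset z0).
  exact: (defect_ext rK rL sK sL QL Kh Kk).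
rewrite (Kspace_Kset m0'); split; first exact: (T_bounded hip rK sK T0K T0lin T0bnd TE).
split; first exact: (basis_exists hip rK sK).
have [hh [kk [Khh [Kkk partsE]]]] := span_parts rK.
move=> E bE; apply: (hs_sum_le hip rK sK T0K TE Khh Kkk partsE bE) => s us Xs os.
have est (h : L2) : Kset m h -> n2 (T0 h) <= 2 * @CF R n m * (NF m h + NG m h).
  by move=> Kh; apply: (defect_est n1 n3 m0 Kh (T0K _ Kh)) => v Kv; exact: T0rip.
have C0 : 0 <= 2 * @CF R n m.
  by rewrite mulr_ge0//; apply: le_trans (CF_ge1 m0); exact: ler01.
apply: (@le_trans _ _ (\sum_(e <- s) 2 * @CF R n m * (NF m (hh e) + NF m (kk e) + (NG m (hh e) + NG m (kk e))))).
  apply: ler_sum => e _; rewrite addrACA mulrDr.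
  by apply: lerD; exact: est.
rewrite -mulr_sumr big_split /=; apply: ler_wpM2l => //.
rewrite !mulrDl; apply: lerD.
- exact: (NF_sum n1 n3 m0 Khh Kkk partsE us Xs os).
- exact: (NG_sum n1 n3 m0 Khh Kkk partsE us Xs os).
Qed.

(** For [m <= 1] both [m] and [m^4] are at most [sqrt m], and [96 = 3 * 32]. *)
Lemma Pm_small m : 0 < m -> m <= 1 -> Pm m <= 96 * Num.sqrt m /\ Num.sqrt m <= 1.
Proof.
move=> m0 m1; have s1 : Num.sqrt m <= 1 by rewrite -sqrtr1 ler_wsqrtr.
have s0 := sqrtr_ge0 m; have e := sqr_sqrtr (ltW m0).
have a : m <= Num.sqrt m by rewrite -{1}e expr2 ler_piMl.
have b : m ^+ 4 <= m by rewrite exprS ler_piMr ?(ltW m0)// exprn_ile1// ltW.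
by split=> //; rewrite /Pm; lra.
Qed.

(** A bound for [2 hs_bound m / sqrt m] on [(0, 1]]: the [Pm m] inside [CF m] is replaced by 96, the
    other one by [96 sqrt m]. *)
Definition hs_const : R := 4 * (2 * @K1 R n * 96 * @IS R n + 1) * ((2 * @K1 R n + K2 n1) * 96 * @IS R n).

Lemma const_alg_ge0 (a b c : R) : 0 <= a -> 0 <= b -> 0 <= c ->
  0 <= 4 * (2 * a * 96 * c + 1) * ((2 * a + b) * 96 * c).
Proof.
move=> a0 b0 c0; apply: mulr_ge0; first by rewrite mulr_ge0// addr_ge0// !mulr_ge0.
by rewrite mulr_ge0// mulr_ge0// addr_ge0// mulr_ge0.
Qed.

Lemma bound_alg (C C' X Y : R) : 0 <= C -> 0 <= X -> C <= C' -> X <= Y ->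
  2 * (2 * C * X) <= 4 * C' * Y.
Proof.
move=> C0 X0 CC XY; have h := ler_pM C0 X0 CC XY.
have -> : 2 * (2 * C * X) = 4 * (C * X) by ring.
by rewrite -[4 * C' * Y]mulrA ler_pM2l.
Qed.

Lemma hs_const_ge0 : 0 <= hs_const.
Proof.
have a := @K1_ge0 R n; have b := K2_ge0 n1 (R := R); have c := @IS_ge0 R n.
exact: const_alg_ge0.
Qed.

Lemma hs_bound_small m : 0 < m -> m <= 1 -> 2 * hs_bound m <= hs_const * Num.sqrt m.
Proof.
move=> m0 m1; have [p1 s1] := Pm_small m0 m1; have s0 := sqrtr_ge0 m.
have a := @K1_ge0 R n; have b := K2_ge0 n1 (R := R); have c := @IS_ge0 R n.
have p0 : 0 <= Pm m by have [_ h _ _] := Pm_ge m0; apply: le_trans h; exact: ltW.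
have f1 : @cFm R n m <= 2 * @K1 R n by rewrite /cFm mulrC ler_wpM2r//; lra.
have f0 := cFm_ge0 (ltW m0) (n := n).
have p2 : Pm m <= 96 by apply: le_trans p1 _; lra.
have c1 : @CF R n m <= 2 * @K1 R n * 96 * @IS R n + 1.
  by rewrite /CF lerD2r ler_wpM2r//; exact: ler_pM.
have c0 := le_trans ler01 (CF_ge1 m0 (n := n)).
have d1 : (@cFm R n m + K2 n1) * Pm m * @IS R n <= (2 * @K1 R n + K2 n1) * 96 * @IS R n * Num.sqrt m.
  rewrite [X in _ <= X]mulrAC ler_wpM2r// -mulrA; apply: ler_pM => //; first exact: addr_ge0.
  by rewrite lerD2r.
have d0 : 0 <= (@cFm R n m + K2 n1) * Pm m * @IS R n by rewrite mulr_ge0// mulr_ge0// addr_ge0.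
rewrite /hs_const -[X in _ <= X]mulrA; exact: (bound_alg c0 d0 c1 d1).
Qed.
End main.

Theorem theorem3p3 (R : realType) (d : nat) (hd : d = 2%N \/ d = 3%N) :
  let ip := @L2_ip _ _ R (@lebesgue_rV R d) in
  let K := @Kspace R d in
  (forall m : R, 0 < m ->
     hilbert_schmidt (complex_span (K m)) (tomita_ip ip (K m))
       (one_sub_QdagQ m)) /\
  hs_norm (complex_span (K m)) (tomita_ip ip (K m)) (one_sub_QdagQ m)
    @[m --> 0^'+] --> (0 : R).
Proof.
move=> ip K; have n1 : (1 < d)%N by case: hd => ->.
have n3 : (d <= 3)%N by case: hd => ->.
split=> [m m0|].
  have [bT [[E bE] hE]] := main_bound n1 n3 m0; split=> //; exists E => //.
  by apply: le_lt_trans (hE E bE) _; rewrite ltry.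
have D0 := hs_const_ge0 (R := R) n1; set D := hs_const n1 in D0.
apply/cvgrPdist_le => eps e0.
have D1 : 0 < D + 1 by rewrite ltr_wpDl.
have q0 : 0 < eps ^+ 2 / (D + 1) by rewrite divr_gt0// exprn_gt0.
near=> m.
have m0 : 0 < m by near: m; exact: nbhs_right_gt.
have m1 : m <= 1 by near: m; exact: nbhs_right_le.
(* Makes [D sqrt m] at most [eps ^ 2]; [D + 1] because [D] may be 0. *)
have mq : m <= (eps ^+ 2 / (D + 1)) ^+ 2 by near: m; apply: nbhs_right_le; rewrite exprn_gt0.
have [_ [exE hE]] := main_bound n1 n3 m0.
rewrite sub0r normrN /hs_norm ger0_norm ?sqrtr_ge0//.
set E := xget _ _; have bE : orthonormal_basis (complex_span (K m)) (tomita_ip ip (K m)) E.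
  exact: (@xgetPex _ set0 [set E | orthonormal_basis (complex_span (K m)) (tomita_ip ip (K m)) E]).
have h := hE E bE; have h0 : (0 <= hs_sum (tomita_ip ip (K m)) (one_sub_QdagQ m) E)%E.
  by apply: esum_ge0 => e _; rewrite lee_fin sqr_ge0.
have sm : Num.sqrt m <= eps ^+ 2 / (D + 1).
  by rewrite -[X in _ <= X]ger0_norm ?(ltW q0)// -sqrtr_sqr ler_wsqrtr.
have fb : fine (hs_sum (tomita_ip ip (K m)) (one_sub_QdagQ m) E) <= eps ^+ 2.
  have fin : hs_sum (tomita_ip ip (K m)) (one_sub_QdagQ m) E \is a fin_num.
    by rewrite ge0_fin_numE//; apply: le_lt_trans h _; rewrite ltry.
  rewrite -lee_fin fineK//; apply: le_trans h _; rewrite lee_fin.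
  apply: le_trans (hs_bound_small n1 m0 m1) _; rewrite -/D.
  apply: le_trans (ler_wpM2l D0 sm) _; rewrite mulrCA ler_piMr ?sqr_ge0//.
  by rewrite ler_pdivrMr// mul1r lerDl.
rewrite -[X in _ <= X]ger0_norm ?(ltW e0)// -sqrtr_sqr; exact: ler_wsqrtr.
Unshelve. all: by end_near. Qed.
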